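(* Let $u\in H$ and $j\in\mathbb N$. The following are equivalent: (i) $u\in D(A^j)$; (ii) the function $\lambda\mapsto\lambda^j(\tilde Vu)(\lambda)$ belongs to $L^2_q$; (iii) for every $k=1,\dots,n$, the function $\lambda\mapsto\lambda^j(\tilde Vu)_k(\lambda)$ belongs to $L^2((a_k,+\infty),q_k\,d\lambda)$.
   Context: Fix an integer $n\ge 2$, constants $c_1,\dots,c_n>0$ and $0\le a_1\le\dots\le a_n<\infty$. Let $N_1,\dots,N_n$ be $n$ disjoint copies of $(0,\infty)$ and $N$ the star-shaped network obtained from $\overline{N_1},\dots,\overline{N_n}$ by identifying their endpoints $0$; functions on $N$ are $n$-tuples of functions on the $N_k$, $\int_N g\,dx:=\sum_k\int_{N_k}g_k\,dx$. $H=L^2(N)=\prod_kL^2(N_k)$. $A$: $D(A)=\{u\in\prod_kH^2(N_k): u_i(0)=u_k(0)\ \forall i,k,\ \sum_kc_ku_k'(0^+)=0\}$, $Au=(-c_ku_k''+a_ku_k)_k$ (self-adjoint); $D(A^j)$ is the domain of its $j$-th power. Complex square root: $\sqrt{re^{i\phi}}=\sqrt re^{i\phi/2}$, $r\ge0$, $\phi\in[-\pi,\pi)$. For $\lambda\in\mathbb C$: $\xi_k(\lambda)=\sqrt{(\lambda-a_k)/c_k}$, $s_k(\lambda)=-\sum_{l\ne k}c_l\xi_l(\lambda)/(c_k\xi_k(\lambda))$. $F^{-,j}_\lambda:N\to\mathbb C$ is given for $x\in\overline{N_k}$ by $F^{-,j}_\lambda(x)=\cos(\xi_j(\lambda)x)-is_j(\lambda)\sin(\xi_j(\lambda)x)$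 if $k=j$ and $\exp(-i\xi_k(\lambda)x)$ if $k\ne j$. For real $\lambda$, $w(\lambda):=-i\sum_jc_j\xi_j(\lambda)$, $q_l(\lambda)=0$ if $\lambda<a_l$ and $q_l(\lambda)=c_l\xi_l(\lambda)/(\pi|w(\lambda)|^2)$ if $\lambda>a_l$. $L^2_q:=\prod_kL^2((a_k,\infty),q_k\,d\lambda)$. For $f\in L^1(N)$, $(Vf)_k(\lambda)=\int_Nf\,\overline{F^{-,k}_\lambda}\,dx$ ($\lambda\ge a_k$); $\tilde V:H\to L^2_q$ is the unique isometric extension of $V$ from $\prod_kC_c^\infty(N_k)$ equipped with the $H$-norm. *)

(* Defs.v *)
From HB Require Import structures.
From mathcomp Require Import all_boot all_order all_algebra.
From mathcomp Require Import all_classical all_reals all_analysis.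
From mathcomp Require Import complex.
Set Implicit Arguments. Unset Strict Implicit. Unset Printing Implicit Defensive.
Import Order.TTheory GRing.Theory Num.Theory.
Import numFieldNormedType.Exports.
Local Open Scope classical_set_scope.
Local Open Scope ring_scope.

(* Star graph N with n edges N_k = (0,+oo); complex scalars are R[i].
   A function on N is an n-tuple  'I_n -> R -> R[i]  (only x > 0 matters). *)

Section StarGraph.
Variable R : realType.
Local Notation leb := (@lebesgue_measure R).
Local Notation C := (R[i]).

Definition ReC (z : C) : R := complex.Re z.
Definition ImC (z : C) : R := complex.Im z.
Definition iC : C := (0 +i* 1)%C.
Definition toC (x : R) : C := (x +i* 0)%C.
Definition sqmod (z : C) : R := ReC z ^+ 2 + ImC z ^+ 2.

Definition cexp (z : C) : C :=
  toC (expR (ReC z)) * (toC (cos (ImC z)) + iC * toC (sin (ImC z))).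
Definition ccos (z : C) : C := (cexp (iC * z) + cexp (- (iC * z))) / 2%:R.
Definition csin (z : C) : C := (cexp (iC * z) - cexp (- (iC * z))) / (2%:R * iC).

Definition pos_half : set R := [set x | 0 < x].

Definition measC (D : set R) (f : R -> C) : Prop :=
  measurable_fun D (ReC \o f) /\ measurable_fun D (ImC \o f).

Definition inL2w (D : set R) (w : R -> R) (f : R -> C) : Prop :=
  measC D f /\ (\int[leb]_(x in D) (sqmod (f x) * w x)%:E < +oo)%E.

Definition inL2 (f : R -> C) : Prop := inL2w pos_half (fun=> 1) f.

Definition cint (g : R -> C) : C :=
  toC (Rintegral leb pos_half (ReC \o g)) + iC * toC (Rintegral leb pos_half (ImC \o g)).

Definition smoothR (f : R -> R) : Prop :=
  forall (m : nat) (x : R), derivable (derive1n m f) x 1.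

Definition testR (f : R -> R) : Prop :=
  smoothR f /\ exists alpha beta : R, 0 < alpha /\
    forall x, x < alpha \/ beta < x -> f x = 0.

Definition testC (f : R -> C) : Prop := testR (ReC \o f) /\ testR (ImC \o f).

Definition weak_deriv (f g : R -> C) : Prop :=
  forall phi : R -> R, testR phi ->
    cint (fun x => f x * toC (derive1 phi x)) = - cint (fun x => g x * toC (phi x)).

Definition isH2 (f g1 g2 : R -> C) : Prop :=
  [/\ inL2 f, inL2 g1, inL2 g2, weak_deriv f g1 & weak_deriv g1 g2].

Definition trace0 (f : R -> C) (t : C) : Prop :=
  exists F : R -> C,
    [/\ {within `[0%R, +oo[, continuous (ReC \o F)},
        {within `[0%R, +oo[, continuous (ImC \o F)},
        leb.-negligible [set x | 0 < x /\ F x <> f x] & F 0 = t].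

Variables (n : nat) (c a : 'I_n -> R).

Definition inH (u : 'I_n -> R -> C) : Prop := forall k, inL2 (u k).

(* graph of the operator A:  u \in D(A) and Au = v (a.e.) *)
Definition Aop (u v : 'I_n -> R -> C) : Prop :=
  exists (g1 g2 : 'I_n -> R -> C) (t : C) (d : 'I_n -> C),
    [/\ forall k, isH2 (u k) (g1 k) (g2 k),
        forall k, trace0 (u k) t,
        forall k, trace0 (g1 k) (d k) &
        \sum_(k < n) toC (c k) * d k = 0] /\
    forall k, inL2 (v k) /\  leb.-negligible
          [set x | 0 < x /\ v k x <> - toC (c k) * g2 k x + toC (a k) * u k x].

Fixpoint DApow (j : nat) (u : 'I_n -> R -> C) : Prop :=
  match j with
  | 0 => inH u
  | j'.+1 => exists v, Aop u v /\ DApow j' v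
  end.

(* xi_k(lambda) = sqrt((lambda - a_k)/c_k) for real lambda with the branch
   sqrt(r e^{i phi}) = sqrt r e^{i phi/2}, phi in [-pi,pi):
   for lambda < a_k the argument is -pi, giving -i sqrt((a_k - lambda)/c_k). *)
Definition xi (k : 'I_n) (lam : R) : C :=
  if a k <= lam then toC (Num.sqrt ((lam - a k) / c k))
  else - iC * toC (Num.sqrt ((a k - lam) / c k)).

Definition sfun (k : 'I_n) (lam : R) : C :=
  - (\sum_(l < n | l != k) toC (c l) * xi l lam) / (toC (c k) * xi k lam).

Definition Fm (j : 'I_n) (lam : R) (k : 'I_n) (x : R) : C :=
  if k == j then ccos (xi j lam * toC x) - iC * sfun j lam * csin (xi j lam * toC x)
  else cexp (- iC * xi k lam * toC x).

Definition wfun (lam : R) : C := - iC * \sum_(j < n) toC (c j) * xi j lam.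

Definition qfun (l : 'I_n) (lam : R) : R :=
  if a l < lam then c l * ReC (xi l lam) / (pi * sqmod (wfun lam)) else 0.

Definition Vop (f : 'I_n -> R -> C) (k : 'I_n) (lam : R) : C :=
  \sum_(l < n) cint (fun x => f l x * (Fm k lam l x)^*%C).

Definition inL2qk (k : 'I_n) (W : R -> C) : Prop :=
  inL2w `]a k, +oo[ (qfun k) W.
Definition inL2q (W : 'I_n -> R -> C) : Prop := forall k, inL2qk k (W k).

Definition distH (u v : 'I_n -> R -> C) : \bar R :=
  (\sum_(k < n) \int[leb]_(x in pos_half) (sqmod (u k x - v k x))%:E)%E.
Definition distq (W Z : 'I_n -> R -> C) : \bar R :=
  (\sum_(k < n) \int[leb]_(x in `]a k, +oo[)
      (sqmod (W k x - Z k x) * qfun k x)%:E)%E.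

(* W = \tilde V u : the value at u of the (unique) isometric extension of V
   from prod_k C_c^infty(N_k) (with the H norm) to H: W is in L^2_q and
   V phi_m -> W in L^2_q whenever test functions phi_m -> u in H. *)
Definition isVtilde (u W : 'I_n -> R -> C) : Prop :=
  inL2q W /\
  forall phi : nat -> 'I_n -> R -> C,
    (forall m k, testC (phi m k)) ->
    (fun m => distH (phi m) u) @ \oo --> 0%E ->
    (fun m => distq (Vop (phi m)) W) @ \oo --> 0%E.

End StarGraph.

(* Main.v *)
(**
The transform V is isometric on test functions: for the branch of the square
root used here the exponentials exp (- i sum_k t_k xi_k (z)) / sum_k m_k xi_k (z),
with t_k >= 0 and m_k > 0, are holomorphic in the lower half-plane.  The products
of V f and of the density q are real parts of superpositions of boundary values
of such functions, and the Poisson formula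
int Re G (l) / (1 + l^2) dl = pi Re G (- i), applied to f and (1 + A^2) f,
collapses the spectral integral to the norm of f.  By density any value W of
the extended transform at u has the norm of u.

If A u = v, then cutting u off far away and integrating by parts gives l * W
as the transform of v: the Kirchhoff conditions cancel the boundary terms.
Conversely let l * W be square integrable.  For smooth compactly supported psi
satisfying the vertex conditions, the transform Z of psi obeys
|W + l Z|^2 <= |W|^2 + |l Z|^2 + |l W|^2 + |Z|^2, that is,
2 Re <u, A psi> - |psi|^2 <= |l W|^2.  Riesz representation on psi supported
away from the vertex makes u twice weakly differentiable; the remaining
boundary terms would be unbounded on functions psi concentrated near the
vertex unless u satisfies the vertex conditions, so u is in D(A).
The powers follow by induction.
*)
Require Import Defs.
From HB Require Import structures.
From mathcomp Require Import all_boot all_order all_algebra.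
From mathcomp Require Import all_classical all_reals all_analysis.
From mathcomp Require Import measurable_realfun complex ring lra.
Set Implicit Arguments. Unset Strict Implicit. Unset Printing Implicit Defensive.
Import Order.TTheory GRing.Theory Num.Theory.
Import numFieldNormedType.Exports.
Local Open Scope classical_set_scope.
Local Open Scope ring_scope.

(** * Complex-valued functions of a real variable *)

(** The pair [f] and [(1 + A^2) f] is chosen for two values of [1 + z^2]. On the real line this
    factor cancels the Poisson weight and leaves the bare spectral density; at [z = - i] it vanishes
    and kills every product of two exponential transforms. The free wave in [|x - y|] is no product:
    its kink at [x = y] survives at [- i] and yields [f (y)], hence the norm. On the real line the
    free and the reflected wave differ by a product of sines, which matches the sine that [F^{-,k}]
    carries on its own edge.

    V is an integral only on integrable functions. Between test functions and H stand the L2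
    functions vanishing beyond some [X]: they include cut-off elements of D(A), and V is continuous
    on them. As multiplication by [l] is unbounded, limits are taken below a spectral bound [N]
    before [N] grows.

    In the converse, [|u|^2] and [|A psi|^2] occur on both sides of the inequality for [W + l Z] and
    cancel, so a functional linear in [psi] is bounded by a constant plus [|psi|^2]. Near the vertex
    this last cost disappears: shrinking functions keep their value and slopes while their norms
    tend to 0. *)

Section ComplexToolbox.
Variable R : realType.
Local Notation C := (R[i]).
Implicit Types z w : C.

Lemma ReCD z w : ReC (z + w) = ReC z + ReC w. Proof. by case: z; case: w. Qed.
Lemma ImCD z w : ImC (z + w) = ImC z + ImC w. Proof. by case: z; case: w. Qed.
Lemma ReCN z : ReC (- z) = - ReC z. Proof. by case: z. Qed.
Lemma ImCN z : ImC (- z) = - ImC z. Proof. by case: z. Qed.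
Lemma ReCM z w : ReC (z * w) = ReC z * ReC w - ImC z * ImC w.
Proof. by case: z; case: w. Qed.
Lemma ImCM z w : ImC (z * w) = ReC z * ImC w + ImC z * ReC w.
Proof. by case: z => a b; case: w => c d; rewrite /ImC/=. Qed.
Lemma ReC0 : ReC (0 : C) = 0. Proof. by []. Qed.
Lemma ImC0 : ImC (0 : C) = 0. Proof. by []. Qed.
Lemma ReC1 : ReC (1 : C) = 1. Proof. by []. Qed.
Lemma ImC1 : ImC (1 : C) = 0. Proof. by []. Qed.
Lemma ReC_toC (x : R) : ReC (toC x) = x. Proof. by []. Qed.
Lemma ImC_toC (x : R) : ImC (toC x) = 0. Proof. by []. Qed.
Lemma ReCi : ReC (iC R) = 0. Proof. by []. Qed.
Lemma ImCi : ImC (iC R) = 1. Proof. by []. Qed.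
Lemma ReCJ z : ReC z^*%C = ReC z. Proof. by case: z. Qed.
Lemma ImCJ z : ImC z^*%C = - ImC z. Proof. by case: z. Qed.
Lemma ReCV z : ReC z^-1 = ReC z / sqmod z.
Proof. by case: z. Qed.
Lemma ImCV z : ImC z^-1 = - (ImC z / sqmod z).
Proof. by case: z. Qed.
Lemma ReC_sum (I : Type) (r : seq I) (P : pred I) (F : I -> C) :
  ReC (\sum_(i <- r | P i) F i) = \sum_(i <- r | P i) ReC (F i).
Proof. by apply: (big_morph _ ReCD ReC0). Qed.
Lemma ImC_sum (I : Type) (r : seq I) (P : pred I) (F : I -> C) :
  ImC (\sum_(i <- r | P i) F i) = \sum_(i <- r | P i) ImC (F i).
Proof. by apply: (big_morph _ ImCD ImC0). Qed.

Lemma ReC_cexp z : ReC (cexp z) = expR (ReC z) * cos (ImC z).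
Proof. by case: z => a b; rewrite /cexp /ReC/=; ring. Qed.
Lemma ImC_cexp z : ImC (cexp z) = expR (ReC z) * sin (ImC z).
Proof. by case: z => a b; rewrite /cexp /ImC/=; ring. Qed.

Definition CE := (ReC_cexp, ImC_cexp, ReCD, ImCD, ReCN, ImCN, ReCM, ImCM, ReC0, ImC0, ReC1, ImC1,
  ReC_toC, ImC_toC, ReCi, ImCi, ReCJ, ImCJ).

Lemma C_ext z w : ReC z = ReC w -> ImC z = ImC w -> z = w.
Proof. by case: z => a b; case: w => c d; rewrite /ReC /ImC /= => -> ->. Qed.

Lemma toCD (x y : R) : toC (x + y) = toC x + toC y.
Proof. by apply: C_ext; rewrite !CE// addr0. Qed.
Lemma toCN (x : R) : toC (- x) = - toC x.
Proof. by apply: C_ext; rewrite !CE// oppr0. Qed.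
Lemma toCM (x y : R) : toC (x * y) = toC x * toC y.
Proof. by apply: C_ext; rewrite !CE; ring. Qed.
Lemma toC0 : toC 0 = 0 :> C. Proof. by []. Qed.
Lemma toC1 : toC 1 = 1 :> C. Proof. by []. Qed.
Lemma toC2 : 2%:R = toC 2 :> C.
Proof. by rewrite -[toC 2]/(toC (1 + 1)) toCD toC1. Qed.
Lemma iC2 : iC R * iC R = -1.
Proof. by apply: C_ext; rewrite !CE; ring. Qed.
Lemma toC_eq0 (x : R) : (toC x == 0) = (x == 0).
Proof. by apply/eqP/eqP => [[]//|->]. Qed.

Lemma sqmod_ge0 z : 0 <= sqmod z. Proof. by rewrite addr_ge0// sqr_ge0. Qed.
Lemma sqmod_eq0 z : (sqmod z == 0) = (z == 0).
Proof.
apply/idP/eqP => [|->]; last by rewrite /sqmod !CE expr0n addr0.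
rewrite /sqmod paddr_eq0 ?sqr_ge0// !sqrf_eq0 => /andP[/eqP a /eqP b].
by apply: C_ext; rewrite ?a ?b.
Qed.
Lemma sqmod_gt0 z : (0 < sqmod z) = (z != 0).
Proof. by rewrite lt_neqAle sqmod_ge0 andbT eq_sym sqmod_eq0. Qed.
Lemma sqmodM z w : sqmod (z * w) = sqmod z * sqmod w.
Proof. by rewrite /sqmod !CE; ring. Qed.
Lemma sqmodN z : sqmod (- z) = sqmod z.
Proof. by rewrite /sqmod !CE; ring. Qed.
Lemma sqmod_toC (x : R) : sqmod (toC x) = x ^+ 2.
Proof. by rewrite /sqmod !CE; ring. Qed.

Definition cmod z := Num.sqrt (sqmod z).
Lemma cmodE z : cmod z = Normc.normc z. Proof. by case: z. Qed.
Lemma cmod_ge0 z : 0 <= cmod z. Proof. exact: sqrtr_ge0. Qed.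
Lemma cmod_sqr z : cmod z ^+ 2 = sqmod z.
Proof. by rewrite sqr_sqrtr// sqmod_ge0. Qed.
Lemma cmodM z w : cmod (z * w) = cmod z * cmod w.
Proof. by rewrite !cmodE Normc.normcM. Qed.
Lemma cmodD z w : cmod (z + w) <= cmod z + cmod w.
Proof. by rewrite !cmodE; exact: le_normcD. Qed.
Lemma cmodN z : cmod (- z) = cmod z. Proof. by rewrite /cmod sqmodN. Qed.
Lemma cmodV z : cmod z^-1 = (cmod z)^-1.
Proof. by rewrite !cmodE Normc.normcV. Qed.
Lemma cmod_toC (x : R) : cmod (toC x) = `|x|.
Proof. by rewrite /cmod sqmod_toC sqrtr_sqr. Qed.
Lemma cmod0 : cmod 0 = 0. Proof. by rewrite -toC0 cmod_toC normr0. Qed.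
Lemma cmod_iC : cmod (iC R) = 1.
Proof. by rewrite /cmod /sqmod !CE expr0n expr1n add0r sqrtr1. Qed.
Lemma cmod_eq0 z : (cmod z == 0) = (z == 0).
Proof. by rewrite sqrtr_eq0 -sqmod_eq0 eq_le sqmod_ge0 andbT. Qed.
Lemma cmod_gt0 z : (0 < cmod z) = (z != 0).
Proof. by rewrite sqrtr_gt0 sqmod_gt0. Qed.
Lemma Re_le_cmod z : `|ReC z| <= cmod z.
Proof. by rewrite -sqrtr_sqr ler_wsqrtr// lerDl sqr_ge0. Qed.
Lemma Im_le_cmod z : `|ImC z| <= cmod z.
Proof. by rewrite -sqrtr_sqr ler_wsqrtr// lerDr sqr_ge0. Qed.
Lemma cmod_sum (I : Type) (r : seq I) (P : pred I) (F : I -> C) :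
  cmod (\sum_(i <- r | P i) F i) <= \sum_(i <- r | P i) cmod (F i).
Proof.
elim/big_ind2 : _ => //; first by rewrite cmod0.
by move=> a b c d ab cd; rewrite (le_trans (cmodD _ _))// lerD.
Qed.

Lemma cexpD z w : cexp (z + w) = cexp z * cexp w.
Proof.
by apply: C_ext; rewrite !CE expRD ?cosD ?sinD; ring.
Qed.
Lemma cexp0 : cexp 0 = 1 :> C.
Proof. by apply: C_ext; rewrite !CE expR0 ?cos0 ?sin0; ring. Qed.
Lemma cmod_cexp z : cmod (cexp z) = expR (ReC z).
Proof.
rewrite /cmod /sqmod !CE !exprMn -mulrDr cos2Dsin2 mulr1.
by rewrite sqrtr_sqr ger0_norm// expR_ge0.
Qed.
End ComplexToolbox.

(** * Derivatives along a real parameter *)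

Section ComplexDerivative.

Variable R : realType.
Local Notation C := (R[i]).
Local Notation Re := (@ReC R).
Local Notation Im := (@ImC R).
Implicit Types (f g : R -> C) (s : R) (d e : C).

(** A pair of real derivatives. Holomorphic functions enter later only through composition with such
    curves, so the chain rule with a complex factor [d] does the work of the Cauchy-Riemann
    equations. *)
Definition cder f s d :=
  is_derive s 1 (Re \o f) (ReC d) /\ is_derive s 1 (Im \o f) (ImC d).

Lemma cder_eq f s d e : cder f s d -> d = e -> cder f s e.
Proof. by move=> h <-. Qed.

Lemma cder_unique f s d e : cder f s d -> cder f s e -> d = e.
Proof. by move=> [[_ a] [_ b]] [[_ c] [_ d']]; apply: C_ext; [rewrite -a -c|rewrite -b -d']. Qed.

Lemma cder_cst (z : C) s : cder (fun=> z) s 0.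
Proof. by split; rewrite /comp/=; exact: is_derive_cst. Qed.

Lemma cder_toC (h : R -> R) s (l : R) : is_derive s 1 h l -> cder (fun x => toC (h x)) s (toC l).
Proof. by move=> H; split => //; rewrite /comp/=; exact: is_derive_cst. Qed.

Lemma cderD f g s d e : cder f s d -> cder g s e -> cder (fun x => f x + g x) s (d + e).
Proof.
move=> [h1 h2] [h3 h4]; split; rewrite CE.
  rewrite (_ : _ \o _ = (Re \o f) + (Re \o g)); first exact: is_deriveD.
  by apply/funext => x; rewrite /= CE.
rewrite (_ : _ \o _ = (Im \o f) + (Im \o g)); first exact: is_deriveD.
by apply/funext => x; rewrite /= CE.
Qed.

Lemma cderM f g s d e : cder f s d -> cder g s e ->
  cder (fun x => f x * g x) s (d * g s + f s * e).
Proof.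
move=> [h1 h2] [h3 h4]; split.
  rewrite (_ : _ \o _ = (Re \o f) * (Re \o g) - (Im \o f) * (Im \o g)); last first.
    by apply/funext => x; rewrite /= CE.
  by apply: is_derive_eq; rewrite /= !CE /GRing.scale/=; ring.
rewrite (_ : _ \o _ = (Re \o f) * (Im \o g) + (Im \o f) * (Re \o g)); last first.
  by apply/funext => x; rewrite /= CE.
by apply: is_derive_eq; rewrite /= !CE /GRing.scale/=; ring.
Qed.

Lemma cderZ f s d (z : C) : cder f s d -> cder (fun x => z * f x) s (z * d).
Proof. by move=> h; apply: cder_eq (cderM (cder_cst z s) h) _; ring. Qed.

Lemma cderN f s d : cder f s d -> cder (fun x => - f x) s (- d).
Proof.
move=> h; have -> : (fun x => - f x) = (fun x => (-1) * f x).
  by apply/funext => x; rewrite mulN1r.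
by apply: cder_eq (cderZ (-1) h) _; ring.
Qed.

Lemma cder_sum (I : Type) (r : seq I) (F : I -> R -> C) (D : I -> C) s :
  (forall i, cder (F i) s (D i)) ->
  cder (fun x => \sum_(i <- r) F i x) s (\sum_(i <- r) D i).
Proof.
move=> h; elim: r => [|i r IH].
  by rewrite big_nil; under eq_fun do rewrite big_nil; exact: cder_cst.
by rewrite big_cons; under eq_fun do rewrite big_cons; exact: cderD.
Qed.

Lemma cderV f s d : cder f s d -> f s != 0 ->
  cder (fun x => (f x)^-1) s (- d / (f s) ^+ 2).
Proof.
move=> [h1 h2] f0.
pose q := (Re \o f) ^+ 2 + (Im \o f) ^+ 2 : R -> R.
have q0 : q s != 0 by rewrite -sqmod_eq0 in f0.
have qE : q s = Re (f s) ^+ 2 + Im (f s) ^+ 2 by [].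
have hq : is_derive s 1 q (2 * (Re (f s) * Re d + Im (f s) * Im d)).
  by apply: is_derive_eq; rewrite /= /GRing.scale/=; ring.
have hV := is_deriveV q0 hq.
have -> : - d / f s ^+ 2 = - d * (f s)^*%C ^+ 2 * toC ((q s) ^- 2).
  have -> : (q s) ^- 2 = (sqmod (f s ^+ 2))^-1 by rewrite expr2 sqmodM -expr2.
  rewrite -mulrA; congr (_ * _); apply: C_ext.
    by rewrite ReCV !expr2 !CE mulr0 subr0; congr (_ / _); ring.
  by rewrite ImCV !expr2 !CE mulr0 add0r -mulNr; congr (_ / _); ring.
split.
  rewrite (_ : _ \o _ = (Re \o f) * (fun x => (q x)^-1)); last first.
    by apply/funext => x; rewrite /= ReCV.
  apply: is_derive_eq.
  rewrite /GRing.scale/= !expr2 !CE; rewrite qE in q0 *; field.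
  exact: q0.
rewrite (_ : _ \o _ = - ((Im \o f) * (fun x => (q x)^-1))); last first.
  by apply/funext => x; rewrite /= ImCV.
apply: is_derive_eq.
rewrite /GRing.scale/= !expr2 !CE; rewrite qE in q0 *; field.
exact: q0.
Qed.

Lemma cder_exp f s d : cder f s d -> cder (fun x => cexp (f x)) s (d * cexp (f s)).
Proof.
move=> [h1 h2].
have hc := @is_derive1_comp _ _ _ _ _ _ (is_derive_cos (ImC (f s))) h2.
have hs := @is_derive1_comp _ _ _ _ _ _ (is_derive_sin (ImC (f s))) h2.
have he := @is_derive1_comp _ _ _ _ _ _ (is_derive_expR (ReC (f s))) h1.
split.
  rewrite (_ : _ \o _ = (expR \o (Re \o f)) * (cos \o (Im \o f))); last first.
    by apply/funext => x; exact: ReC_cexp.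
  by apply: is_derive_eq; rewrite !CE /GRing.scale/=; ring.
rewrite (_ : _ \o _ = (expR \o (Re \o f)) * (sin \o (Im \o f))); last first.
  by apply/funext => x; exact: ImC_cexp.
by apply: is_derive_eq; rewrite !CE /GRing.scale/=; ring.
Qed.

End ComplexDerivative.

(** * The square root on the closed lower half-plane *)

Section ComplexSqrt.
Variable R : realType.
Local Notation C := (R[i]).
Local Notation Re := (@ReC R).
Local Notation Im := (@ImC R).
Implicit Types z w : C.

(* the branch of the square root that is continuous on the closed lower half-plane *)
Definition csq z : C :=
  Complex (Num.sqrt ((cmod z + Re z) / 2)) (- Num.sqrt ((cmod z - Re z) / 2)).

Lemma Re_csq z : Re (csq z) = Num.sqrt ((cmod z + Re z) / 2).
Proof. by []. Qed.
Lemma Im_csq z : Im (csq z) = - Num.sqrt ((cmod z - Re z) / 2).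
Proof. by []. Qed.
Lemma Re_csq_ge0 z : 0 <= Re (csq z). Proof. by rewrite Re_csq sqrtr_ge0. Qed.
Lemma Im_csq_le0 z : Im (csq z) <= 0. Proof. by rewrite Im_csq oppr_le0 sqrtr_ge0. Qed.

Lemma cmodDRe_ge0 z : 0 <= (cmod z + Re z) / 2.
Proof.
rewrite divr_ge0// -lerBlDr sub0r (le_trans _ (Re_le_cmod z))//.
by rewrite (le_trans (ler_norm _))// normrN.
Qed.
Lemma cmodBRe_ge0 z : 0 <= (cmod z - Re z) / 2.
Proof. by rewrite divr_ge0// subr_ge0 (le_trans (ler_norm _))// Re_le_cmod. Qed.

Lemma sqmod_csq z : sqmod (csq z) = cmod z.
Proof.
rewrite /sqmod Re_csq Im_csq sqrrN !sqr_sqrtr ?cmodDRe_ge0 ?cmodBRe_ge0//; lra.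
Qed.

(** Since [|z|^2 - (Re z)^2 = (Im z)^2], the two real roots in [csq] multiply to [|Im z| / 2]. The
    minus sign in [csq] then restores [Im z] exactly when it is nonpositive. *)
Lemma csq_sqr z : Im z <= 0 -> csq z * csq z = z.
Proof.
move=> z0; apply: C_ext; rewrite !CE Re_csq Im_csq.
  rewrite mulrNN -!expr2 !sqr_sqrtr ?cmodDRe_ge0 ?cmodBRe_ge0//; lra.
rewrite mulrN mulNr (mulrC (Num.sqrt ((_ - _) / _))) -sqrtrM ?cmodDRe_ge0//.
have -> : (cmod z + Re z) / 2 * ((cmod z - Re z) / 2) = (- Im z / 2) ^+ 2.
  have := cmod_sqr z; rewrite /sqmod => h.
  have {}h : (Im z) ^+ 2 = cmod z ^+ 2 - Re z ^+ 2 by rewrite h; ring.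
  rewrite (_ : (- Im z / 2) ^+ 2 = (Im z) ^+ 2 / 4); last by field.
  by rewrite h; field.
rewrite sqrtr_sqr ger0_norm; first by field.
by rewrite divr_ge0// oppr_ge0.
Qed.

Lemma csq_eq0 z : (csq z == 0) = (z == 0).
Proof. by rewrite -sqmod_eq0 sqmod_csq cmod_eq0. Qed.

(** The explicit formula only serves to show that some derivative [e] exists. Its value comes from
    differentiating [csq f * csq f = f], an identity that holds in a neighbourhood because
    [Im f < 0] is an open condition. *)
Lemma cder_csq (f : R -> C) s d : Im (f s) < 0 -> cder f s d ->
  cder (fun x => csq (f x)) s (d / (2%:R * csq (f s))).
Proof.
move=> f0 [h1 h2].
have Imn0 : 0 < Im (f s) ^+ 2 by rewrite exprn_even_gt0//= lt_eqF.
have sq0 : 0 < sqmod (f s) by rewrite ltr_wpDl// sqr_ge0.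
have lt_cmod : `|Re (f s)| < cmod (f s).
  by rewrite -sqrtr_sqr ltr_sqrt// ltrDl.
have [d1 hm] : exists d1, is_derive s 1 (@cmod R \o f) d1.
  eexists; rewrite (_ : _ \o _ = Num.sqrt \o ((Re \o f) ^+ 2 + (Im \o f) ^+ 2)) //.
  apply: is_derive1_comp; exact: is_derive1_sqrt.
have p1 : 0 < (cmod (f s) + Re (f s)) / 2.
  by move: lt_cmod; rewrite ltr_norml => /andP[? ?]; rewrite divr_gt0//; lra.
have p2 : 0 < (cmod (f s) - Re (f s)) / 2.
  by move: lt_cmod; rewrite ltr_norml => /andP[? ?]; rewrite divr_gt0//; lra.
have [e he] : exists e, cder (fun x => csq (f x)) s e.
  have [e1 he1] : exists e1, is_derive s 1 (fun x => Num.sqrt ((cmod (f x) + Re (f x)) / 2)) e1.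
    eexists.
    rewrite (_ : (fun x => _) = Num.sqrt \o (2^-1 *: ((@cmod R \o f) + (Re \o f)))); last first.
      by apply/funext => x /=; rewrite mulrC.
    apply: is_derive1_comp; apply: is_derive1_sqrt.
    by rewrite mulrC in p1.
  have [e2 he2] : exists e1, is_derive s 1 (fun x => Num.sqrt ((cmod (f x) - Re (f x)) / 2)) e1.
    eexists.
    rewrite (_ : (fun x => _) = Num.sqrt \o (2^-1 *: ((@cmod R \o f) - (Re \o f)))); last first.
      by apply/funext => x /=; rewrite mulrC.
    apply: is_derive1_comp; apply: is_derive1_sqrt.
    by rewrite mulrC in p2.
  by exists (Complex e1 (- e2)); split => //; exact: is_deriveN.
apply: (cder_eq he).
have hq := cderM he he.
have c0 : csq (f s) != 0.
  by rewrite csq_eq0 -sqmod_eq0 gt_eqF.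
suff hd : e * csq (f s) + csq (f s) * e = d.
  rewrite -hd; field.
  exact: c0.
apply: (cder_unique hq).
have [g1 g2] : cder f s d by split.
have cI : {for s, continuous (Im \o f)}.
  by apply: differentiable_continuous; apply/derivable1_diffP; case: h2.
have nf : \near s, f s = csq (f s) * csq (f s).
  have : \forall x \near s, (Im \o f) x < 0 by apply: cvgr_lt cI _ f0.
  by apply: filterS => x x0; rewrite csq_sqr// ltW.
split; [apply: near_eq_is_derive g1|apply: near_eq_is_derive g2];
  apply: filterS nf => x h; [exact: (congr1 Re h)|exact: (congr1 Im h)].
Qed.

End ComplexSqrt.

(** * Real functions with finite integrals *)

Section RealIntegrals.
Context d (T : measurableType d) (R : realType) (mu : {measure set T -> \bar R}).
Implicit Types (D : set T) (f g : T -> R).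

Definition rint D f := mu.-integrable D (EFin \o f).

Lemma rint_meas D f : rint D f -> measurable_fun D f.
Proof. by move=> /measurable_int/measurable_EFinP. Qed.

Lemma rint_le D f g : measurable D -> measurable_fun D f -> rint D g ->
  (forall x, D x -> `|f x| <= g x) -> rint D f.
Proof.
move=> mD mf ig fg; apply: (le_integrable mD _ _ ig).
  exact/measurable_EFinP.
by move=> x Dx; rewrite /= lee_fin (le_trans (fg _ Dx))// ler_norm.
Qed.

Lemma rintD D f g : measurable D -> rint D f -> rint D g -> rint D (fun x => f x + g x).
Proof. by move=> mD hf hg; rewrite /rint; exact: (integrableD mD hf hg). Qed.

Lemma rintN D f : measurable D -> rint D f -> rint D (fun x => - f x).
Proof. by move=> mD hf; rewrite /rint; exact: (integrableN hf). Qed.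

Lemma rintB D f g : measurable D -> rint D f -> rint D g -> rint D (fun x => f x - g x).
Proof. by move=> mD hf hg; apply: rintD => //; exact: rintN. Qed.

Lemma rintZ D f (k : R) : measurable D -> rint D f -> rint D (fun x => k * f x).
Proof. by move=> mD hf; rewrite /rint /comp; under eq_fun do rewrite EFinM; exact: integrableZl. Qed.

Lemma rintZr D f (k : R) : measurable D -> rint D f -> rint D (fun x => f x * k).
Proof.
by move=> mD hf; under [X in rint _ X]eq_fun do rewrite mulrC; exact: rintZ.
Qed.

Lemma rint0 D : measurable D -> rint D (fun=> 0).
Proof. by move=> mD; rewrite /rint; exact: integrable0. Qed.

Lemma rint_sum D (I : Type) (r : seq I) (F : I -> T -> R) : measurable D ->
  (forall i, rint D (F i)) -> rint D (fun x => \sum_(i <- r) F i x).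
Proof.
move=> mD h; elim: r => [|i r IH].
  by under eq_fun do rewrite big_nil; exact: rint0.
by under eq_fun do rewrite big_cons; exact: rintD.
Qed.

Lemma rint_norm D f : measurable D -> rint D f -> rint D (fun x => `|f x|).
Proof. by move=> mD hf; rewrite /rint; exact: (integrable_norm hf). Qed.

Lemma rint_mkcond D f : measurable D -> rint D f <-> rint setT (f \_ D).
Proof. by move=> mD; rewrite /rint -restrict_EFin; exact: integrable_mkcond. Qed.

Lemma rint_EFin D f : measurable D -> rint D f ->
  (\int[mu]_(x in D) (f x)%:E)%E = (Rintegral mu D f)%:E.
Proof. by move=> mD hf; rewrite /Rintegral fineK// integrable_fin_num. Qed.

Lemma RintD D f g : measurable D -> rint D f -> rint D g ->
  Rintegral mu D (fun x => f x + g x) = Rintegral mu D f + Rintegral mu D g.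
Proof. by move=> *; exact: RintegralD. Qed.

Lemma RintZ D f k : measurable D -> rint D f ->
  Rintegral mu D (fun x => k * f x) = k * Rintegral mu D f.
Proof. by move=> *; exact: RintegralZl. Qed.

Lemma RintB D f g : measurable D -> rint D f -> rint D g ->
  Rintegral mu D (fun x => f x - g x) = Rintegral mu D f - Rintegral mu D g.
Proof. by move=> *; exact: RintegralB. Qed.

Lemma RintN D f : measurable D -> rint D f ->
  Rintegral mu D (fun x => - f x) = - Rintegral mu D f.
Proof.
move=> mD hf; rewrite -[RHS]mulN1r -RintZ//.
by apply: eq_Rintegral => x _; rewrite mulN1r.
Qed.

Lemma Rint_sum D (I : Type) (r : seq I) (F : I -> T -> R) : measurable D ->
  (forall i, rint D (F i)) ->
  Rintegral mu D (fun x => \sum_(i <- r) F i x) = \sum_(i <- r) Rintegral mu D (F i).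
Proof.
move=> mD h; elim: r => [|i r IH].
  under eq_fun do rewrite big_nil; rewrite big_nil.
  by rewrite /Rintegral integral0.
under eq_fun do rewrite big_cons; rewrite big_cons RintD// ?IH//.
exact: rint_sum.
Qed.

Lemma Rdct D (f_ : (T -> R)^nat) f g : measurable D ->
  (forall n, measurable_fun D (f_ n)) -> measurable_fun D f ->
  {ae mu, forall x, D x -> f_ ^~ x @ \oo --> f x} ->
  rint D g -> {ae mu, forall x n, D x -> `|f_ n x| <= g x} ->
  rint D f /\ Rintegral mu D (f_ n) @[n --> \oo] --> Rintegral mu D f.
Proof.
move=> mD mf_ mf cv ig le.
have [] := @dominated_convergence _ _ _ mu D mD (fun n => EFin \o f_ n) (EFin \o f) (EFin \o g).
- by move=> n; exact/measurable_EFinP.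
- exact/measurable_EFinP.
- by apply: filterS cv => x cx Dx; apply/cvg_EFin; [exact: nearW|exact: cx].
- exact: ig.
- by apply: filterS le => x le n Dx; rewrite /= lee_fin le.
move=> i1 _ i2; split; first exact: i1.
have : fine (\int[mu]_(x in D) (f_ n x)%:E)%E @[n --> \oo] --> fine (\int[mu]_(x in D) (f x)%:E)%E.
  apply: fine_cvg; rewrite fineK; first exact: i2.
  exact: integrable_fin_num.
exact.
Qed.

End RealIntegrals.
Arguments rint {d T R} mu D f.

(** * Integration on the line and the Cauchy density *)

Section LebesgueToolbox.
Variable R : realType.
Local Notation mu := (@lebesgue_measure R).
Implicit Types (f g F : R -> R).

Lemma measurable_inv (D : set R) : measurable_fun D (@GRing.inv R).
Proof.
apply: measurable_funS (@subsetT _ D) _ => //.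
rewrite -(setUv [set 0 : R]); apply/measurable_funU => //; first exact: measurableC.
split; first exact: measurable_fun_set1.
apply: open_continuous_measurable_fun.
  by rewrite openC; exact: closed_eq.
by move=> x /set_mem/= /eqP x0; exact: inv_continuous.
Qed.

Lemma measurable_funV d (T : measurableType d) (D : set T) (h : T -> R) :
  measurable_fun D h -> measurable_fun D (fun x => (h x)^-1).
Proof. by move=> mh; apply: measurableT_comp mh; exact: measurable_inv. Qed.

Lemma measurable_funsqrt d (T : measurableType d) (D : set T) (h : T -> R) :
  measurable_fun D h -> measurable_fun D (fun x => Num.sqrt (h x)).
Proof.
move=> mh; apply: (@measurableT_comp _ _ _ _ _ _ (@Num.sqrt R)) mh.
by apply: continuous_measurable_fun; exact: sqrt_continuous.
Qed.

Lemma FTC f F (a b : R) : a <= b -> (forall x : R, is_derive x (1 : R) F (f x)) -> continuous f ->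
  (\int[mu]_(x in `[a, b]) (f x)%:E)%E = (F b - F a)%:E.
Proof.
rewrite le_eqVlt => /predU1P[<-|ab] dF cf.
  by rewrite set_itv1 integral_set1 subrr.
have cF : continuous F.
  move=> x; apply: differentiable_continuous; apply/derivable1_diffP.
  by case: (dF x).
rewrite (@continuous_FTC2 _ f F)//.
- by exact: continuous_subspaceT cf.
- split => [x _||].
  + by case: (dF x).
  + by apply: cvg_at_right_filter; exact: cF.
  + by apply: cvg_at_left_filter; exact: cF.
- by move=> x _; rewrite derive1E; case: (dF x).
Qed.

Lemma rint_itv f a b : continuous f -> rint mu `[a, b] f.
Proof.
move=> cf; rewrite /rint; apply: continuous_compact_integrable.
  exact: segment_compact.
by exact: continuous_subspaceT cf.
Qed.

Definition nnitv (n : nat) : set R := `[- n%:R, n%:R]%classic.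

Lemma nnitv_near x : \forall n \near \oo, nnitv n x.
Proof.
near=> n; rewrite /nnitv/= in_itv/= -ler_norml.
by near: n; apply: nbhs_infty_ger; exact: num_real.
Unshelve. all: by end_near. Qed.

Lemma cvg_restrict_nnitv f x : (f \_ (nnitv n)) x @[n --> \oo] --> f x.
Proof.
apply: cvg_near_cst; near=> n; rewrite patchE mem_set//.
by near: n; exact: nnitv_near.
Unshelve. all: by end_near. Qed.

Lemma measurable_restrict_nnitv f n : measurable_fun setT f ->
  measurable_fun setT (f \_ (nnitv n)).
Proof. by move=> mf; apply/(measurable_restrictT _ _).1; [exact: measurable_itv|exact: measurable_funTS]. Qed.

Lemma Rintegral_cvg_nnitv f : rint mu setT f ->
  Rintegral mu (nnitv n) f @[n --> \oo] --> Rintegral mu setT f.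
Proof.
move=> hf; have mf := rint_meas hf.
have cv : {ae mu, forall x, setT x -> (fun n => (f \_ (nnitv n)) x) @ \oo --> f x}.
  by apply: aeW => x _; exact: cvg_restrict_nnitv.
have le : {ae mu, forall x n, setT x -> `|(f \_ (nnitv n)) x| <= `|f x|}.
  by apply: aeW => x n _; rewrite patchE; case: ifP => // _; rewrite normr0.
have [_] := @Rdct _ _ _ mu _ _ _ _ measurableT (fun n => measurable_restrict_nnitv n mf) mf cv
  (rint_norm measurableT hf) le.
by under eq_fun do rewrite -Rintegral_mkcond.
Qed.

(** The primitive need not vanish at infinity: it is enough that its values at [n] and [- n]
    approach each other. The primitive used later follows a closed circle, whose two ends meet at
    one point. *)
Lemma FTC_line0 f F : (forall x : R, is_derive x (1 : R) F (f x)) -> continuous f ->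
  rint mu setT f -> (F n%:R - F (- n%:R)) @[n --> \oo] --> (0:R) ->
  Rintegral mu setT f = 0.
Proof.
move=> dF cf hf cv.
rewrite -(cvg_lim _ (Rintegral_cvg_nnitv hf))//; apply/cvg_lim => //.
rewrite (_ : (fun n => _) = (fun n : nat => F n%:R - F (- n%:R)))//.
apply/funext => n; rewrite /Rintegral/nnitv (@FTC f F)//.
by rewrite lerNl (le_trans _ (ler0n _ _))// oppr_le0.
Qed.

Lemma FTC_line_ge0 f F l : (forall x : R, is_derive x (1 : R) F (f x)) -> continuous f ->
  (forall x, 0 <= f x) -> (F n%:R - F (- n%:R)) @[n --> \oo] --> l ->
  (\int[mu]_x (f x)%:E)%E = l%:E.
Proof.
move=> dF cf f0 cv.
have mf := continuous_measurable_fun cf.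
pose g n x := (f \_ (nnitv n) x)%:E.
have := @cvg_monotone_convergence _ _ _ mu setT measurableT g.
have mg n : measurable_fun setT (g n).
  by apply/measurable_EFinP; exact: measurable_restrict_nnitv.
have g0 n x : (setT x -> 0 <= g n x)%E.
  by move=> _; rewrite lee_fin patchE; case: ifP.
have ndg x : setT x -> {homo (g ^~ x) : n m / (n <= m)%N >-> (n <= m)%E}.
  move=> _ n m nm; rewrite lee_fin !patchE.
  case: ifPn => [/set_mem xn|_]; last by case: ifP.
  rewrite mem_set//; move: xn; rewrite /nnitv/= !in_itv/= -!ler_norml => /le_trans; apply.
  by rewrite ler_nat.
move=> /(_ mg g0 ndg) h.
have -> : (\int[mu]_x (f x)%:E = \int[mu]_x limn (g^~ x))%E.
  apply: eq_integral => x _; apply/esym/cvg_lim => //.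
  by apply/cvg_EFin; [exact: nearW|exact: cvg_restrict_nnitv].
rewrite -(cvg_lim _ h)//; apply/cvg_lim => //.
rewrite (_ : (fun n => _) = (fun n : nat => (F n%:R - F (- n%:R))%:E)).
  by apply/cvg_EFin; [exact: nearW|].
apply/funext => n; rewrite -(@FTC f F)//.
  by rewrite [RHS]integral_mkcond; apply: eq_integral => x _; rewrite /g !patchE; case: ifP.
by rewrite lerNl (le_trans _ (ler0n _ _))// oppr_le0.
Qed.

Definition cauchyd (x : R) : R := (oneDsqr x)^-1.

Lemma cauchyd_ge0 x : 0 <= cauchyd x.
Proof. by rewrite invr_ge0 (le_trans ler01). Qed.
Lemma cauchyd_continuous : continuous cauchyd. Proof. exact: continuous_oneDsqrV. Qed.

Lemma integral_cauchyd : (\int[mu]_x (cauchyd x)%:E)%E = (pi : R)%:E.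
Proof.
apply: (@FTC_line_ge0 _ atan) => [||].
- exact: cauchyd_continuous.
- exact: cauchyd_ge0.
rewrite (_ : pi = pi / 2 - - (pi / 2)); last by lra.
have cn : (atan n%:R : R) @[n --> \oo] --> pi / 2.
  by apply: (@cvg_comp _ _ _ (fun n => n%:R) atan); [exact: cvgr_idn|exact: cvgy_atan].
under eq_fun do rewrite atanN.
by apply: cvgB => //; exact: cvgN.
Qed.

Lemma rint_cauchyd : rint mu setT cauchyd.
Proof.
apply/integrableP; split.
  by apply/measurable_EFinP; apply: continuous_measurable_fun; exact: cauchyd_continuous.
under eq_integral => x _ do rewrite /= ger0_norm ?cauchyd_ge0//.
by rewrite integral_cauchyd ltry.
Qed.

End LebesgueToolbox.

(** * The Poisson formula in the lower half-plane *)

Section Poisson.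
Variable R : realType.
Local Notation C := (R[i]).
Local Notation Re := (@ReC R).
Local Notation Im := (@ImC R).
Local Notation mu := (@lebesgue_measure R).
Implicit Types (t s x : R) (z : C).

(* For t in ]0, 1[ this is (s - i t) / (1 + i t s): it maps the real line onto the
   hyperbolic circle of the lower half-plane centered at - i. *)
Definition mob t s : C :=
  Complex (s * (1 - t ^+ 2) / (1 + t ^+ 2 * s ^+ 2))
          (- (t * (1 + s ^+ 2) / (1 + t ^+ 2 * s ^+ 2))).
(** This is [(1 + i t s)^-2], the common factor of both partial derivatives of [mob]. They are its
    multiples by [1 - t^2] (in [s]) and by [- i (1 + s^2)] (in [t]), so a radial derivative can be
    rewritten as a tangential one. *)
Definition mobk t s : C :=
  Complex ((1 - t ^+ 2 * s ^+ 2) / (1 + t ^+ 2 * s ^+ 2) ^+ 2)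
          (- (2 * t * s / (1 + t ^+ 2 * s ^+ 2) ^+ 2)).

Lemma mob_den_gt0 t s : 0 < 1 + t ^+ 2 * s ^+ 2.
Proof. by rewrite ltr_pwDl// mulr_ge0// sqr_ge0. Qed.
Lemma mob_den_neq0 t s : 1 + t ^+ 2 * s ^+ 2 != 0.
Proof. by rewrite gt_eqF// mob_den_gt0. Qed.

Lemma Im_mob t s : 0 < t -> t <= 1 -> Im (mob t s) <= - t.
Proof.
move=> t0 t1; rewrite lerN2 ler_pdivlMr ?mob_den_gt0// ler_pM2l// lerD2l.
by rewrite ler_piMl ?sqr_ge0// expr_le1// ltW.
Qed.

Lemma mob1 s : mob 1 s = - iC R.
Proof.
apply: C_ext; rewrite !CE /mob/=; first by rewrite expr1n subrr mulr0 mul0r oppr0.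
by rewrite expr1n !mul1r divff// gt_eqF// ltr_pwDl// sqr_ge0.
Qed.

Lemma is_derive_quad (k b s : R) : is_derive s 1 (fun s : R => k + b * s ^+ 2) (2 * b * s).
Proof.
have h := is_deriveD (is_derive_cst k s 1) (is_deriveZ b (is_deriveX 2 (is_derive_id s 1))).
have -> : (fun s : R => k + b * s ^+ 2) = cst k + b \*: id ^+ 2 by [].
apply: (is_derive_eq h); rewrite /GRing.scale/=; ring.
Qed.

Lemma is_derive_lin (b s : R) : is_derive s 1 (fun s : R => b * s) b.
Proof.
have h := is_deriveZ b (is_derive_id s 1).
by apply: (is_derive_eq h); rewrite /GRing.scale/= mulr1.
Qed.

Lemma is_derive_frac (N Q : R -> R) (s n q : R) : is_derive s 1 Q q -> Q s != 0 ->
  is_derive s 1 N n ->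
  is_derive s 1 (fun s => N s / Q s) ((n * Q s - N s * q) / (Q s) ^+ 2).
Proof.
move=> hQ Q0 hN; have h := is_deriveM hN (is_deriveV Q0 hQ).
apply: (is_derive_eq h); rewrite /GRing.scale/=; field.
exact: Q0.
Qed.

Lemma cder_mob_s t s : cder (mob t) s (toC (1 - t ^+ 2) * mobk t s).
Proof.
have h0 := mob_den_neq0 t s.
have hq := is_derive_quad 1 (t ^+ 2) s.
split.
  have h := is_derive_frac hq h0 (is_derive_lin (1 - t ^+ 2) s).
  have -> : Re \o mob t = (fun s => (1 - t ^+ 2) * s / (1 + t ^+ 2 * s ^+ 2)).
    by apply/funext => r; rewrite /mob/= (mulrC r).
  apply: (is_derive_eq h); rewrite !CE /mobk/=; field.
  by rewrite ?exprMn h0.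
have h := is_deriveN (is_derive_frac hq h0 (is_derive_quad t t s)).
have -> : Im \o mob t = - (fun s => (t + t * s ^+ 2) / (1 + t ^+ 2 * s ^+ 2)).
  by apply/funext => r; rewrite /mob/= mulrDr mulr1.
apply: (is_derive_eq h); rewrite !CE /mobk/=; field.
by rewrite ?exprMn h0.
Qed.

Lemma cder_mob_t t s : cder (mob ^~ s) t (- iC R * toC (1 + s ^+ 2) * mobk t s).
Proof.
have h0 : 1 + s ^+ 2 * t ^+ 2 != 0 by rewrite mulrC mob_den_neq0.
have hq := is_derive_quad 1 (s ^+ 2) t.
split.
  have h := is_derive_frac hq h0 (is_derive_quad s (- s) t).
  have -> : Re \o (mob ^~ s) = (fun t => (s + - s * t ^+ 2) / (1 + s ^+ 2 * t ^+ 2)).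
    by apply/funext => r; rewrite /mob/= mulrBr mulr1 mulNr (mulrC (s ^+ 2)).
  apply: (is_derive_eq h); rewrite !CE /mobk/=; field.
  by rewrite ?exprMn mob_den_neq0.
have h := is_deriveN (is_derive_frac hq h0 (is_derive_lin (1 + s ^+ 2) t)).
have -> : Im \o (mob ^~ s) = - (fun t => ((1 + s ^+ 2) * t) / (1 + s ^+ 2 * t ^+ 2)).
  by apply/funext => r; congr (- (_ / (1 + _))); exact: mulrC.
apply: (is_derive_eq h); rewrite !CE /mobk/=; field.
by rewrite ?exprMn mob_den_neq0.
Qed.

Lemma cmod_mobk t s : cmod (mobk t s) = (1 + t ^+ 2 * s ^+ 2)^-1.
Proof.
have h0 := mob_den_neq0 t s.
rewrite /cmod (_ : sqmod _ = ((1 + t ^+ 2 * s ^+ 2)^-1) ^+ 2).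
  by rewrite sqrtr_sqr ger0_norm// invr_ge0 ltW// mob_den_gt0.
by rewrite /sqmod /mobk /=; field; rewrite ?exprMn h0.
Qed.

(* mob t at 1 / s, extended through s = 0 *)
Definition mobV t s : C :=
  Complex (s * (1 - t ^+ 2) / (s ^+ 2 + t ^+ 2)) (- (t * (1 + s ^+ 2) / (s ^+ 2 + t ^+ 2))).

Lemma mobVE t s : s != 0 -> mobV t s^-1 = mob t s.
Proof.
move=> s0; have h0 := mob_den_neq0 t s.
have h1 : s ^- 2 + t ^+ 2 != 0.
  have -> : s ^- 2 + t ^+ 2 = (1 + t ^+ 2 * s ^+ 2) / s ^+ 2 by field.
  by rewrite mulf_neq0// invr_neq0// expf_neq0.
by apply: C_ext; rewrite /mobV /mob /=; field; rewrite ?exprMn s0 ?h0 ?andbT.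
Qed.

Lemma cder_mobV t : 0 < t -> exists d, cder (mobV t) 0 d.
Proof.
move=> t0.
have hq := is_derive_quad (t ^+ 2) 1 0.
have h0 : t ^+ 2 + 1 * 0 ^+ 2 != 0 by rewrite expr0n mulr0 addr0 expf_neq0// gt_eqF.
eexists (Complex _ _); split.
  have -> : Re \o mobV t = (fun s => (1 - t ^+ 2) * s / (t ^+ 2 + 1 * s ^+ 2)).
    by apply/funext => r; rewrite /mobV/= (mulrC r) mul1r (addrC (r ^+ 2)).
  exact: (is_derive_frac hq h0 (is_derive_lin (1 - t ^+ 2) 0)).
have -> : Im \o mobV t = - (fun s => (t + t * s ^+ 2) / (t ^+ 2 + 1 * s ^+ 2)).
  by apply/funext => r; congr (- (_ / _)); rewrite ?mulrDr ?mulr1 ?mul1r /= ?mul1r ?mulr1 1?addrC.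
exact: (is_deriveN (is_derive_frac hq h0 (is_derive_quad t t 0))).
Qed.

Lemma Im_mobV0 t : 0 < t -> Im (mobV t 0) < 0.
Proof.
move=> t0; rewrite /mobV/= oppr_lt0 expr0n addr0 add0r mulr1 divr_gt0//.
by rewrite exprn_gt0.
Qed.

(* Holomorphy in the lower half-plane is expressed along curves. *)
Record holb (G G' : C -> C) : Prop := Holb {
  holbD : forall (f : R -> C) s d, Im (f s) < 0 -> cder f s d ->
    cder (fun x => G (f x)) s (d * G' (f s));
  holbD' : forall (f : R -> C) s d, Im (f s) < 0 -> cder f s d ->
    exists e, cder (fun x => G' (f x)) s e;
  holb_bound : forall t, 0 < t -> exists K, forall z, Im z <= - t ->
    cmod (G z) <= K /\ cmod (G' z) <= K }.

Lemma cder_cvgRe (f : R -> C) s d : cder f s d -> {for s, continuous (Re \o f)}.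
Proof. by case=> h _; apply: differentiable_continuous; apply/derivable1_diffP; case: h. Qed.
Lemma cder_cvgIm (f : R -> C) s d : cder f s d -> {for s, continuous (Im \o f)}.
Proof. by case=> _ h; apply: differentiable_continuous; apply/derivable1_diffP; case: h. Qed.

Variables (G G' : C -> C) (D : R -> R).
Hypothesis hG : holb G G'.
Hypothesis Dint : rint mu setT (fun s => D s * cauchyd s).
Hypothesis Dub : {ae mu, forall s t, 0 < t -> t <= 1 -> cmod (G (mob t s)) <= D s}.

Let g t s := Re (G (mob t s)) * cauchyd s.

Let Imob_lt0 t s : 0 < t -> t <= 1 -> Im (mob t s) < 0.
Proof. by move=> t0 t1; rewrite (le_lt_trans (Im_mob s t0 t1))// oppr_lt0. Qed.

Let g_cont t : 0 < t -> t <= 1 -> continuous (g t).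
Proof.
move=> t0 t1 s; rewrite /g; apply: cvgM; last exact: cauchyd_continuous.
exact: cder_cvgRe (holbD hG (Imob_lt0 s t0 t1) (cder_mob_s t s)).
Qed.

Let g_le (t_ : nat -> R) : (forall n, 0 < t_ n) -> (forall n, t_ n <= 1) ->
  {ae mu, forall s n, setT s -> `|g (t_ n) s| <= D s * cauchyd s}.
Proof.
move=> t0 t1; case: Dub => N [mN N0 sN]; exists N; split => // s /= hs; apply: sN => /= h.
apply: hs => n _.
rewrite /g normrM (ger0_norm (cauchyd_ge0 _)) ler_wpM2r ?cauchyd_ge0//.
by rewrite (le_trans (Re_le_cmod _))// h.
Qed.

Let g_int t : 0 < t -> t <= 1 -> rint mu setT (g t).
Proof.
move=> t0 t1; have [K hK] := holb_bound hG t0.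
apply: (rint_le measurableT) (rintZ K measurableT (@rint_cauchyd R)) _ => [|s _].
  by apply: continuous_measurable_fun; exact: g_cont.
rewrite /g normrM (ger0_norm (cauchyd_ge0 _)) ler_wpM2r ?cauchyd_ge0//.
by rewrite (le_trans (Re_le_cmod _))//; have [] := hK _ (Im_mob s t0 t1).
Qed.

(** The radial derivative of the weighted integrand: the factor [1 + s^2] produced by [mob] cancels
    [cauchyd], and multiplication by [- i] turns the real part into an imaginary part. *)
Let dg t s := Im (mobk t s * G' (mob t s)).

Let g_der t s : 0 < t -> t <= 1 -> is_derive t 1 (g ^~ s) (dg t s).
Proof.
move=> t0 t1.
have [h _] := @holbD _ _ hG (mob ^~ s) t _ (Imob_lt0 s t0 t1) (cder_mob_t t s).
have -> : g ^~ s = cauchyd s *: (Re \o (fun x => G (mob x s))).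
  by apply/funext => x; rewrite /g/= /GRing.scale/= mulrC.
apply: is_derive_eq; rewrite /dg/= /GRing.scale/= !CE.
have h0 : 1 + s ^+ 2 != 0 by rewrite gt_eqF// ltr_pwDl// sqr_ge0.
by rewrite /cauchyd /oneDsqr; field.
Qed.


Let dg_le t v : 0 < v -> v <= t -> t <= 1 -> forall K,
  (forall z, Im z <= - v -> cmod (G z) <= K /\ cmod (G' z) <= K) ->
  forall s, `|dg t s| <= K * v ^- 2 * cauchyd s.
Proof.
move=> v0 vt t1 K hK s.
have zv : Im (mob t s) <= - v.
  by rewrite (le_trans (Im_mob s (lt_le_trans v0 vt) t1))// lerN2.
have [_ hG'] := hK _ zv.
rewrite (le_trans (Im_le_cmod _))// cmodM cmod_mobk mulrC -mulrA ler_pM ?cmod_ge0//.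
  by rewrite invr_ge0 ltW// mob_den_gt0.
have o0 : 0 < oneDsqr s by rewrite (lt_le_trans ltr01).
rewrite /cauchyd -invfM lef_pV2 ?posrE ?mulr_gt0 ?exprn_gt0 ?mob_den_gt0//.
have vt2 : v ^+ 2 <= t ^+ 2 by rewrite lerXn2r// ?nnegrE ltW// (lt_le_trans v0).
have v1 : v ^+ 2 <= 1 by rewrite (le_trans vt2)// expr_le1// ltW// (lt_le_trans v0).
by rewrite /oneDsqr mulrDr mulr1 lerD// ler_wpM2r// sqr_ge0.
Qed.

Let dg_cont t : 0 < t -> t <= 1 -> continuous (dg t).
Proof.
move=> t0 t1 s.
have [e he] := holbD' hG (Imob_lt0 s t0 t1) (cder_mob_s t s).
have [k hk] : exists k, cder (mobk t) s k.
  have h0 := mob_den_neq0 t s.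
  have h2 : (1 + t ^+ 2 * s ^+ 2) ^+ 2 != 0 by rewrite expf_neq0.
  have hq := is_deriveX 2 (is_derive_quad 1 (t ^+ 2) s).
  eexists (Complex _ _); split.
    have -> : Re \o mobk t = (fun s => (1 + - t ^+ 2 * s ^+ 2) / (1 + t ^+ 2 * s ^+ 2) ^+ 2).
      by apply/funext => r; rewrite mulNr.
    exact: (is_derive_frac hq h2 (is_derive_quad 1 (- t ^+ 2) s)).
  have -> : Im \o mobk t = - (fun s => (2 * t * s) / (1 + t ^+ 2 * s ^+ 2) ^+ 2) by [].
  exact: (is_deriveN (is_derive_frac hq h2 (is_derive_lin (2 * t) s))).
exact: cder_cvgIm (cderM hk he).
Qed.

Let dg_int t : 0 < t -> t <= 1 -> rint mu setT (dg t).
Proof.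
move=> t0 t1; have [K hK] := holb_bound hG t0.
apply: (rint_le measurableT) (rintZ (K * t ^- 2) measurableT (@rint_cauchyd R)) _ => [|s _].
  by apply: continuous_measurable_fun; exact: dg_cont.
exact: dg_le.
Qed.

(** Up to the constant [1 - t^2], [dg t] is the derivative in [s] of [Im G (mob t s)]. Both ends of
    the line correspond to the same point of the circle, namely [mobV t 0], where [G] is continuous;
    the boundary terms therefore cancel. *)
Let dg_int0 t : 0 < t -> t < 1 -> Rintegral mu setT (dg t) = 0.
Proof.
move=> t0 t1.
have t2 : 1 - t ^+ 2 != 0.
  by rewrite subr_eq0 eq_sym lt_eqF// expr_lt1// ltW.
pose H s := (1 - t ^+ 2)^-1 * Im (G (mob t s)).
apply: (@FTC_line0 _ (dg t) H) => [s|||].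
- have [_ h] := holbD hG (Imob_lt0 s t0 (ltW t1)) (cder_mob_s t s).
  apply: (is_derive_eq (is_deriveZ (1 - t ^+ 2)^-1 h)).
  rewrite /dg/= /GRing.scale/= !CE; field.
  exact: t2.
- exact: dg_cont (ltW t1).
- exact: dg_int (ltW t1).
have [d hd] := cder_mobV t0.
have [_ h] := holbD hG (Im_mobV0 t0) hd.
pose P s := (1 - t ^+ 2)^-1 * Im (G (mobV t s)).
have cP : {for 0, continuous P}.
  apply: cvgM; first exact: cvg_cst.
  by apply: differentiable_continuous; apply/derivable1_diffP; case: h.
have inv0 : (n%:R^-1 : R) @[n --> \oo] --> (0 : R).
  by rewrite -cvg_shiftS; exact: cvg_harmonic.
have c1 : P (n%:R^-1) @[n --> \oo] --> P 0.
  by apply: (@cvg_comp _ _ _ (fun n => n%:R^-1) P); [exact: inv0|exact: cP].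
have c2 : P (- n%:R^-1) @[n --> \oo] --> P 0.
  apply: (@cvg_comp _ _ _ (fun n => - n%:R^-1) P); last exact: cP.
  by rewrite -oppr0; exact: cvgN.
rewrite -(subrr (P 0)).
apply: cvg_trans (cvgB c1 c2); apply: near_eq_cvg.
near=> n.
have n0 : (n%:R : R) != 0.
  by rewrite pnatr_eq0 -lt0n; near: n; exact: nbhs_infty_gt.
have e x : x != 0 -> P x^-1 = H x by move=> x0; rewrite /P/H mobVE.
suff <- : P n%:R^-1 - P (- n%:R^-1) = H n%:R - H (- n%:R) by [].
by rewrite -!e ?oppr_eq0// invrN.
Unshelve. all: by end_near. Qed.

Let I t := Rintegral mu setT (g t).

Let I_der t : 0 < t -> t < 1 -> is_derive t 1 I 0.
Proof.
move=> t0 t1.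
(* An open interval around [t] inside []0, 1[]. On it the circles stay in [Im z <= - v], so a single
   bound [K] dominates the derivative and allows differentiation under the integral. *)
pose v := t / 2; pose v' := (1 + t) / 2.
have v0 : 0 < v by rewrite /v; lra.
have [K hK] := holb_bound hG v0.
have K0 : 0 <= K.
  have zz : Im (Complex 0 (- v)) <= - v by [].
  by have [h _] := hK _ zz; exact: le_trans (cmod_ge0 _) h.
pose U s := K * v ^- 2 * cauchyd s.
have U0 s : 0 <= U s.
  by rewrite /U !mulr_ge0// ?cauchyd_ge0// invr_ge0 exprn_ge0// ltW.
have iU : rint mu setT U by apply: rintZ => //; exact: rint_cauchyd.
have it : `]v, v'[%classic t by rewrite /= in_itv/= /v /v'; apply/andP; split; lra.
have bd x : `]v, v'[%classic x -> 0 < x /\ x < 1.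
  by rewrite /= in_itv/= /v /v' => /andP[? ?]; split; lra.
have ig x : `]v, v'[%classic x -> mu.-integrable setT (EFin \o g x).
  by move=> /bd[? ?]; apply: g_int => //; exact: ltW.
have dgx x y : `]v, v'[%classic x -> setT y -> derivable (g ^~ y) x 1.
  by move=> /bd[? ?] _; case: (@g_der x y) => //; exact: ltW.
have dgE x y : `]v, v'[%classic x -> partial1of2 g x y = dg x y.
  by move=> /bd[x0 x1]; rewrite partial1of2E; case: (g_der y x0 (ltW x1)).
have ub x y : `]v, v'[%classic x -> setT y -> `|partial1of2 g x y| <= U y.
  move=> xi _; rewrite dgE//; apply: dg_le => //.
    by move: xi => /=; rewrite in_itv/= => /andP[/ltW].
  by have [_ /ltW] := bd _ xi.
have dI := derivable_under_integral measurableT it ig dgx U0 iU ub.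
have DI := differentiation_under_integral measurableT it ig dgx U0 iU ub.
apply: DeriveDef; first exact: dI.
rewrite -derive1E DI -[RHS](dg_int0 t0 t1).
by apply: eq_Rintegral => y _; exact: dgE.
Qed.

Let I_cst t t' : 0 < t -> t < t' -> t' < 1 -> I t = I t'.
Proof.
move=> t0 tt' t'1.
have [x _] : exists2 x, x \in `[t, t']%R & I t' - I t = 0 * (t' - t).
  apply: (@MVT_segment _ I (fun=> 0)); first exact: ltW.
    move=> x; rewrite in_itv/= => /andP[tx xt']; apply: I_der.
      exact: lt_trans tx.
    exact: lt_trans t'1.
  apply: derivable_within_continuous => x; rewrite in_itv/= => /andP[tx xt'].
  have : is_derive x 1 I 0.
    by apply: I_der; [exact: lt_le_trans tx|exact: le_lt_trans t'1].
  by case.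
by rewrite mul0r => /eqP; rewrite subr_eq0 => /eqP.
Qed.

(** By [dg_int0] the mean of [Re G] over the hyperbolic circles does not depend on [t]. As [t] tends
    to 0 the circles open up to the real line, as [t] tends to 1 they shrink to [- i]; [D] dominates
    both passages to the limit. *)
Lemma poisson :
  {ae mu, forall s, forall t_ : nat -> R, (forall n, 0 < t_ n) -> t_ n @[n --> \oo] --> (0 : R) ->
     Re (G (mob (t_ n) s)) @[n --> \oo] --> Re (G (toC s))} ->
  measurable_fun setT (fun s => Re (G (toC s))) ->
  rint mu setT (fun s => Re (G (toC s)) * cauchyd s) /\
  Rintegral mu setT (fun s => Re (G (toC s)) * cauchyd s) = pi * Re (G (- iC R)).
Proof.
move=> hlim mG.
(* The shift by 2 gives [h n <= 1/2], so that both [h n] and [1 - h n] are admissible radii; they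
   run to the two ends of []0, 1[]. *)
pose h n : R := (n.+2%:R)^-1.
have h0 n : 0 < h n by rewrite invr_gt0 ltr0n.
have h1 n : h n <= 2^-1 by rewrite lef_pV2 ?posrE ?ltr0n// ler_nat.
have ch : h n @[n --> \oo] --> (0 : R).
  have : (n.+1%:R^-1 : R) @[n --> \oo] --> (0 : R) by exact: cvg_harmonic.
  by rewrite -cvg_shiftS.
have IE t : 0 < t -> t < 1 -> I t = I 2^-1.
  move=> t0 t1; have [tl|tl|->//] := ltgtP t 2^-1.
    by apply: I_cst => //; lra.
  by apply/esym; apply: I_cst => //; lra.
have h1' n : h n <= 1 by have := h1 n; lra.
have mlim : measurable_fun setT (fun s => Re (G (toC s)) * cauchyd s).
  by apply: measurable_funM => //; exact: rint_meas (@rint_cauchyd R).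
have clim : {ae mu, forall s, setT s ->
    (fun n => g (h n) s) @ \oo --> Re (G (toC s)) * cauchyd s}.
  case: hlim => N [mN N0 sN]; exists N; split => // s /= hs; apply: sN => /= h'.
  by apply: hs => _; apply: cvgM; [exact: h'|exact: cvg_cst].
have [i1 c1] := @Rdct _ _ R mu setT _ _ _ measurableT
  (fun n => rint_meas (g_int (h0 n) (h1' n))) mlim clim
  Dint (g_le h0 h1').
split; first exact: i1.
have e1 : I (h n) @[n --> \oo] --> I 2^-1.
  by apply: cvg_near_cst; apply: nearW => n; apply: IE => //; rewrite (le_lt_trans (h1 n))//; lra.
have cs : rint mu setT (fun s => Re (G (- iC R)) * cauchyd s).
  by apply: rintZ => //; exact: rint_cauchyd.
have k0 n : 0 < 1 - h n by have := h1 n; lra.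
have k1 n : 1 - h n <= 1 by have := h0 n; lra.
have clim1 : {ae mu, forall s, setT s ->
    (fun n => g (1 - h n) s) @ \oo --> Re (G (- iC R)) * cauchyd s}.
  apply: aeW => s _; apply: cvgM; last exact: cvg_cst.
  rewrite -(mob1 s).
  apply: (@cvg_comp _ _ _ (fun n => 1 - h n) (Re \o (fun t => G (mob t s)))); last first.
    exact: cder_cvgRe (@holbD _ _ hG (mob ^~ s) 1 _ (Imob_lt0 s ltr01 (lexx 1)) (cder_mob_t 1 s)).
  have : (1 - h n) @[n --> \oo] --> (1 - 0 : R) by apply: cvgB => //; exact: cvg_cst.
  by rewrite subr0.
have [i2 c2] := @Rdct _ _ R mu setT _ _ _ measurableT
  (fun n => rint_meas (g_int (k0 n) (k1 n))) (rint_meas cs) clim1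
  Dint (g_le k0 k1).
have e2 : I (1 - h n) @[n --> \oo] --> I 2^-1.
  apply: cvg_near_cst; apply: nearW => n; apply: IE => //.
  by have := h0 n; lra.
rewrite (cvg_unique _ c1 e1)// -(cvg_unique _ c2 e2)//.
rewrite RintZ//; last exact: rint_cauchyd.
by rewrite /Rintegral integral_cauchyd mulrC.
Qed.

End Poisson.

(** * Limits and measurability of complex functions *)

Section ComplexLimits.
Variable R : realType.
Local Notation C := (R[i]).
Local Notation Re := (@ReC R).
Local Notation Im := (@ImC R).

Section ccvg.
Context (T : Type) (F : set_system T) {FF : ProperFilter F}.
Implicit Types (f g : T -> C) (l k : C).

Definition ccvg f l := (Re (f x) @[x --> F] --> Re l) /\ (Im (f x) @[x --> F] --> Im l).

Lemma ccvg_cst l : ccvg (fun=> l) l. Proof. by split; exact: cvg_cst. Qed.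
Lemma ccvg_toC (h : T -> R) (r : R) : h x @[x --> F] --> r -> ccvg (fun x => toC (h x)) (toC r).
Proof. by move=> hr; split => //; exact: cvg_cst. Qed.
Lemma ccvgD f g l k : ccvg f l -> ccvg g k -> ccvg (fun x => f x + g x) (l + k).
Proof.
move=> [a b] [c d]; split; rewrite CE; under eq_fun do rewrite CE; exact: cvgD.
Qed.
Lemma ccvgM f g l k : ccvg f l -> ccvg g k -> ccvg (fun x => f x * g x) (l * k).
Proof.
move=> [a b] [c d]; split; rewrite CE; under eq_fun do rewrite CE.
  by apply: cvgB; exact: cvgM.
by apply: cvgD; exact: cvgM.
Qed.
Lemma ccvg_sum (I : Type) (r : seq I) (G : I -> T -> C) (L : I -> C) :
  (forall i, ccvg (G i) (L i)) -> ccvg (fun x => \sum_(i <- r) G i x) (\sum_(i <- r) L i).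
Proof.
move=> h; elim: r => [|i r IH].
  by rewrite big_nil; under eq_fun do rewrite big_nil; exact: ccvg_cst.
by rewrite big_cons; under eq_fun do rewrite big_cons; exact: ccvgD.
Qed.
Lemma cvg_sqmod f l : ccvg f l -> sqmod (f x) @[x --> F] --> sqmod l.
Proof. by move=> [a b]; rewrite /sqmod !expr2; under eq_fun do rewrite !expr2; apply: cvgD; exact: cvgM. Qed.
Lemma ccvgV f l : l != 0 -> ccvg f l -> ccvg (fun x => (f x)^-1) l^-1.
Proof.
move=> l0 h; have q := cvg_sqmod h; have [a b] := h.
have q0 : sqmod l != 0 by rewrite sqmod_eq0.
split.
  rewrite ReCV; under eq_fun do rewrite ReCV.
  by apply: cvgM => //; exact: cvgV.
rewrite ImCV; under eq_fun do rewrite ImCV.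
by apply: cvgN; apply: cvgM => //; exact: cvgV.
Qed.
Lemma cvg_cmod f l : ccvg f l -> cmod (f x) @[x --> F] --> cmod l.
Proof.
by move=> h; exact: (cvg_comp _ _ (cvg_sqmod h) (@sqrt_continuous R _)).
Qed.
Lemma ccvg_exp f l : ccvg f l -> ccvg (fun x => cexp (f x)) (cexp l).
Proof.
move=> [a b].
have e : expR (Re (f x)) @[x --> F] --> expR (Re l).
  exact: (cvg_comp _ _ a (@continuous_expR R _)).
have c : cos (Im (f x)) @[x --> F] --> cos (Im l).
  exact: (cvg_comp _ _ b (@continuous_cos R _)).
have s : sin (Im (f x)) @[x --> F] --> sin (Im l).
  exact: (cvg_comp _ _ b (@continuous_sin R _)).
by split; rewrite CE; under eq_fun do rewrite CE; exact: cvgM.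
Qed.
Lemma ccvg_csq f l : ccvg f l -> ccvg (fun x => csq (f x)) (csq l).
Proof.
move=> h; have q := cvg_cmod h; have [a b] := h.
split.
  have p : (cmod (f x) + Re (f x)) / 2 @[x --> F] --> (cmod l + Re l) / 2.
    by apply: cvgM; [exact: cvgD|exact: cvg_cst].
  exact: (cvg_comp _ _ p (@sqrt_continuous R _)).
have p : (cmod (f x) - Re (f x)) / 2 @[x --> F] --> (cmod l - Re l) / 2.
  by apply: cvgM; [exact: cvgB|exact: cvg_cst].
by apply: cvgN; exact: (cvg_comp _ _ p (@sqrt_continuous R _)).
Qed.
End ccvg.

Section cmeas.
Context d (T : measurableType d) (D : set T).
Implicit Types (f g : T -> C).

Definition cmeas f := measurable_fun D (Re \o f) /\ measurable_fun D (Im \o f).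

Lemma cmeas_cst l : cmeas (fun=> l). Proof. by split; exact: measurable_cst. Qed.
Lemma cmeas_toC (h : T -> R) : measurable_fun D h -> cmeas (fun x => toC (h x)).
Proof. by move=> mh; split => //; exact: measurable_cst. Qed.
Lemma cmeasD f g : cmeas f -> cmeas g -> cmeas (fun x => f x + g x).
Proof.
move=> [a b] [c e]; split; rewrite /comp; under eq_fun do rewrite CE; exact: measurable_funD.
Qed.
Lemma cmeasM f g : cmeas f -> cmeas g -> cmeas (fun x => f x * g x).
Proof.
move=> [a b] [c e]; split; rewrite /comp; under eq_fun do rewrite CE.
  by apply: measurable_funB; exact: measurable_funM.
by apply: measurable_funD; exact: measurable_funM.
Qed.
Lemma cmeasN f : cmeas f -> cmeas (fun x => - f x).
Proof. by move=> [a b]; split; rewrite /comp; under eq_fun do rewrite CE; exact: measurable_funN. Qed.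
Lemma cmeasJ f : cmeas f -> cmeas (fun x => (f x)^*%C).
Proof.
move=> [a b]; split; rewrite /comp.
  by under eq_fun do rewrite ReCJ.
by under eq_fun do rewrite ImCJ; exact: measurable_funN.
Qed.
Lemma cmeas_sum (I : Type) (r : seq I) (G : I -> T -> C) :
  (forall i, cmeas (G i)) -> cmeas (fun x => \sum_(i <- r) G i x).
Proof.
move=> h; elim: r => [|i r IH].
  by under eq_fun do rewrite big_nil; exact: cmeas_cst.
by under eq_fun do rewrite big_cons; exact: cmeasD.
Qed.
Lemma meas_sqmod f : cmeas f -> measurable_fun D (fun x => sqmod (f x)).
Proof. by move=> [a b]; apply: measurable_funD; exact: measurable_funX. Qed.
Lemma meas_cmod f : cmeas f -> measurable_fun D (fun x => cmod (f x)).
Proof. by move=> h; apply: measurable_funsqrt; exact: meas_sqmod. Qed.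
Lemma cmeasV f : cmeas f -> cmeas (fun x => (f x)^-1).
Proof.
move=> h; have q := measurable_funV (meas_sqmod h); have [a b] := h.
split; rewrite /comp.
  by under eq_fun do rewrite ReCV; exact: measurable_funM.
by under eq_fun do rewrite ImCV; apply: measurable_funN; exact: measurable_funM.
Qed.
Lemma cmeas_exp f : cmeas f -> cmeas (fun x => cexp (f x)).
Proof.
move=> [a b].
have e : measurable_fun D (fun x => expR (Re (f x))).
  by apply: measurableT_comp a; exact: measurable_expR.
have c : measurable_fun D (fun x => cos (Im (f x))).
  by apply: measurableT_comp b; apply: continuous_measurable_fun; exact: continuous_cos.
have s : measurable_fun D (fun x => sin (Im (f x))).
  by apply: measurableT_comp b; apply: continuous_measurable_fun; exact: continuous_sin.
by split; rewrite /comp; under eq_fun do rewrite CE; exact: measurable_funM.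
Qed.
Lemma cmeas_csq f : cmeas f -> cmeas (fun x => csq (f x)).
Proof.
move=> h; have q := meas_cmod h; have [a b] := h.
split; rewrite /comp.
  apply: measurable_funsqrt.
  by apply: measurable_funM; [exact: measurable_funD|exact: measurable_cst].
apply: measurable_funN; apply: measurable_funsqrt.
by apply: measurable_funM; [exact: measurable_funB|exact: measurable_cst].
Qed.
End cmeas.

End ComplexLimits.

(** * Integrability of an inverse square root *)

Section LocalIntegrability.
Variable R : realType.
Local Notation mu := (@lebesgue_measure R).

Lemma integral_bndcvg (f : R -> R) (A : set R) (A_ : (set R)^nat) (M : R) :
  measurable A -> (forall n, measurable (A_ n)) ->
  measurable_fun A f -> (forall x, A x -> 0 <= f x) ->
  (forall n m, (n <= m)%N -> A_ n `<=` A_ m) -> (\bigcup_n A_ n = A) ->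
  (forall n, (\int[mu]_(x in A_ n) (f x)%:E <= M%:E)%E) ->
  (\int[mu]_(x in A) (f x)%:E <= M%:E)%E.
Proof.
move=> mA mA_ mf f0 nd AE bd.
have sA n : A_ n `<=` A by rewrite -AE; exact: bigcup_sup.
pose g n x := ((f \_ (A_ n)) x)%:E.
have mg n : measurable_fun A (g n).
  apply/measurable_EFinP.
  apply: (measurable_funS measurableT) => //.
  apply/(measurable_restrictT _ _).1 => //.
  exact: measurable_funS mf.
have g0 n x : A x -> (0 <= g n x)%E.
  by move=> Ax; rewrite lee_fin patchE; case: ifP => // _; exact: f0.
have ndg x : A x -> {homo (g ^~ x) : n m / (n <= m)%N >-> (n <= m)%E}.
  move=> Ax n m nm; rewrite lee_fin !patchE.
  case: ifPn => [/set_mem xn|_]; last by case: ifP => // _; exact: f0.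
  by rewrite mem_set//; exact: nd xn.
have h := @cvg_monotone_convergence _ _ _ mu A mA g mg g0 ndg.
have gl x : A x -> limn (g ^~ x) = (f x)%:E.
  rewrite -AE => -[n _ An]; apply/cvg_lim => //; apply: cvg_near_cst; near=> m.
  rewrite /g patchE mem_set//; apply: nd An.
  by near: m; exact: nbhs_infty_ge.
have -> : (\int[mu]_(x in A) (f x)%:E = \int[mu]_(x in A) limn (g^~ x))%E.
  by apply: eq_integral => x /set_mem Ax; rewrite gl.
rewrite -(cvg_lim _ h)//; apply: lime_le; first by apply/cvg_ex; eexists; exact: h.
apply: nearW => n; apply: le_trans (bd n).
rewrite le_eqVlt; apply/orP; left; apply/eqP.
rewrite [RHS](integral_mkcond) [LHS]integral_mkcond; apply: eq_integral => x _.
rewrite /g !patchE; case: ifP => [xA|/negbT xA]; first by case: ifP.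
by rewrite ifF//; apply/negbTE; apply: contra xA => /set_mem/sA/mem_set.
Unshelve. all: by end_near. Qed.

Lemma FTC_itv (f F : R -> R) (a b : R) : a < b ->
  (forall x, a <= x -> x <= b -> {for x, continuous f}) -> continuous F ->
  (forall x, a < x -> x < b -> is_derive x 1 F (f x)) ->
  (\int[mu]_(x in `[a, b]) (f x)%:E)%E = (F b - F a)%:E.
Proof.
move=> ab cf cF dF; rewrite (@continuous_FTC2 _ f F)//.
- apply: continuous_in_subspaceT => x /set_mem/=; rewrite in_itv/= => /andP[? ?].
  exact: cf.
- split => [x||].
  + by rewrite in_itv/= => /andP[ax xb]; case: (dF x ax xb).
  + by apply: cvg_at_right_filter; exact: cF.
  + by apply: cvg_at_left_filter; exact: cF.
- by move=> x; rewrite in_itv/= derive1E => /andP[ax xb]; case: (dF x ax xb).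
Qed.

Lemma continuous_sqrtB (s a : R) : continuous (fun x => Num.sqrt (s * (x - a))).
Proof.
move=> x; have h : (s * (y - a)) @[y --> x] --> s * (x - a).
  by apply: cvgM; [exact: cvg_cst|apply: cvgB; [exact: cvg_id|exact: cvg_cst]].
exact: (cvg_comp _ _ h (@sqrt_continuous R _)).
Qed.

Lemma integral_invsqrt_side (s a lo hi : R) : s ^+ 2 = 1 -> lo < hi ->
  (forall x, lo <= x -> x <= hi -> 0 < s * (x - a)) ->
  (\int[mu]_(x in `[lo, hi]) ((Num.sqrt `|x - a|)^-1)%:E)%E =
  (2 * s * (Num.sqrt (s * (hi - a)) - Num.sqrt (s * (lo - a))))%:E.
Proof.
move=> s1 lh pos.
transitivity (\int[mu]_(x in `[lo, hi]) ((Num.sqrt (s * (x - a)))^-1)%:E)%E.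
  apply: eq_integral => x /set_mem/=; rewrite in_itv/= => /andP[lx xh].
  congr ((Num.sqrt _)^-1)%:E; rewrite -[RHS]ger0_norm ?(ltW (pos _ lx xh))// normrM.
  suff -> : `|s| = 1 by rewrite mul1r.
  by apply/eqP; rewrite -[_ == _](@eqrXn2 _ 2)// -normrX s1 normr1 expr1n.
rewrite mulrBr.
apply: (@FTC_itv _ (fun x => 2 * s * Num.sqrt (s * (x - a)))) => //.
- move=> x lx xh; apply: cvgV; first by rewrite gt_eqF// sqrtr_gt0 pos.
  exact: continuous_sqrtB.
- by move=> x; apply: cvgM; [exact: cvg_cst|exact: continuous_sqrtB].
- move=> x lx xh; have p := pos x (ltW lx) (ltW xh).
  have h0 := is_deriveZ s (is_deriveB (is_derive_id x 1) (is_derive_cst a x 1)).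
  have h1 := is_deriveZ (2 * s) (@is_derive1_comp _ _ (s \*: (id - cst a)) _ _ _ (is_derive1_sqrt p) h0).
  have -> : (fun x => 2 * s * Num.sqrt (s * (x - a))) =
      (2 * s) \*: (Num.sqrt \o (s \*: (id - cst a))) by [].
  apply: (is_derive_eq h1); rewrite /GRing.scale/= subr0 mulr1.
  have q : Num.sqrt (s * (x - a)) != 0 by rewrite gt_eqF// sqrtr_gt0.
  transitivity (s ^+ 2 / Num.sqrt (s * (x - a))); last by rewrite s1 mul1r.
  by field.
Qed.

(** On either side of [a] a primitive is [2 sqrt |x - a|] up to sign, so each side contributes at
    most 2: this is the bound 4. The intervals at distance [1 / (n + 2)] from [a] exhaust the
    punctured interval, and the bound passes to their union. *)
Lemma rint_invsqrt (a : R) :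
  rint mu (`[a - 1, a + 1]%classic `\ a) (fun x => (Num.sqrt `|x - a|)^-1).
Proof.
pose A : set R := `[a - 1, a + 1]%classic `\ a.
pose L n : set R := `[a - 1, a - (n.+2%:R)^-1]%classic.
pose U n : set R := `[a + (n.+2%:R)^-1, a + 1]%classic.
have mA : measurable A by apply: measurableD.
have mf (D : set R) : measurable_fun D (fun x : R => (Num.sqrt `|x - a|)^-1).
  apply: measurable_funV; apply: measurable_funsqrt; apply: measurableT_comp => //.
  by apply: measurable_funB => //; exact: measurable_cst.
have e0 n : 0 < (n.+2%:R : R)^-1 by rewrite invr_gt0 ltr0n.
have e1 n : (n.+2%:R : R)^-1 < 1 by rewrite invf_lt1 ?ltr0n// ltr1n.
suff h : (\int[mu]_(x in A) ((Num.sqrt `|x - a|)^-1)%:E <= 4%:E)%E.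
  apply/integrableP; split; first by apply/measurable_EFinP; exact: mf.
  under eq_integral => x _ do rewrite /= ger0_norm ?invr_ge0 ?sqrtr_ge0//.
  by rewrite (le_lt_trans h)// ltry.
apply: (@integral_bndcvg _ _ (fun n => L n `|` U n)) => //.
- by move=> n; apply: measurableU; exact: measurable_itv.
- move=> n m nm x; have nm' : (m.+2%:R : R)^-1 <= (n.+2%:R)^-1.
    by rewrite lef_pV2 ?posrE ?ltr0n// ler_nat.
  rewrite /L/U/= !in_itv/=; move: (n.+2%:R^-1) (m.+2%:R^-1) nm' => p q pq.
  by case=> /andP[h1 h2]; [left|right]; apply/andP; split; lra.
- apply/seteqP; split => x.
    move=> [n _]; have := e0 n; have := e1 n; rewrite /L/U/A/= !in_itv/=.
    move: (n.+2%:R^-1) => p h1 h2.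
    by case=> /andP[? ?]; split; [apply/andP; split; lra|move=> xa; lra
      |apply/andP; split; lra|move=> xa; lra].
  move=> [/=]; rewrite in_itv/= => /andP[h1 h2] /eqP xa.
  have d0 : 0 < `|x - a| by rewrite normr_gt0 subr_eq0.
  exists (Num.truncn `|x - a|^-1) => //=; rewrite /L/U/= !in_itv/= h1 h2 andbT.
  set k := (_.+2%:R)^-1; have kd : k <= `|x - a|.
    rewrite -[leRHS]invrK lef_pV2 ?posrE ?ltr0n ?invr_gt0//.
    by rewrite ltW// (lt_le_trans (truncnS_gt _))// ler_nat.
  have [xs|xs] := lerP 0 (x - a); [right|left].
    by rewrite ger0_norm// in kd; move: k kd => p ?; lra.
  by rewrite ltr0_norm// in kd; apply/andP; split => //; move: k kd => p ?; lra.
- move=> n; rewrite ge0_integral_setU//=; last 4 first.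
  + exact: measurable_itv.
  + exact: measurable_itv.
  + by apply/measurable_EFinP; exact: mf.
  + apply/disj_setPS => x; rewrite /L/U/= !in_itv/=; have := e0 n; move: (n.+2%:R^-1) => p ?.
    by move=> -[/andP[_ ?] /andP[? _]]; lra.
  have s1 : (-1 : R) ^+ 2 = 1 by rewrite sqrrN expr1n.
  rewrite (@integral_invsqrt_side (-1)) ?s1//; last 2 first.
  + by have := e1 n; move: (n.+2%:R^-1) => p *; lra.
  + by move=> x _; have := e0 n; move: (n.+2%:R^-1) => p *; lra.
  rewrite (@integral_invsqrt_side 1) ?expr1n//; last 2 first.
  + by have := e1 n; move: (n.+2%:R^-1) => p *; lra.
  + by move=> x + _; have := e0 n; move: (n.+2%:R^-1) => p *; lra.
  rewrite -EFinD lee_fin.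
  have -> : -1 * (a - 1 - a) = 1 by ring.
  have -> : 1 * (a + 1 - a) = 1 by ring.
  rewrite sqrtr1.
  have := sqrtr_ge0 (-1 * (a - n.+2%:R^-1 - a)).
  have := sqrtr_ge0 (1 * (a + n.+2%:R^-1 - a)).
  by move=> *; lra.
Qed.
End LocalIntegrability.

(** * Kernels holomorphic in the lower half-plane *)

Section ResolventKernel.
Variable R : realType.
Local Notation C := (R[i]).
Local Notation Re := (@ReC R).
Local Notation Im := (@ImC R).
Local Notation mu := (@lebesgue_measure R).
Variables (n : nat) (c a : 'I_n -> R).
Hypothesis c_gt0 : forall k, 0 < c k.

Definition xarg (k : 'I_n) (z : C) : C := toC (c k)^-1 * (z - toC (a k)).
(** The continuation of [xi] from the real line into the lower half-plane. The convention [phi] in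
    [[-pi, pi)] makes [xi] the boundary value from below, which is why everything happens in that
    half-plane. *)
Definition xiz (k : 'I_n) (z : C) : C := csq (xarg k z).

Lemma Re_xarg k z : Re (xarg k z) = (Re z - a k) / c k.
Proof. by rewrite /xarg !CE; ring. Qed.
Lemma Im_xarg k z : Im (xarg k z) = Im z / c k.
Proof. by rewrite /xarg !CE; ring. Qed.

Lemma xiz_real k (s : R) : xiz k (toC s) = xi c a k s.
Proof.
have ck := c_gt0 k.
rewrite /xiz /csq Re_xarg CE.
have -> : cmod (xarg k (toC s)) = `|s - a k| / c k.
  rewrite /xarg -toCN -toCD cmodM !cmod_toC mulrC; congr (_ * _).
  by rewrite ger0_norm// invr_ge0 ltW.
rewrite /xi; have [h|h] := leP (a k) s.
  rewrite ger0_norm ?subr_ge0// subrr mul0r sqrtr0; apply: C_ext; rewrite !CE /= ?oppr0//.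
  by congr Num.sqrt; field; rewrite gt_eqF.
rewrite ltr0_norm ?subr_lt0//; apply: C_ext; rewrite !CE /=.
  by rewrite -mulrDl addNr mul0r mul0r sqrtr0; ring.
rewrite mulr0 add0r mulN1r; congr (- Num.sqrt _); field.
by rewrite gt_eqF.
Qed.

Lemma cmod_xiz k z : cmod (xiz k z) = Num.sqrt (cmod (xarg k z)).
Proof. by rewrite /cmod sqmod_csq. Qed.

Lemma xiz_sqr k z : Im z <= 0 -> toC (c k) * (xiz k z * xiz k z) = z - toC (a k).
Proof.
move=> z0; rewrite csq_sqr; last first.
  by rewrite Im_xarg pmulr_lle0// invr_gt0.
by rewrite /xarg mulrA -toCM divff ?gt_eqF// mul1r.
Qed.

Lemma xiz_neq0 k z : z != toC (a k) -> xiz k z != 0.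
Proof.
move=> za; rewrite /xiz csq_eq0 /xarg mulf_neq0 ?subr_eq0//.
by rewrite toC_eq0 invr_neq0// gt_eqF.
Qed.

Lemma xiz_neq0_Im k z : Im z < 0 -> xiz k z != 0.
Proof. by move=> z0; apply: xiz_neq0; apply: contraTneq z0 => ->; rewrite CE ltxx. Qed.

Definition dxiz k z : C := toC (c k)^-1 / (2%:R * xiz k z).

Lemma cder_xiz k (f : R -> C) s d : Im (f s) < 0 -> cder f s d ->
  cder (fun x => xiz k (f x)) s (d * dxiz k (f s)).
Proof.
move=> f0 h; have h1 := cderZ (toC (c k)^-1) (cderD h (cder_cst (- toC (a k)) s)).
have h2 : Im (xarg k (f s)) < 0 by rewrite Im_xarg pmulr_llt0// invr_gt0.
apply: (cder_eq (cder_csq h2 h1)).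
by rewrite addr0 mulrCA /dxiz /xiz mulrA.
Qed.

Lemma cmod_dxiz k z : cmod (dxiz k z) = (2 * c k * cmod (xiz k z))^-1.
Proof.
rewrite /dxiz !cmodM cmodV cmodM cmod_toC toC2 cmod_toC.
rewrite ger0_norm ?invr_ge0 ?(ltW (c_gt0 k))// ger0_norm//.
by rewrite !invfM mulrA (mulrC (c k)^-1).
Qed.

Section Kernel.
Variables (t m : 'I_n -> R) (k0 : 'I_n).
Hypothesis t_ge0 : forall k, 0 <= t k.
Hypothesis m_ge0 : forall k, 0 <= m k.
Hypothesis mk0 : 0 < m k0.

Definition kexp z : C := cexp (- iC R * \sum_(k < n) toC (t k) * xiz k z).
Definition ksum z : C := \sum_(k < n) toC (m k) * xiz k z.
(** The building block of resolvent kernels, up to constant factors: [m = c] gives the waves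
    reflected and transmitted at the vertex, while a single weight [2 c k] gives the free Green
    function of one edge. *)
Definition ker z : C := kexp z / ksum z.
Definition dksum z : C := \sum_(k < n) toC (m k) * dxiz k z.
Definition dker z : C :=
  (- iC R * \sum_(k < n) toC (t k) * dxiz k z) * kexp z / ksum z
  - kexp z * dksum z / (ksum z * ksum z).

Lemma cmod_kexp z : cmod (kexp z) <= 1.
Proof.
rewrite /kexp cmod_cexp -expR0 ler_expR.
have -> : Re (- iC R * \sum_(k < n) toC (t k) * xiz k z) = \sum_(k < n) t k * Im (xiz k z).
  have -> (z' : C) : Re (- iC R * z') = Im z' by rewrite !CE; ring.
  by rewrite ImC_sum; apply: eq_bigr => k _; rewrite CE !CE mul0r addr0.
by apply: sumr_le0 => k _; rewrite mulr_ge0_le0// Im_csq_le0.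
Qed.

(** No cancellation is possible: all [xiz k z] lie in the quadrant with nonnegative real and
    nonpositive imaginary part, and the weights are nonnegative, so one term already bounds the real
    and the imaginary part of the sum from below. *)
Lemma ksum_ge z : m k0 * cmod (xiz k0 z) <= cmod (ksum z).
Proof.
have e : m k0 * cmod (xiz k0 z) = Num.sqrt (m k0 ^+ 2 * sqmod (xiz k0 z)).
  by rewrite sqrtrM ?sqr_ge0// sqrtr_sqr ger0_norm// ltW.
rewrite e ler_sqrt ?sqmod_ge0// /sqmod /ksum ReC_sum ImC_sum mulrDr.
apply: lerD.
  rewrite -exprMn lerXn2r ?nnegrE ?mulr_ge0 ?Re_csq_ge0//.
    by apply: sumr_ge0 => k _; rewrite !CE mul0r subr0 mulr_ge0// Re_csq_ge0.
  rewrite (bigD1 k0)// !CE mul0r subr0 lerDl.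
  by apply: sumr_ge0 => k _; rewrite !CE mul0r subr0 mulr_ge0// Re_csq_ge0.
rewrite -exprMn -sqrrN -[leRHS]sqrrN lerXn2r ?nnegrE ?oppr_ge0 ?mulr_ge0_le0 ?Im_csq_le0//.
  by apply: sumr_le0 => k _; rewrite !CE mul0r addr0 mulr_ge0_le0// Im_csq_le0.
rewrite lerN2 (bigD1 k0)// !CE mul0r addr0 gerDl.
by apply: sumr_le0 => k _; rewrite !CE mul0r addr0 mulr_ge0_le0// Im_csq_le0.
Qed.

Lemma ksum_neq0 z : xiz k0 z != 0 -> ksum z != 0.
Proof.
by move=> z0; rewrite -cmod_gt0 (lt_le_trans _ (ksum_ge z))// mulr_gt0// cmod_gt0.
Qed.

Lemma cmod_ker z : xiz k0 z != 0 -> cmod (ker z) <= (m k0 * cmod (xiz k0 z))^-1.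
Proof.
move=> z0; rewrite /ker cmodM cmodV -[leRHS]mul1r ler_pM ?invr_ge0 ?cmod_ge0 ?cmod_kexp//.
by rewrite lef_pV2 ?posrE ?ksum_ge// ?cmod_gt0 ?ksum_neq0// mulr_gt0// cmod_gt0.
Qed.

Lemma holb_ker : holb ker dker.
Proof.
have dE f s d : Im (f s) < 0 -> cder f s d ->
    cder (fun x => kexp (f x)) s (d * (- iC R * \sum_(k < n) toC (t k) * dxiz k (f s)) * kexp (f s)).
  move=> f0 h; apply: (cder_eq (cder_exp (cderZ (- iC R) (cder_sum _ (fun k => cderZ (toC (t k)) (cder_xiz k f0 h)))))).
  congr (_ * _); rewrite mulrCA; congr (_ * _); rewrite mulr_sumr.
  by apply: eq_bigr => k _; rewrite mulrCA.
have dS f s d : Im (f s) < 0 -> cder f s d -> cder (fun x => ksum (f x)) s (d * dksum (f s)).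
  move=> f0 h; apply: (cder_eq (cder_sum _ (fun k => cderZ (toC (m k)) (cder_xiz k f0 h)))).
  by rewrite /dksum mulr_sumr; apply: eq_bigr => k _; rewrite mulrCA.
have dX k f s d : Im (f s) < 0 -> cder f s d -> exists e, cder (fun x => dxiz k (f x)) s e.
  move=> f0 h; have x0 : 2%:R * xiz k (f s) != 0.
    by rewrite mulf_neq0// ?xiz_neq0_Im// toC2 toC_eq0.
  by rewrite /dxiz; eexists; apply: cderZ; exact: (cderV (cderZ _ (cder_xiz k f0 h)) x0).
have S0 z : Im z < 0 -> ksum z != 0 by move=> z0; exact: ksum_neq0 (xiz_neq0_Im _ z0).
split.
- move=> f s d f0 h.
  apply: (cder_eq (cderM (dE _ _ _ f0 h) (cderV (dS _ _ _ f0 h) (S0 _ f0)))).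
  rewrite /dker; have := S0 _ f0.
  move: (ksum _) (dksum _) (kexp _) => A B E A0.
  by field.
- move=> f s d f0 h.
  have hs (w : 'I_n -> R) : exists e, cder (fun x => \sum_(k < n) toC (w k) * dxiz k (f x)) s e.
    have /choice[e he] : forall k, exists e, cder (fun x => dxiz k (f x)) s e.
      by move=> k; exact: dX f0 h.
    by eexists; exact: (cder_sum _ (fun k => cderZ (toC (w k)) (he k))).
  have [e1 h1] := hs t; have [e2 h2] := hs m.
  have hE := dE _ _ _ f0 h; have hS := dS _ _ _ f0 h.
  have S2 : ksum (f s) * ksum (f s) != 0 by rewrite mulf_neq0// S0.
  rewrite /dker; eexists; apply: cderD.
    exact: (cderM (cderM (cderZ (- iC R) h1) hE) (cderV hS (S0 _ f0))).
  exact: (cderN (cderM (cderM hE h2) (cderV (cderM hS hS) S2))).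
- move=> r r0.
  (* A lower bound for [|xiz k z|] on [Im z <= - r], since the argument of the root has modulus at
     least [r / c k]. It controls the kernel as well as the factors [dxiz] in its derivative. *)
  pose x k := Num.sqrt (r / c k).
  have x0 k : 0 < x k by rewrite sqrtr_gt0 divr_gt0.
  have xle k z : Im z <= - r -> x k <= cmod (xiz k z).
    move=> zr; rewrite cmod_xiz ler_sqrt ?cmod_ge0// (le_trans _ (Im_le_cmod _))// Im_xarg.
    rewrite normrM (ger0_norm (x := (c k)^-1)) ?invr_ge0 ?(ltW (c_gt0 k))//.
    rewrite ler_wpM2r ?invr_ge0 ?(ltW (c_gt0 k))// -normrN (le_trans _ (ler_norm _))//.
    by rewrite lerNr.
  pose q := (m k0 * x k0)^-1.
  have q0 : 0 <= q by rewrite invr_ge0 mulr_ge0// ltW.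
  have sle z : Im z <= - r -> cmod (ksum z)^-1 <= q.
    move=> zr; rewrite cmodV /q lef_pV2 ?posrE ?mulr_gt0 ?cmod_gt0//.
      by rewrite (le_trans _ (ksum_ge z))// ler_pM2l// xle.
    by apply: S0; rewrite (le_lt_trans zr)// oppr_lt0.
  pose T (w : 'I_n -> R) := \sum_(k < n) w k * (2 * c k * x k)^-1.
  have T0 w : (forall k, 0 <= w k) -> 0 <= T w.
    by move=> w0; apply: sumr_ge0 => k _; rewrite mulr_ge0// invr_ge0 !mulr_ge0// ltW.
  have Tle w z : (forall k, 0 <= w k) -> Im z <= - r ->
      cmod (\sum_(k < n) toC (w k) * dxiz k z) <= T w.
    move=> w0 zr; rewrite (le_trans (cmod_sum _ _ _))//; apply: ler_sum => k _.
    rewrite cmodM cmod_toC ger0_norm// ler_wpM2l// cmod_dxiz lef_pV2 ?posrE ?mulr_gt0//.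
      by rewrite ler_pM2l ?xle// mulr_gt0.
    by rewrite (lt_le_trans (x0 k))// xle.
  exists (q + (T t * q + T m * q ^+ 2)) => z zr.
  have g1 : cmod (ker z) <= q.
    by rewrite cmodM -[leRHS]mul1r ler_pM ?cmod_ge0 ?cmod_kexp ?sle.
  have g2 : cmod (dker z) <= T t * q + T m * q ^+ 2.
    rewrite (le_trans (cmodD _ _))// cmodN; apply: lerD.
      rewrite cmodM ler_pM ?cmod_ge0 ?sle// cmodM -[leRHS]mulr1 ler_pM ?cmod_ge0 ?cmod_kexp//.
      by rewrite cmodM cmodN cmod_iC mul1r Tle.
    rewrite cmodM ler_pM ?cmod_ge0//.
      by rewrite cmodM -[leRHS]mul1r ler_pM ?cmod_ge0 ?cmod_kexp ?Tle.
    by rewrite invfM cmodM expr2 ler_pM ?cmod_ge0 ?sle.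
  split; first by rewrite (le_trans g1)// lerDl addr_ge0// mulr_ge0// ?T0// ?exprn_ge0.
  by rewrite (le_trans g2)// lerDr.
Qed.
End Kernel.
End ResolventKernel.

(** * The Poisson formula for the kernels *)

Section PoissonKernel.
Variable R : realType.
Local Notation C := (R[i]).
Local Notation Re := (@ReC R).
Local Notation Im := (@ImC R).
Local Notation mu := (@lebesgue_measure R).

(** After clearing denominators the difference of the squares is a sum of two nonnegative terms, one
    of them with the factor [1 - t^2]. The bound does not involve [t], so one function of [s] can
    dominate the kernel on all circles at once. *)
Lemma cmod_mobB (t s a : R) : 0 < t -> t <= 1 ->
  `|s - a| / Num.sqrt (oneDsqr s) <= cmod (mob t s - toC a).
Proof.
move=> t0 t1; have q0 := mob_den_neq0 t s; have qp := mob_den_gt0 t s.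
have o0 : 0 < oneDsqr s by rewrite (lt_le_trans ltr01).
have -> : `|s - a| / Num.sqrt (oneDsqr s) = Num.sqrt ((s - a) ^+ 2 / oneDsqr s).
  by rewrite sqrtrM ?sqr_ge0// sqrtr_sqr sqrtrV// ltW.
rewrite /cmod ler_sqrt ?sqmod_ge0// ler_pdivrMr//.
have -> : sqmod (mob t s - toC a) =
    ((s - a) ^+ 2 + t ^+ 2 * (1 + a * s) ^+ 2) / (1 + t ^+ 2 * s ^+ 2).
  by rewrite /sqmod !CE /mob/=; field; rewrite ?exprMn mob_den_neq0.
rewrite mulrAC ler_pdivlMr// -subr_ge0.
have -> : ((s - a) ^+ 2 + t ^+ 2 * (1 + a * s) ^+ 2) * oneDsqr s
    - (s - a) ^+ 2 * (1 + t ^+ 2 * s ^+ 2) =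
    (s - a) ^+ 2 * s ^+ 2 * (1 - t ^+ 2) + oneDsqr s * (t ^+ 2 * (1 + a * s) ^+ 2).
  by rewrite /oneDsqr; ring.
have t21 : 0 <= 1 - t ^+ 2 by rewrite subr_ge0 expr_le1// ltW.
by apply: addr_ge0; apply: mulr_ge0 => //; rewrite ?(ltW o0)//; apply: mulr_ge0; exact: sqr_ge0.
Qed.

Lemma ccvg_mob (t_ : nat -> R) (s : R) : t_ n @[n --> \oo] --> (0 : R) ->
  ccvg \oo (fun n => mob (t_ n) s) (toC s).
Proof.
move=> t0.
have t2 : t_ n ^+ 2 @[n --> \oo] --> (0 : R).
  have : (t_ n * t_ n) @[n --> \oo] --> (0 * 0 : R) by exact: cvgM.
  by rewrite mulr0.
have cst_ (r : R) : r @[n --> \oo] --> r by exact: cvg_cst.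
have q : (1 + t_ n ^+ 2 * s ^+ 2)^-1 @[n --> \oo] --> (1 : R).
  have : (1 + t_ n ^+ 2 * s ^+ 2)^-1 @[n --> \oo] --> ((1 + 0 * s ^+ 2)^-1 : R).
    apply: cvgV; first by rewrite mul0r addr0.
    by apply: cvgD => //; exact: cvgM.
  by rewrite mul0r addr0 invr1.
split; rewrite CE /mob /=.
  have : s * (1 - t_ n ^+ 2) * (1 + t_ n ^+ 2 * s ^+ 2)^-1 @[n --> \oo] --> s * (1 - 0) * 1.
    by apply: cvgM => //; apply: cvgM => //; exact: cvgB.
  by rewrite subr0 !mulr1.
have : - (t_ n * (1 + s ^+ 2) * (1 + t_ n ^+ 2 * s ^+ 2)^-1) @[n --> \oo] --> - (0 * (1 + s ^+ 2) * 1).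
  by apply: cvgN; apply: cvgM => //; exact: cvgM.
by rewrite mul0r mulr1 oppr0.
Qed.

Variables (n : nat) (c a : 'I_n -> R).
Hypothesis c_gt0 : forall k, 0 < c k.
Variables (t m : 'I_n -> R) (k0 : 'I_n).
Hypothesis t_ge0 : forall k, 0 <= t k.
Hypothesis m_ge0 : forall k, 0 <= m k.
Hypothesis mk0 : 0 < m k0.
Local Notation ker := (ker c a t m).

(** The bound [1 / (m0 |xi|)] on the kernel in which [|z - a0|] has been replaced by its lower bound
    [|s - a0| / sqrt (1 + s^2)]; [kdomE] shows it in this form. *)
Definition kdom (c0 a0 m0 s : R) : R :=
  Num.sqrt c0 / m0 * (Num.sqrt (Num.sqrt (oneDsqr s)) * (Num.sqrt `|s - a0|)^-1).

Lemma kdomE (c0 a0 m0 s : R) : 0 < c0 ->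
  kdom c0 a0 m0 s = (m0 * Num.sqrt (`|s - a0| / Num.sqrt (oneDsqr s) / c0))^-1.
Proof.
move=> c00; rewrite !sqrtrM ?divr_ge0// ?sqrtr_ge0// !sqrtrV ?sqrtr_ge0// ?ltW// /kdom.
by rewrite !invfM !invrK; ring.
Qed.

Lemma kdom_ge0 (c0 a0 m0 s : R) : 0 <= m0 -> 0 <= kdom c0 a0 m0 s.
Proof. by move=> m00; rewrite /kdom !mulr_ge0// ?invr_ge0 ?sqrtr_ge0. Qed.

Let ker_le z s : s != a k0 -> `|s - a k0| / Num.sqrt (oneDsqr s) <= cmod (z - toC (a k0)) ->
  cmod (ker z) <= kdom (c k0) (a k0) (m k0) s.
Proof.
move=> sa h; have o0 : 0 < Num.sqrt (oneDsqr s) by rewrite sqrtr_gt0 (lt_le_trans ltr01).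
have p0 : 0 < `|s - a k0| / Num.sqrt (oneDsqr s) by rewrite divr_gt0// normr_gt0 subr_eq0.
have za : z != toC (a k0).
  by apply: contraTneq h => ->; rewrite subrr cmod0 -ltNge.
rewrite (le_trans (cmod_ker t_ge0 m_ge0 mk0 (xiz_neq0 c_gt0 za)))//.
rewrite kdomE// lef_pV2 ?posrE ?mulr_gt0//; last 2 first.
- by rewrite cmod_gt0 xiz_neq0.
- by rewrite sqrtr_gt0 divr_gt0.
rewrite ler_pM2l// cmod_xiz ler_sqrt ?cmod_ge0// /xarg cmodM.
have ci : 0 < (c k0)^-1 by rewrite invr_gt0.
by rewrite cmod_toC (gtr0_norm ci) mulrC ler_pM2l.
Qed.

Lemma ker_mob_le s r : s != a k0 -> 0 < r -> r <= 1 ->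
  cmod (ker (mob r s)) <= kdom (c k0) (a k0) (m k0) s.
Proof. by move=> sa r0 r1; apply: ker_le => //; exact: cmod_mobB. Qed.

Lemma rint_kdom (c0 a0 m0 : R) : 0 < m0 -> rint mu setT (fun s => kdom c0 a0 m0 s * cauchyd s).
Proof.
move=> m00.
pose B : set R := `[a0 - 1, a0 + 1]%classic `\ a0.
pose f (x : R) := (Num.sqrt `|x - a0|)^-1.
(* Chosen so that [1 + s^2 <= L^4 (s - a0)^2] as soon as [|s - a0| >= 1]: indeed
   [s^2 <= 2 (s - a0)^2 + 2 a0^2]. Away from the singularity the majorant is thus a multiple of the
   Cauchy density. *)
pose L := Num.sqrt (Num.sqrt (3 + 2 * a0 ^+ 2)).
pose K := Num.sqrt c0 / m0.
have K0 : 0 <= K by rewrite divr_ge0// ?sqrtr_ge0// ltW.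
have mi : 0 <= m0^-1 by rewrite invr_ge0 ltW.
have mB : measurable B by apply: measurableD.
have iB : rint mu setT (f \_ B).
  by apply/(rint_mkcond mu f mB); exact: rint_invsqrt.
have iG : rint mu setT (fun s => K * ((f \_ B) s + L * cauchyd s)).
  by apply: rintZ => //; apply: rintD => //; apply: rintZ => //; exact: rint_cauchyd.
have md : measurable_fun setT (fun s : R => kdom c0 a0 m0 s).
  apply: measurable_funM; first exact: measurable_cst.
  apply: measurable_funM.
    do 2 apply: measurable_funsqrt.
    by apply: continuous_measurable_fun; exact: continuous_oneDsqr.
  apply: measurable_funV; apply: measurable_funsqrt; apply: measurableT_comp => //.
  by apply: measurable_funB => //; exact: measurable_cst.
apply: (rint_le measurableT) iG _ => [|s _].
  by apply: measurable_funM => //; exact: rint_meas (@rint_cauchyd R).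
have o1 : 1 <= oneDsqr s by [].
have o0 : 0 < oneDsqr s by rewrite (lt_le_trans ltr01).
have kc : 0 <= kdom c0 a0 m0 s * cauchyd s by rewrite mulr_ge0 ?cauchyd_ge0 ?kdom_ge0// ltW.
rewrite (ger0_norm kc).
have -> : kdom c0 a0 m0 s = K * (Num.sqrt (Num.sqrt (oneDsqr s)) * (Num.sqrt `|s - a0|)^-1) by [].
rewrite -mulrA; apply: (ler_wpM2l K0).
rewrite patchE; case: ifPn => [sB|sB].
  rewrite -[leLHS]addr0; apply: lerD; last by rewrite mulr_ge0 ?sqrtr_ge0 ?cauchyd_ge0.
  rewrite -/(f s) mulrAC ler_piMl//; first by rewrite /f invr_ge0 sqrtr_ge0.
  rewrite /cauchyd ler_pdivrMr// mul1r.
  have s1 : Num.sqrt (oneDsqr s) <= oneDsqr s.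
    rewrite -[leRHS]sqr_sqrtr ?(ltW o0)// expr2 ler_pMl ?sqrtr_gt0//.
    by rewrite -[leLHS]sqrtr1 ler_sqrt// ltW.
  rewrite (le_trans _ s1)// ler_sqrt// ltW//.
rewrite add0r ler_wpM2r ?cauchyd_ge0//.
have [->|sa] := eqVneq s a0.
  by rewrite subrr normr0 sqrtr0 invr0 mulr0 sqrtr_ge0.
have d1 : 1 <= `|s - a0|.
  move: sB; apply: contraNT; rewrite -ltNge ltr_norml => /andP[h1 h2].
  apply/mem_set; split; last by move=> /= h; rewrite h eqxx in sa.
  by rewrite /= in_itv/=; apply/andP; split; lra.
rewrite ler_pdivrMr ?sqrtr_gt0 ?(lt_le_trans ltr01)// /L -sqrtrM ?sqrtr_ge0//.
rewrite ler_sqrt ?mulr_ge0 ?sqrtr_ge0//.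
have -> : `|s - a0| = Num.sqrt ((s - a0) ^+ 2) by rewrite sqrtr_sqr.
rewrite -sqrtrM; last by rewrite addr_ge0// mulr_ge0// sqr_ge0.
rewrite ler_sqrt; last by rewrite mulr_ge0 ?sqr_ge0// addr_ge0// mulr_ge0// sqr_ge0.
have d2 : 1 <= (s - a0) ^+ 2 by rewrite -real_normK ?num_real// expr_ge1.
rewrite /oneDsqr.
have a2 : 0 <= a0 ^+ 2 by exact: sqr_ge0.
have h : 0 <= a0 ^+ 2 * ((s - a0) ^+ 2 - 1) by rewrite mulr_ge0// subr_ge0.
have h' : 0 <= (s - 2 * a0) ^+ 2 by exact: sqr_ge0.
by nra.
Qed.

Lemma cmeas_ker_real : cmeas setT (fun s : R => ker (toC s)).
Proof.
have mx k : cmeas setT (fun s : R => xiz c a k (toC s)).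
  apply: cmeas_csq; apply: cmeasM; first exact: cmeas_cst.
  by apply: cmeasD; [apply: cmeas_toC; exact: measurable_id|exact: cmeas_cst].
apply: cmeasM.
  apply: cmeas_exp; apply: cmeasM; first exact: cmeas_cst.
  by apply: cmeas_sum => k; apply: cmeasM => //; exact: cmeas_cst.
by apply: cmeasV; apply: cmeas_sum => k; apply: cmeasM => //; exact: cmeas_cst.
Qed.

Lemma ccvg_ker (z_ : nat -> C) z : z != toC (a k0) ->
  ccvg \oo z_ z -> ccvg \oo (fun j => ker (z_ j)) (ker z).
Proof.
move=> za hz.
have hx k : ccvg \oo (fun j => xiz c a k (z_ j)) (xiz c a k z).
  apply: ccvg_csq; apply: ccvgM; first exact: ccvg_cst.
  by apply: ccvgD => //; exact: ccvg_cst.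
apply: ccvgM.
  apply: ccvg_exp; apply: ccvgM; first exact: ccvg_cst.
  by apply: ccvg_sum => k; apply: ccvgM => //; exact: ccvg_cst.
apply: ccvgV; first by apply: (ksum_neq0 m_ge0 mk0); exact: xiz_neq0.
by apply: ccvg_sum => k; apply: ccvgM => //; exact: ccvg_cst.
Qed.

Lemma poisson_ker :
  rint mu setT (fun s => Re (ker (toC s)) * cauchyd s) /\
  Rintegral mu setT (fun s => Re (ker (toC s)) * cauchyd s) = pi * Re (ker (- iC R)).
Proof.
(* At [s = a k0] the lower bound on [ksum] degenerates; domination and convergence are claimed off
   this single point. *)
have neg1 : mu.-negligible [set a k0].
  by exists [set a k0]; split => //; exact: lebesgue_measure_set1.
apply: (poisson (holb_ker a c_gt0 t_ge0 m_ge0 mk0) (rint_kdom (c k0) (a k0) mk0)).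
- apply: negligibleS neg1 => s /=; apply: contra_notP => /eqP sa r r0 r1.
  exact: ker_mob_le.
- apply: negligibleS neg1 => s /=; apply: contra_notP => /eqP sa t_ _ ct.
  have za : toC s != toC (a k0) by apply: contra sa => /eqP[->].
  by have [] := ccvg_ker za (ccvg_mob s ct).
- by have [] := cmeas_ker_real.
Qed.

End PoissonKernel.

(** * Exponential transforms of test functions *)

Section ParamIntegral.
Variable R : realType.
Local Notation mu := (@lebesgue_measure R).
Local Notation TR := (measurableTypeR R).

(** Integrability of the slices is not assumed: Tonelli applies to the positive and negative parts
    separately, the indicator of [D] is absorbed into the integrand, and [fine] of the difference is
    measurable. *)
Lemma measurable_param_integral d (T : measurableType d) (D : set TR) (H : TR * T -> R) :
  measurable D -> measurable_fun setT H ->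
  measurable_fun setT (fun t : T => Rintegral mu D (fun x => H (x, t))).
Proof.
move=> mD mH.
have mi : measurable_fun setT (fun p : TR * T => (\1_D p.1 : R)).
  by apply: measurableT_comp => //; exact: measurable_indic.
have mHi : measurable_fun setT (fun p : TR * T => (H p * \1_D p.1)%:E).
  by apply/measurable_EFinP; exact: measurable_funM.
have mp := measurable_funepos mHi; have mn := measurable_funeneg mHi.
have mP := measurable_fun_fubini_tonelli_G (m1 := mu) _ mp (fun x => funepos_ge0 _ x).
have mN := measurable_fun_fubini_tonelli_G (m1 := mu) _ mn (fun x => funeneg_ge0 _ x).
rewrite /Rintegral.
apply: measurableT_comp => //.
apply: eq_measurable_fun (emeasurable_funB mP mN) => t _ /=.
rewrite /fubini_G [RHS]integral_mkcond [RHS]integralE.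
have e x : ((fun x => (H (x, t))%:E) \_ D) x = (H (x, t) * \1_D x)%:E.
  by rewrite patchE indicE; case: ifP => _; rewrite ?mulr1 ?mulr0.
by congr (_ - _)%E; apply: eq_integral => x _; rewrite ?funeposE ?funenegE e.
Qed.

Lemma Rintegral_normle (D : set TR) (f g : R -> R) : measurable D -> rint mu D f ->
  rint mu D g -> (forall x, D x -> `|f x| <= g x) -> `|Rintegral mu D f| <= Rintegral mu D g.
Proof.
move=> mD hf hg fg; rewrite (le_trans (le_normr_Rintegral mD hf))//.
by apply: le_Rintegral => //; exact: rint_norm.
Qed.

Section fubini_dom.
Variables (D : set TR) (f w : R -> R) (K : TR * TR -> R).
Hypothesis mD : measurable D.
Hypothesis hf : rint mu D f.
Hypothesis hw : rint mu setT w.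
Hypothesis mK : measurable_fun setT K.
Hypothesis Kw : forall y s, D y -> `|K (y, s)| <= w s.

Let mKy y : measurable_fun setT (fun s => K (y, s)).
Proof. exact: measurableT_comp. Qed.
Let mKs s : measurable_fun D (fun y => K (y, s)).
Proof. by apply: measurable_funTS; exact: (measurableT_comp mK (pair2_measurable s)). Qed.

Lemma rint_dom_slice s : rint mu D (fun y => f y * K (y, s)).
Proof.
apply: (rint_le mD) (rintZr (w s) mD (rint_norm mD hf)) _.
  by apply: measurable_funM => //; exact: (rint_meas hf).
by move=> y Dy; rewrite normrM ler_wpM2l// Kw.
Qed.

Lemma rint_dom_other y : D y -> rint mu setT (fun s => K (y, s)).
Proof. by move=> Dy; apply: (rint_le measurableT) hw _ => // s _; exact: Kw. Qed.

Lemma Rintegral_dom_le s :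
  `|Rintegral mu D (fun y => f y * K (y, s))| <= Rintegral mu D (fun y => `|f y|) * w s.
Proof.
apply: (@le_trans _ _ (Rintegral mu D (fun y => `|f y| * w s))).
  apply: Rintegral_normle => //; first exact: rint_dom_slice.
    by apply: rintZr => //; exact: rint_norm.
  by move=> y Dy; rewrite normrM ler_wpM2l// Kw.
rewrite le_eqVlt; apply/orP; left; apply/eqP.
by rewrite mulrC -RintZ//; [apply: eq_Rintegral => y _; rewrite mulrC|exact: rint_norm].
Qed.

Let phi (p : TR * TR) : R := (f \_ D) p.1 * K p.

Let mphi : measurable_fun setT phi.
Proof.
apply: measurable_funM => //; apply: (@measurableT_comp _ _ _ _ _ _ (f \_ D)) => //.
by apply/(measurable_restrictT _ _).1 => //; exact: (rint_meas hf).
Qed.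

Let Fw := Rintegral mu setT w.

Let phiE y : (\int[mu]_s `|(phi (y, s))%:E| <= `|(f \_ D) y|%:E * Fw%:E)%E.
Proof.
have [Dy|Dy] := boolP (y \in D); last first.
  under eq_integral => s _ do rewrite /phi/= patchE (negbTE Dy) mul0r normr0.
  by rewrite integral0 patchE (negbTE Dy) normr0 mul0e.
have -> : (`|(f \_ D) y|%:E * Fw%:E = \int[mu]_s (`|(f \_ D) y| * w s)%:E)%E.
  by rewrite (@rint_EFin _ _ _ mu)// ?(@RintZ _ _ _ mu)//; exact: rintZ.
apply: ge0_le_integral => //.
- by apply: measurableT_comp => //; apply/measurable_EFinP; exact: (measurableT_comp mphi (pair1_measurable y)).
- by apply/measurable_EFinP; apply: measurable_funM => //; exact: (rint_meas hw).
- by move=> s _; rewrite /= lee_fin /phi normrM ler_wpM2l// Kw//; exact: set_mem.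
Qed.

Let iphi : (mu \x mu)%E.-integrable setT (EFin \o phi).
Proof.
have mE : measurable_fun setT (EFin \o phi) by apply/measurable_EFinP; exact: mphi.
apply/(integrable12ltyP mu mu mE).
have hfD : rint mu setT (f \_ D) by exact: (rint_mkcond mu f mD).1 hf.
have hq := rintZr Fw measurableT (rint_norm measurableT hfD).
apply: (@le_lt_trans _ _ (\int[mu]_y (`|(f \_ D) y| * Fw)%:E)%E).
  apply: ge0_le_integral => //.
  - by move=> y _; exact: integral_ge0.
  - apply: (measurable_fun_fubini_tonelli_F (m2 := mu) (fun p => `|(phi p)%:E|%E)) => //.
    exact: measurableT_comp mE.
  - by apply/measurable_EFinP; exact: (rint_meas hq).
  - by move=> y _; rewrite EFinM; exact: phiE.
by rewrite (@rint_EFin _ _ _ mu)// ltry.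
Qed.

Let slice s : (\int[mu]_y (phi (y, s))%:E)%E = (Rintegral mu D (fun y => f y * K (y, s)))%:E%E.
Proof.
rewrite -rint_EFin//; last exact: rint_dom_slice.
rewrite [RHS]integral_mkcond; apply: eq_integral => y _.
by rewrite /phi/= !patchE; case: ifP => // _; rewrite mul0r.
Qed.

Lemma rint_fubini_dom : rint mu setT (fun s => Rintegral mu D (fun y => f y * K (y, s))).
Proof.
apply: (rint_le measurableT) (rintZ (Rintegral mu D (fun y => `|f y|)) measurableT hw) _.
  apply: eq_measurable_fun (measurable_param_integral measurableT mphi) => s _.
  by rewrite /Rintegral slice.
by move=> s _; exact: Rintegral_dom_le.
Qed.

(** The majorant [w s] of the kernel is uniform in [y], so [f] times the kernel is dominated by the
    product [|f y| w s] of two integrable functions, and Fubini applies. *)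
Lemma fubini_dom : Rintegral mu setT (fun s => Rintegral mu D (fun y => f y * K (y, s))) =
  Rintegral mu D (fun y => f y * Rintegral mu setT (fun s => K (y, s))).
Proof.
have := Fubini iphi.
under [RHS]eq_integral => s _ do rewrite /= slice.
move=> E; rewrite [LHS]/Rintegral -E [RHS]Rintegral_mkcond /Rintegral; congr fine.
apply: eq_integral => y _; rewrite /= /phi/= patchE.
have [Dy|Dy] := boolP (y \in D); rewrite patchE ?Dy ?(negbTE Dy); last first.
  by under eq_integral do rewrite mul0r; rewrite integral0.
have iK : rint mu setT (fun s => K (y, s)) by apply: rint_dom_other; exact: set_mem.
by rewrite (@rint_EFin _ _ _ mu)// ?(@RintZ _ _ _ mu)//; exact: rintZ.
Qed.

End fubini_dom.
End ParamIntegral.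

(** * Integrals of complex functions on half-lines *)

Section ComplexIntegral.
Variable R : realType.
Local Notation C := (R[i]).
Local Notation Re := (@ReC R).
Local Notation Im := (@ImC R).
Local Notation mu := (@lebesgue_measure R).
Local Notation TR := (measurableTypeR R).
Implicit Types (D : set TR) (f g : R -> C).

Definition crint D f := rint mu D (Re \o f) /\ rint mu D (Im \o f).
Definition cintD D f : C := Complex (Rintegral mu D (Re \o f)) (Rintegral mu D (Im \o f)).

Lemma cintE f : cint f = cintD (@pos_half R) f.
Proof. by apply: C_ext; rewrite /cint !CE /=; ring. Qed.

Lemma measurable_pos_half : measurable (@pos_half R : set TR).
Proof.
have -> : @pos_half R = `]0, +oo[%classic by apply/seteqP; split => x; rewrite /pos_half/= in_itv/= andbT.
exact: measurable_itv.
Qed.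

Lemma eq_cintD D f g : (forall x, D x -> f x = g x) -> cintD D f = cintD D g.
Proof.
by move=> fg; congr Complex; apply: eq_Rintegral => x /set_mem Dx /=; rewrite fg.
Qed.

Lemma eq_cint f g : (forall x, 0 < x -> f x = g x) -> cint f = cint g.
Proof. by move=> fg; rewrite !cintE; exact: eq_cintD. Qed.

Lemma eq_rint D (f g : R -> R) : measurable D -> (forall x, D x -> f x = g x) -> rint mu D f -> rint mu D g.
Proof.
by move=> mD fg; apply: eq_integrable => // x /set_mem Dx /=; rewrite fg.
Qed.

Lemma eq_crint D f g : measurable D -> (forall x, D x -> f x = g x) -> crint D f -> crint D g.
Proof. by move=> mD fg [h1 h2]; split; [apply: (eq_rint mD) h1|apply: (eq_rint mD) h2] => x Dx /=; rewrite fg. Qed.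

Lemma crint_le D f (w : R -> R) : measurable D -> cmeas D f -> rint mu D w ->
  (forall x, D x -> cmod (f x) <= w x) -> crint D f.
Proof.
move=> mD [m1 m2] hw fw; split; apply: (rint_le mD) hw _ => // x Dx.
  by rewrite (le_trans (Re_le_cmod _))// fw.
by rewrite (le_trans (Im_le_cmod _))// fw.
Qed.

Lemma crintD D f g : measurable D -> crint D f -> crint D g -> crint D (fun x => f x + g x).
Proof.
move=> mD [a b] [c d]; split.
  by apply: (@eq_rint _ (fun x => Re (f x) + Re (g x)) _ mD) => [x _|]; [rewrite /= CE|exact: rintD].
by apply: (@eq_rint _ (fun x => Im (f x) + Im (g x)) _ mD) => [x _|]; [rewrite /= CE|exact: rintD].
Qed.

Lemma crintZ D f (z : C) : measurable D -> crint D f -> crint D (fun x => z * f x).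
Proof.
move=> mD [a b]; split.
  apply: (@eq_rint _ (fun x => Re z * Re (f x) - Im z * Im (f x)) _ mD) => [x _|]; first by rewrite /= CE.
  by apply: rintB => //; exact: rintZ.
apply: (@eq_rint _ (fun x => Re z * Im (f x) + Im z * Re (f x)) _ mD) => [x _|]; first by rewrite /= CE.
by apply: rintD => //; exact: rintZ.
Qed.

Lemma cintDD D f g : measurable D -> crint D f -> crint D g ->
  cintD D (fun x => f x + g x) = cintD D f + cintD D g.
Proof.
move=> mD [a b] [c d]; apply: C_ext; rewrite CE /=.
  by rewrite -(@RintD _ _ _ mu)//; apply: eq_Rintegral => x _; rewrite /= CE.
by rewrite -(@RintD _ _ _ mu)//; apply: eq_Rintegral => x _; rewrite /= CE.
Qed.

Lemma cintDZ D f (z : C) : measurable D -> crint D f ->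
  cintD D (fun x => z * f x) = z * cintD D f.
Proof.
move=> mD [a b]; apply: C_ext; rewrite CE /=.
  rewrite -!(@RintZ _ _ _ mu)// -(@RintB _ _ _ mu)//; try exact: rintZ.
  by apply: eq_Rintegral => x _; rewrite /= CE.
rewrite -!(@RintZ _ _ _ mu)// -(@RintD _ _ _ mu)//; try exact: rintZ.
by apply: eq_Rintegral => x _; rewrite /= CE.
Qed.

Lemma cintDJ D f : measurable D -> crint D f -> cintD D (fun x => (f x)^*%C) = (cintD D f)^*%C.
Proof.
move=> mD [a b]; apply: C_ext; rewrite CE /=.
  by apply: eq_Rintegral => x _; rewrite /= CE.
rewrite -(@RintN _ _ _ mu)//; apply: eq_Rintegral => x _; by rewrite /= CE.
Qed.

Lemma cint_cmeas_param d (T : measurableType d) D (H : TR * T -> C) :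
  measurable D -> cmeas setT H -> cmeas setT (fun t : T => cintD D (fun x => H (x, t))).
Proof.
move=> mD [h1 h2]; split.
  exact: (measurable_param_integral mD h1).
exact: (measurable_param_integral mD h2).
Qed.

Lemma rint_ray (f : R -> R) (y b : R) : y <= b -> continuous f -> (forall x, b <= x -> f x = 0) ->
  rint mu (`]y, +oo[%classic) f.
Proof.
move=> yb cf f0.
have mf : measurable_fun setT f by exact: continuous_measurable_fun.
apply/(rint_mkcond mu f); first exact: measurable_itv.
have h : rint mu setT (f \_ `[y, b]) by apply/(rint_mkcond mu f); [exact: measurable_itv|exact: rint_itv].
apply: (rint_le measurableT) (rint_norm measurableT h) _.
  by apply/(measurable_restrictT _ _).1; [exact: measurable_itv|exact: measurable_funTS].
move=> x _; rewrite !patchE; case: ifPn => [/set_mem/=|_]; last by rewrite normr0.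
rewrite in_itv/= andbT => yx; have [xb|bx] := leP x b.
  by rewrite mem_set//= in_itv/= xb (ltW yx).
by rewrite f0 ?normr0// ltW.
Qed.

Lemma FTC_ray (f F : R -> R) (y b : R) : y <= b ->
  (forall x : R, is_derive x (1 : R) F (f x)) -> continuous f ->
  (forall x, b <= x -> f x = 0) -> F b = 0 ->
  Rintegral mu (`]y, +oo[%classic) f = - F y.
Proof.
move=> yb dF cf f0 Fb.
transitivity (Rintegral mu (`[y, b]%classic) f); last by rewrite /Rintegral (@FTC _ f F)// Fb sub0r.
rewrite Rintegral_itv_obnd_cbnd; last exact: (rint_ray yb).
rewrite Rintegral_mkcond [RHS]Rintegral_mkcond; apply: eq_Rintegral => x _.
rewrite !patchE; case: ifPn => [/set_mem/=|xn].
  rewrite in_itv/= andbT => yx; have [xb|bx] := leP x b.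
    by rewrite mem_set//= in_itv/= xb yx.
  by rewrite f0 ?(ltW bx)//; case: ifP.
rewrite ifF//; apply/negbTE; apply: contra xn => /set_mem/=; rewrite in_itv/= => /andP[yx _].
by apply/mem_set; rewrite /= in_itv/= yx.
Qed.

Lemma crint_ray f (y b : R) : y <= b -> continuous (Re \o f) -> continuous (Im \o f) ->
  (forall x, b <= x -> f x = 0) -> crint (`]y, +oo[%classic) f.
Proof.
move=> yb c1 c2 f0; split; apply: (rint_ray yb) => // x bx; rewrite /= f0//.
Qed.

Lemma CFTC_ray (f F : R -> C) (y b : R) : y <= b ->
  (forall x : R, cder F x (f x)) -> continuous (Re \o f) -> continuous (Im \o f) ->
  (forall x, b <= x -> f x = 0) -> F b = 0 ->
  cintD (`]y, +oo[%classic) f = - F y.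
Proof.
move=> yb dF c1 c2 f0 Fb; apply: C_ext; rewrite CE /=.
- apply: (@FTC_ray _ (Re \o F) y b) => //= [x|x bx|]; [by case: (dF x)|by rewrite f0|by rewrite Fb].
- apply: (@FTC_ray _ (Im \o F) y b) => //= [x|x bx|]; [by case: (dF x)|by rewrite f0|by rewrite Fb].
Qed.

Lemma pos_halfE : @pos_half R = `]0, +oo[%classic.
Proof. by apply/seteqP; split => x; rewrite /pos_half/= in_itv/= andbT. Qed.

End ComplexIntegral.

(** * Smooth functions and test functions *)

Section Smooth.
Variable R : realType.
Implicit Types f g h : R -> R.

Lemma is_derive_derive1 f (x d : R) : is_derive x 1 f d -> derive1 f x = d.
Proof. by move=> h; rewrite derive1E; case: h. Qed.

Lemma smooth_is_derive f (x : R) : smoothR f -> is_derive x 1 f (derive1 f x).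
Proof. by move=> /(_ 0%N x) h; rewrite derive1E; exact: derivableP. Qed.

Lemma smooth_derive1 f : smoothR f -> smoothR (derive1 f).
Proof. by move=> h m x; rewrite -derive1Sn; exact: h. Qed.

Lemma smooth_continuous f : smoothR f -> continuous f.
Proof.
move=> h x; apply: differentiable_continuous; apply/derivable1_diffP.
by case: (smooth_is_derive x h).
Qed.

(** Smoothness by coinduction: a class closed under taking one derivative consists of smooth
    functions. It replaces inductions on the order by families stable under derivation, such as sums
    of products or exponentials times trigonometric functions. *)
Lemma smooth_coind (P : (R -> R) -> Prop) :
  (forall f, P f -> exists2 f', (forall x : R, is_derive x (1 : R) f (f' x)) & P f') ->
  forall f, P f -> smoothR f.
Proof.
move=> HP f Pf m x.
suff : P (derive1n m f) by move=> /HP[f' /(_ x)[]].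
elim: m => // m IH; rewrite derive1nS.
have [f' df' Pf'] := HP _ IH.
rewrite (_ : derive1 _ = f')//; apply/funext => y; exact: is_derive_derive1.
Qed.

Lemma smooth_cst (k : R) : smoothR (fun=> k).
Proof.
apply: (smooth_coind (P := fun f => exists k, f = fun=> k)); last by exists k.
by move=> f [r ->]; exists (fun=> 0); [move=> x; exact: is_derive_cst|exists 0].
Qed.

Lemma smoothM_sum (s : seq ((R -> R) * (R -> R))) :
  (forall p, List.In p s -> smoothR p.1 /\ smoothR p.2) ->
  smoothR (fun x => \sum_(p <- s) p.1 x * p.2 x).
Proof.
move=> hs; apply: (smooth_coind (P := fun f => exists2 s : seq ((R -> R) * (R -> R)),
  (forall p, List.In p s -> smoothR p.1 /\ smoothR p.2) &
  f = fun x => \sum_(p <- s) p.1 x * p.2 x)); last by exists s.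
move=> f [r hr ->] {s hs f}.
elim: r hr => [|p r IH] hr.
  exists (fun=> 0); first by move=> x; under eq_fun do rewrite big_nil; exact: is_derive_cst.
  by exists [::] => //; apply/funext => x; rewrite big_nil.
have [|f' df' [r' hr' E]] := IH; first by move=> q hq; apply: hr; right.
have [h1 h2] := hr p (or_introl erefl).
exists (fun x => (derive1 p.1 x * p.2 x + p.1 x * derive1 p.2 x) + f' x).
  move=> x; under eq_fun do rewrite big_cons.
  have d := is_deriveD (is_deriveM (smooth_is_derive x h1) (smooth_is_derive x h2)) (df' x).
  apply: (is_derive_eq d); rewrite /GRing.scale/=; ring.
exists ((derive1 p.1, p.2) :: (p.1, derive1 p.2) :: r').
  move=> q [<-|[<-|/hr' h]]; [split|split|exact: h].
  - exact: smooth_derive1 h1.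
  - exact: h2.
  - exact: h1.
  - exact: smooth_derive1 h2.
by apply/funext => x; rewrite !big_cons /= E addrA.
Qed.

Lemma smoothM f g : smoothR f -> smoothR g -> smoothR (fun x => f x * g x).
Proof.
move=> hf hg.
have -> : (fun x => f x * g x) = (fun x => \sum_(p <- [:: (f, g)]) p.1 x * p.2 x).
  by apply/funext => x; rewrite big_cons big_nil addr0.
by apply: (@smoothM_sum [:: (f, g)]) => p [<-|[]]; split; [exact: hf|exact: hg].
Qed.

Lemma smoothD f g : smoothR f -> smoothR g -> smoothR (fun x => f x + g x).
Proof.
move=> hf hg.
have -> : (fun x => f x + g x) =
    (fun x => \sum_(p <- [:: (f, fun=> 1); (g, fun=> 1)]) p.1 x * p.2 x).
  by apply/funext => x; rewrite !big_cons big_nil addr0 /= !mulr1.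
apply: (@smoothM_sum [:: (f, fun=> 1); (g, fun=> 1)]) => p [<-|[<-|[]]]; split;
  [exact: hf|exact: smooth_cst|exact: hg|exact: smooth_cst].
Qed.

Lemma smoothZ (k : R) f : smoothR f -> smoothR (fun x => k * f x).
Proof. by move=> hf; apply: smoothM => //; exact: smooth_cst. Qed.

Lemma smooth_id : smoothR (fun x : R => x).
Proof.
apply: (smooth_coind (P := fun f => f = (fun x => x) \/ exists k, f = fun=> k)); last by left.
move=> f [->|[k ->]].
  by exists (fun=> 1); [move=> x; exact: is_derive_id|right; exists 1].
by exists (fun=> 0); [move=> x; exact: is_derive_cst|right; exists 0].
Qed.

Lemma smooth_exp_trig (b w p q : R) :
  smoothR (fun x => expR (b * x) * (p * cos (w * x) + q * sin (w * x))).
Proof.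
apply: (smooth_coind (P := fun f => exists p q : R,
  f = fun x => expR (b * x) * (p * cos (w * x) + q * sin (w * x)))); last by exists p, q.
move=> f [{}p [{}q ->]].
exists (fun x => expR (b * x) * ((b * p + w * q) * cos (w * x) + (b * q - w * p) * sin (w * x))); last first.
  by exists (b * p + w * q), (b * q - w * p).
move=> x.
have hb := is_deriveZ b (is_derive_id x 1).
have hw := is_deriveZ w (is_derive_id x 1).
have he := @is_derive1_comp _ expR (b \*: id) x _ _ (is_derive_expR _) hb.
have hc := @is_derive1_comp _ (@cos R) (w \*: id) x _ _ (is_derive_cos _) hw.
have hs := @is_derive1_comp _ (@sin R) (w \*: id) x _ _ (is_derive_sin _) hw.
have h := is_deriveM he (is_deriveD (is_deriveZ p hc) (is_deriveZ q hs)).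
by apply: (is_derive_eq h); rewrite !fctE /= /GRing.scale/=; ring.
Qed.

Lemma derive1_test0 f (al be x : R) : (forall x, x < al \/ be < x -> f x = 0) ->
  x < al \/ be < x -> derive1 f x = 0.
Proof.
move=> h hx; apply: is_derive_derive1.
apply: near_eq_is_derive (is_derive_cst 0 x 1).
case: hx => hx; near=> y; rewrite /= h//; [left|right]; near: y.
- exact: lt_nbhsl.
- exact: lt_nbhsr.
Unshelve. all: by end_near. Qed.

Lemma test_derive1 f : testR f -> testR (derive1 f).
Proof.
move=> [sf [al [be [al0 h]]]]; split; first exact: smooth_derive1.
by exists al, be; split => // x; exact: derive1_test0.
Qed.

Lemma testMs f g : testR f -> smoothR g -> testR (fun x => g x * f x).
Proof.
move=> [sf [al [be [al0 h]]]] sg; split; first exact: smoothM.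
by exists al, be; split => // x hx; rewrite h// mulr0.
Qed.

Lemma testZ (k : R) f : testR f -> testR (fun x => k * f x).
Proof. by move=> hf; apply: testMs => //; exact: smooth_cst. Qed.

Lemma testD f g : testR f -> testR g -> testR (fun x => f x + g x).
Proof.
move=> [sf [al [be [al0 h]]]] [sg [al' [be' [al'0 h']]]].
split; first exact: smoothD.
exists (Num.min al al'), (Num.max be be'); split; first by rewrite lt_min al0.
move=> x hx; rewrite h ?h' ?addr0//.
  by case: hx => [|]; rewrite ?lt_min ?gt_max => /andP[? ?]; [left|right].
by case: hx => [|]; rewrite ?lt_min ?gt_max => /andP[? ?]; [left|right].
Qed.

Lemma test0 : testR (fun=> 0 : R).
Proof. by split; [exact: smooth_cst|exists 1, 1; split]. Qed.

Lemma test_supp f : testR f -> exists al be : R, [/\ 0 < al, al <= be,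
  forall x, x <= al -> f x = 0 & forall x, be <= x -> f x = 0].
Proof.
move=> [sf [al [be [al0 h]]]].
exists (al / 2), (Num.max (be + 1) al); split.
- by rewrite divr_gt0.
- by rewrite le_max; apply/orP; right; lra.
- by move=> x hx; apply: h; left; lra.
- by move=> x; rewrite ge_max => /andP[hx _]; apply: h; right; lra.
Qed.

End Smooth.

(** * Integration by parts against exponentials *)

Section ExponentialTransform.
Variable R : realType.
Local Notation C := (R[i]).
Local Notation Re := (@ReC R).
Local Notation Im := (@ImC R).
Local Notation mu := (@lebesgue_measure R).
Implicit Types (f : R -> R) (zt : C).

Definition ex zt (x : R) : C := cexp (- iC R * zt * toC x).

Lemma ex0 zt : ex zt 0 = 1. Proof. by rewrite /ex toC0 mulr0 cexp0. Qed.

Lemma cder_ex zt x : cder (ex zt) x (- iC R * zt * ex zt x).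
Proof.
apply: (cder_eq (cder_exp (cderZ (- iC R * zt) (cder_toC (is_derive_id x 1))))).
by rewrite mulr1.
Qed.

Lemma cmod_ex zt x : Im zt <= 0 -> 0 <= x -> cmod (ex zt x) <= 1.
Proof.
move=> z0 x0; rewrite cmod_cexp -expR0 ler_expR.
have -> : Re (- iC R * zt * toC x) = Im zt * x by rewrite !CE; ring.
by rewrite mulr_le0_ge0.
Qed.

Lemma cder_continuous (F : R -> C) : (forall x, exists d, cder F x d) ->
  continuous (Re \o F) /\ continuous (Im \o F).
Proof.
move=> h; split=> x; have [d [d1 d2]] := h x.
  by apply: differentiable_continuous; apply/derivable1_diffP; case: d1.
by apply: differentiable_continuous; apply/derivable1_diffP; case: d2.
Qed.

Lemma cder_smooth f x : smoothR f -> cder (fun x => toC (f x)) x (toC (derive1 f x)).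
Proof. by move=> sf; apply: cder_toC; exact: smooth_is_derive. Qed.

Lemma measurable_ray (y : R) : measurable (`]y, +oo[%classic : set (measurableTypeR R)).
Proof. exact: measurable_itv. Qed.

Section transform.
Variables (f : R -> R) (zt : C).
Hypothesis tf : testR f.

Let sf := tf.1.

(* s = 1 or - 1 selects the solution decaying to the right or to the left of y *)
Let F (s y : R) (x : R) : C :=
  (toC (derive1 f x) + toC s * iC R * zt * toC (f x)) * ex zt (s * (x - y)).
Let J (s y : R) (x : R) : C :=
  (toC (derive1 (derive1 f) x) + zt * zt * toC (f x)) * ex zt (s * (x - y)).

Let cder_exs s y x : cder (fun x => ex zt (s * (x - y))) x (- iC R * zt * toC s * ex zt (s * (x - y))).
Proof.
have h := is_deriveZ s (is_deriveB (is_derive_id x 1) (is_derive_cst y x 1)).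
apply: (cder_eq (cder_exp (cderZ (- iC R * zt) (cder_toC h)))).
by rewrite /GRing.scale/= subr0 mulr1.
Qed.

Let dF s y x : s ^+ 2 = 1 -> cder (F s y) x (J s y x).
Proof.
move=> s1.
have h := cderM (cderD (cder_smooth x (smooth_derive1 sf))
  (cderZ (toC s * iC R * zt) (cder_smooth x sf))) (cder_exs s y x).
apply: (cder_eq h); rewrite /J.
have i2 := iC2 R.
have s2 : toC s * toC s = 1 by rewrite -toCM -expr2 s1.
move: (ex _ _) (toC s) s2 (iC R) i2 (toC (derive1 (derive1 f) x)) (toC (derive1 f x)) (toC (f x)) =>
  E S s2 I i2 f2 f1 f0.
rewrite (_ : zt * zt * f0 = - (I * I) * (S * S) * zt * zt * f0); last by rewrite i2 s2; ring.
by ring.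
Qed.

Let J_cont s y : continuous (Re \o J s y) /\ continuous (Im \o J s y).
Proof.
apply: cder_continuous => x; eexists.
exact: (cderM (cderD (cder_smooth x (smooth_derive1 (smooth_derive1 sf)))
  (cderZ (zt * zt) (cder_smooth x sf))) (cder_exs s y x)).
Qed.

Let ray_int s y y0 be : s ^+ 2 = 1 -> y0 <= be -> (forall x, be <= x -> f x = 0) ->
  (forall x, be <= x -> derive1 f x = 0) -> (forall x, be <= x -> derive1 (derive1 f) x = 0) ->
  crint (`]y0, +oo[%classic) (J s y) /\ cintD (`]y0, +oo[%classic) (J s y) = - F s y y0.
Proof.
move=> s1 yb f0 f1 f2; have [c1 c2] := J_cont s y.
have J0 x : be <= x -> J s y x = 0 by move=> bx; rewrite /J f0// f2// !toC0 mulr0 addr0 mul0r.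
split; first exact: (crint_ray yb).
apply: (CFTC_ray yb) => // [x|]; first exact: dF.
by rewrite /F f0// f1// !toC0 mulr0 addr0 mul0r.
Qed.

Let supp : exists al be : R, [/\ 0 < al, al <= be,
  forall x, x <= al -> [/\ f x = 0, derive1 f x = 0 & derive1 (derive1 f) x = 0] &
  forall x, be <= x -> [/\ f x = 0, derive1 f x = 0 & derive1 (derive1 f) x = 0]].
Proof.
have [al [be [al0 ab h1 h2]]] := test_supp tf.
have h x : x < al \/ be < x -> f x = 0.
  by case=> [/ltW|/ltW]; [exact: h1|exact: h2].
have h' := derive1_test0 h; have h'' := derive1_test0 h'.
exists (al / 2), (be + 1); split; first by rewrite divr_gt0.
- lra.
- by move=> x hx; split; [apply: h|apply: h'|apply: h'']; left; lra.
- by move=> x hx; split; [apply: h|apply: h'|apply: h'']; right; lra.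
Qed.

(** The integrand has the primitive [(f' + i zt f) exp (- i zt x)], which vanishes at both ends
    because [f] is supported away from 0 and from infinity. *)
Lemma ftr_derive2 : cint (fun x => (toC (derive1 (derive1 f) x) + zt * zt * toC (f x)) * ex zt x) = 0.
Proof.
have [al [be [al0 ab h1 h2]]] := supp.
have [_] := @ray_int 1 0 0 be (expr1n _ _) (le_trans (ltW al0) ab) (fun x h => let: And3 h _ _ := h2 x h in h)
  (fun x h => let: And3 _ h _ := h2 x h in h) (fun x h => let: And3 _ _ h := h2 x h in h).
rewrite cintE pos_halfE => E.
transitivity (cintD `]0, +oo[ (J 1 0)).
  by apply: eq_cintD => x _; rewrite /J mul1r subr0.
rewrite E /F; have [-> -> _] := h1 0 (ltW al0).
by rewrite !toC0 mulr0 addr0 mul0r oppr0.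
Qed.

(** The exponential in [|x - y|] is a fundamental solution. Split at [y], the two primitives carry
    [f' + i zt f] and [f' - i zt f]; at [y] the derivatives cancel and the terms in [f] add up. *)
Lemma free_derive2 y : 0 < y ->
  cint (fun x => (toC (derive1 (derive1 f) x) + zt * zt * toC (f x)) * ex zt `|x - y|) =
  - (2%:R * iC R * zt * toC (f y)).
Proof.
move=> y0; have [al [be [al0 ab h1 h2]]] := supp.
pose b := Num.max be y.
have bb : be <= b by rewrite le_max lexx.
have yb : y <= b by rewrite le_max lexx orbT.
have b0 : 0 <= b by rewrite (le_trans _ yb)// ltW.
have g0 x : b <= x -> f x = 0 by move=> hx; have [] := h2 x (le_trans bb hx).
have g1 x : b <= x -> derive1 f x = 0 by move=> hx; have [] := h2 x (le_trans bb hx).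
have g2 x : b <= x -> derive1 (derive1 f) x = 0 by move=> hx; have [] := h2 x (le_trans bb hx).
have s1 : (-1 : R) ^+ 2 = 1 by rewrite sqrrN expr1n.
have [i1 e1] := @ray_int 1 y y b (expr1n _ _) yb g0 g1 g2.
have [i2 e2] := @ray_int (-1) y y b s1 yb g0 g1 g2.
have [i3 e3] := @ray_int (-1) y 0 b s1 b0 g0 g1 g2.
have U : `]0, +oo[%classic = `]0, y]%classic `|` `]y, +oo[%classic :> set (measurableTypeR R).
  apply/seteqP; split => x /=; rewrite !in_itv/= !andbT.
    by move=> x0; have [|] := leP x y; [left; rewrite x0|right].
  by case=> [/andP[]//|]; exact: lt_trans.
have dj : [disjoint `]0, y]%classic & `]y, +oo[%classic].
  apply/disj_setPS => x [/=]; rewrite !in_itv/= andbT => /andP[_ h] h'.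
  by rewrite ltNge h in h'.
have m1 : measurable (`]0, y]%classic : set (measurableTypeR R)) by exact: measurable_itv.
have m2 := measurable_ray y.
have split_ (X : R -> C) : crint `]0, +oo[ X ->
    cintD `]0, +oo[ X = cintD `]0, y] X + cintD `]y, +oo[ X.
  by move=> [h h']; apply: C_ext; rewrite CE /= U; apply: Rintegral_setU => //; rewrite -U.
rewrite cintE pos_halfE.
pose K x := (toC (derive1 (derive1 f) x) + zt * zt * toC (f x)) * ex zt `|x - y|.
have Kl x : `]0, y]%classic x -> K x = J (-1) y x.
  by rewrite /= in_itv/= => /andP[_ xy]; rewrite /K /J ler0_norm ?subr_le0// mulN1r.
have Kr x : `]y, +oo[%classic x -> K x = J 1 y x.
  by rewrite /= in_itv/= andbT => xy; rewrite /K /J gtr0_norm ?subr_gt0// mul1r.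
have cK x : ccvg (nbhs x) K (K x).
  have c0 : f x0 @[x0 --> x] --> f x := smooth_continuous sf (x := x).
  have c2 : derive1 (derive1 f) x0 @[x0 --> x] --> derive1 (derive1 f) x :=
    smooth_continuous (smooth_derive1 (smooth_derive1 sf)) (x := x).
  have cn : `|x0 - y| @[x0 --> x] --> `|x - y|.
    by apply: cvg_norm; apply: cvgB; [exact: cvg_id|exact: cvg_cst].
  apply: ccvgM.
    by apply: ccvgD; [exact: ccvg_toC|apply: ccvgM; [exact: ccvg_cst|exact: ccvg_toC]].
  by apply: ccvg_exp; apply: ccvgM; [exact: ccvg_cst|exact: ccvg_toC].
have iK : crint `]0, +oo[ K.
  apply: (crint_ray b0) => [x|x|x bx]; [by case: (cK x)|by case: (cK x)|].
  by rewrite /K g0// g2// !toC0 mulr0 addr0 mul0r.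
rewrite (split_ K)// (eq_cintD Kl) (eq_cintD Kr) e1.
have := split_ _ i3; rewrite e3 e2 => E.
have -> : cintD `]0, y] (J (-1) y) = - F (-1) y 0 + F (-1) y y by rewrite E; ring.
rewrite /F subrr !mulr0 ex0 !mulr1; have [-> -> _] := h1 0 (ltW al0).
rewrite !toC0 mulr0 addr0 mul0r toC1 toCN toC1.
by ring.
Qed.
End transform.
End ExponentialTransform.

(** * The Poisson formula under two space integrals *)

Section DoublePoisson.
Variable R : realType.
Local Notation C := (R[i]).
Local Notation Re := (@ReC R).
Local Notation Im := (@ImC R).
Local Notation mu := (@lebesgue_measure R).
Local Notation TR := (measurableTypeR R).
Local Notation pos := (@pos_half R : set TR).
Variables (n : nat) (c a : 'I_n -> R).
Hypothesis c_gt0 : forall k, 0 < c k.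

Let mpos : measurable pos := @measurable_pos_half R.

Lemma Re_cint_mul (h : R -> R) (e : R -> C) (w : C) : crint pos (fun x => toC (h x) * e x) ->
  Rintegral mu pos (fun x => h x * Re (w * e x)) = Re (w * cint (fun x => toC (h x) * e x)).
Proof.
move=> hi; rewrite cintE -cintDZ//=; apply: eq_Rintegral => x _ /=.
by rewrite !CE; ring.
Qed.

Variables (m : 'I_n -> R) (k0 : 'I_n).
Hypothesis m_ge0 : forall k, 0 <= m k.
Hypothesis mk0 : 0 < m k0.

Definition kbd (s : R) : R := (cmod (ksum c a m (toC s)))^-1 * cauchyd s.

Lemma cmeas_xiz k : cmeas setT (fun s : TR => xiz c a k (toC s)).
Proof.
apply: cmeas_csq; apply: cmeasM; first exact: cmeas_cst.
by apply: cmeasD; [apply: cmeas_toC; exact: measurable_id|exact: cmeas_cst].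
Qed.

Lemma cmeas_ksum : cmeas setT (fun s : TR => ksum c a m (toC s)).
Proof. by apply: cmeas_sum => k; apply: cmeasM; [exact: cmeas_cst|exact: cmeas_xiz]. Qed.

Lemma meas_cauchyd : measurable_fun setT (@cauchyd R).
Proof. exact: rint_meas (@rint_cauchyd R). Qed.

Lemma rint_kbd : rint mu setT kbd.
Proof.
have mb : measurable_fun setT kbd.
  by apply: measurable_funM meas_cauchyd; apply: measurable_funV; exact: meas_cmod cmeas_ksum.
have kd := rint_kdom (c k0) (a k0) mk0.
apply/integrableP; split; first exact/measurable_EFinP.
have kd2 := (integrableP _ _ _ kd).2; apply: le_lt_trans kd2.
apply: ae_ge0_le_integral => //.
- by apply: measurableT_comp => //; apply/measurable_EFinP; exact: mb.
- by apply: measurableT_comp => //; apply/measurable_EFinP; exact: (rint_meas kd).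
exists [set a k0]; split => //; first exact: lebesgue_measure_set1.
move=> s /=; apply: contra_notP => /eqP sa _.
have k0' : 0 <= kdom (c k0) (a k0) (m k0) s * cauchyd s.
  by rewrite mulr_ge0 ?cauchyd_ge0 ?kdom_ge0// ltW.
have b0 : 0 <= kbd s by rewrite mulr_ge0 ?cauchyd_ge0// invr_ge0 cmod_ge0.
rewrite /= lee_fin (ger0_norm k0') (ger0_norm b0) /kbd ler_wpM2r ?cauchyd_ge0//.
have za : toC s != toC (a k0) by apply: contra sa => /eqP[->].
have x0 := xiz_neq0 c_gt0 za.
rewrite kdomE// lef_pV2 ?posrE ?cmod_gt0 ?(ksum_neq0 m_ge0 mk0 x0)//; last first.
  rewrite mulr_gt0// sqrtr_gt0; apply: divr_gt0 => //; apply: divr_gt0.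
    by rewrite normr_gt0 subr_eq0.
  by rewrite sqrtr_gt0 (lt_le_trans ltr01).
have kg := ksum_ge c a k0 m_ge0 (toC s).
rewrite (le_trans _ kg)//.
rewrite ler_pM2l// cmod_xiz ler_sqrt ?cmod_ge0// /xarg cmodM -toCN -toCD !cmod_toC.
rewrite (gtr0_norm (x := (c k0)^-1)) ?invr_gt0// mulrC ler_pM2l ?invr_gt0//.
rewrite ler_piMr// invf_le1 ?sqrtr_gt0 ?(lt_le_trans ltr01)//.
by rewrite -[leLHS]sqrtr1 ler_sqrt// (le_trans ler01).
Qed.

Variable (T : TR -> TR -> 'I_n -> R).
Hypothesis mT : forall k, measurable_fun setT (fun p : TR * TR => T p.1 p.2 k).
Hypothesis T_ge0 : forall x y k, 0 < x -> 0 < y -> 0 <= T x y k.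
Variables (h f : R -> R).
Hypotheses (mh : measurable_fun setT h) (hh : rint mu pos h) (hf : rint mu pos f).

Local Notation kr x y z := (ker c a (T x y) m z).

Let K0 (p : TR * (TR * TR)) : R := Re (kr p.1 p.2.1 (toC p.2.2)) * cauchyd p.2.2.

Let mK0 : measurable_fun setT K0.
Proof.
have m22 : measurable_fun setT (fun p : TR * (TR * TR) => p.2.2) by exact: measurableT_comp.
have m21 : measurable_fun setT (fun p : TR * (TR * TR) => (p.1, p.2.1)).
  by apply: measurable_fun_pair => //; exact: (measurableT_comp measurable_fst measurable_snd).
apply: measurable_funM; last exact: (measurableT_comp meas_cauchyd m22).
suff [] : cmeas setT (fun p : TR * (TR * TR) => kr p.1 p.2.1 (toC p.2.2)) by [].
have mx k : cmeas setT (fun p : TR * (TR * TR) => xiz c a k (toC p.2.2)).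
  have [x1 x2] := cmeas_xiz k; split; first exact: (measurableT_comp x1 m22).
  exact: (measurableT_comp x2 m22).
apply: cmeasM.
  apply: cmeas_exp; apply: cmeasM; first exact: cmeas_cst.
  apply: cmeas_sum => k; apply: cmeasM => //; apply: cmeas_toC.
  exact: (measurableT_comp (mT k) m21).
by apply: cmeasV; apply: cmeas_sum => k; apply: cmeasM => //; exact: cmeas_cst.
Qed.

Let K0_le x y s : 0 < x -> 0 < y -> `|K0 (x, (y, s))| <= kbd s.
Proof.
move=> x0 y0; rewrite /K0/= normrM (ger0_norm (cauchyd_ge0 _)) ler_wpM2r ?cauchyd_ge0//.
rewrite (le_trans (Re_le_cmod _))// cmodM cmodV ler_piMl ?invr_ge0 ?cmod_ge0//.
by apply: cmod_kexp => k; exact: T_ge0.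
Qed.

Let mK0y y : measurable_fun setT (fun p : TR * TR => K0 (p.1, (y, p.2))).
Proof.
apply: (measurableT_comp mK0); apply: measurable_fun_pair => //.
by apply: measurable_fun_pair => //; exact: measurable_cst.
Qed.

Let K1 (p : TR * TR) : R := Rintegral mu pos (fun x => h x * K0 (x, p)).

Let mK1 : measurable_fun setT K1.
Proof.
apply: (measurable_param_integral (H := fun p => h p.1 * K0 p) mpos).
by apply: measurable_funM => //; exact: (measurableT_comp mh measurable_fst).
Qed.

Let M := Rintegral mu pos (fun x => `|h x|).

Let K1_le y s : pos y -> `|K1 (y, s)| <= M * kbd s.
Proof.
move=> y0; apply: (Rintegral_dom_le (K := fun p => K0 (p.1, (y, p.2))) mpos hh (mK0y y)).
by move=> x r x0; exact: K0_le.
Qed.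

Let iM : rint mu setT (fun s => M * kbd s).
Proof. by apply: rintZ => //; exact: rint_kbd. Qed.

Let K1E y : pos y -> Rintegral mu setT (fun s => K1 (y, s)) =
  pi * Rintegral mu pos (fun x => h x * Re (kr x y (- iC R))).
Proof.
move=> y0; rewrite /K1.
rewrite (fubini_dom (K := fun p => K0 (p.1, (y, p.2))) mpos hh rint_kbd (mK0y y)); last first.
  by move=> x s x0; exact: K0_le.
have e x : pos x -> Rintegral mu setT (fun s => K0 (x, (y, s))) = pi * Re (kr x y (- iC R)).
  by move=> x0; have [_] := poisson_ker a c_gt0 (fun k => @T_ge0 x y k x0 y0) m_ge0 mk0.
have hk : rint mu pos (fun x => h x * Re (kr x y (- iC R))).
  apply: (rint_le mpos) (rintZr ((cmod (ksum c a m (- iC R)))^-1) mpos (rint_norm mpos hh)) _.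
    apply: measurable_funM; first exact: measurable_funTS.
    apply: measurable_funTS; suff [] : cmeas setT (fun x : TR => kr x y (- iC R)) by [].
    apply: cmeasM; last exact: cmeas_cst.
    apply: cmeas_exp; apply: cmeasM; first exact: cmeas_cst.
    apply: cmeas_sum => k; apply: cmeasM; last exact: cmeas_cst.
    by apply: cmeas_toC; exact: (measurableT_comp (mT k) (pair2_measurable y)).
  move=> x x0; rewrite normrM ler_wpM2l// (le_trans (Re_le_cmod _))//.
  rewrite cmodM cmodV ler_piMl ?invr_ge0 ?cmod_ge0//.
  by apply: cmod_kexp => k; exact: T_ge0.
rewrite -(@RintZ _ _ _ mu)//; apply: eq_Rintegral => x /set_mem x0.
by rewrite e//; ring.
Qed.

Let kr_int y s : pos y -> rint mu pos (fun x => h x * Re (kr x y (toC s))).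
Proof.
move=> y0.
have o0 : oneDsqr s != 0 by rewrite gt_eqF// (lt_le_trans ltr01).
have := rintZr (oneDsqr s) mpos (rint_dom_slice (K := fun p => K0 (p.1, (y, p.2))) mpos hh (mK0y y)
  (fun x s x0 => K0_le s x0 y0) s).
apply: (eq_rint mpos) => x x0.
by rewrite /K0/= /cauchyd; field.
Qed.

Let K1s y s : pos y -> K1 (y, s) = Rintegral mu pos (fun x => h x * Re (kr x y (toC s))) * cauchyd s.
Proof.
move=> y0; rewrite mulrC -(@RintZ _ _ _ mu)//; last exact: kr_int.
by apply: eq_Rintegral => x _; rewrite /K0/=; ring.
Qed.

Definition kquad (z : C) : R :=
  Rintegral mu pos (fun y => f y * Rintegral mu pos (fun x => h x * Re (kr x y z))).

Let fK1 s : Rintegral mu pos (fun y => f y * K1 (y, s)) = kquad (toC s) * cauchyd s.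
Proof.
have o0 : oneDsqr s != 0 by rewrite gt_eqF// (lt_le_trans ltr01).
have hi := rint_dom_slice mpos hf mK1 K1_le s.
rewrite -[LHS](mulfVK o0) -/(cauchyd s) mulrAC (mulrC _ (oneDsqr s)) -(@RintZ _ _ _ mu)//.
congr (_ * _); apply: eq_Rintegral => y /set_mem y0.
by rewrite K1s// /cauchyd; field.
Qed.

(** Two applications of [fubini_dom] bring the spectral integral innermost, where [poisson_ker]
    evaluates it for fixed [x] and [y]. Both rest on the majorant [kbd], which is free of [x] and
    [y] because the exponential factor has modulus at most 1. *)
Lemma double_poisson : rint mu setT (fun s => kquad (toC s) * cauchyd s) /\
  Rintegral mu setT (fun s => kquad (toC s) * cauchyd s) = pi * kquad (- iC R).
Proof.
have h1 := rint_fubini_dom mpos hf iM mK1 K1_le.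
have h2 := fubini_dom mpos hf iM mK1 K1_le.
have e : (fun s => kquad (toC s) * cauchyd s) = (fun s => Rintegral mu pos (fun y => f y * K1 (y, s))).
  by apply/funext => s; rewrite fK1.
rewrite e; split => //; rewrite h2 /kquad.
have hi := rint_dom_other iM mK1 K1_le.
have pi0 : pi != 0 :> R by rewrite gt_eqF// pi_gt0.
rewrite -[LHS](mulVKf pi0) -[X in _ * X = _](@RintZ _ _ _ mu)//.
  by congr (_ * _); apply: eq_Rintegral => y /set_mem y0; rewrite K1E// mulrCA mulKf.
pose w := Rintegral mu setT (fun s => M * kbd s).
have mf := rint_meas hf.
apply: (rint_le mpos) (rintZr w mpos (rint_norm mpos hf)) _.
  apply: measurable_funM => //; apply: measurable_funTS.
  have sw : measurable_fun setT (fun p : TR * TR => K1 (p.2, p.1)).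
    by apply: (measurableT_comp mK1); exact: measurable_swap.
  exact: (measurable_param_integral measurableT sw).
move=> y y0; rewrite normrM ler_wpM2l//; apply: Rintegral_normle => //; first exact: hi.
by move=> s _; exact: K1_le.
Qed.
End DoublePoisson.

(** * The Parseval identity *)

Section RealParseval.
Variable R : realType.
Local Notation C := (R[i]).
Local Notation Re := (@ReC R).
Local Notation Im := (@ImC R).
Local Notation mu := (@lebesgue_measure R).
Local Notation TR := (measurableTypeR R).
Local Notation pos := (@pos_half R : set TR).

Let mpos : measurable pos := @measurable_pos_half R.

Lemma crint_mul (h : R -> R) (e : R -> C) : rint mu pos h -> cmeas pos e ->
  (forall x, 0 < x -> cmod (e x) <= 1) -> crint pos (fun x => toC (h x) * e x).
Proof.
move=> hh me e1; apply: (crint_le mpos _ (rint_norm mpos hh)) => [|x x0].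
  by apply: cmeasM => //; apply: cmeas_toC; exact: rint_meas hh.
by rewrite cmodM cmod_toC ler_piMr// e1.
Qed.

Lemma rint_test (f : R -> R) : testR f -> rint mu pos f.
Proof.
move=> tf; have [al [be [al0 ab h1 h2]]] := test_supp tf; rewrite pos_halfE.
apply: (@rint_ray _ _ _ be) => //; first by rewrite (le_trans (ltW al0)).
exact: smooth_continuous tf.1.
Qed.

Lemma cmeas_ex_comp (D : set TR) (zt : C) (g : TR -> R) : measurable_fun setT g ->
  cmeas D (fun x => ex zt (g x)).
Proof.
move=> mg; apply: cmeas_exp; apply: cmeasM; first exact: cmeas_cst.
by apply: cmeas_toC; exact: measurable_funTS.
Qed.

Lemma meas_absB (y : R) : measurable_fun setT (fun x : TR => `|x - y|).
Proof.
by apply: measurableT_comp => //; apply: measurable_funB => //; exact: measurable_cst.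
Qed.

Variables (n : nat) (c a : 'I_n -> R).
Hypothesis c_gt0 : forall k, 0 < c k.
Local Notation xz := (xiz c a).

Definition Ar (k : 'I_n) (f : R -> R) : R -> R :=
  fun x => - c k * derive1 (derive1 f) x + a k * f x.
Definition Et (k : 'I_n) (f : R -> R) (z : C) : C := cint (fun x => toC (f x) * ex (xz k z) x).
Definition Fr (k : 'I_n) (f : R -> R) (z : C) (y : R) : C :=
  cint (fun x => toC (f x) * ex (xz k z) `|x - y|).

Lemma test_Ar k f : testR f -> testR (Ar k f).
Proof. by move=> tf; apply: testD; apply: testZ => //; do 2 apply: test_derive1. Qed.

Lemma crint_Et k f z : rint mu pos f -> crint pos (fun x => toC (f x) * ex (xz k z) x).
Proof.
move=> hf; apply: crint_mul => //.
  by apply: cmeas_ex_comp; exact: measurable_id.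
by move=> x /ltW x0; apply: cmod_ex => //; exact: Im_csq_le0.
Qed.

Lemma crint_Fr k f z y : rint mu pos f -> crint pos (fun x => toC (f x) * ex (xz k z) `|x - y|).
Proof.
move=> hf; apply: crint_mul => //; first exact: cmeas_ex_comp (meas_absB y).
by move=> x _; apply: cmod_ex => //; exact: Im_csq_le0.
Qed.

Let lin (f g : R -> R) (e : R -> C) (p q : C) :
  crint pos (fun x => toC (f x) * e x) -> crint pos (fun x => toC (g x) * e x) ->
  cint (fun x => (p * toC (f x) + q * toC (g x)) * e x) =
  p * cint (fun x => toC (f x) * e x) + q * cint (fun x => toC (g x) * e x).
Proof.
move=> hf hg; rewrite !cintE -!cintDZ// -cintDD//; try exact: crintZ.
by apply: eq_cintD => x _; ring.
Qed.

Let Ar_lin k f (e : R -> C) : 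
  crint pos (fun x => toC (derive1 (derive1 f) x) * e x) -> crint pos (fun x => toC (f x) * e x) ->
  cint (fun x => toC (Ar k f x) * e x) =
  - toC (c k) * cint (fun x => toC (derive1 (derive1 f) x) * e x) + toC (a k) * cint (fun x => toC (f x) * e x).
Proof.
move=> h1 h2; rewrite -lin//; apply: eq_cint => x _.
by rewrite /Ar toCD !toCM toCN.
Qed.

Let d2_lin f (e : R -> C) (q : C) :
  crint pos (fun x => toC (derive1 (derive1 f) x) * e x) -> crint pos (fun x => toC (f x) * e x) ->
  cint (fun x => (toC (derive1 (derive1 f) x) + q * toC (f x)) * e x) =
  cint (fun x => toC (derive1 (derive1 f) x) * e x) + q * cint (fun x => toC (f x) * e x).
Proof.
move=> h1 h2; have := @lin (derive1 (derive1 f)) f e 1 q h1 h2; rewrite mul1r => <-.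
by apply: eq_cint => x _; rewrite mul1r.
Qed.

Lemma Et_Ar k f z : testR f -> Im z <= 0 -> Et k (Ar k f) z = z * Et k f z.
Proof.
move=> tf z0; have t2 := test_derive1 (test_derive1 tf).
have i2 := crint_Et k z (rint_test t2); have i0 := crint_Et k z (rint_test tf).
have := ftr_derive2 (xz k z) tf; rewrite (d2_lin _ i2 i0) => /eqP; rewrite addr_eq0 => /eqP E.
rewrite /Et (Ar_lin _ i2 i0) E.
have := xiz_sqr a c_gt0 k z0; move: (cint _) => X; move: (xz k z) => zt h.
transitivity ((toC (c k) * (zt * zt) + toC (a k)) * X); first by ring.
by rewrite h subrK.
Qed.

Lemma Fr_Ar k f z y : testR f -> Im z <= 0 -> 0 < y ->
  Fr k (Ar k f) z y = z * Fr k f z y + 2%:R * iC R * toC (c k) * xz k z * toC (f y).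
Proof.
move=> tf z0 y0; have t2 := test_derive1 (test_derive1 tf).
have i2 := crint_Fr k z y (rint_test t2); have i0 := crint_Fr k z y (rint_test tf).
have := free_derive2 (xz k z) tf y0; rewrite (d2_lin _ i2 i0) => E.
rewrite /Fr (Ar_lin _ i2 i0).
have -> : cint (fun x => toC (derive1 (derive1 f) x) * ex (xz k z) `|x - y|) =
   - (xz k z * xz k z * cint (fun x => toC (f x) * ex (xz k z) `|x - y|)) - 2%:R * iC R * xz k z * toC (f y).
  by rewrite -E; ring.
have := xiz_sqr a c_gt0 k z0; move: (cint _) => X; move: (xz k z) => zt h.
transitivity ((toC (c k) * (zt * zt) + toC (a k)) * X + 2%:R * iC R * toC (c k) * zt * toC (f y)); first by ring.
by rewrite h subrK.
Qed.

(** The operator [1 + A^2] on one edge. Its symbol [1 + z^2] equals the inverse Poisson weight on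
    the real line and vanishes at [- i]. *)
Definition A2 k (f : R -> R) : R -> R := fun x => f x + Ar k (Ar k f) x.

Lemma test_A2 k f : testR f -> testR (A2 k f).
Proof. by move=> tf; apply: testD => //; do 2 apply: test_Ar. Qed.

Let addlin (f g : R -> R) (e : R -> C) :
  crint pos (fun x => toC (f x) * e x) -> crint pos (fun x => toC (g x) * e x) ->
  cint (fun x => toC (f x + g x) * e x) =
  cint (fun x => toC (f x) * e x) + cint (fun x => toC (g x) * e x).
Proof.
move=> hf hg; rewrite !cintE -cintDD//.
by apply: eq_cintD => x _; rewrite toCD; ring.
Qed.

Lemma Et_A2 k f z : testR f -> Im z <= 0 -> Et k (A2 k f) z = (1 + z * z) * Et k f z.
Proof.
move=> tf z0; have t1 := test_Ar k tf; have t2 := test_Ar k t1.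
rewrite {1}/Et addlin; [|exact: crint_Et (rint_test tf)|exact: crint_Et (rint_test t2)].
rewrite -/(Et k f z) -/(Et k (Ar k (Ar k f)) z) !Et_Ar//; ring.
Qed.

(** Each application of the operator multiplies the free transform by [z] and adds a local term in
    [f y]. At [z = - i] the nonlocal parts cancel since [1 + z^2 = 0]; what remains is local, with
    real part proportional to [f y] once [2 c k xi] is divided out. *)
Lemma Fr_A2 k f y : testR f -> 0 < y ->
  Fr k (A2 k f) (- iC R) y = 2%:R * toC (c k) * xz k (- iC R) * (toC (f y) + iC R * toC (Ar k f y)).
Proof.
move=> tf y0; have z0 : Im (- iC R) <= 0 by rewrite !CE lerN10.
have t1 := test_Ar k tf; have t2 := test_Ar k t1.
rewrite {1}/Fr addlin; [|exact: crint_Fr (rint_test tf)|exact: crint_Fr (rint_test t2)].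
rewrite -/(Fr k f _ y) -/(Fr k (Ar k (Ar k f)) _ y) !Fr_Ar//.
have := iC2 R; move: (Fr _ _ _ _) => F; move: (xz _ _) => zt.
move: (toC (c k)) (toC (f y)) (toC (Ar k f y)) => cc f0 f1; move: (iC R) => I i2.
transitivity ((1 + I * I) * F + 2%:R * cc * zt * (- (I * I) * f0 + I * f1)); first by ring.
by rewrite i2; ring.
Qed.

(* the exponents of the reflected (and transmitted) and of the free waves *)
Definition Tvtx (k l : 'I_n) (x y : R) (j : 'I_n) : R := x *+ (j == k) + y *+ (j == l).
Definition Tfree (k : 'I_n) (x y : R) (j : 'I_n) : R := `|x - y| *+ (j == k).
Definition mfree (k : 'I_n) (j : 'I_n) : R := (2 * c k) *+ (j == k).

Let sum_delta (k : 'I_n) (r : R) (F : 'I_n -> C) :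
  \sum_(j < n) toC (r *+ (j == k)) * F j = toC r * F k.
Proof.
rewrite (bigD1 k)//= eqxx big1 ?addr0// => j /negbTE ->.
by rewrite toC0 mul0r.
Qed.

Lemma kexp_vtx k l x y z : kexp c a (Tvtx k l x y) z = ex (xz k z) x * ex (xz l z) y.
Proof.
rewrite /kexp /ex -cexpD; congr cexp; rewrite /Tvtx.
under eq_bigr do rewrite toCD mulrDl.
by rewrite big_split /= !sum_delta; ring.
Qed.
Lemma kexp_free k x y z : kexp c a (Tfree k x y) z = ex (xz k z) `|x - y|.
Proof. by rewrite /kexp /ex /Tfree sum_delta; congr cexp; ring. Qed.
Lemma ksum_free k z : ksum c a (mfree k) z = 2%:R * toC (c k) * xz k z.
Proof. by rewrite /ksum /mfree sum_delta toCM toC2. Qed.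

Lemma kquad_vtx k l m h f z : rint mu pos h -> rint mu pos f ->
  kquad c a m (Tvtx k l) h f z = Re (Et k h z * Et l f z / ksum c a m z).
Proof.
move=> hh hf; rewrite /kquad.
have e y : Rintegral mu pos (fun x => h x * Re (ker c a (Tvtx k l x y) m z)) =
    Re ((Et k h z / ksum c a m z) * ex (xz l z) y).
  transitivity (Rintegral mu pos (fun x => h x * Re (ex (xz l z) y / ksum c a m z * ex (xz k z) x))).
    by apply: eq_Rintegral => x _; rewrite /ker kexp_vtx; congr (_ * Re _); ring.
  by rewrite Re_cint_mul; [congr Re; rewrite -/(Et k h z); ring|exact: crint_Et].
under eq_Rintegral do rewrite e.
rewrite Re_cint_mul; last exact: crint_Et.
rewrite -/(Et l f z); congr Re; move: (Et k h z) (Et l f z) (ksum c a m z) => X Y Z.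
by rewrite mulrAC.
Qed.

Lemma inner_free k m h z y : rint mu pos h ->
  Rintegral mu pos (fun x => h x * Re (ker c a (Tfree k x y) m z)) = Re (Fr k h z y / ksum c a m z).
Proof.
move=> hh.
transitivity (Rintegral mu pos (fun x => h x * Re ((ksum c a m z)^-1 * ex (xz k z) `|x - y|))).
  by apply: eq_Rintegral => x _; rewrite /ker kexp_free; congr (_ * Re _); ring.
by rewrite Re_cint_mul; [congr Re; rewrite -/(Fr k h z y); ring|exact: crint_Fr].
Qed.

(** Above the threshold [a k] this is [cos (x - y) = cos (x + y) + 2 sin x sin y], scaled by [xi].
    Below it [xi] is imaginary and the exponentials are real, so both quotients are imaginary and
    the sine term is 0. When [xi] itself vanishes, division by 0 gives 0 throughout. *)
Lemma free_real k (s x y : R) : let e := ex (xz k (toC s)) in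
  Re (e `|x - y| / ksum c a (mfree k) (toC s)) =
  Re (e x * e y / ksum c a (mfree k) (toC s)) + Im (e x) * Im (e y) / (c k * Re (xz k (toC s))).
Proof.
move=> e; rewrite /e ksum_free xiz_real// {e}.
have ck := c_gt0 k; have ck0 : c k != 0 by rewrite gt_eqF.
rewrite /xi; have [h|h] := leP (a k) s; last first.
  set b := Num.sqrt _.
  have eE r : ex (- iC R * toC b) r = toC (expR (- (b * r))).
    have a1 : Re (- iC R * (- iC R * toC b) * toC r) = - (b * r) by rewrite !CE; ring.
    have a2 : Im (- iC R * (- iC R * toC b) * toC r) = 0 by rewrite !CE; ring.
    apply: C_ext; first by rewrite /ex ReC_cexp a1 a2 cos0 mulr1.
    by rewrite /ex ImC_cexp a1 a2 sin0 mulr0.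
  rewrite !eE -toCM !ImC_toC !mul0r addr0.
  have re0 (r : R) : Re (toC r / (2%:R * toC (c k) * (- iC R * toC b))) = 0.
    by rewrite ReCM ReCV ImCV toC2 !CE; ring.
  by rewrite !re0.
set al := Num.sqrt _.
have [al0|al0] := eqVneq al 0.
  by rewrite al0 toC0 mulr0 invr0 !mulr0 invr0 mulr0 addr0.
have a1 r : Re (- iC R * toC al * toC r) = 0 by rewrite !CE; ring.
have a2 r : Im (- iC R * toC al * toC r) = - (al * r) by rewrite !CE; ring.
have eR r : Re (ex (toC al) r) = cos (al * r).
  by rewrite /ex ReC_cexp a1 a2 expR0 mul1r cosN.
have eI r : Im (ex (toC al) r) = - sin (al * r).
  by rewrite /ex ImC_cexp a1 a2 expR0 mul1r sinN.
have q (z : C) : Re (z / (2%:R * toC (c k) * toC al)) = Re z / (2 * c k * al).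
  by rewrite toC2 -!toCM ReCM ReCV ImCV sqmod_toC !CE; field; rewrite ck0 al0.
rewrite !q ReCM !eR !eI.
have -> : cos (al * `|x - y|) = cos (al * x) * cos (al * y) + sin (al * x) * sin (al * y).
  have [xy|xy] := leP 0 (x - y).
    by rewrite ger0_norm// mulrBr cosB.
  by rewrite ltr0_norm// -cosN -mulrN opprK mulrBr cosB.
rewrite CE; field.
by rewrite al0 ck0.
Qed.

Lemma Im_Et k h z : rint mu pos h ->
  Rintegral mu pos (fun x => h x * Im (ex (xz k z) x)) = Im (Et k h z).
Proof.
move=> hh; rewrite /Et cintE /cintD/=; apply: eq_Rintegral => x _ /=.
by rewrite !CE; ring.
Qed.

Lemma rint_Re_ex k h z w : rint mu pos h -> rint mu pos (fun x => h x * Re (w * ex (xz k z) x)).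
Proof.
move=> hh; have [i1 _] := crintZ w mpos (crint_Et k z hh).
by apply: (eq_rint mpos _ i1) => x _ /=; rewrite !CE; ring.
Qed.

Lemma rint_Im_ex k h z : rint mu pos h -> rint mu pos (fun x => h x * Im (ex (xz k z) x)).
Proof.
move=> hh; have [_ i1] := crint_Et k z hh.
by apply: (eq_rint mpos _ i1) => x _ /=; rewrite !CE; ring.
Qed.

Lemma kquad_free_real k h f s : rint mu pos h -> rint mu pos f ->
  kquad c a (mfree k) (Tfree k) h f (toC s) =
  kquad c a (mfree k) (Tvtx k k) h f (toC s) +
  Im (Et k h (toC s)) * Im (Et k f (toC s)) / (c k * Re (xz k (toC s))).
Proof.
move=> hh hf; rewrite [LHS]/kquad.
set z := toC s; set Q := (c k * _)^-1; set S := ksum c a (mfree k) z.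
have e y : Rintegral mu pos (fun x => h x * Re (ker c a (Tfree k x y) (mfree k) z)) =
    Re ((Et k h z / S) * ex (xz k z) y) + Im (Et k h z) * Q * Im (ex (xz k z) y).
  transitivity (Rintegral mu pos (fun x => h x * Re (ex (xz k z) y / S * ex (xz k z) x) +
      (Q * Im (ex (xz k z) y)) * (h x * Im (ex (xz k z) x)))).
    apply: eq_Rintegral => x _; rewrite /ker kexp_free free_real -/S -/Q.
    rewrite (_ : ex (xz k z) x * ex (xz k z) y / S = ex (xz k z) y / S * ex (xz k z) x); last by ring.
    by rewrite -/z -/Q; ring.
  rewrite (@RintD _ _ _ mu)//; [|exact: rint_Re_ex|by apply: rintZ => //; exact: rint_Im_ex].
  rewrite (@RintZ _ _ _ mu)//; last exact: rint_Im_ex.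
  rewrite Im_Et// Re_cint_mul; last exact: crint_Et.
  by congr (_ + _); [congr Re; rewrite -/(Et k h z); ring|ring].
under eq_Rintegral do rewrite e.
transitivity (Rintegral mu pos (fun y => f y * Re ((Et k h z / S) * ex (xz k z) y) +
   (Im (Et k h z) * Q) * (f y * Im (ex (xz k z) y)))).
  by apply: eq_Rintegral => y _; ring.
rewrite (@RintD _ _ _ mu)//; [|exact: rint_Re_ex|by apply: rintZ => //; exact: rint_Im_ex].
rewrite (@RintZ _ _ _ mu)//; last exact: rint_Im_ex.
rewrite Im_Et// Re_cint_mul; last exact: crint_Et.
rewrite kquad_vtx//; congr (_ + _); last by ring.
rewrite -/(Et k f z) -/S; congr Re; exact: mulrAC.
Qed.

End RealParseval.

(** * The spectral identity for real test functions *)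

Section SpectralIdentity.
Variable R : realType.
Local Notation C := (R[i]).
Local Notation Re := (@ReC R).
Local Notation Im := (@ImC R).
Local Notation mu := (@lebesgue_measure R).
Local Notation TR := (measurableTypeR R).
Local Notation pos := (@pos_half R : set TR).
Variables (n : nat) (c a : 'I_n -> R).
Hypothesis c_gt0 : forall k, 0 < c k.
Local Notation xz := (xiz c a).

Let mpos : measurable pos := @measurable_pos_half R.
Let c_ge0 k : 0 <= c k. Proof. exact: ltW. Qed.

Lemma meas_muln (g : TR * TR -> R) (b : bool) : measurable_fun setT g ->
  measurable_fun setT (fun p => g p *+ b).
Proof.
by move=> mg; case: b; [rewrite /= ; under eq_fun do rewrite mulr1n|under eq_fun do rewrite mulr0n; exact: measurable_cst].
Qed.

Lemma meas_Tvtx k l j : measurable_fun setT (fun p : TR * TR => @Tvtx R n k l p.1 p.2 j).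
Proof. by apply: measurable_funD; apply: meas_muln. Qed.

Lemma meas_Tfree k j : measurable_fun setT (fun p : TR * TR => @Tfree R n k p.1 p.2 j).
Proof.
apply: meas_muln; apply: measurableT_comp => //.
by apply: measurable_funB.
Qed.

Lemma Tvtx_ge0 k l x y j : 0 < x -> 0 < y -> 0 <= @Tvtx R n k l x y j.
Proof. by move=> /ltW x0 /ltW y0; rewrite addr_ge0// mulrn_wge0. Qed.
Lemma Tfree_ge0 k x y j : 0 < x -> 0 < y -> 0 <= @Tfree R n k x y j.
Proof. by move=> _ _; rewrite mulrn_wge0. Qed.
Lemma mfree_ge0 k j : 0 <= mfree c k j.
Proof. by rewrite mulrn_wge0// mulr_ge0. Qed.
Lemma mfree_gt0 k : 0 < mfree c k k.
Proof. by rewrite /mfree eqxx mulr1n mulr_gt0. Qed.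

Lemma meas_smooth (f : R -> R) : smoothR f -> measurable_fun setT f.
Proof. by move=> sf; apply: continuous_measurable_fun; exact: smooth_continuous. Qed.

Variable f : 'I_n -> R -> R.
Hypothesis tf : forall k, testR (f k).

Let h k := A2 c a k (f k).
Let th k : testR (h k). Proof. exact: test_A2. Qed.
Let ih k : rint mu pos (h k). Proof. exact: rint_test. Qed.
Let if_ k : rint mu pos (f k). Proof. exact: rint_test. Qed.
Let mh k : measurable_fun setT (h k). Proof. exact: meas_smooth (th k).1. Qed.
Let E k (s : R) := Et c a k (f k) (toC s).
Let Eh k s : Et c a k (h k) (toC s) = toC (oneDsqr s) * E k s.
Proof. by rewrite /h Et_A2//= -toCM -toC1 -toCD -expr2. Qed.

Let Eh0 k : Et c a k (h k) (- iC R) = 0.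
Proof.
by rewrite /h Et_A2//= ?CE ?lerN10// mulrNN iC2 addrN mul0r.
Qed.

Let P k l s := kquad c a c (Tvtx k l) (h k) (f l) (toC s).
Let P' k s := kquad c a (mfree c k) (Tvtx k k) (h k) (f k) (toC s).
Let Q k s := kquad c a (mfree c k) (Tfree k) (h k) (f k) (toC s).

Let P_int k l : rint mu setT (fun s => P k l s * cauchyd s) /\
  Rintegral mu setT (fun s => P k l s * cauchyd s) = 0.
Proof.
have [h1 h2] := double_poisson a c_gt0 c_ge0 (c_gt0 k) (meas_Tvtx k l) (@Tvtx_ge0 k l) (mh k) (ih k) (if_ l).
by split => //; rewrite h2 kquad_vtx// Eh0 !mul0r ReC0 mulr0.
Qed.

Let P'_int k : rint mu setT (fun s => P' k s * cauchyd s) /\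
  Rintegral mu setT (fun s => P' k s * cauchyd s) = 0.
Proof.
have [h1 h2] := double_poisson a c_gt0 (mfree_ge0 k) (mfree_gt0 k) (meas_Tvtx k k) (@Tvtx_ge0 k k) (mh k) (ih k) (if_ k).
by split => //; rewrite h2 kquad_vtx// Eh0 !mul0r ReC0 mulr0.
Qed.

(** The only contribution that survives at [- i]. By [Fr_A2], dividing by [2 c k xi] leaves
    [f + i A f], whose real part is [f]; the outer integral against [f] is the square norm. *)
Let Q_int k : rint mu setT (fun s => Q k s * cauchyd s) /\
  Rintegral mu setT (fun s => Q k s * cauchyd s) = pi * Rintegral mu pos (fun y => f k y ^+ 2).
Proof.
have [h1 h2] := double_poisson a c_gt0 (mfree_ge0 k) (mfree_gt0 k) (meas_Tfree k) (@Tfree_ge0 k) (mh k) (ih k) (if_ k).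
split => //; rewrite h2; congr (_ * _); apply: eq_Rintegral => y /set_mem y0.
rewrite inner_free// Fr_A2// ksum_free.
have x0 : xz k (- iC R) != 0 by apply: xiz_neq0_Im => //; rewrite !CE ltrN10.
have c0 : toC (c k) != 0 by rewrite toC_eq0 gt_eqF.
rewrite mulrAC mulfV ?mul1r; last by rewrite !mulf_neq0// toC2 toC_eq0.
by rewrite !CE expr2; ring.
Qed.

Let E_ (s : R) := \sum_(k < n) E k s.

(** The density [D] is recovered from the kernels [P], [Q] and [P']: on the real line [Q - P'] is
    the pure sine term, and the factor [1 + s^2] of the transform of [h] cancels [cauchyd]. The
    integrals of [P] and [P'] are 0 because the transform of [h] vanishes at [- i], so only [Q]
    counts. *)
Lemma spectral_identity :
  let D s := Re (E_ s ^+ 2 / ksum c a c (toC s)) +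
             \sum_(l < n) Im (E l s) ^+ 2 / (c l * Re (xz l (toC s))) in
  rint mu setT D /\
  Rintegral mu setT D = pi * \sum_(l < n) Rintegral mu pos (fun y => f l y ^+ 2).
Proof.
move=> D.
have DE : D = fun s => (\sum_(k < n) \sum_(l < n) P k l s * cauchyd s) +
    \sum_(k < n) (Q k s * cauchyd s - P' k s * cauchyd s).
  apply/funext => s.
  have o0 : oneDsqr s != 0 by rewrite gt_eqF// (lt_le_trans ltr01).
  have EE k r : Et c a k (f k) (toC r) = E k r by [].
  rewrite /D; congr (_ + _).
    under eq_bigr => k _.
      under eq_bigr => l _ do rewrite /P kquad_vtx// Eh EE.
      over.
    rewrite /E_ expr2 mulr_suml mulr_suml ReC_sum; apply: eq_bigr => k _.
    rewrite mulr_sumr mulr_suml ReC_sum; apply: eq_bigr => l _.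
    move: (E k s) (E l s) (ksum c a c (toC s)) => X Y Z.
    rewrite -!mulrA [in RHS]ReCM ReC_toC ImC_toC mul0r subr0.
    by rewrite [RHS]mulrC [RHS]mulrA /cauchyd mulVf// mul1r.
  apply: eq_bigr => k _; rewrite /Q kquad_free_real// -/(P' k s) Eh EE.
  rewrite ImCM ReC_toC ImC_toC mul0r addr0 mulrDl addrC addrA addNr add0r.
  rewrite /cauchyd.
  by rewrite expr2; move: (Im _) (c k * _)^-1 => X Y; field.
have i1 : rint mu setT (fun s => \sum_(k < n) \sum_(l < n) P k l s * cauchyd s).
  by apply: (@rint_sum _ _ _ mu) => // k; apply: (@rint_sum _ _ _ mu) => // l; case: (P_int k l).
have i2 k : rint mu setT (fun s => Q k s * cauchyd s - P' k s * cauchyd s).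
  by apply: rintB => //; [case: (Q_int k)|case: (P'_int k)].
have i3 : rint mu setT (fun s => \sum_(k < n) (Q k s * cauchyd s - P' k s * cauchyd s)).
  exact: rint_sum.
rewrite DE; split; first exact: rintD.
rewrite (@RintD _ _ _ mu)// (@Rint_sum _ _ _ mu)//; last first.
  by move=> k; apply: (@rint_sum _ _ _ mu) => // l; case: (P_int k l).
rewrite big1 ?add0r => [|k _]; last first.
  rewrite (@Rint_sum _ _ _ mu)// => [|l]; last by case: (P_int k l).
  by rewrite big1// => l _; case: (P_int k l).
rewrite (@Rint_sum _ _ _ mu)// mulr_sumr; apply: eq_bigr => k _.
have [q1 q2] := Q_int k; have [p1 p2] := P'_int k.
move: (Q k) (P' k) q1 q2 p1 p2 => q p q1 q2 p1 p2.
by rewrite (@RintB _ _ _ mu)// q2 p2 subr0.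
Qed.

End SpectralIdentity.

(** * The transform V on integrable functions *)

Section SpectralTransform.
Variable R : realType.
Local Notation C := (R[i]).
Local Notation Re := (@ReC R).
Local Notation Im := (@ImC R).
Local Notation mu := (@lebesgue_measure R).
Local Notation TR := (measurableTypeR R).
Local Notation pos := (@pos_half R : set TR).
Variables (n : nat) (c a : 'I_n -> R).
Hypothesis c_gt0 : forall k, 0 < c k.
Local Notation xz := (xiz c a).
Local Notation Et := (Et c a).

Let mpos : measurable pos := @measurable_pos_half R.

Lemma Re_xi_gt0 l s : a l < s -> 0 < Re (xz l (toC s)) /\ xz l (toC s) = toC (Re (xz l (toC s))).
Proof.
move=> als; rewrite xiz_real// /xi (ltW als) CE; split => //.
by rewrite sqrtr_gt0 divr_gt0// subr_gt0.
Qed.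

Lemma Re_xi_eq0 l s : s <= a l -> Re (xz l (toC s)) = 0.
Proof.
move=> sal; rewrite xiz_real// /xi; case: leP => h; last by rewrite !CE; ring.
have -> : s = a l by apply/eqP; rewrite eq_le sal h.
by rewrite subrr mul0r sqrtr0.
Qed.

Lemma Im_Et0 l s (f : R -> R) : s <= a l -> Im (Et l f (toC s)) = 0.
Proof.
move=> sal; have r0 := Re_xi_eq0 sal.
rewrite /Et cintE /cintD/=.
transitivity (Rintegral mu pos (fun=> 0)); last by rewrite /Rintegral integral0.
apply: eq_Rintegral => x _; rewrite -[LHS]/(Im (toC (f x) * ex (xz l (toC s)) x)).
rewrite ImCM ReC_toC ImC_toC mul0r addr0 /ex ImC_cexp.
have -> : Im (- iC R * xz l (toC s) * toC x) = 0 by rewrite !CE r0; ring.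
by rewrite sin0 !mulr0.
Qed.

Lemma ccos_toC (r : R) : ccos (toC r) = toC (cos r).
Proof.
have two : (2%:R : C) != 0 by rewrite toC2 toC_eq0.
have a1 : Re (iC R * toC r) = 0 by rewrite !CE; ring.
have a2 : Im (iC R * toC r) = r by rewrite !CE; ring.
apply: (mulIf two); rewrite /ccos mulfVK// toC2.
apply: C_ext.
  by rewrite ReCD !ReC_cexp ReCN ImCN a1 a2 cosN oppr0 expR0 !CE; ring.
by rewrite ImCD !ImC_cexp ReCN ImCN a1 a2 sinN oppr0 expR0 !CE; ring.
Qed.

Lemma csin_toC (r : R) : csin (toC r) = toC (sin r).
Proof.
have two : (2%:R * iC R : C) != 0.
  by rewrite mulf_neq0 ?toC2 ?toC_eq0// -cmod_gt0 cmod_iC.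
have a1 : Re (iC R * toC r) = 0 by rewrite !CE; ring.
have a2 : Im (iC R * toC r) = r by rewrite !CE; ring.
apply: (mulIf two); rewrite /csin mulfVK// toC2.
apply: C_ext.
  by rewrite ReCD ReCN !ReC_cexp ReCN ImCN a1 a2 cosN oppr0 expR0 !CE; ring.
by rewrite ImCD ImCN !ImC_cexp ReCN ImCN a1 a2 sinN oppr0 expR0 !CE; ring.
Qed.

Definition cal l s : R := c l * Re (xz l (toC s)).
Local Notation S s := (ksum c a c (toC s)).

Lemma wfunE s : wfun c a s = - iC R * S s.
Proof. by rewrite /wfun /ksum; congr (_ * _); apply: eq_bigr => k _; rewrite xiz_real. Qed.

(** On every edge the wave is the same exponential; only edge [l] receives an additional sine.
    Rewriting [s_l] through the full sum [S] shows its coefficient to be [w] over [c_l xi_l], up to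
    the sign hidden in [Im] of the exponential. *)
Lemma FmE l s k x : a l < s ->
  Fm c a l s k x = ex (xz k (toC s)) x +
    (if k == l then wfun c a s / toC (cal l s) * toC (Im (ex (xz l (toC s)) x)) else 0).
Proof.
move=> als; rewrite /Fm; case: eqVneq => [->|kl]; last by rewrite addr0 /ex xiz_real.
have [al0 xE] := Re_xi_gt0 als; rewrite -xiz_real// xE.
set al := Re _ in al0 xE *.
have a1 : Re (- iC R * toC al * toC x) = 0 by rewrite !CE; ring.
have a2 : Im (- iC R * toC al * toC x) = - (al * x) by rewrite !CE; ring.
have eE : ex (toC al) x = toC (cos (al * x)) - iC R * toC (sin (al * x)).
  apply: C_ext; first by rewrite /ex ReC_cexp a1 a2 expR0 cosN !CE; ring.
  by rewrite /ex ImC_cexp a1 a2 expR0 sinN !CE; ring.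
rewrite -toCM ccos_toC csin_toC eE.
have -> : Im (toC (cos (al * x)) - iC R * toC (sin (al * x))) = - sin (al * x) by rewrite !CE; ring.
have -> : Defs.sfun c a l s = - (S s - toC (c l) * toC al) / (toC (c l) * toC al).
  rewrite /Defs.sfun -xiz_real// xE; congr (- _ / _).
  rewrite /ksum [in RHS](bigD1 l)// xE [RHS]addrAC subrr add0r.
  by apply: eq_bigr => j _; rewrite xiz_real.
rewrite wfunE /cal xE ReC_toC toCM toCN.
have c0 : toC (c l) != 0 by rewrite toC_eq0 gt_eqF.
have l0 : toC al != 0 by rewrite toC_eq0 gt_eqF.
move: (S s) (toC (c l)) c0 (toC al) l0 (toC (cos _)) (toC (sin _)) => SS cc c0 aa l0 u v.
by field; rewrite c0 l0.
Qed.

(** V on real-valued functions. The first term is common to all [l]; the second is the sine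
    correction of the own edge. [Vc] extends it complex-linearly. *)
Definition Vr (f : 'I_n -> R -> R) (l : 'I_n) (s : R) : C :=
  (\sum_(k < n) Et k (f k) (toC s))^*%C +
  (wfun c a s)^*%C / toC (cal l s) * toC (Im (Et l (f l) (toC s))).

Definition Vc (f : 'I_n -> R -> C) (l : 'I_n) (s : R) : C :=
  Vr (fun k => Re \o f k) l s + iC R * Vr (fun k => Im \o f k) l s.

Lemma conjC_sum (I : Type) (r : seq I) (F : I -> C) :
  (\sum_(i <- r) F i)^*%C = \sum_(i <- r) (F i)^*%C.
Proof. by apply: (big_morph (@conjc R)) => [z z'|]; apply: C_ext; rewrite !CE ?oppr0//; ring. Qed.

Lemma cint_conj_ex (f : R -> R) k s : rint mu pos f ->
  cint (fun x => toC (f x) * (ex (xz k (toC s)) x)^*%C) = (Et k f (toC s))^*%C.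
Proof.
move=> hf; rewrite /Et !cintE -cintDJ//; last exact: crint_Et.
by apply: eq_cintD => x _; apply: C_ext; rewrite !CE; ring.
Qed.

Lemma VopE f l s : a l < s -> (forall k, crint pos (f k)) -> Vop c a f l s = Vc f l s.
Proof.
move=> als hf; rewrite /Vop.
have [al0 xE] := Re_xi_gt0 als.
set w := (wfun c a s)^*%C / toC (cal l s).
have sp (z v : C) : z * v = toC (Re z) * v + iC R * (toC (Im z) * v).
  by apply: C_ext; rewrite !CE; ring.
have e k : cint (fun x => f k x * (Fm c a l s k x)^*%C) =
   ((Et k (Re \o f k) (toC s))^*%C + iC R * (Et k (Im \o f k) (toC s))^*%C) +
   (if k == l then w * (toC (Im (Et l (Re \o f l) (toC s))) + iC R * toC (Im (Et l (Im \o f l) (toC s)))) else 0).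
  have [h1 h2] := hf k.
  pose e x := ex (xz k (toC s)) x.
  have ce (g : R -> R) : rint mu pos g -> crint pos (fun x => toC (g x) * (e x)^*%C).
    move=> hg; have [i1 i2] := crint_Et c a k (toC s) hg.
    have r1 (r : R) (z : C) : Re (toC r * z) = Re (toC r * z^*%C) by rewrite !CE; ring.
    have r2 (r : R) (z : C) : - Im (toC r * z) = Im (toC r * z^*%C) by rewrite !CE; ring.
    split; first by apply: (eq_rint mpos _ i1) => x _; exact: r1.
    by apply: (eq_rint mpos _ (rintN mpos i2)) => x _; exact: r2.
  have ci (g : R -> R) : rint mu pos g -> crint pos (fun x => toC (g x * Im (e x))).
    move=> hg; have hi := rint_Im_ex c a k (toC s) hg; split; first exact: hi.
    by rewrite /comp/=; exact: rint0.
  have mainE : cint (fun x => f k x * (e x)^*%C) =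
      (Et k (Re \o f k) (toC s))^*%C + iC R * (Et k (Im \o f k) (toC s))^*%C.
    rewrite -!cint_conj_ex// !cintE -cintDZ//; last exact: ce.
    rewrite -cintDD//; [|exact: ce|by apply: crintZ => //; exact: ce].
    by apply: eq_cintD => x _; exact: sp.
  have fce : crint pos (fun x => f k x * (e x)^*%C).
    apply: (eq_crint mpos _ (crintD mpos (ce _ h1) (crintZ (iC R) mpos (ce _ h2)))) => x _.
    exact/esym/sp.
  case: eqVneq => [kl|kl]; last first.
    rewrite addr0 -mainE; apply: eq_cint => x _.
    by rewrite FmE// (negbTE kl) addr0.
  subst k; rewrite -mainE.
  have iE (g : R -> R) : rint mu pos g -> toC (Im (Et l g (toC s))) = cintD pos (fun x => toC (g x * Im (e x))).
    move=> hg; rewrite -Im_Et//; apply: C_ext => //=.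
    by rewrite /comp/= /Rintegral integral0.
  pose A1 x := toC (Re (f l x) * Im (e x)).
  pose A2 x := toC (Im (f l x) * Im (e x)).
  have c1 : crint pos A1 := ci _ h1.
  have c2 : crint pos A2 := ci _ h2.
  have c2' : crint pos (fun x => iC R * A2 x) by exact: crintZ.
  have c12 : crint pos (fun x => A1 x + iC R * A2 x) by exact: crintD.
  have c3 : crint pos (fun x => w * (A1 x + iC R * A2 x)) by exact: crintZ.
  rewrite (iE _ h1) (iE _ h2) -/A1 -/A2.
  rewrite -(cintDZ (iC R) mpos c2) -(cintDD mpos c1 c2') -(cintDZ w mpos c12).
  rewrite !cintE -(cintDD mpos fce c3).
  apply: eq_cintD => x _; rewrite FmE// eqxx /w -/(e x).
  have cc (z : C) (r q : R) : (z / toC r * toC q)^*%C = z^*%C / toC r * toC q.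
    by apply: C_ext; rewrite !(CE, ReCV, ImCV) sqmod_toC; ring.
  rewrite rmorphD /= cc /A1 /A2 !toCM.
  have fin (F W i : C) : F * (W * i) = W * (toC (Re F) * i + iC R * (toC (Im F) * i)).
    by rewrite mulrCA -sp.
  by rewrite mulrDr; congr (_ + _); exact: fin.
under eq_bigr do rewrite e.
rewrite big_split -big_mkcond big_pred1_eq big_split -mulr_sumr /Vc /Vr.
have fin (A B v p q : C) : A + iC R * B + v * (p + iC R * q) = A + v * p + iC R * (B + v * q) by ring.
by rewrite -!conjC_sum; exact: fin.
Qed.

Section algebra.
Variables (f g : 'I_n -> R -> R) (s : R).

Let E := \sum_(k < n) Et k (f k) (toC s).
Let E' := \sum_(k < n) Et k (g k) (toC s).
Let T l := Im (Et l (f l) (toC s)).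
Let T' l := Im (Et l (g l) (toC s)).
Let w := wfun c a s.

Let ReS : Re (S s) = \sum_(l < n) cal l s.
Proof. by rewrite /ksum ReC_sum; apply: eq_bigr => l _; rewrite ReCM ReC_toC ImC_toC mul0r subr0. Qed.

Let cal_ge0 l : 0 <= cal l s.
Proof. by apply: mulr_ge0; [exact: ltW|exact: Re_csq_ge0]. Qed.

Let sqw : sqmod w = sqmod (S s).
Proof. by rewrite /w wfunE sqmodM sqmodN /sqmod !CE; ring. Qed.

(** [F] stands for [Re] or [Im], hence only real linearity is asked. Below the threshold both sides
    vanish: the density is 0 there, and so are [cal] and the imaginary parts [T]. *)
Let q_term (F : C -> R) l : (forall z z', F (z + z') = F z + F z') ->
  (forall (r : R) z, F (toC r * z) = r * F z) ->
  pi * qfun c a l s * F (Vr f l s * (Vr g l s)^*%C) =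
  cal l s * F (E^*%C * E') / sqmod w + T' l * F (E^*%C * w) / sqmod w
  + T l * F (w^*%C * E') / sqmod w + T l * T' l / cal l s * F 1.
Proof.
move=> FD FZ; rewrite /qfun; case: ltP => [als|sal]; last first.
  rewrite /T /T' !Im_Et0// /cal Re_xi_eq0//; ring.
have [al0 xE] := Re_xi_gt0 als.
have c0 : 0 < cal l s by rewrite mulr_gt0.
have w0 : sqmod w != 0.
  rewrite sqw sqmod_eq0; apply: contraTneq c0 => S0.
  have := ReS; rewrite S0 ReC0 (bigD1 l)//= => h.
  rewrite -leNgt [leRHS]h lerDl; exact: sumr_ge0.
rewrite -xiz_real// -/(cal l s).
have -> : Vr f l s * (Vr g l s)^*%C = E^*%C * E' + toC (T' l / cal l s) * (E^*%C * w)
    + toC (T l / cal l s) * (w^*%C * E') + toC (T l * T' l * ((cal l s)^-1 * (cal l s)^-1) * sqmod w) * 1.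
  rewrite /Vr -/E -/E' -/(T l) -/(T' l) -/w.
  have cinv (r : R) : (toC r)^-1 = toC r^-1.
    by apply: C_ext; rewrite ?ReCV ?ImCV sqmod_toC !CE ?mul0r ?oppr0//; have [->|r0] := eqVneq r 0; [rewrite invr0 mul0r|field].
  rewrite !cinv; move: (cal l s)^-1 (T l) (T' l) E E' w => r t t' e e' v.
  apply: C_ext; rewrite /sqmod !CE; ring.
rewrite !FD !FZ; move: (F (E^*%C * E')) (F (E^*%C * w)) (F (w^*%C * E')) (F 1) => x1 x2 x3 x4.
have p0 : pi != 0 :> R by rewrite gt_eqF// pi_gt0.
have c1 : cal l s != 0 by rewrite gt_eqF.
by rewrite -/w; move: (pi : R) p0 => p p0; field; rewrite p0 c1 w0.
Qed.

Let sumT : \sum_(l < n) T l = Im E. Proof. by rewrite /E ImC_sum. Qed.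
Let sumT' : \sum_(l < n) T' l = Im E'. Proof. by rewrite /E' ImC_sum. Qed.

Let q_sum (F : C -> R) : (forall z z', F (z + z') = F z + F z') ->
  (forall (r : R) z, F (toC r * z) = r * F z) ->
  pi * \sum_(l < n) qfun c a l s * F (Vr f l s * (Vr g l s)^*%C) =
  (Re (S s) * F (E^*%C * E') + Im E' * F (E^*%C * w) + Im E * F (w^*%C * E')) / sqmod (S s)
   + (\sum_(l < n) T l * T' l / cal l s) * F 1.
Proof.
move=> FD FZ; rewrite mulr_sumr -sqw.
under eq_bigr do rewrite mulrA q_term//.
by rewrite !big_split/= -!mulr_suml -ReS sumT sumT'; ring.
Qed.

(** Summing over [l] uses [sum cal = Re S] and [sum T = Im E]. As [w = - i S], the three terms over
    [|w|^2] recombine into one real part divided by [S], the expression met in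
    [spectral_identity]. *)
Lemma qsum_Re : pi * \sum_(l < n) qfun c a l s * Re (Vr f l s * (Vr g l s)^*%C) =
  Re (E * E' / S s) + \sum_(l < n) T l * T' l / cal l s.
Proof.
rewrite q_sum; last 2 first.
- by move=> z z'; rewrite CE.
- by move=> r z; rewrite !CE; ring.
rewrite ReC1 mulr1; congr (_ + _); rewrite /w wfunE.
rewrite [RHS]ReCM ReCV ImCV; move: (sqmod (S s))^-1 (S s) E E' => q x e e'.
by rewrite !CE; ring.
Qed.

(** The weighted form is real on real functions. This decouples the real and the imaginary part of a
    complex function, so that Parseval may be proved for each of them. *)
Lemma qsum_Im : \sum_(l < n) qfun c a l s * Im (Vr f l s * (Vr g l s)^*%C) = 0.
Proof.
have p0 : pi != 0 :> R by rewrite gt_eqF// pi_gt0.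
apply: (mulfI p0); rewrite q_sum; last 2 first.
- by move=> z z'; rewrite CE.
- by move=> r z; rewrite !CE; ring.
rewrite ImC1 mulr0 addr0 mulr0 /w wfunE; move: (sqmod (S s))^-1 (S s) E E' => q x e e'.
by rewrite !CE; ring.
Qed.
End algebra.

End SpectralTransform.

(** * Parseval for complex test functions *)

Section Parseval.
Variable R : realType.
Local Notation C := (R[i]).
Local Notation Re := (@ReC R).
Local Notation Im := (@ImC R).
Local Notation mu := (@lebesgue_measure R).
Local Notation TR := (measurableTypeR R).
Local Notation pos := (@pos_half R : set TR).
Variables (n : nat) (c a : 'I_n -> R).
Hypothesis c_gt0 : forall k, 0 < c k.
Local Notation xz := (xiz c a).
Local Notation Et := (Et c a).

Let mpos : measurable pos := @measurable_pos_half R.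

Definition nH (u : 'I_n -> R -> C) : \bar R :=
  (\sum_(k < n) \int[mu]_(x in @pos_half R) (sqmod (u k x))%:E)%E.
Definition nq (W : 'I_n -> R -> C) : \bar R :=
  (\sum_(k < n) \int[mu]_(x in `]a k, +oo[) (sqmod (W k x) * qfun c a k x)%:E)%E.

Lemma qfun_ge0 k s : 0 <= qfun c a k s.
Proof.
rewrite /qfun; case: ifP => // ak; have [r0 _] := Re_xi_gt0 c_gt0 ak.
rewrite -xiz_real// divr_ge0//; first by rewrite mulr_ge0// ltW.
by rewrite mulr_ge0 ?sqmod_ge0// pi_ge0.
Qed.

Lemma cmeas_Et k (f : R -> R) : rint mu pos f -> cmeas setT (fun s : TR => Et k f (toC s)).
Proof.
move=> hf.
have mp : measurable_fun setT (f \_ pos).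
  exact: ((measurable_restrictT f mpos).1 (rint_meas hf)).
pose H (p : TR * TR) : C := toC ((f \_ pos) p.1) * ex (xz k (toC p.2)) p.1.
have mH : cmeas setT H.
  apply: cmeasM.
    by apply: cmeas_toC; exact: (measurableT_comp mp measurable_fst).
  apply: cmeas_exp; apply: cmeasM; last by apply: cmeas_toC; exact: measurable_fst.
  apply: cmeasM; first exact: cmeas_cst.
  have [x1 x2] := cmeas_xiz c a k; split.
    exact: (measurableT_comp x1 measurable_snd).
  exact: (measurableT_comp x2 measurable_snd).
have := cint_cmeas_param mpos mH; congr cmeas; apply/funext => s.
rewrite /Et cintE; apply: eq_cintD => x x0.
by rewrite /H/= patchE mem_set.
Qed.

Lemma cmeas_xz k : cmeas setT (fun s : TR => xz k (toC s)).
Proof. exact: cmeas_xiz. Qed.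

Lemma meas_cal k : measurable_fun setT (fun s : TR => cal c a k s).
Proof. by apply: measurable_funM; [exact: measurable_cst|case: (cmeas_xz k)]. Qed.

Lemma cmeas_wfun : cmeas setT (fun s : TR => wfun c a s).
Proof.
have -> : (fun s : TR => wfun c a s) = fun s => - iC R * ksum c a c (toC s).
  by apply/funext => s; rewrite wfunE.
by apply: cmeasM; [exact: cmeas_cst|exact: cmeas_ksum].
Qed.

Lemma cmeas_Vr (f : 'I_n -> R -> R) k : (forall j, rint mu pos (f j)) -> cmeas setT (fun s : TR => Vr c a f k s).
Proof.
move=> hf; apply: cmeasD.
  by apply: cmeasJ; apply: cmeas_sum => j; exact: cmeas_Et.
apply: cmeasM; last by apply: cmeas_toC; case: (cmeas_Et k (hf k)).
apply: cmeasM; first by apply: cmeasJ; exact: cmeas_wfun.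
by apply: cmeasV; apply: cmeas_toC; exact: meas_cal.
Qed.

Lemma cmeas_Vc (g : 'I_n -> R -> C) k : (forall j, crint pos (g j)) -> cmeas setT (fun s : TR => Vc c a g k s).
Proof.
move=> hg; apply: cmeasD; first by apply: cmeas_Vr => j; case: (hg j).
by apply: cmeasM; [exact: cmeas_cst|apply: cmeas_Vr => j; case: (hg j)].
Qed.

Lemma meas_qfun k : measurable_fun setT (fun s : TR => qfun c a k s).
Proof.
have -> : (fun s : TR => qfun c a k s) = (fun s => \1_(`]a k, +oo[%classic) s * (cal c a k s / (pi * sqmod (wfun c a s)))).
  apply/funext => s; rewrite indicE /qfun /cal xiz_real//.
  case: ifPn => h; first by rewrite mem_set ?mul1r//= in_itv/= h.
  by rewrite memNset ?mul0r//= in_itv/= (negbTE h).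
apply: measurable_funM; first by apply: measurable_indic; exact: measurable_itv.
apply: measurable_funM; first exact: meas_cal.
apply: measurable_funV; apply: measurable_funM; first exact: measurable_cst.
by apply: meas_sqmod; exact: cmeas_wfun.
Qed.

Lemma nq_line (W : 'I_n -> R -> C) k :
  (\int[mu]_(x in `]a k, +oo[) (sqmod (W k x) * qfun c a k x)%:E =
   \int[mu]_x (sqmod (W k x) * qfun c a k x)%:E)%E.
Proof.
rewrite [LHS]integral_mkcond; apply: eq_integral => x _; rewrite patchE; case: ifPn => // xa.
rewrite /qfun ifF ?mulr0//; apply/negbTE; apply: contra xa => xa.
by rewrite mem_set//= in_itv/= xa.
Qed.

Lemma eq_nq (W Z : 'I_n -> R -> C) : (forall k s, a k < s -> W k s = Z k s) -> nq W = nq Z.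
Proof.
move=> WZ; apply: eq_bigr => k _; apply: eq_integral => s /set_mem/=.
by rewrite in_itv/= andbT => ks; rewrite WZ.
Qed.

Lemma crint_testC (g : R -> C) : testC g -> crint pos g.
Proof. by move=> [t1 t2]; split; exact: rint_test. Qed.

Lemma parseval (g : 'I_n -> R -> C) : (forall k, testC (g k)) -> nq (Vop c a g) = nH g.
Proof.
move=> tg; have ig k := crint_testC (tg k).
rewrite (@eq_nq _ (Vc c a g)); last by move=> k s ks; exact: VopE.
pose f1 k := Re \o g k; pose f2 k := Im \o g k.
have t1 k : testR (f1 k) by case: (tg k).
have t2 k : testR (f2 k) by case: (tg k).
have [i1 e1] := spectral_identity a c_gt0 t1.
have [i2 e2] := spectral_identity a c_gt0 t2.
have p0 : pi != 0 :> R by rewrite gt_eqF// pi_gt0.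
have qs f s : pi * \sum_(l < n) qfun c a l s * Re (Vr c a f l s * (Vr c a f l s)^*%C) =
    Re ((\sum_(k < n) Et k (f k) (toC s)) ^+ 2 / ksum c a c (toC s)) +
    \sum_(l < n) Im (Et l (f l) (toC s)) ^+ 2 / (c l * Re (xz l (toC s))).
  by rewrite qsum_Re// expr2; congr (_ + _); apply: eq_bigr => l _; rewrite expr2.
rewrite /nq; under eq_bigr do rewrite nq_line.
rewrite -ge0_integral_sum//; last 2 first.
- move=> k; apply/measurable_EFinP; apply: measurable_funM; last exact: meas_qfun.
  by apply: meas_sqmod; exact: cmeas_Vc.
- by move=> k s _; rewrite lee_fin mulr_ge0 ?sqmod_ge0 ?qfun_ge0.
under eq_integral => s _.
  have -> : (\sum_(k < n) (sqmod (Vc c a g k s) * qfun c a k s)%:E)%E =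
     (pi^-1 * ((Re ((\sum_(k < n) Et k (f1 k) (toC s)) ^+ 2 / ksum c a c (toC s)) +
             \sum_(l < n) Im (Et l (f1 l) (toC s)) ^+ 2 / (c l * Re (xz l (toC s)))) +
     (Re ((\sum_(k < n) Et k (f2 k) (toC s)) ^+ 2 / ksum c a c (toC s)) +
             \sum_(l < n) Im (Et l (f2 l) (toC s)) ^+ 2 / (c l * Re (xz l (toC s))))))%:E.
    rewrite sumEFin; congr EFin; apply: (mulfI p0); rewrite mulVKf// -!qs -mulrDr; congr (_ * _).
    have q0 := qsum_Im a c_gt0 f1 f2 s.
    rewrite -big_split/=.
    (* The cross terms of [|V f1 + i V f2|^2] are twice the imaginary parts of [V f1] times the
       conjugate of [V f2]. Their weighted sum is 0, so it may be added to match both sides term by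
       term. *)
    set B := RHS; have -> : B = B + 2 * \sum_(l < n) qfun c a l s * Im (Vr c a f1 l s * (Vr c a f2 l s)^*%C).
      by rewrite q0 mulr0 addr0.
    rewrite /B mulr_sumr -big_split/=.
    apply: eq_bigr => k _; rewrite /Vc -/f1 -/f2.
    move: (Vr c a f1 k s) (Vr c a f2 k s) (qfun c a k s) => z w q.
    by rewrite /sqmod !CE; ring.
  over.
rewrite (@rint_EFin _ _ _ mu)//; last by apply: rintZ => //; exact: rintD.
rewrite (@RintZ _ _ _ mu)//; last exact: rintD.
rewrite (@RintD _ _ _ mu)// e1 e2 -mulrDr mulKf//.
rewrite -big_split/= -sumEFin; apply: eq_bigr => k _.
have sq (f : R -> R) : testR f -> rint mu pos (fun x => f x ^+ 2).
  by move=> tf; rewrite /rint; under eq_fun do rewrite expr2; apply: rint_test; apply: testMs tf.1.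
rewrite -(@RintD _ _ _ mu)//; try exact: sq.
by rewrite -(@rint_EFin _ _ _ mu)//; apply: rintD => //; exact: sq.
Qed.

End Parseval.

(** * Test functions and square-integrable functions *)

Section Cutoff.
Variable R : realType.
Implicit Types f g h : R -> R.

Lemma smooth_comp_lin (k b : R) f : smoothR f -> smoothR (fun x => f (k * x + b)).
Proof.
move=> sf; apply: (smooth_coind (P := fun f => exists (q : R) g, smoothR g /\
  f = fun x => q * g (k * x + b))); last first.
  by exists 1, f; split => //; apply/funext => x; rewrite mul1r.
move=> _ [q [g [sg ->]]].
exists (fun x => (q * k) * derive1 g (k * x + b)); last first.
  by exists (q * k), (derive1 g); split => //; exact: smooth_derive1.
move=> x.
have hl : is_derive x 1 (k \*: id + cst b) (k *: 1 + 0).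
  by apply: is_deriveD; exact: is_deriveZ.
have h := is_deriveZ q (@is_derive1_comp _ g (k \*: id + cst b) x _ _ (smooth_is_derive _ sg) hl).
by apply: (is_derive_eq h); rewrite !fctE /= /GRing.scale/=; ring.
Qed.

Lemma smoothV f : smoothR f -> (forall x, f x != 0) -> smoothR (fun x => (f x)^-1).
Proof.
move=> sf f0; apply: (smooth_coind (P := fun h => exists (k : nat) g, smoothR g /\
  h = fun x => g x * (f x) ^- k)); last first.
  exists 1%N, (fun=> 1); split; first exact: smooth_cst.
  by apply/funext => x; rewrite mul1r expr1.
move=> _ [k [g [sg ->]]].
exists (fun x => (derive1 g x * f x + (- k%:R) * (g x * derive1 f x)) * (f x) ^- k.+1); last first.
  exists k.+1, (fun x => derive1 g x * f x + (- k%:R) * (g x * derive1 f x)); split => //.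
  apply: smoothD; first by apply: smoothM => //; exact: smooth_derive1.
  by apply: smoothZ; apply: smoothM => //; exact: smooth_derive1.
move=> x.
have fk : (f ^+ k) x != 0 by rewrite fctE /= expf_neq0.
have h := is_deriveM (smooth_is_derive x sg) (is_deriveV fk (is_deriveX k (smooth_is_derive x sf))).
have e : (fun x => g x * f x ^- k) = (g * (fun x => ((f ^+ k) x)^-1)).
  by apply/funext => y; rewrite !fctE.
rewrite e; apply: (is_derive_eq h).
rewrite /= !fctE /GRing.scale/= -mulr_natr.
case: k {fk h e} => [|k]; first by rewrite !expr0 expr1 mulr0n; field; exact: f0.
rewrite /= !exprS; have := f0 x; have := expf_neq0 k (f0 x); move: (f x) (f x ^+ k) => y z z0 y0.
by field; apply/andP.
Qed.

(** The family [p (1/x) exp (- 1/x)], extended by 0, is closed under derivation: [p] becomes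
    [X^2 (p - p')]. The case [p = 1] is the classical flat function. *)
Definition flat (p : {poly R}) (x : R) : R := if 0 < x then p.[x^-1] * expR (- x^-1) else 0.

(** With [y = m (y / m)] the quotient is the [m]-th power of [y exp (- y / m)], and
    [exp (y / m) >= y / m] bounds that by [m]. *)
Lemma powexp_le (m : nat) (y : R) : 0 < y -> y ^+ m * expR (- y) <= m%:R ^+ m.
Proof.
move=> y0; case: m => [|m].
  by rewrite !expr0 mul1r -[leRHS]expR0 ler_expR oppr_le0 ltW.
rewrite expRN ler_pdivrMr ?expR_gt0//.
have {2}-> : y = m.+1%:R * (y / m.+1%:R) by rewrite mulrC divfK// pnatr_eq0.
rewrite expRM_natl -exprMn.
apply: lerXn2r; rewrite ?nnegrE ?(ltW y0) ?mulr_ge0 ?expR_ge0//.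
rewrite -ler_pdivrMl ?ltr0n// mulrC (le_trans _ (expR_ge1Dx _))//.
by rewrite lerDr.
Qed.

Lemma polyexp_le (p : {poly R}) : exists K, forall y, 0 < y -> `|p.[y] * expR (- y)| <= K.
Proof.
exists (\sum_(i < size p) `|p`_i| * i%:R ^+ i) => y y0.
rewrite horner_coef mulr_suml (le_trans (ler_norm_sum _ _ _))// ler_sum// => i _.
rewrite -mulrA normrM ler_wpM2l// ger0_norm ?mulr_ge0 ?exprn_ge0 ?expR_ge0 ?(ltW y0)//.
exact: powexp_le.
Qed.

Lemma is_derive_flat0 f (K : R) : f 0 = 0 -> (forall x, `|f x| <= K * x ^+ 2) -> is_derive (0 : R) 1 f 0.
Proof.
move=> f0 fK.
have cv : h^-1 *: ((f \o shift 0) (h *: (1:R)) - f 0) @[h --> 0^'] --> (0 : R).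
  apply/cvgrPdist_le => e e0; near=> h.
  have h0 : h != 0 by near: h; exact: nbhs_dnbhs_neq.
  rewrite /= f0 subr0 sub0r normrN /GRing.scale/= mulr1 addr0 normrM normfV.
  rewrite ler_pdivrMl ?normr_gt0// (le_trans (fK _))//.
  rewrite -real_normK ?num_real// expr2 mulrA [leRHS]mulrC ler_wpM2r//.
  rewrite (le_trans (_ : _ <= (`|K| + 1) * `|h|))//.
    by rewrite ler_wpM2r// (le_trans (ler_norm _))// lerDl.
  rewrite -ler_pdivlMl; last by rewrite ltr_wpDl.
  near: h; apply: dnbhs0_le.
  by rewrite mulr_gt0// invr_gt0 ltr_wpDl.
by split; [apply/cvg_ex; exists 0; exact: cv|exact: (cvg_lim _ cv)].
Unshelve. all: by end_near. Qed.

Lemma smooth_flat p : smoothR (flat p).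
Proof.
apply: (smooth_coind (P := fun f => exists p, f = flat p)); last by exists p.
move=> _ [{}p ->].
exists (flat ('X ^+ 2 * (p - p^`()))); last by exists ('X ^+ 2 * (p - p^`())).
move=> x; have [x0|x0|->] := ltgtP x 0.
- have -> : flat ('X ^+ 2 * (p - p^`())) x = 0 by rewrite /flat ltNge ltW.
  apply: near_eq_is_derive (is_derive_cst 0 x 1).
  near=> y; rewrite /flat ifF//; apply/negbTE; rewrite -leNgt ltW//.
  by near: y; exact: lt_nbhsl.
- rewrite /flat x0.
  have xn0 : id x != 0 by rewrite gt_eqF.
  have hV := is_deriveV xn0 (is_derive_id x 1).
  have hp := @is_derive1_comp _ (horner p) (fun x => x^-1) x _ _ (is_derive_poly p _) hV.
  have he := @is_derive1_comp _ expR (- (fun x => x^-1)) x _ _ (is_derive_expR _) (is_deriveN hV).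
  have h := is_deriveM hp he.
  apply: near_eq_is_derive (is_derive_eq h _).
    near=> y; rewrite /= ifT//.
    by near: y; exact: lt_nbhsr.
  rewrite !fctE /= /GRing.scale/= !hornerE /=.
  by field.
- have -> : flat ('X ^+ 2 * (p - p^`())) 0 = 0 by rewrite /flat ltxx.
  have [K hK] := polyexp_le ('X ^+ 2 * p).
  have K0 : 0 <= K by apply: le_trans (hK 1 ltr01); exact: normr_ge0.
  apply: (@is_derive_flat0 _ K); first by rewrite /flat ltxx.
  move=> y; rewrite /flat; case: ifP => y0; last by rewrite normr0 mulr_ge0// sqr_ge0.
  have := hK y^-1; rewrite invr_gt0 y0 => /(_ isT).
  rewrite hornerM hornerXn -mulrA normrM (ger0_norm (sqr_ge0 _)).
  by rewrite exprVn mulrC ler_pdivrMr// exprn_gt0.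
Unshelve. all: by end_near. Qed.

Definition flate : R -> R := flat 1.

Lemma flate_ge0 x : 0 <= flate x.
Proof. by rewrite /flate /flat; case: ifP => // _; rewrite hornerE mul1r expR_ge0. Qed.
Lemma flate_gt0 x : 0 < x -> 0 < flate x.
Proof. by rewrite /flate /flat => ->; rewrite hornerE mul1r expR_gt0. Qed.
Lemma flate_eq0 x : x <= 0 -> flate x = 0.
Proof. by rewrite /flate /flat leNgt => /negbTE ->. Qed.

Definition sstep x : R := flate x / (flate x + flate (- x + 1)).

Lemma sstep_den x : 0 < flate x + flate (- x + 1).
Proof.
have [x0|x0] := ltP 0 x; first by rewrite ltr_wpDr ?flate_ge0 ?flate_gt0.
by rewrite ltr_wpDl ?flate_ge0// flate_gt0//; lra.
Qed.

Lemma smooth_sstep : smoothR sstep.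
Proof.
have s1 : smoothR flate by exact: smooth_flat.
apply: smoothM => //; apply: smoothV; last by move=> x; rewrite gt_eqF ?sstep_den.
apply: smoothD => //; have := @smooth_comp_lin (-1) 1 _ s1.
by congr smoothR; apply/funext => x; rewrite mulN1r.
Qed.

Lemma sstep0 x : x <= 0 -> sstep x = 0.
Proof. by move=> x0; rewrite /sstep (flate_eq0 x0) mul0r. Qed.

Lemma sstep1 x : 1 <= x -> sstep x = 1.
Proof.
move=> x1; rewrite /sstep (@flate_eq0 (- x + 1)); last by lra.
by rewrite addr0 divff// gt_eqF// flate_gt0//; lra.
Qed.

Lemma sstep_ge0 x : 0 <= sstep x.
Proof. by rewrite divr_ge0 ?flate_ge0 ?(ltW (sstep_den _)). Qed.

Lemma sstep_le1 x : sstep x <= 1.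
Proof. by rewrite ler_pdivrMr ?sstep_den// mul1r lerDl flate_ge0. Qed.

End Cutoff.

(** * Square-integrable functions: completeness and representation *)

Section SquareIntegrable.
Context d (T : measurableType d) (R : realType) (mu : {measure set T -> \bar R}).
Variable D : set T.
Hypothesis mD : measurable D.
Implicit Types (f g h : T -> R).

Lemma fatou_bound (f_ : (T -> R)^nat) f (K : \bar R) (N : nat) :
  (forall n, measurable_fun D (f_ n)) -> (forall n x, D x -> 0 <= f_ n x) ->
  (forall x, D x -> f_ ^~ x @ \oo --> f x) ->
  (forall n, (N <= n)%N -> (\int[mu]_(x in D) (f_ n x)%:E <= K)%E) ->
  (\int[mu]_(x in D) (f x)%:E <= K)%E.
Proof.
move=> mf f0 cf hK.
have := @fatou _ _ _ mu D mD (fun n x => (f_ n x)%:E).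
move=> /(_ (fun n => (measurable_EFinP _ _).2 (mf n))) /(_ (fun n x Dx => f0 n x Dx)) h.
have -> : (\int[mu]_(x in D) (f x)%:E = \int[mu]_(x in D) limn_einf (fun n => (f_ n x)%:E))%E.
  apply: eq_integral => x /set_mem Dx; apply/esym.
  have c : (f_ n x)%:E @[n --> \oo] --> (f x)%:E by apply/cvg_EFin; [exact: nearW|exact: cf].
  by have [-> _] := cvg_limn_einf_sup c.
apply: le_trans h _; rewrite limn_einf_lim; apply: lime_le; first exact: is_cvg_einfs.
near=> n; apply: le_trans (hK n _); last by near: n; exists N.
by apply: ereal_inf_lbound; exists n => /=.
Unshelve. all: by end_near. Qed.

Definition L2r f := measurable_fun D f /\ rint mu D (fun x => f x ^+ 2).
Definition ip f g := Rintegral mu D (fun x => f x * g x).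
Definition nsq f := Rintegral mu D (fun x => f x ^+ 2).

Lemma L2r_mul f g : L2r f -> L2r g -> rint mu D (fun x => f x * g x).
Proof.
move=> [mf f2] [mg g2]; apply: (rint_le mD _ (rintD mD f2 g2)); first exact: measurable_funM.
move=> x _; have := sqr_ge0 (f x - g x); have := sqr_ge0 (f x + g x).
by rewrite ler_norml !expr2 => *; apply/andP; split; nra.
Qed.

Lemma L2rZ k f : L2r f -> L2r (fun x => k * f x).
Proof.
move=> [mf f2]; split; first exact: measurable_funM.
by under eq_fun do rewrite exprMn; exact: rintZ.
Qed.

Lemma L2rD f g : L2r f -> L2r g -> L2r (fun x => f x + g x).
Proof.
move=> hf hg; split; first by apply: measurable_funD; [exact: hf.1|exact: hg.1].
have -> : (fun x => (f x + g x) ^+ 2) = (fun x => (f x ^+ 2 + 2 * (f x * g x)) + g x ^+ 2).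
  by apply/funext => x; ring.
by apply: rintD => //; [apply: rintD => //; [exact: hf.2|apply: rintZ => //; exact: L2r_mul]|exact: hg.2].
Qed.

Lemma L2rB f g : L2r f -> L2r g -> L2r (fun x => f x - g x).
Proof.
move=> hf hg; have -> : (fun x => f x - g x) = (fun x => f x + (-1) * g x).
  by apply/funext => x; rewrite mulN1r.
by apply: L2rD => //; exact: L2rZ.
Qed.

Lemma nsq_ge0 f : 0 <= nsq f.
Proof. by apply: Rintegral_ge0 => x _; exact: sqr_ge0. Qed.

Lemma nsqE f : L2r f -> (\int[mu]_(x in D) (f x ^+ 2)%:E)%E = (nsq f)%:E.
Proof. by move=> [_ h]; rewrite (@rint_EFin _ _ _ mu). Qed.

Lemma L2rP f (K : R) : measurable_fun D f -> (\int[mu]_(x in D) (f x ^+ 2)%:E <= K%:E)%E ->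
  L2r f /\ nsq f <= K.
Proof.
move=> mf h; have hf : L2r f.
  split=> //; apply/integrableP; split; first by apply/measurable_EFinP; exact: measurable_funX.
  under eq_integral do rewrite /= ger0_norm ?sqr_ge0//.
  by apply: le_lt_trans h _; rewrite ltry.
by split=> //; rewrite -lee_fin -nsqE.
Qed.

Lemma ipC f g : ip f g = ip g f.
Proof. by apply: eq_Rintegral => x _; rewrite mulrC. Qed.

Lemma ipDl f g h : L2r f -> L2r g -> L2r h -> ip (fun x => f x + g x) h = ip f h + ip g h.
Proof.
move=> hf hg hh; rewrite /ip -(@RintD _ _ _ mu)//; try exact: L2r_mul.
by apply: eq_Rintegral => x _; rewrite mulrDl.
Qed.

Lemma ipZl k f h : L2r f -> L2r h -> ip (fun x => k * f x) h = k * ip f h.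
Proof.
move=> hf hh; rewrite /ip -(@RintZ _ _ _ mu)//; try exact: L2r_mul.
by apply: eq_Rintegral => x _; rewrite mulrA.
Qed.

Lemma nsqD f g k : L2r f -> L2r g ->
  nsq (fun x => f x + k * g x) = nsq f + 2 * k * ip f g + k ^+ 2 * nsq g.
Proof.
move=> hf hg; rewrite /nsq.
have -> : (fun x => (f x + k * g x) ^+ 2) =
   (fun x => (f x ^+ 2 + (2 * k) * (f x * g x)) + k ^+ 2 * g x ^+ 2).
  by apply/funext => x; ring.
rewrite !(@RintD _ _ _ mu)//; try exact: hf.2; try (apply: rintZ => //; first [exact: L2r_mul|exact: hg.2]).
  by rewrite !(@RintZ _ _ _ mu)//; [exact: hg.2|exact: L2r_mul].
by apply: rintD => //; [exact: hf.2|apply: rintZ => //; exact: L2r_mul].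
Qed.

Lemma ip_le f g s : 0 < s -> L2r f -> L2r g -> 2 * `|ip f g| <= s * nsq f + s^-1 * nsq g.
Proof.
move=> s0 hf hg.
have s1 : s * s^-1 = 1 by rewrite divff// gt_eqF.
have h k : k ^+ 2 = 1 -> 0 <= s * nsq f + 2 * k * ip f g + s^-1 * nsq g.
  move=> k2; have := nsq_ge0 (fun x => f x + (k / s) * g x); rewrite nsqD// => h.
  have := mulr_ge0 (ltW s0) h; rewrite !mulrDr; congr (_ <= _).
  have -> : s * ((k / s) ^+ 2 * nsq g) = k ^+ 2 * (s * s^-1) * s^-1 * nsq g by ring.
  have -> : s * (2 * (k / s) * ip f g) = (s * s^-1) * 2 * k * ip f g by ring.
  by rewrite k2 s1 !mul1r.
have h1 := h 1 (expr1n _ 2); have := h (-1); rewrite sqrrN expr1n => /(_ erefl) h2.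
by case: (ger0P (ip f g)) => _; lra.
Qed.

Section completeness.
Variables (phi : (T -> R)^nat).
Hypothesis hphi : forall m, L2r (phi m).
Hypothesis cauchy : forall m l, (m <= l)%N -> nsq (fun x => phi l x - phi m x) <= 4^-1 ^+ m.

Let dif m x := phi m.+1 x - phi m x.

(** The weights [2^m] lie between two requirements: the decay [4^-m] still makes the sum integrable,
    and finiteness of the sum at a point forces the increments to be absolutely summable there. *)
Let S x := (\sum_(0 <= m <oo) (2 ^+ m * dif m x ^+ 2)%:E)%E.

Let Sfin : {ae mu, forall x, D x -> S x \is a fin_num}.
Proof.
apply: integrable_ae => //; apply/integrableP.
have md m : measurable_fun D (fun x => (2 ^+ m * dif m x ^+ 2)%:E).
  apply/measurable_EFinP; apply: measurable_funM => //; apply: measurable_funX.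
  by apply: measurable_funB; [exact: (hphi _).1|exact: (hphi _).1].
have d0 m x : (0 <= (2 ^+ m * dif m x ^+ 2)%:E)%E by rewrite lee_fin mulr_ge0 ?sqr_ge0 ?exprn_ge0.
split; first by apply: ge0_emeasurable_sum.
rewrite (@eq_integral _ _ _ mu D S); last by move=> x _; rewrite gee0_abs// nneseries_ge0.
rewrite /S integral_nneseries//.
apply: (@le_lt_trans _ _ (\sum_(0 <= m <oo) ((2^-1 ^+ m)%:E : \bar R)))%E.
  apply: lee_nneseries => m _; first by move=> _; apply: integral_ge0.
  under eq_integral do rewrite EFinM.
  rewrite ge0_integralZl//; last 2 first.
  - apply/measurable_EFinP; apply: measurable_funX.
    by apply: measurable_funB; [exact: (hphi _).1|exact: (hphi _).1].
  - by move=> x _; rewrite lee_fin sqr_ge0.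
  rewrite nsqE; last exact: L2rB.
  rewrite -EFinM lee_fin (le_trans (ler_wpM2l _ (cauchy (leqnSn m))))//.
  by rewrite -exprMn (_ : 2 * 4^-1 = 2^-1)//; field.
have h := @cvg_geometric_series R 1 2^-1.
rewrite (_ : (\sum_(0 <= m <oo) _)%E = (1 / (1 - 2^-1))%:E) ?ltry//.
apply/cvg_lim => //.
have -> : (fun n => \sum_(0 <= i < n) (2^-1 ^+ i)%:E)%E = EFin \o series (geometric 1 (2^-1 : R)).
  apply/funext => n; rewrite /= /series/= sumEFin; congr EFin.
  by apply: eq_bigr => i _; rewrite mul1r.
by apply/cvg_EFin; [exact: nearW|apply: h; rewrite ger0_norm//; lra].
Qed.

Let cvg_at x : S x \is a fin_num -> cvgn (phi ^~ x).
Proof.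
move=> Sx.
have c1 : cvgn (series (fun m => 2 ^+ m * dif m x ^+ 2)).
  apply: nondecreasing_is_cvgn.
    by apply: nondecreasing_series => n _ _; rewrite mulr_ge0 ?sqr_ge0 ?exprn_ge0.
  exists (fine (S x)) => _ [n _ <-]; rewrite -lee_fin fineK// /series/= -sumEFin.
  by apply: nneseries_lim_ge => m _ _; rewrite lee_fin mulr_ge0 ?sqr_ge0 ?exprn_ge0.
have c2 : cvgn (series (dif ^~ x)).
  apply: normed_cvg.
  (* The inequality [y <= 2^-m + 2^m y^2] turns weighted square summability into absolute
     summability. *)
  apply: (@series_le_cvg _ _ (fun m => geometric 1 2^-1 m + 2 ^+ m * dif m x ^+ 2)).
  - by move=> m; exact: normr_ge0.
  - by move=> m; rewrite /= mul1r addr_ge0 ?exprn_ge0 ?invr_ge0// mulr_ge0 ?sqr_ge0 ?exprn_ge0.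
  - move=> m /=; rewrite mul1r exprVn.
    have p0 : 0 < (2 : R) ^+ m by rewrite exprn_gt0.
    move: (2 ^+ m) p0 => p p0; have := mulVf (lt0r_neq0 p0).
    have : 0 < p^-1 by rewrite invr_gt0.
    rewrite -[dif m x ^+ 2]real_normK ?num_real//.
    move: (p^-1) `|dif m x| (normr_ge0 (dif m x)) => q y y0 q0 qp.
    have h : p * (q + p * y ^+ 2 - y) = (p * y - 1) ^+ 2 + p * y + (q * p - 1) by ring.
    rewrite -subr_ge0 -(pmulr_rge0 _ p0) h qp subrr addr0.
    by rewrite addr_ge0 ?sqr_ge0// mulr_ge0// ltW.
  - rewrite seriesD; apply: is_cvgD => //.
    by apply: is_cvg_geometric_series; rewrite ger0_norm//; lra.
have c3 : cvgn (fun n => series (telescope (phi ^~ x)) n + phi 0%N x).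
  by apply: is_cvgD; [exact: c2|exact: is_cvg_cst].
by move: c3; rewrite telescopeK; under eq_fun do rewrite subrK.
Qed.

Lemma L2r_complete : exists2 g, L2r g & forall m, nsq (fun x => g x - phi m x) <= 4^-1 ^+ m.
Proof.
have [A [mA A0 hA]] := Sfin.
have cvA x : D x -> ~ A x -> cvgn (phi ^~ x).
  by move=> Dx Ax; apply: cvg_at; apply: contrapT => h; apply: Ax; apply: hA => /= h'; apply: h; exact: h'.
(* Resetting the sequence to 0 on the exceptional null set makes it converge everywhere on [D], so
   its pointwise limit is measurable. *)
pose psi m x := phi m x * \1_(~` A) x.
have mpsi m : measurable_fun D (psi m).
  apply: measurable_funM; first exact: (hphi _).1.
  by apply: measurable_funTS; apply: measurable_indic; exact: measurableC.
pose g x := limn (psi ^~ x).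
have cg x : D x -> psi ^~ x @ \oo --> g x.
  move=> Dx; suff : cvgn (psi ^~ x) by [].
  rewrite /psi indicE; have [/set_mem Ax|_] := boolP (x \in ~` A).
    by apply: is_cvgM; [exact: cvA|exact: is_cvg_cst].
  by under eq_fun do rewrite mulr0; exact: is_cvg_cst.
have mg : measurable_fun D g by apply: measurable_fun_cvg cg.
have mpB m l : measurable_fun D (fun x => (psi l x - phi m x) ^+ 2).
  by apply: measurable_funX; apply: measurable_funB => //; exact: (hphi _).1.
have bd m : (\int[mu]_(x in D) ((g x - phi m x) ^+ 2)%:E <= (4^-1 ^+ m)%:E)%E.
  apply: (@fatou_bound (fun l x => (psi l x - phi m x) ^+ 2) _ _ m) => //.
  - by move=> n x _; exact: sqr_ge0.
  - move=> x Dx; have c : psi n x - phi m x @[n --> \oo] --> g x - phi m x.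
      by apply: cvgB; [exact: cg|exact: cvg_cst].
    by rewrite expr2; under eq_fun do rewrite expr2; exact: cvgM.
  move=> l ml.
  rewrite (@ae_eq_integral _ _ _ _ _ (fun x => ((phi l x - phi m x) ^+ 2)%:E))//.
  - by rewrite nsqE ?lee_fin ?cauchy//; exact: L2rB.
  - exact/measurable_EFinP.
  - apply/measurable_EFinP; apply: measurable_funX; apply: measurable_funB; exact: (hphi _).1.
  exists A; split => //; apply: subset_trans (_ : ~` (~` A) `<=` _); last by rewrite setCK.
  by apply: subsetC => x Ax /= Dx; rewrite /psi indicE mem_set// mulr1.
have mB m : measurable_fun D (fun x => g x - phi m x).
  by apply: measurable_funB => //; exact: (hphi _).1.
exists g; last by move=> m; have [] := L2rP (mB m) (bd m).
have [h _] := L2rP (mB 0%N) (bd 0%N).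
have -> : g = (fun x => (g x - phi 0%N x) + phi 0%N x) by apply/funext => x; rewrite subrK.
exact: L2rD.
Qed.
End completeness.

(* Maximizing the concave functional [2 * l f - nsq f] over the space P represents l on P
   by an element of the closure of P. *)
Lemma riesz (P : (T -> R) -> Prop) (l : (T -> R) -> R) (M : R) :
  (forall f, P f -> L2r f) -> P (fun=> 0) -> (forall f g k, P f -> P g -> P (fun x => f x + k * g x)) ->
  (forall f g k, P f -> P g -> l (fun x => f x + k * g x) = l f + k * l g) ->
  (forall f, P f -> 2 * l f - nsq f <= M) ->
  exists2 g, L2r g & (forall f, P f -> l f = ip g f) /\
    exists2 phi : (T -> R)^nat, (forall m, P (phi m)) &
      forall m, nsq (fun x => g x - phi m x) <= 4^-1 ^+ m.
Proof.
move=> PL P0 PD lD JM.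
pose J f := 2 * l f - nsq f.
pose A := [set J f | f in P].
have hsA : has_sup A.
  by split; [exists (J (fun=> 0)); exists (fun=> 0)|exists M => _ [f Pf <-]; exact: JM].
pose s := sup A.
have Js f : P f -> J f <= s by move=> Pf; apply: sup_upper_bound => //; exists f.
(* Near-maximizers form a Cauchy sequence by comparison with their midpoint: its value exceeds the
   mean of the two values by a quarter of the squared distance. A defect below [4^-m / 8] keeps that
   distance under [4^-m]. *)
pose e m : R := 8^-1 * 4^-1 ^+ m.
have e0 m : 0 < e m by rewrite mulr_gt0// exprn_gt0.
have /choice[phi hphi] : forall m, exists f, P f /\ s - e m < J f.
  by move=> m; have [_ [f Pf <-] h] := sup_adherent (e0 m) hsA; exists f.
have Pphi m : P (phi m) by case: (hphi m).
have lZ k f : P f -> l (fun x => 0 + k * f x) = k * l f.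
  move=> Pf; rewrite lD//; suff -> : l (fun=> 0) = 0 by rewrite add0r.
  have := lD _ _ 1 P0 P0; under [in LHS]eq_fun do rewrite mulr0 addr0.
  by rewrite mul1r => /eqP; rewrite -subr_eq subrr eq_sym => /eqP.
have JD f g k : P f -> P g ->
    J (fun x => f x + k * g x) = J f + 2 * k * (l g - ip f g) - k ^+ 2 * nsq g.
  by move=> Pf Pg; rewrite /J lD// nsqD; [ring|exact: PL|exact: PL].
have cau m k : (m <= k)%N -> nsq (fun x => phi k x - phi m x) <= 4^-1 ^+ m.
  move=> mk; pose h x := phi k x + (-1) * phi m x.
  have Ph : P h by exact: PD.
  have -> : (fun x => phi k x - phi m x) = h by apply/funext => x; rewrite /h mulN1r.
  have := Js _ (PD _ _ 2^-1 (Pphi m) Ph).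
  have hk : J (phi k) = J (fun x => phi m x + 1 * h x).
    by congr J; apply/funext => x; rewrite /h; ring.
  rewrite JD// in hk; rewrite JD// (_ : 2^-1 ^+ 2 = 4^-1 :> R); last by field.
  rewrite expr1n !mulr1 mul1r divff// mul1r in hk *.
  have [_ h1] := hphi m; have [_ h2] := hphi k.
  have ek : e k <= e m.
    by rewrite ler_wpM2l// ler_wiXn2l//; lra.
  have : e m = 8^-1 * 4^-1 ^+ m by [].
  have e0m := e0 m; clear Js hphi; move: e0m hk h1 h2 ek; move: (4^-1 ^+ m) (nsq h) (l h - ip _ h) (e m) (e k) (J _) (J _) s => *; lra.
have Lphi m := PL _ (Pphi m).
have [g Lg gphi] := L2r_complete Lphi cau.
exists g => //; split; last by exists phi.
move=> f Pf; have Lf := PL _ Pf.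
have N0 := nsq_ge0 f.
(* First variation at the supremum in direction [t f], passed to the limit [phi m -> g]; the error,
   a multiple of [4^-m], falls below any [dl]. *)
have key t : 2 * t * (l f - ip g f) <= 2 * t ^+ 2 * nsq f.
  apply/ler_addgt0Pl => dl dl0.
  have [m hm] : exists m, 4^-1 ^+ m * 2 < dl :> R.
    have : 4^-1 ^+ m * 2 @[m --> \oo] --> (0 * 2 : R).
      by apply: cvgMl; apply: cvg_expr; rewrite ger0_norm//; lra.
    rewrite mul0r => /cvgr_lt /(_ _ dl0) [N _ hN]; exists N.
    exact: hN (leqnn N).
  have := Js _ (PD _ _ t (Pphi m) Pf); rewrite JD//.
  have [_] := hphi m; rewrite /e.
  have ipE : ip (fun x => g x - phi m x) f = ip g f - ip (phi m) f.
    have -> : (fun x => g x - phi m x) = (fun x => g x + (-1) * phi m x).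
      by apply/funext => x; rewrite mulN1r.
    by rewrite ipDl ?ipZl//; [rewrite mulN1r|exact: L2rZ].
  have := nsq_ge0 (fun x => (g x - phi m x) + t * f x); rewrite nsqD//; last exact: L2rB.
  rewrite ipE; have := gphi m.
  have p0 : 0 < (4^-1 : R) ^+ m by rewrite exprn_gt0.
  by move: (4^-1 ^+ m) p0 hm (nsq f) (J _) (nsq (fun x => g x - phi m x)) => *; lra.
have N1 : 0 < nsq f + 1 by lra.
(* The quadratic bound is of second order in [t], the left side of first order. For this [t],
   written [r] below, it reads [2 r^2 (N + 1) <= 2 r^2 N], hence [r = 0]; adding 1 avoids dividing
   by a zero norm. *)
have := key ((l f - ip g f) / (nsq f + 1)).
move: (l f) (ip g f) (nsq f) N0 N1 => p q N N0 N1 h.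
have /mulfVK h1 : N + 1 != 0 by rewrite gt_eqF.
apply/eqP; rewrite -subr_eq0 -sqrf_eq0 eq_le sqr_ge0 andbT.
move: h; set r := (p - q) / (N + 1) => h.
have rE : p - q = r * (N + 1) by rewrite h1.
rewrite rE in h *; have hr := sqr_ge0 r.
have : r ^+ 2 <= 0 by move: h; rewrite !expr2 in hr *; nra.
by move=> r0; rewrite exprMn mulr_le0_ge0// sqr_ge0.
Qed.
End SquareIntegrable.

(** * Density of test functions *)

Section TestDensity.
Variable R : realType.
Local Notation mu := (@lebesgue_measure R).
Local Notation TR := (measurableTypeR R).
Local Notation pos := (@pos_half R : set TR).
Implicit Types (f g h : R -> R).

Let mpos : measurable pos := @measurable_pos_half R.

Lemma test_plateau (x X : R) : 0 < x -> x < X -> exists2 phi : nat -> R -> R,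
  (forall m, testR (phi m) /\ forall y, X <= y -> phi m y = 0) &
  (forall m y, `|phi m y| <= 1) /\
  forall y, 0 < y -> (fun m => phi m y) @ \oo --> ((y <= x)%R%:R : R).
Proof.
move=> x0 xX.
have [N _ hN] : \forall m \near \oo, (X - x)^-1 <= m%:R :> R.
  by apply: nbhs_infty_ger; exact: num_real.
pose k m : R := (m + N).+1%:R.
have k0 m : 0 < k m by rewrite ltr0n.
have kX m : (X - x)^-1 <= k m by apply: hN; rewrite /= leqW// leq_addl.
have kb m : 1 <= k m * (X - x).
  by have := kX m; rewrite -[_^-1]mul1r ler_pdivrMr ?subr_gt0.
exists (fun m y => sstep (k m * y + (-1)) * sstep (- k m * y + (k m * x + 1))).
  move=> m; split.
    split.
      by apply: smoothM; apply: smooth_comp_lin; exact: smooth_sstep.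
    exists (k m)^-1, (x + (k m)^-1); split; first by rewrite invr_gt0.
    have kk : k m * (k m)^-1 = 1 by rewrite divff// gt_eqF.
    move=> y [hy|hy].
      rewrite sstep0 ?mul0r//.
      by move: hy; rewrite -(ltr_pM2l (k0 m)) kk; lra.
    rewrite (@sstep0 _ (- k m * y + _)) ?mulr0//.
    by move: hy; rewrite -(ltr_pM2l (k0 m)) mulrDr kk; lra.
  move=> y hy; rewrite (@sstep0 _ (- k m * y + _)) ?mulr0//.
  by have := kb m; have := ler_wpM2l (ltW (k0 m)) hy; lra.
split.
  move=> m y; rewrite ger0_norm; last by apply: mulr_ge0; exact: sstep_ge0.
  by apply: mulr_ile1; first [exact: sstep_ge0|exact: sstep_le1].
move=> y y0; apply: cvg_near_cst.
have [K _ hK] : \forall m \near \oo, 2 * y^-1 <= m%:R :> R.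
  by apply: nbhs_infty_ger; exact: num_real.
have hk1 m : (K <= m)%N -> 2 <= k m * y.
  move=> Km; have : 2 * y^-1 <= k m by apply: hK; rewrite /= leqW// (leq_trans Km)// leq_addr.
  by rewrite ler_pdivrMr.
have [yx|yx] := leP y x.
  exists K => // m Km; rewrite /= !sstep1 ?mulr1//; last by have := hk1 m Km; lra.
  by have := ler_wpM2l (ltW (k0 m)) yx; lra.
have [L _ hL] : \forall m \near \oo, (y - x)^-1 <= m%:R :> R.
  by apply: nbhs_infty_ger; exact: num_real.
exists L => // m Lm; rewrite /= (@sstep0 _ (- k m * y + _)) ?mulr0//.
have : (y - x)^-1 <= k m by apply: hL; rewrite /= leqW// (leq_trans Lm)// leq_addr.
by rewrite -[_^-1]mul1r ler_pdivrMr ?subr_gt0//; lra.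
Qed.

(** Plateau functions approximate the indicator of []0, x]] boundedly, so every integral of [h] over
    such an interval is 0. Lebesgue differentiation of this constant primitive gives [h = 0] almost
    everywhere. *)
Lemma fundamental_lemma h (X : R) : rint mu `]0, X[ h ->
  (forall phi, testR phi -> (forall y, X <= y -> phi y = 0) ->
    Rintegral mu `]0, X[ (fun x => h x * phi x) = 0) ->
  {ae mu, forall x, 0 < x < X -> h x = 0}.
Proof.
move=> hi hphi.
pose f := h \_ (`]0, X[%classic).
have mX : measurable (`]0, X[%classic : set TR) by [].
have fi : rint mu setT f := (rint_mkcond mu h mX).1 hi.
have mh := rint_meas hi.
have F0 x : x < X -> Rintegral mu `]-oo, x] f = 0.
  move=> xX; have [x0|x0] := leP x 0.
    rewrite /Rintegral integral0_eq// => y /=; rewrite in_itv/= => yx; congr EFin.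
    rewrite /f patchE; case: ifPn => // /set_mem/=.
    by rewrite in_itv/= => /andP[]; lra.
  have [phi tphi [phi1 cphi]] := test_plateau x0 xX.
  pose hl (y : R) : R := h y * (y <= x)%R%:R.
  have mhl : measurable_fun (`]0, X[%classic : set TR) hl.
    apply: measurable_funM => //.
    rewrite (_ : (fun y => _) = \1_(`]-oo, x]%classic : set TR)); last first.
      apply/funext => y; rewrite indicE; congr (nat_of_bool _)%:R.
      by apply/idP/idP => [yx|/set_mem/=]; [apply/mem_set; rewrite /= in_itv|rewrite in_itv].
    exact: measurable_funTS.
  have mp m : measurable_fun (`]0, X[%classic : set TR) (fun y => h y * phi m y).
    by apply: measurable_funM => //; apply: measurable_funTS; apply: meas_smooth; exact: (tphi m).1.1.
  have cv : {ae mu, forall y, (`]0, X[%classic : set TR) y -> (fun m => h y * phi m y) @ \oo --> hl y}.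
    apply: aeW => y /=; rewrite in_itv/= => /andP[y0 _].
    by apply: cvgM; [exact: cvg_cst|exact: cphi].
  have le : {ae mu, forall y m, (`]0, X[%classic : set TR) y -> `|h y * phi m y| <= `|h y|}.
    by apply: aeW => y m _; rewrite normrM ler_piMr.
  have [_] := @Rdct _ _ _ mu _ (fun m y => h y * phi m y) hl (fun y => `|h y|) mX mp mhl cv
    (rint_norm mX hi) le.
  have E : (fun m => Rintegral mu `]0, X[ (fun y => h y * phi m y)) = fun=> 0.
    by apply/funext => m; apply: hphi; [exact: (tphi m).1|exact: (tphi m).2].
  rewrite E => /(cvg_lim (@Rhausdorff R)); rewrite lim_cst// => /esym hl0.
  rewrite -[RHS]hl0 Rintegral_mkcond [RHS]Rintegral_mkcond; apply: eq_Rintegral => y _.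
  rewrite /f !patchE; case: ifPn => [/set_mem/=|]; rewrite ?in_itv/= => yx.
    by case: ifP => // _; rewrite /hl yx mulr1.
  case: ifP => // _; rewrite /hl; case: leP => yx'; last by rewrite mulr0.
  by case/negP: yx; apply/mem_set; rewrite /= in_itv.
have fiy y : mu.-integrable `]-oo, y] (EFin \o f).
  by apply: (@integrableS _ _ _ mu (setT : set TR)) => //; exact: measurable_itv.
have fl : locally_integrable setT f by apply: integrable_locally => //; exact: fi.
have := @FTC1Ny R f fiy fl; apply: filterS; first exact: (ae_filter_ringOfSetsType mu).
move=> x [_ dF] /andP[x0 xX].
have -> : h x = f x by rewrite /f patchE mem_set//= in_itv/= x0.
rewrite -dF; apply: is_derive_derive1; apply: near_eq_is_derive (is_derive_cst 0 x 1).
by near=> y; rewrite F0//; near: y; exact: lt_nbhsl.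
Unshelve. all: by end_near. Qed.

Section dense.
Variable X : R.
Local Notation D := (`]0, X[%classic : set TR).

Let mD : measurable D. Proof. by []. Qed.

Let posD : D `<=` pos.
Proof. by move=> x /=; rewrite in_itv/= => /andP[]. Qed.

Lemma rint_trunc f : (forall x, X <= x -> f x = 0) -> rint mu D f <-> rint mu pos f.
Proof.
move=> f0; rewrite (rint_mkcond _ _ mD) (rint_mkcond _ _ mpos).
suff -> : f \_ D = f \_ pos by [].
apply/funext => x; rewrite !patchE; case: ifPn => [/set_mem/posD h|h]; first by rewrite mem_set.
case: ifPn => // /set_mem x0; apply/esym/f0; rewrite leNgt; apply: contra h => xX.
by apply/mem_set; rewrite /= in_itv/= x0.
Qed.

Lemma Rintegral_trunc f : (forall x, X <= x -> f x = 0) -> Rintegral mu D f = Rintegral mu pos f.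
Proof.
move=> f0; rewrite Rintegral_mkcond [RHS]Rintegral_mkcond; apply: eq_Rintegral => x _.
rewrite !patchE; case: ifPn => [/set_mem/posD h|h]; first by rewrite mem_set.
case: ifPn => // /set_mem x0; apply/esym/f0; rewrite leNgt; apply: contra h => xX.
by apply/mem_set; rewrite /= in_itv/= x0.
Qed.

Lemma L2r_test f : testR f -> L2r mu pos f.
Proof.
move=> tf; split; first by apply: measurable_funTS; apply: meas_smooth; exact: tf.1.
by under eq_fun do rewrite expr2; apply: rint_test; apply: testMs tf.1.
Qed.

Lemma L2rS f : L2r mu pos f -> L2r mu D f.
Proof.
move=> [mf hf]; split; first exact: measurable_funS mf.
exact: (integrableS mpos mD posD hf).
Qed.

Lemma L2r_rint f : L2r mu D f -> rint mu D f.
Proof.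
move=> hf; have h1 : L2r mu D (fun=> 1).
  split => //; rewrite /rint.
  apply: eq_integrable (_ : mu.-integrable _ (EFin \o cst 1)) => //.
    by move=> x _; rewrite /= expr1n.
  apply: (@integrableS _ _ _ mu `[0, X]%classic) => //.
    by apply: subset_itv; rewrite bnd_simp.
  by apply: rint_itv; exact: cst_continuous.
by apply: eq_rint (L2r_mul mD hf h1) => // x _; rewrite mulr1.
Qed.

(** [riesz] is applied to the functional induced by [f] itself: it returns an element [g] of the
    closure of the test functions such that [f - g] annihilates them all, and [fundamental_lemma]
    identifies the two. *)
Lemma test_dense_trunc f : L2r mu pos f -> (forall x, X <= x -> f x = 0) ->
  exists2 phi : nat -> R -> R, (forall m, testR (phi m) /\ forall x, X <= x -> phi m x = 0) &
    forall m, nsq mu pos (fun x => f x - phi m x) <= 4^-1 ^+ m.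
Proof.
move=> hf f0; pose P (phi : R -> R) := testR phi /\ forall x, X <= x -> phi x = 0.
have hfD := L2rS hf.
have PL phi : P phi -> L2r mu D phi by move=> [tp _]; apply: L2rS; exact: L2r_test.
have [|g k r [tg g0] [tk k0]|g k r Pg Pk|g Pg|g Lg [hg [phi Pphi gphi]]] :=
    @riesz _ _ _ mu D mD P (fun phi => ip mu D phi f) (nsq mu D f) PL.
- by split => //; exact: test0.
- split; first by apply: testD => //; exact: testZ.
  by move=> x hx; rewrite g0// k0// mulr0 addr0.
- by have h1 := PL _ Pg; have h2 := PL _ Pk; rewrite ipDl ?ipZl//; exact: L2rZ.
- have := nsq_ge0 mu D (fun x => f x + (-1) * g x); rewrite nsqD//; last exact: PL.
  by rewrite sqrrN expr1n mul1r mulrN1 mulNr (ipC _ _ g) => h; lra.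
have fg : {ae mu, forall x, 0 < x < X -> f x - g x = 0}.
  apply: fundamental_lemma; first by apply: rintB => //; exact: L2r_rint.
  move=> psi tpsi psi0; have Ppsi : P psi by [].
  under eq_Rintegral do rewrite mulrBl.
  rewrite (@RintB _ _ _ mu)//; try by apply: L2r_mul => //; exact: PL.
  by have := hg _ Ppsi; rewrite ipC /ip => ->; rewrite subrr.
exists phi => // m; have Pm := Pphi m.
rewrite /nsq -Rintegral_trunc; last by move=> x hx; rewrite f0// Pm.2// subrr expr0n.
apply: le_trans (gphi m); rewrite le_eqVlt; apply/orP; left; apply/eqP.
have mphi m' : measurable_fun D (phi m') by exact: (PL _ (Pphi m')).1.
rewrite /nsq /Rintegral; congr fine; apply: ae_eq_integral => //.
- by apply/measurable_EFinP; apply: measurable_funX; apply: measurable_funB => //; exact: hfD.1.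
- by apply/measurable_EFinP; apply: measurable_funX; apply: measurable_funB => //; exact: Lg.1.
move: fg; apply: filterS; first exact: (ae_filter_ringOfSetsType mu).
move=> x hx /=; rewrite in_itv/= => /hx /eqP; rewrite subr_eq0 => /eqP ->.
by [].
Qed.
End dense.

End TestDensity.

Section TestDensityGlobal.
Variable R : realType.
Local Notation C := (R[i]).
Local Notation Re := (@ReC R).
Local Notation Im := (@ImC R).
Local Notation mu := (@lebesgue_measure R).
Local Notation TR := (measurableTypeR R).
Local Notation pos := (@pos_half R : set TR).

Let mpos : measurable pos := @measurable_pos_half R.

Lemma cvg0_pick (u : nat -> R) (e : R) : u @ \oo --> (0:R) -> 0 < e -> exists m, u m < e.
Proof. by move=> /cvgr_lt h /h[N _ hN]; exists N; exact: hN (leqnn N). Qed.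

Lemma test_dense (f : R -> R) (e : R) : L2r mu pos f -> 0 < e ->
  exists2 phi, testR phi & nsq mu pos (fun x => f x - phi x) < e.
Proof.
move=> hf e0; pose fm (m : nat) x := f x * (x < m%:R)%R%:R.
have mfm m : measurable_fun pos (fm m).
  apply: measurable_funM; first exact: hf.1.
  rewrite (_ : (fun y => _) = \1_(`]-oo, m%:R[%classic : set TR)); last first.
    apply/funext => y; rewrite indicE; congr (nat_of_bool _)%:R.
    by apply/idP/idP => [yx|/set_mem/=]; [apply/mem_set; rewrite /= in_itv|rewrite in_itv].
  exact: measurable_funTS.
have fm2 m : L2r mu pos (fm m).
  split => //; apply: (rint_le mpos _ hf.2); first exact: measurable_funX.
  by move=> x _; rewrite ger0_norm ?sqr_ge0// /fm; case: (_ < _); rewrite ?mulr1// mulr0 expr0n sqr_ge0.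
have mB m : measurable_fun pos (fun x => (f x - fm m x) ^+ 2).
  by apply: measurable_funX; apply: measurable_funB => //; exact: hf.1.
have [||_] := @Rdct _ _ _ mu _ (fun m x => (f x - fm m x) ^+ 2) (fun=> 0) (fun x => f x ^+ 2)
    mpos mB (measurable_cst _) _ hf.2.
- apply: aeW => x _; apply: cvg_near_cst; near=> m.
  rewrite /fm (_ : (x < m%:R) = true) ?mulr1 ?subrr ?expr0n//.
  by near: m; apply: nbhs_infty_gtr; exact: num_real.
- apply: aeW => x m _; rewrite ger0_norm ?sqr_ge0// /fm.
  by case: (_ < _); rewrite ?mulr1 ?mulr0 ?subrr ?subr0// expr0n sqr_ge0.
rewrite [X in _ --> X]/Rintegral integral0 => cv.
have e4 : 0 < e / 4 by rewrite divr_gt0.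
have [m] := cvg0_pick cv e4; rewrite -/(nsq mu pos _) => hm.
have [|phi tphi hphi] := @test_dense_trunc R m%:R (fm m) (fm2 m).
  move=> x; rewrite /fm => hx; rewrite (_ : (x < m%:R) = false) ?mulr0//.
  by apply/negbTE; rewrite -leNgt.
have cp : 4^-1 ^+ j @[j --> \oo] --> (0 : R).
  by apply: cvg_expr; rewrite ger0_norm//; lra.
have [j hj] := cvg0_pick cp e4.
exists (phi j); first exact: (tphi j).1.
have L1 : L2r mu pos (fun x => f x - fm m x) by apply: L2rB.
have L2 : L2r mu pos (fun x => fm m x - phi j x) by apply: L2rB => //; apply: L2r_test; exact: (tphi j).1.
have -> : (fun x => f x - phi j x) = (fun x => (f x - fm m x) + 1 * (fm m x - phi j x)).
  by apply/funext => x; ring.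
rewrite nsqD// expr1n mulr1 mul1r.
have := ip_le mpos ltr01 L1 L2; rewrite invr1 !mul1r.
have := hphi j; have := ler_norm (ip mu pos (fun x => f x - fm m x) (fun x => fm m x - phi j x)).
by move: (ip _ _ _ _) (4^-1 ^+ j) hj => p q hj; lra.
Unshelve. all: by end_near. Qed.

End TestDensityGlobal.

(** * The extended transform *)

Section WeightedNorm.
Variable R : realType.
Local Notation C := (R[i]).
Local Notation Re := (@ReC R).
Local Notation Im := (@ImC R).
Local Notation mu := (@lebesgue_measure R).
Local Notation TR := (measurableTypeR R).
Local Notation pos := (@pos_half R : set TR).

Let mpos : measurable pos := @measurable_pos_half R.

(** The triangle inequality in squared form. The parameter stays free because two regimes occur:
    [e = 1] for continuity estimates with crude constants, small [e] for the exact isometry. *)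
Lemma sqmodD_le (z w : C) (e : R) : 0 < e -> sqmod (z + w) <= (1 + e) * sqmod z + (1 + e^-1) * sqmod w.
Proof.
move=> e0; have key (x y : R) : (x + y) ^+ 2 <= (1 + e) * x ^+ 2 + (1 + e^-1) * y ^+ 2.
  have ee : e * e^-1 = 1 by rewrite divff// gt_eqF.
  rewrite -subr_ge0 (_ : _ - _ = e * (x - e^-1 * y) ^+ 2).
    by rewrite mulr_ge0 ?sqr_ge0// ltW.
  have -> : e * (x - e^-1 * y) ^+ 2 = e * x ^+ 2 - 2 * (e * e^-1) * x * y + (e * e^-1) * e^-1 * y ^+ 2 by ring.
  by rewrite ee; ring.
have := key (Re z) (Re w); have := key (Im z) (Im w).
by rewrite /sqmod !CE; lra.
Qed.

Lemma weighted_tri (D : set TR) (w : R -> R) (f g : R -> C) (e : R) : measurable D ->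
  measurable_fun D w -> (forall x, 0 <= w x) -> cmeas D f -> cmeas D g -> 0 < e ->
  (\int[mu]_(x in D) (sqmod (f x + g x) * w x)%:E <=
   (1 + e)%:E * \int[mu]_(x in D) (sqmod (f x) * w x)%:E +
   (1 + e^-1)%:E * \int[mu]_(x in D) (sqmod (g x) * w x)%:E)%E.
Proof.
move=> mD mw w0 mf mg e0.
have e1 : 0 <= 1 + e by rewrite addr_ge0// ltW.
have e2 : 0 <= 1 + e^-1 by rewrite addr_ge0// invr_ge0 ltW.
have m1 (h : R -> C) : cmeas D h -> measurable_fun D (fun x => (sqmod (h x) * w x)%:E).
  by move=> mh; apply/measurable_EFinP; apply: measurable_funM => //; exact: meas_sqmod.
have p1 (h : R -> C) x : (0 <= (sqmod (h x) * w x)%:E)%E by rewrite lee_fin mulr_ge0 ?sqmod_ge0.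
rewrite -!ge0_integralZl_EFin//; try exact: m1.
have p2 (h : R -> C) (r : R) x : 0 <= r -> (0 <= r%:E * (sqmod (h x) * w x)%:E)%E.
  by move=> r0; rewrite mule_ge0 ?p1.
have m2 (h : R -> C) (r : R) : cmeas D h -> measurable_fun D (fun x => r%:E * (sqmod (h x) * w x)%:E)%E.
  by move=> mh; apply: measurable_funeM; exact: m1.
rewrite -ge0_integralD//; try (by move=> x _; exact: p2); try exact: m2.
apply: ge0_le_integral => //.
- by move=> x _; exact: (p1 (fun x => f x + g x)).
- by apply: (m1 (fun x => f x + g x)); exact: cmeasD.
- by apply: emeasurable_funD; exact: m2.
move=> x _; rewrite -!EFinM -EFinD lee_fin !mulrA -mulrDl ler_wpM2r//.
exact: sqmodD_le.
Qed.

Definition cL2 (f : R -> C) := L2r mu pos (Re \o f) /\ L2r mu pos (Im \o f).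
Definition cn (f : R -> C) := nsq mu pos (Re \o f) + nsq mu pos (Im \o f).

Lemma int_sqmod f : cL2 f -> (\int[mu]_(x in pos) (sqmod (f x))%:E = (cn f)%:E)%E.
Proof.
move=> [[m1 h1] [m2 h2]]; rewrite /cn EFinD /nsq -!(@rint_EFin _ _ _ mu)//.
rewrite -ge0_integralD//; first by move=> x _; rewrite lee_fin sqr_ge0.
- by apply/measurable_EFinP; exact: measurable_funX.
- by move=> x _; rewrite lee_fin sqr_ge0.
- by apply/measurable_EFinP; exact: measurable_funX.
Qed.

Lemma inL2P f : inL2 f <-> cL2 f.
Proof.
split=> [[[m1 m2] h]|h]; last first.
  split; first by split; [exact: h.1.1|exact: h.2.1].
  by under eq_integral do rewrite mulr1; rewrite int_sqmod// ltry.
have {}h : (\int[mu]_(x in pos) (sqmod (f x))%:E < +oo)%E.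
  by move: h; under eq_integral do rewrite mulr1.
have ms : measurable_fun pos (fun x => sqmod (f x)) by exact: meas_sqmod.
have is_ : rint mu pos (fun x => sqmod (f x)).
  apply/integrableP; split; first exact/measurable_EFinP.
  by under eq_integral do rewrite /= ger0_norm ?sqmod_ge0//.
split; split => //; apply: (rint_le mpos _ is_); try exact: measurable_funX.
  by move=> x _; rewrite ger0_norm ?sqr_ge0// lerDl sqr_ge0.
by move=> x _; rewrite ger0_norm ?sqr_ge0// lerDr sqr_ge0.
Qed.

Lemma cL2_cmeas f : cL2 f -> cmeas pos f. Proof. by move=> [[h _] [h' _]]; split. Qed.

Lemma cL2D (f g : R -> C) (r : R) : cL2 f -> cL2 g -> cL2 (fun x => f x + toC r * g x).
Proof.
move=> [f1 f2] [g1 g2]; split.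
  rewrite (_ : _ \o _ = (fun x => Re (f x) + r * Re (g x))).
    by apply: L2rD => //; exact: L2rZ.
  by apply/funext => x; rewrite /= !CE mul0r subr0.
rewrite (_ : _ \o _ = (fun x => Im (f x) + r * Im (g x))).
  by apply: L2rD => //; exact: L2rZ.
by apply/funext => x; rewrite /= !CE mul0r addr0.
Qed.

Lemma cL2_test g : testC g -> cL2 g.
Proof. by move=> [t1 t2]; split; exact: L2r_test. Qed.

Variable n : nat.
Implicit Types (u v : 'I_n -> R -> C).

Lemma inHP u : inH u <-> forall k, cL2 (u k).
Proof. by split=> h k; apply/inL2P. Qed.

Lemma nHE u : inH u -> nH u = (\sum_(k < n) cn (u k))%:E.
Proof.
by move=> /inHP hu; rewrite -sumEFin; apply: eq_bigr => k _; exact: int_sqmod.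
Qed.

Lemma nH_ge0 u : (0 <= nH u)%E.
Proof. by apply: sume_ge0 => k _; apply: integral_ge0 => x _; rewrite lee_fin sqmod_ge0. Qed.

Definition axpy (r : R) u v : 'I_n -> R -> C := fun k x => u k x + toC r * v k x.

Lemma inH_axpy r u v : inH u -> inH v -> inH (axpy r u v).
Proof. by move=> /inHP hu /inHP hv; apply/inHP => k; exact: cL2D. Qed.

Lemma inH_test u : (forall k, testC (u k)) -> inH u.
Proof. by move=> tu; apply/inHP => k; exact: cL2_test. Qed.

Lemma nH_tri u v (e : R) : inH u -> inH v -> 0 < e ->
  (nH (fun k x => u k x + v k x)%R <= (1 + e)%:E * nH u + (1 + e^-1)%:E * nH v)%E.
Proof.
move=> /inHP hu /inHP hv e0.
have e1 : 0 <= 1 + e by rewrite addr_ge0// ltW.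
have e2 : 0 <= 1 + e^-1 by rewrite addr_ge0// invr_ge0 ltW.
rewrite /nH !ge0_sume_distrr -?big_split/=; last 2 first.
- by move=> k _; apply: integral_ge0 => x _; rewrite lee_fin sqmod_ge0.
- by move=> k _; apply: integral_ge0 => x _; rewrite lee_fin sqmod_ge0.
apply: lee_sum => k _.
have := @weighted_tri pos (fun=> 1) (u k) (v k) e mpos (measurable_cst _) (fun=> ler01)
  (cL2_cmeas (hu k)) (cL2_cmeas (hv k)) e0.
by rewrite !(eq_integral _ _ (fun x _ => congr1 EFin (mulr1 _))).
Qed.

Lemma nHN u : nH (fun k x => - u k x) = nH u.
Proof. by apply: eq_bigr => k _; apply: eq_integral => x _; rewrite sqmodN. Qed.

Variables (c a : 'I_n -> R).
Hypothesis c_gt0 : forall k, 0 < c k.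
Implicit Types W Z : 'I_n -> R -> C.

Definition qmeas W := forall k, cmeas (`]a k, +oo[%classic : set TR) (W k).

Lemma inL2qP W : inL2q c a W <-> qmeas W /\ (nq c a W < +oo)%E.
Proof.
have p k : (0 <= \int[mu]_(x in `]a k, +oo[) (sqmod (W k x) * qfun c a k x)%:E)%E.
  by apply: integral_ge0 => x _; rewrite lee_fin mulr_ge0 ?sqmod_ge0 ?qfun_ge0.
split=> [h|[mW h] k].
  split; first by move=> k; case: (h k).
  by rewrite /nq; apply: lte_sum_pinfty => k _; case: (h k).
split; first exact: mW.
apply: le_lt_trans h; rewrite /nq (bigD1 k)//= leeDl// sume_ge0 => // i _; exact: p.
Qed.

Lemma nq_ge0 W : (0 <= nq c a W)%E.
Proof.
by apply: sume_ge0 => k _; apply: integral_ge0 => x _; rewrite lee_fin mulr_ge0 ?sqmod_ge0 ?qfun_ge0.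
Qed.

Lemma nq_tri W Z (e : R) : qmeas W -> qmeas Z -> 0 < e ->
  (nq c a (fun k x => W k x + Z k x)%R <= (1 + e)%:E * nq c a W + (1 + e^-1)%:E * nq c a Z)%E.
Proof.
move=> hu hv e0.
have e1 : 0 <= 1 + e by rewrite addr_ge0// ltW.
have e2 : 0 <= 1 + e^-1 by rewrite addr_ge0// invr_ge0 ltW.
rewrite /nq !ge0_sume_distrr -?big_split/=; last 2 first.
- by move=> k _; apply: integral_ge0 => x _; rewrite lee_fin mulr_ge0 ?sqmod_ge0 ?qfun_ge0.
- by move=> k _; apply: integral_ge0 => x _; rewrite lee_fin mulr_ge0 ?sqmod_ge0 ?qfun_ge0.
apply: lee_sum => k _; apply: weighted_tri => //.
- by apply: measurable_funTS; exact: meas_qfun.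
- by move=> x; exact: qfun_ge0.
Qed.

Lemma nqN W : nq c a (fun k x => - W k x) = nq c a W.
Proof. by apply: eq_bigr => k _; apply: eq_integral => x _; rewrite sqmodN. Qed.

End WeightedNorm.

(** * The transform of truncated functions *)

Section Bessel.
Variable R : realType.
Local Notation C := (R[i]).
Local Notation Re := (@ReC R).
Local Notation Im := (@ImC R).
Local Notation mu := (@lebesgue_measure R).
Local Notation TR := (measurableTypeR R).
Local Notation pos := (@pos_half R : set TR).

Let mpos : measurable pos := @measurable_pos_half R.

Lemma ip_cvg d (T : measurableType d) (nu : {measure set T -> \bar R}) (D : set T)
    (f_ : nat -> T -> R) (f e : T -> R) : measurable D ->
  (forall m, L2r nu D (f_ m)) -> L2r nu D f -> L2r nu D e ->
  nsq nu D (fun x => f x - f_ m x) @[m --> \oo] --> (0 : R) ->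
  ip nu D (f_ m) e @[m --> \oo] --> ip nu D f e.
Proof.
move=> mD Lm Lf Le cv; apply/cvgrPdist_lt => dl dl0.
(* The weight in [ip_le] is chosen so that [nsq e / s] is below [dl]; the remaining term is small
   once [nsq (f - f_ m) < dl / s]. *)
pose s := (nsq nu D e + 1) / dl.
have N0 := nsq_ge0 nu D e.
have s0 : 0 < s by rewrite divr_gt0//; lra.
have : 0 < dl / s by rewrite divr_gt0.
move/(cvgr_lt _ cv); apply: filterS => m hm.
have L1 : L2r nu D (fun x => f x - f_ m x) by exact: L2rB.
have := ip_le mD s0 L1 Le.
have -> : ip nu D (fun x => f x - f_ m x) e = ip nu D f e - ip nu D (f_ m) e.
  have -> : (fun x => f x - f_ m x) = (fun x => f x + (-1) * f_ m x).
    by apply/funext => x; rewrite mulN1r.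
  by rewrite ipDl ?ipZl//; [rewrite mulN1r|exact: L2rZ].
move: hm; rewrite ltr_pdivlMr// mulrC => hm h.
have : s^-1 * nsq nu D e < dl.
  rewrite /s invf_div mulrAC ltr_pdivrMr; last by lra.
  by rewrite ltr_pM2l//; lra.
by move: h hm; lra.
Qed.

Variables (n : nat) (c a : 'I_n -> R).
Hypothesis c_gt0 : forall k, 0 < c k.
Local Notation xz := (xiz c a).
Local Notation Etk := (Et c a).
Implicit Types (u v : 'I_n -> R -> C).

Lemma EtD k (f g : R -> R) (r : R) z : rint mu pos f -> rint mu pos g ->
  Etk k (fun x => f x + r * g x) z = Etk k f z + toC r * Etk k g z.
Proof.
move=> hf hg.
have i1 := @crint_Et R n c a k f z hf; have i2 := @crint_Et R n c a k g z hg.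
rewrite /Et !cintE -cintDZ// -cintDD//; last exact: crintZ.
by apply: eq_cintD => x _; rewrite toCD toCM; ring.
Qed.

Lemma VcD u v (r : R) l s : (forall k, crint pos (u k)) -> (forall k, crint pos (v k)) ->
  Vc c a (axpy r u v) l s = Vc c a u l s + toC r * Vc c a v l s.
Proof.
move=> hu hv.
have E F f g : (forall k x, F k x = f k x + r * g k x) -> (forall k, rint mu pos (f k)) ->
    (forall k, rint mu pos (g k)) -> Vr c a F l s = Vr c a f l s + toC r * Vr c a g l s.
  move=> FE hf hg; have -> : F = (fun k x => f k x + r * g k x).
    by apply/funext => k; apply/funext => x; exact: FE.
  rewrite /Vr (eq_bigr (fun k => Etk k (f k) (toC s) + toC r * Etk k (g k) (toC s))); last first.
    by move=> k _; rewrite EtD.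
  rewrite EtD// big_split/= -mulr_sumr.
  set p := \sum_(k < n) Etk k (f k) (toC s); set q := \sum_(k < n) Etk k (g k) (toC s).
  set p' := Etk l (f l) (toC s); set q' := Etk l (g l) (toC s); set w := (wfun c a s)^*%C / _.
  clearbody p q p' q' w.
  apply: C_ext; rewrite !CE; ring.
rewrite /Vc (E (fun k => Re \o axpy r u v k) (fun k => Re \o u k) (fun k => Re \o v k)); last 3 first.
- by move=> k x; rewrite /comp /axpy !CE; ring.
- by move=> k; exact: (hu k).1.
- by move=> k; exact: (hv k).1.
rewrite (E (fun k => Im \o axpy r u v k) (fun k => Im \o u k) (fun k => Im \o v k)); last 3 first.
- by move=> k x; rewrite /comp /axpy !CE; ring.
- by move=> k; exact: (hu k).2.
- by move=> k; exact: (hv k).2.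
ring.
Qed.

(** Truncated functions of H are integrable, so [Vc] is a genuine integral on them, and the class
    contains smooth cutoffs of elements of D(A), which in general do not vanish near the vertex as
    test functions do. *)
Definition trunc (X : R) u := forall k x, X <= x -> u k x = 0.

Lemma crint_trunc X u k : inH u -> trunc X u -> crint pos (u k).
Proof.
move=> /inHP hu tu; split; apply/(@rint_trunc _ X).
- by move=> x hx; rewrite /= tu.
- by apply: L2r_rint; apply: L2rS; exact: (hu k).1.
- by move=> x hx; rewrite /= tu.
- by apply: L2r_rint; apply: L2rS; exact: (hu k).2.
Qed.

Lemma truncW X Y u : X <= Y -> trunc X u -> trunc Y u.
Proof. by move=> XY hu k x hx; rewrite hu// (le_trans XY). Qed.

Lemma test_trunc u : (forall k, testC (u k)) -> exists X, trunc X u.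
Proof.
move=> tu; have /choice[b hb] : forall k, exists b, forall x, b <= x -> u k x = 0.
  move=> k; have [t1 t2] := tu k.
  have [_ [b1 [_ _ _ h1]]] := test_supp t1; have [_ [b2 [_ _ _ h2]]] := test_supp t2.
  exists (Num.max b1 b2) => x; rewrite ge_max => /andP[x1 x2].
  by apply: C_ext; [exact: h1|exact: h2].
exists (\sum_(k < n) `|b k|) => k x hx; apply: hb; apply: le_trans hx.
by rewrite (bigD1 k)//= (le_trans (ler_norm _))// lerDl sumr_ge0.
Qed.

(** On the bounded interval []0, X[] the exponential has modulus at most 1 and is square integrable,
    so the transform at fixed [s] is an inner product there, continuous for the L2 norm. *)
Lemma Et_cvg X k (f_ : nat -> R -> R) (f : R -> R) (s : R) :
  (forall m, L2r mu pos (f_ m) /\ forall x, X <= x -> f_ m x = 0) ->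
  L2r mu pos f -> (forall x, X <= x -> f x = 0) ->
  nsq mu pos (fun x => f x - f_ m x) @[m --> \oo] --> (0 : R) ->
  ccvg \oo (fun m => Etk k (f_ m) (toC s)) (Etk k f (toC s)).
Proof.
move=> hf_ hf f0 cv.
have mD : measurable (`]0, X[%classic : set TR) by [].
have cvD : nsq mu (`]0, X[%classic : set TR) (fun x => f x - f_ m x) @[m --> \oo] --> (0 : R).
  have E m : nsq mu (`]0, X[%classic : set TR) (fun x => f x - f_ m x) = nsq mu pos (fun x => f x - f_ m x).
    by rewrite /nsq Rintegral_trunc// => x hx; rewrite f0// (hf_ m).2// subrr expr0n.
  by under eq_fun do rewrite E.
have me : cmeas setT (fun x : TR => ex (xz k (toC s)) x).
  apply: (@cmeas_ex_comp R setT (xz k (toC s)) (fun x => x)); exact: measurable_id.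
have Le (F : C -> R) : measurable_fun setT (fun x : TR => F (ex (xz k (toC s)) x)) ->
    (forall z, `|F z| <= cmod z) ->
    L2r mu (`]0, X[%classic : set TR) (fun x => F (ex (xz k (toC s)) x)).
  move=> mF hF; split; first exact: measurable_funTS.
  apply: (@rint_le _ _ _ mu _ _ (fun=> 1)) => //.
  - by apply: measurable_funTS; apply: measurable_funX.
  - apply: (@integrableS _ _ _ mu `[0, X]%classic) => //.
      by apply: subset_itv; rewrite bnd_simp.
    by apply: rint_itv; exact: cst_continuous.
  move=> x /=; rewrite in_itv/= => /andP[x0 _].
  rewrite normrX exprn_ile1//; apply: le_trans (hF _) _.
  apply: cmod_ex; last exact: ltW.
  exact: Im_csq_le0.
have EtE (g : R -> R) : (forall x, X <= x -> g x = 0) -> Etk k g (toC s) =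
    Complex (ip mu `]0, X[ g (fun x => Re (ex (xz k (toC s)) x)))
            (ip mu `]0, X[ g (fun x => Im (ex (xz k (toC s)) x))).
  move=> g0; rewrite /ip !Rintegral_trunc; try by move=> x hx; rewrite g0// mul0r.
  rewrite /Et cintE /cintD; congr Complex; apply: eq_Rintegral => x _.
    by rewrite /comp; move: (ex _ x) => z; rewrite !CE; ring.
  by rewrite /comp; move: (ex _ x) => z; rewrite !CE; ring.
pose e (F : C -> R) x := F (ex (xz k (toC s)) x).
rewrite EtE// (_ : (fun m => Etk k (f_ m) (toC s)) =
    fun m => Complex (ip mu `]0, X[ (f_ m) (e Re)) (ip mu `]0, X[ (f_ m) (e Im))); last first.
  by apply/funext => m; apply: EtE; exact: (hf_ m).2.
have LD m : L2r mu (`]0, X[%classic : set TR) (f_ m) by apply: L2rS; exact: (hf_ m).1.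
have LDf : L2r mu (`]0, X[%classic : set TR) f by exact: L2rS.
split; apply: ip_cvg => //; apply: Le => //.
- exact: me.1.
- exact: Re_le_cmod.
- exact: me.2.
- exact: Im_le_cmod.
Qed.

End Bessel.

Section Vtilde.
Variable R : realType.
Local Notation C := (R[i]).
Local Notation Re := (@ReC R).
Local Notation Im := (@ImC R).
Local Notation mu := (@lebesgue_measure R).
Local Notation TR := (measurableTypeR R).
Local Notation pos := (@pos_half R : set TR).

Let mpos : measurable pos := @measurable_pos_half R.

Variables (n : nat) (c a : 'I_n -> R).
Hypothesis c_gt0 : forall k, 0 < c k.
Implicit Types (u v : 'I_n -> R -> C).

Lemma cn_ge0 (f : R -> C) : 0 <= cn f.
Proof. by rewrite addr_ge0// nsq_ge0. Qed.

Lemma nH_subC u v : nH (fun k x => u k x - v k x) = nH (fun k x => v k x - u k x).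
Proof. by rewrite -nHN; apply: eq_bigr => k _; apply: eq_integral => x _; rewrite opprB. Qed.

Lemma axpyN1 u v : axpy (-1) u v = (fun k x => u k x - v k x).
Proof. by apply/funext => k; apply/funext => x; rewrite /axpy toCN toC1 mulN1r. Qed.

Lemma inHB u v : inH u -> inH v -> inH (fun k x => u k x - v k x).
Proof. by move=> hu hv; rewrite -axpyN1; exact: inH_axpy. Qed.

Lemma nHB_small u v (e : R) : inH u -> inH v ->
  (forall k, nsq mu pos (fun x => Re (u k x) - Re (v k x)) <= e /\
             nsq mu pos (fun x => Im (u k x) - Im (v k x)) <= e) ->
  (nH (fun k x => u k x - v k x)%R <= (2 * e *+ n)%:E)%E.
Proof.
move=> hu hv h; rewrite nHE; last exact: inHB.
rewrite lee_fin -[X in _ *+ X]card_ord -sumr_const ler_sum// => k _.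
have [h1 h2] := h k; rewrite /cn mulr_natl mulr2n; apply: lerD.
  by apply: le_trans h1; rewrite le_eqVlt; apply/orP; left; apply/eqP;
     apply: eq_Rintegral => x _; rewrite /comp !CE.
by apply: le_trans h2; rewrite le_eqVlt; apply/orP; left; apply/eqP;
   apply: eq_Rintegral => x _; rewrite /comp !CE.
Qed.

Lemma test_near u (e : R) : inH u -> 0 < e -> exists2 phi : 'I_n -> R -> C,
  (forall k, testC (phi k)) & (distH phi u <= e%:E)%E.
Proof.
move=> hu e0; pose e' := e / (2 *+ n.+1).
have n0 : 0 < (2 *+ n.+1 : R) by rewrite pmulrn_lgt0.
have e'0 : 0 < e' by rewrite divr_gt0.
have /choice[p hp] : forall k, exists p : R -> C, testC p /\
    (nsq mu pos (fun x => Re (u k x) - Re (p x)) <= e' /\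
     nsq mu pos (fun x => Im (u k x) - Im (p x)) <= e').
  move=> k; have [L1 L2] := (inHP u).1 hu k.
  have [p1 t1 h1] := test_dense L1 e'0; have [p2 t2 h2] := test_dense L2 e'0.
  by exists (fun x => Complex (p1 x) (p2 x)); split; [split|split; exact: ltW].
exists p; first by move=> k; case: (hp k).
rewrite /distH -/(nH (fun k x => p k x - u k x)) nH_subC.
have hp' : inH p by apply: inH_test => k; case: (hp k).
apply: le_trans (nHB_small hu hp' (fun k => (hp k).2)) _.
rewrite lee_fin /e' -[leLHS]mulr_natr.
have -> : 2 * (e / (2 *+ n.+1)) * n%:R = e * (n%:R / n.+1%:R).
  have : n.+1%:R != 0 :> R by rewrite pnatr_eq0.
  by rewrite -[2 *+ _]mulr_natr; move: (n.+1%:R) => N N0; field.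
rewrite ler_piMr ?(ltW e0)// ler_pdivrMr ?ltr0n// mul1r ler_nat//.
Qed.

Lemma test_seq u : inH u -> exists2 phi : nat -> 'I_n -> R -> C,
  (forall m k, testC (phi m k)) & (fun m => distH (phi m) u) @ \oo --> 0%E.
Proof.
move=> hu.
have /choice[phi hphi] : forall m : nat, exists phi : 'I_n -> R -> C,
    (forall k, testC (phi k)) /\ (distH phi u <= (m.+1%:R^-1)%:E)%E.
  move=> m; have [|p tp hp] := @test_near u (m.+1%:R^-1) hu; last by exists p.
  by rewrite invr_gt0 ltr0n.
exists phi; first by move=> m; exact: (hphi m).1.
have c0 : (m.+1%:R^-1 : R)%:E @[m --> \oo] --> 0%E.
  by apply: cvg_EFin; [exact: nearW|exact: cvg_harmonic].
apply: (@squeeze_cvge _ _ _ _ (fun=> 0%E) _ (fun m => (m.+1%:R^-1 : R)%:E)) => //.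
  apply: nearW => m; rewrite (hphi m).2 andbT; exact: (nH_ge0 (fun k x => phi m k x - u k x)).
exact: cvg_cst.
Qed.

Lemma Vc_cvg X (phi : nat -> 'I_n -> R -> C) u l s : inH u -> trunc X u ->
  (forall m k, testC (phi m k)) -> (forall m, trunc X (phi m)) ->
  (forall m k, nsq mu pos (fun x => Re (u k x) - Re (phi m k x)) <= 4^-1 ^+ m /\
               nsq mu pos (fun x => Im (u k x) - Im (phi m k x)) <= 4^-1 ^+ m) ->
  ccvg \oo (fun m => Vc c a (phi m) l s) (Vc c a u l s).
Proof.
move=> hu tu tphi phiX hphi.
have cp : 4^-1 ^+ j @[j --> \oo] --> (0 : R).
  by apply: cvg_expr; rewrite ger0_norm//; lra.
have cv0 (N : nat -> R) : (forall m, 0 <= N m <= 4^-1 ^+ m) -> N m @[m --> \oo] --> (0 : R).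
  move=> hN; apply: (@squeeze_cvgr _ _ _ _ (fun=> 0) (fun m => 4^-1 ^+ m)) => //.
  - exact: nearW.
  - exact: cvg_cst.
have E (F : C -> R) : F 0 = 0 -> (forall g, testC g -> testR (F \o g)) ->
    (forall k, L2r mu pos (F \o u k)) ->
    (forall m k, nsq mu pos (fun x => F (u k x) - F (phi m k x)) <= 4^-1 ^+ m) ->
    ccvg \oo (fun m => Vr c a (fun k => F \o phi m k) l s) (Vr c a (fun k => F \o u k) l s).
  move=> F0 tF LF hF.
  have EC k : ccvg \oo (fun m => Et c a k (F \o phi m k) (toC s)) (Et c a k (F \o u k) (toC s)).
    apply: (@Et_cvg R n c a X k (fun m => F \o phi m k) (F \o u k)).
    - move=> m; split; first by apply: L2r_test; exact: tF.
      by move=> x hx; rewrite /= phiX.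
    - exact: LF.
    - by move=> x hx; rewrite /= tu.
    - by apply: cv0 => m; rewrite hF nsq_ge0.
  have [s1 s2] := ccvg_sum (index_enum 'I_n) EC.
  rewrite /Vr; apply: ccvgD.
    by split; under eq_fun do rewrite ?ReCJ ?ImCJ; rewrite ?ReCJ ?ImCJ; [|apply: cvgN].
  by apply: ccvgM; [exact: ccvg_cst|apply: ccvg_toC; exact: (EC l).2].
rewrite /Vc; apply: ccvgD.
  apply: (E Re) => //.
  - by move=> g [].
  - by move=> k; exact: ((inHP u).1 hu k).1.
  - by move=> m k; exact: (hphi m k).1.
apply: ccvgM; first exact: ccvg_cst.
apply: (E Im) => //.
- by move=> g [].
- by move=> k; exact: ((inHP u).1 hu k).2.
- by move=> m k; exact: (hphi m k).2.
Qed.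

(** Parseval holds for approximating test functions, their transforms converge pointwise, and Fatou
    gives the bound. The factor 2 comes from the triangle inequality with [e = 1]; it is enough for
    continuity, and [isometry] removes it later. *)
Lemma bessel X u : inH u -> trunc X u -> (nq c a (Vc c a u) <= 2%:E * nH u)%E.
Proof.
move=> hu tu.
have /choice[p hp] : forall k, exists p : nat -> R -> C, forall m,
    [/\ testC (p m), forall x, X <= x -> p m x = 0,
        nsq mu pos (fun x => Re (u k x) - Re (p m x)) <= 4^-1 ^+ m &
        nsq mu pos (fun x => Im (u k x) - Im (p m x)) <= 4^-1 ^+ m].
  move=> k; have [L1 L2] := (inHP u).1 hu k.
  have [|p1 t1 h1] := test_dense_trunc L1 (_ : forall x, X <= x -> _).
    by move=> x hx; rewrite /= tu.
  have [|p2 t2 h2] := test_dense_trunc L2 (_ : forall x, X <= x -> _).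
    by move=> x hx; rewrite /= tu.
  exists (fun m x => Complex (p1 m x) (p2 m x)) => m; split.
  - by split; [exact: (t1 m).1|exact: (t2 m).1].
  - by move=> x hx; rewrite (t1 m).2// (t2 m).2.
  - exact: h1.
  - exact: h2.
pose phi m k := p k m.
have tphi m k : testC (phi m k) by case: (hp k m).
have phiX m : trunc X (phi m) by move=> k x hx; case: (hp k m) => _ h _ _; exact: h.
have hphi m k : nsq mu pos (fun x => Re (u k x) - Re (phi m k x)) <= 4^-1 ^+ m /\
    nsq mu pos (fun x => Im (u k x) - Im (phi m k x)) <= 4^-1 ^+ m by case: (hp k m).
have Hphi m : inH (phi m) by exact: inH_test.
have mV v : (forall k, crint pos (v k)) -> measurable_fun setT
    (fun s : TR => \sum_(k < n) sqmod (Vc c a v k s) * qfun c a k s).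
  move=> iv; apply: measurable_sum => k; apply: measurable_funM; last exact: meas_qfun.
  by apply: meas_sqmod; exact: cmeas_Vc.
have nqE v : (forall k, crint pos (v k)) -> (nq c a (Vc c a v) =
    \int[mu]_s (\sum_(k < n) sqmod (Vc c a v k s) * qfun c a k s)%:E)%E.
  move=> iv; rewrite /nq; under eq_bigr do rewrite nq_line.
  rewrite -ge0_integral_sum//.
  - by apply: eq_integral => s _; rewrite sumEFin.
  - move=> k; apply/measurable_EFinP; apply: measurable_funM; last exact: meas_qfun.
    by apply: meas_sqmod; exact: cmeas_Vc.
  - by move=> k s _; rewrite lee_fin mulr_ge0 ?sqmod_ge0 ?qfun_ge0.
have iphi m k : crint pos (phi m k) by exact: crint_testC.
have iu k : crint pos (u k) by exact: crint_trunc hu tu.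
apply/lee_addgt0Pr => e e0.
(* The error after the triangle inequality is [2 * (2 * 4^-m * n)], which this threshold for [4^-m]
   keeps below [e]. *)
have e40 : 0 < e / (4 *+ n.+1) by rewrite divr_gt0// pmulrn_lgt0.
have cp : 4^-1 ^+ j @[j --> \oo] --> (0 : R).
  by apply: cvg_expr; rewrite ger0_norm//; lra.
have [N _ hN] := cvgr_lt _ cp _ e40.
rewrite nqE//; apply: (@fatou_bound _ _ _ mu setT measurableT
  (fun m s => \sum_(k < n) sqmod (Vc c a (phi m) k s) * qfun c a k s) _ _ N).
- by move=> m; exact: mV.
- by move=> m s _; apply: sumr_ge0 => k _; rewrite mulr_ge0 ?sqmod_ge0 ?qfun_ge0.
- move=> s _; apply: cvg_big => [|k _]; first exact: add_continuous.
  apply: cvgM; last exact: cvg_cst.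
  by apply: cvg_sqmod; exact: (@Vc_cvg X).
move=> m Nm; rewrite -nqE//.
have -> : nq c a (Vc c a (phi m)) = nH (phi m).
  rewrite -(parseval a c_gt0 (tphi m)); apply: eq_nq => k s ks.
  by rewrite VopE.
have -> : phi m = fun k x => u k x + (phi m k x - u k x).
  by apply/funext => k; apply/funext => x; rewrite addrC subrK.
apply: le_trans (nH_tri hu (inHB (Hphi m) hu) ltr01) _.
rewrite invr1; apply: leeD2l.
rewrite nH_subC; apply: le_trans (lee_wpmul2l _ (nHB_small hu (Hphi m) (hphi m))) _ => //.
have := hN m Nm; rewrite ltr_pdivlMr ?pmulrn_lgt0// => h.
rewrite -EFinM lee_fin; apply: le_trans (ltW h).
have p0 : 0 <= (4^-1 : R) ^+ m by rewrite exprn_ge0.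
rewrite -[2 * _ *+ n]mulr_natr -[4 *+ _]mulr_natr -natr1.
move: (4^-1 ^+ m) p0 => q q0; rewrite -subr_ge0 (_ : _ - _ = 4 * q); first by rewrite mulr_ge0.
by ring.
Qed.

End Vtilde.

(** * Isometry of the extended transform *)

Section VtildeTheory.
Variable R : realType.
Local Notation C := (R[i]).
Local Notation Re := (@ReC R).
Local Notation Im := (@ImC R).
Local Notation mu := (@lebesgue_measure R).
Local Notation TR := (measurableTypeR R).
Local Notation pos := (@pos_half R : set TR).

Variables (n : nat) (c a : 'I_n -> R).
Hypothesis c_gt0 : forall k, 0 < c k.
Implicit Types (u v h : 'I_n -> R -> C).

Definition hn u := \sum_(k < n) cn (u k).

Lemma hn_ge0 u : 0 <= hn u.
Proof. by apply: sumr_ge0 => k _; exact: cn_ge0. Qed.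

Lemma nHhn u : inH u -> nH u = (hn u)%:E. Proof. exact: nHE. Qed.

Lemma hnB_sym u v : inH u -> inH v -> hn (fun k x => u k x - v k x) = hn (fun k x => v k x - u k x).
Proof.
move=> hu hv; apply: EFin_inj; rewrite -!nHhn; try exact: inHB.
exact: nH_subC.
Qed.

Lemma hn_tri2 u v h : inH u -> inH v -> inH h ->
  hn (fun k x => u k x - h k x) <=
  2 * hn (fun k x => u k x - v k x) + 2 * hn (fun k x => v k x - h k x).
Proof.
move=> hu hv hh; have := nH_tri (inHB hu hv) (inHB hv hh) ltr01.
have -> : (fun k x => u k x - v k x + (v k x - h k x)) = (fun k x => u k x - h k x).
  by apply/funext => k; apply/funext => x; rewrite addrA subrK.
by rewrite !nHhn; try exact: inHB; rewrite invr1 -!EFinM -EFinD lee_fin.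
Qed.

Lemma qmeasB W Z : qmeas a W -> qmeas a Z -> @qmeas R n a (fun k x => W k x - Z k x).
Proof. by move=> hW hZ k; apply: cmeasD => //; exact: cmeasN. Qed.

Lemma qmeas_Vc u : (forall k, crint pos (u k)) -> qmeas a (Vc c a u).
Proof. by move=> hu k; have [h1 h2] := @cmeas_Vc R n c a c_gt0 u k hu; split; exact: measurable_funTS. Qed.

Lemma nq_tri2 W Z Y : qmeas a W -> qmeas a Z -> qmeas a Y ->
  (nq c a (fun k x => W k x - Y k x)%R <=
  2%:E * nq c a (fun k x => W k x - Z k x)%R + 2%:E * nq c a (fun k x => Z k x - Y k x)%R)%E.
Proof.
move=> hW hZ hY; have := nq_tri c_gt0 (qmeasB hW hZ) (qmeasB hZ hY) ltr01.
have -> : (fun k x => W k x - Z k x + (Z k x - Y k x)) = (fun k x => W k x - Y k x).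
  by apply/funext => k; apply/funext => x; rewrite addrA subrK.
by rewrite invr1.
Qed.

Lemma distq_Vop u W : (forall k, crint pos (u k)) ->
  distq c a (Vop c a u) W = nq c a (fun k x => Vc c a u k x - W k x).
Proof.
move=> hu; apply: (@eq_nq R n c a (fun k x => Vop c a u k x - W k x)) => k s ks.
by rewrite VopE.
Qed.

Lemma VcB u v : (forall k, crint pos (u k)) -> (forall k, crint pos (v k)) ->
  Vc c a (fun k x => u k x - v k x) = (fun k s => Vc c a u k s - Vc c a v k s).
Proof.
move=> hu hv; apply/funext => k; apply/funext => s.
by rewrite -axpyN1 VcD// toCN toC1 mulN1r.
Qed.

Lemma truncB X u v : trunc X u -> trunc X v -> trunc X (fun k x => u k x - v k x).
Proof. by move=> hu hv k x hx; rewrite hu// hv// subrr. Qed.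

Lemma besselB X Y u v : inH u -> trunc X u -> inH v -> trunc Y v ->
  (nq c a (fun k s => Vc c a u k s - Vc c a v k s)%R <= (2 * hn (fun k x => u k x - v k x))%:E)%E.
Proof.
move=> hu tu hv tv; have iu k : crint pos (u k) by exact: crint_trunc hu tu.
have iv k : crint pos (v k) by exact: crint_trunc hv tv.
rewrite -VcB// EFinM -nHhn; last exact: inHB.
apply: (@bessel R n c a c_gt0 (Num.max X Y)); first exact: inHB.
by apply: truncB; [apply: truncW tu|apply: truncW tv]; rewrite le_max lexx ?orbT.
Qed.

Lemma cvge0_near (x : nat -> \bar R) (e : R) : x @ \oo --> 0%E -> 0 < e ->
  \forall m \near \oo, (x m < e%:E)%E.
Proof.
move=> /fine_cvgP[fx cx] e0; move/(cvgr_lt _ cx): e0 => lx.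
by near=> m; rewrite -(@fineK _ (x m)) ?lte_fin; near: m.
Unshelve. all: by end_near. Qed.

Lemma Vtilde_pick u W (e : R) : inH u -> isVtilde c a u W -> 0 < e -> exists phi : 'I_n -> R -> C,
  [/\ forall k, testC (phi k), hn (fun k x => phi k x - u k x) <= e &
      (nq c a (fun k s => Vc c a phi k s - W k s)%R <= e%:E)%E].
Proof.
move=> hu [hW hV] e0; have [phi tphi cphi] := test_seq hu.
have cV := hV phi tphi cphi.
have [N1 _ h1] := cvge0_near cphi e0.
have [N2 _ h2] := cvge0_near cV e0.
exists (phi (maxn N1 N2)); split; first exact: tphi.
  rewrite -lee_fin -nHhn; last by apply: inHB => //; exact: inH_test.
  by apply: ltW; apply: h1; exact: leq_maxl.
rewrite -distq_Vop; last by move=> k; exact: crint_testC.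
by apply: ltW; apply: h2; exact: leq_maxr.
Qed.

(** The constant 8 is the product of three factors 2: the triangle inequality in L2_q, the Bessel
    bound, and the triangle inequality in H, when passing from [h] to a test function and from there
    to [u]. *)
Lemma Vtilde_dist X u W h : inH u -> isVtilde c a u W -> inH h -> trunc X h ->
  (nq c a (fun k s => Vc c a h k s - W k s)%R <= (8 * hn (fun k x => h k x - u k x))%:E)%E.
Proof.
move=> hu hV hh th; apply/lee_addgt0Pr => e e0.
(* The approximation of [u] enters with weight 8 and that of [W] with weight 2. *)
have e10 : 0 < e / 10 by rewrite divr_gt0.
have [phi [tphi h1 h2]] := Vtilde_pick hu hV e10.
have [mW _] := (@inL2qP R n c a c_gt0 W).1 hV.1.
have hphi := inH_test tphi.
have [Y tY] := test_trunc tphi.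
have ih k : crint pos (h k) by exact: crint_trunc hh th.
have ip k : crint pos (phi k) by exact: crint_testC.
apply: le_trans (nq_tri2 (qmeas_Vc ih) (qmeas_Vc ip) mW) _.
have b := besselB hh th hphi tY.
apply: le_trans (leeD (lee_wpmul2l _ b) (lee_wpmul2l _ h2)) _ => //.
rewrite -!EFinM -!EFinD lee_fin.
have := hn_tri2 hh hu hphi; rewrite (hnB_sym hu hphi).
by move: h1; lra.
Qed.

(** [besselB] makes V Lipschitz across truncated functions, so the integral [Vc] is itself the
    extended value. This supplies transforms for the comparison functions [psi] of the converse. *)
Lemma Vtilde_trunc X h : inH h -> trunc X h -> isVtilde c a h (Vc c a h).
Proof.
move=> hh th; have ih k : crint pos (h k) by exact: crint_trunc hh th.
split.
  apply/inL2qP => //; split; first exact: qmeas_Vc.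
  apply: le_lt_trans (bessel a c_gt0 hh th) _.
  by rewrite nHhn// -EFinM ltry.
move=> phi tphi cphi.
have c2 : (2%:E * distH (phi m) h)%E @[m --> \oo] --> (2%:E * 0)%E by apply: cvgeZl.
rewrite mule0 in c2.
apply: (@squeeze_cvge _ _ _ _ (fun=> 0%E) _ (fun m => 2%:E * distH (phi m) h)%E) => //; last exact: cvg_cst.
apply: nearW => m; apply/andP; split.
  exact: (nq_ge0 a c_gt0 (fun k s => Vop c a (phi m) k s - Vc c a h k s)).
rewrite distq_Vop; last by move=> k; exact: crint_testC.
have hphi := inH_test (tphi m); have [Y tY] := test_trunc (tphi m).
apply: le_trans (besselB hphi tY hh th) _.
by rewrite EFinM -nHhn//; exact: inHB.
Qed.

Lemma isometry u W : inH u -> isVtilde c a u W -> nq c a W = nH u.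
Proof.
move=> hu hV; have [mW fW] := (@inL2qP R n c a c_gt0 W).1 hV.1.
have [w wE] : exists w : R, nq c a W = w%:E.
  by exists (fine (nq c a W)); rewrite fineK// ge0_fin_numE// nq_ge0.
rewrite wE nHhn//; congr EFin.
(* Approximating to accuracy [e^2] pays for the large factor [1 + 1/e] of the second term: their
   product is at most [2 e] for [e <= 1]. Both factors [1 + e] then tend to 1. *)
have key e : 0 < e -> e <= 1 -> w <= (1 + e) * ((1 + e) * hn u + 2 * e) + 2 * e /\
   hn u <= (1 + e) * ((1 + e) * w + 2 * e) + 2 * e.
  move=> e0 e1; have ee0 : 0 < e ^+ 2 by rewrite exprn_gt0.
  have [phi [tphi h1 h2]] := Vtilde_pick hu hV ee0.
  have hphi := inH_test tphi.
  have ip k : crint pos (phi k) by exact: crint_testC.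
  have par : nq c a (Vc c a phi) = (hn phi)%:E.
    rewrite -nHhn// -(parseval a c_gt0 tphi); apply: eq_nq => k s ks.
    by rewrite VopE.
  have [d dE] : exists d : R, nq c a (fun k s => Vc c a phi k s - W k s) = d%:E.
    exists (fine (nq c a (fun k s => Vc c a phi k s - W k s))); rewrite fineK// ge0_fin_numE ?nq_ge0//.
    by apply: le_lt_trans h2 _; rewrite ltry.
  have d2 : d <= e ^+ 2 by rewrite -lee_fin -dE.
  have t1 := nq_tri c_gt0 (qmeas_Vc ip) (qmeasB mW (qmeas_Vc ip)) e0.
  have t2 := nq_tri c_gt0 mW (qmeasB (qmeas_Vc ip) mW) e0.
  have t3 := nH_tri hu (inHB hphi hu) e0.
  have t4 := nH_tri hphi (inHB hu hphi) e0.
  have aC (T : Type) (f g : 'I_n -> R -> C) : (fun k x => f k x + (g k x - f k x)) = g.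
    by apply/funext => k; apply/funext => x; rewrite addrC subrK.
  rewrite !(aC R) in t1 t2 t3 t4.
  have sym : nq c a (fun k s => W k s - Vc c a phi k s) = d%:E.
    rewrite -dE -nqN; apply: eq_nq => k s _; exact: opprB.
  rewrite !nHhn// in t3 t4; try exact: inHB.
  rewrite sym par wE in t1; rewrite dE par wE in t2.
  move: t1 t2 t3 t4; rewrite (hnB_sym hu hphi) -!EFinM -!EFinD !lee_fin.
  have s0 : 0 < e^-1 by rewrite invr_gt0.
  have bd x : x <= e ^+ 2 -> (1 + e^-1) * x <= 2 * e.
    move=> hx; have s1 : 0 <= 1 + e^-1 by lra.
    apply: le_trans (ler_wpM2l s1 hx) _.
    have -> : (1 + e^-1) * e ^+ 2 = e * e + (e^-1 * e) * e by ring.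
    rewrite mulVf ?gt_eqF// mul1r.
    have := ler_wpM2l (ltW e0) e1; lra.
  have b1 := bd _ d2; have b2 := bd _ h1.
  move=> t1 t2 t3 t4; have e10 : 0 <= 1 + e by lra.
  split.
    apply: le_trans t1 _; apply: lerD => //; apply: ler_wpM2l => //.
    by apply: le_trans t3 _; apply: lerD.
  apply: le_trans t4 _; apply: lerD => //; apply: ler_wpM2l => //.
  by apply: le_trans t2 _; apply: lerD.
have lim (x y : R) : (forall e, 0 < e -> e <= 1 -> x <= (1 + e) * ((1 + e) * y + 2 * e) + 2 * e) -> 0 <= y -> x <= y.
  move=> hxy y0; apply/ler_addgt0Pl => dl dl0.
  (* Collects the error [2 e y + e^2 y + 4 e + 2 e^2], using [e^2 <= e]. *)
  pose K := 3 * y + 6; have K0 : 0 < K by rewrite /K; lra.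
  pose e := Num.min 1 (dl / K).
  have e0 : 0 < e by rewrite lt_min ltr01 divr_gt0.
  have e1 : e <= 1 by rewrite ge_min lexx.
  have eK : e * K <= dl by rewrite -ler_pdivlMr// ge_min lexx orbT.
  apply: le_trans (hxy e e0 e1) _.
  have ee : e * e <= e by rewrite -[leRHS]mulr1 ler_wpM2l// ltW.
  have eey : e * e * y <= e * y by rewrite ler_wpM2r.
  have -> : (1 + e) * ((1 + e) * y + 2 * e) + 2 * e = y + (2 * (e * y) + e * e * y + 4 * e + 2 * (e * e)) by ring.
  move: eK; rewrite /K => eK.
  have : e * (3 * y + 6) = 3 * (e * y) + 6 * e by ring.
  by move: (e * y) (e * e * y) (e * e) eey ee eK => *; lra.
have w0 : 0 <= w by rewrite -lee_fin -wE nq_ge0.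
apply/eqP; rewrite eq_le; apply/andP; split; apply: lim => //.
- by move=> e e0 e1; have [] := key e e0 e1.
- exact: hn_ge0.
- by move=> e e0 e1; have [] := key e e0 e1.
Qed.

End VtildeTheory.

(** * Sums and multiplication by the spectral variable *)

Section VtildeLimit.
Variable R : realType.
Local Notation C := (R[i]).
Local Notation Re := (@ReC R).
Local Notation Im := (@ImC R).
Local Notation mu := (@lebesgue_measure R).
Local Notation TR := (measurableTypeR R).
Local Notation pos := (@pos_half R : set TR).

Variables (n : nat) (c a : 'I_n -> R).
Hypothesis c_gt0 : forall k, 0 < c k.
Hypothesis a_ge0 : forall k, 0 <= a k.
Implicit Types (u v h : 'I_n -> R -> C).

Lemma qmeasD W Z : qmeas a W -> qmeas a Z -> @qmeas R n a (fun k x => W k x + Z k x).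
Proof. by move=> hW hZ k; exact: cmeasD. Qed.

(** A test sequence tending to [u + v] does not come split. An auxiliary sequence [psi] tending to
    [u] is subtracted from it; the difference tends to [v], and the two known limits add up. *)
Lemma Vtilde_add u v W Z : inH u -> inH v -> isVtilde c a u W -> isVtilde c a v Z ->
  isVtilde c a (fun k x => u k x + v k x) (fun k s => W k s + Z k s).
Proof.
move=> hu hv [hW VW] [hZ VZ].
have [mW fW] := (@inL2qP R n c a c_gt0 W).1 hW; have [mZ fZ] := (@inL2qP R n c a c_gt0 Z).1 hZ.
split.
  apply/inL2qP => //; split; first exact: qmeasD.
  apply: le_lt_trans (nq_tri c_gt0 mW mZ ltr01) _.
  by apply: lte_add_pinfty; apply: lte_mul_pinfty => //; rewrite lee_fin// invr1.
move=> phi tphi cphi; have [psi tpsi cpsi] := test_seq hu.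
pose chi m := axpy (-1) (phi m) (psi m).
have tchi m k : testC (chi m k).
  rewrite /chi axpyN1; split.
    rewrite (_ : _ \o _ = (fun x => Re (phi m k x) + (-1) * Re (psi m k x))).
      by apply: testD; [exact: (tphi m k).1|apply: testZ; exact: (tpsi m k).1].
    by apply/funext => x; rewrite /comp !CE mulN1r.
  rewrite (_ : _ \o _ = (fun x => Im (phi m k x) + (-1) * Im (psi m k x))).
    by apply: testD; [exact: (tphi m k).2|apply: testZ; exact: (tpsi m k).2].
  by apply/funext => x; rewrite /comp !CE mulN1r.
have huv : inH (fun k x => u k x + v k x).
  rewrite (_ : (fun k x => _) = axpy 1 u v); first exact: inH_axpy.
  by apply/funext => k; apply/funext => x; rewrite /axpy toC1 mul1r.
have hphi m := inH_test (tphi m); have hpsi m := inH_test (tpsi m); have hchi m := inH_test (tchi m).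
have cchi : (fun m => distH (chi m) v) @ \oo --> 0%E.
  pose B m := (2%:E * distH (phi m) (fun k x => u k x + v k x)%R + 2%:E * distH (psi m) u)%E.
  have c2 : B m @[m --> \oo] --> (2%:E * 0 + 2%:E * 0)%E.
    by apply: cvgeD; [rewrite !mule0|apply: cvgeZl|apply: cvgeZl].
  rewrite !mule0 adde0 in c2.
  apply: (@squeeze_cvge _ _ _ _ (fun=> 0%E) _ B) => //; last exact: cvg_cst.
  apply: nearW => m; apply/andP; split.
    exact: (nH_ge0 (fun k x => chi m k x - v k x)).
  have := nH_tri (inHB (hphi m) huv) (inHB hu (hpsi m)) ltr01.
  rewrite invr1 (nH_subC u (psi m)); apply: le_trans; rewrite le_eqVlt; apply/orP; left; apply/eqP.
  rewrite /distH -/(nH (fun k x => chi m k x - v k x)); congr nH.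
  by apply/funext => k; apply/funext => x; rewrite /chi axpyN1; ring.
have cV1 := VW psi tpsi cpsi; have cV2 := VZ chi tchi cchi.
pose B m := (2%:E * distq c a (Vop c a (psi m)) W + 2%:E * distq c a (Vop c a (chi m)) Z)%E.
have c2 : B m @[m --> \oo] --> (2%:E * 0 + 2%:E * 0)%E.
  by apply: cvgeD; [rewrite !mule0|apply: cvgeZl|apply: cvgeZl].
rewrite !mule0 adde0 in c2.
apply: (@squeeze_cvge _ _ _ _ (fun=> 0%E) _ B) => //; last exact: cvg_cst.
apply: nearW => m; apply/andP; split.
  exact: (nq_ge0 a c_gt0 (fun k s => Vop c a (phi m) k s - (W k s + Z k s))).
have ip k : crint pos (phi m k) by exact: crint_testC.
have iq k : crint pos (psi m k) by exact: crint_testC.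
have ir k : crint pos (chi m k) by exact: crint_testC.
rewrite /B !distq_Vop//.
have := nq_tri c_gt0 (qmeasB (qmeas_Vc a c_gt0 iq) mW) (qmeasB (qmeas_Vc a c_gt0 ir) mZ) ltr01.
rewrite invr1; apply: le_trans; rewrite le_eqVlt; apply/orP; left; apply/eqP; congr nq.
apply/funext => k; apply/funext => s.
rewrite /chi axpyN1 VcB//; ring.
Qed.

(** This expresses closedness of multiplication by [l]. On [s <= N] the factor is at most [N]
    (thresholds being nonnegative), so approximants may be taken as close as [N] demands; the
    resulting bound on [V phi - l W] does not depend on [N], and Fatou lets [N] grow. *)
Lemma Vtilde_limit u v W : inH u -> inH v -> isVtilde c a u W ->
  (forall e : R, 0 < e -> exists X f g,
    [/\ inH f, inH g, trunc X f & trunc X g] /\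
    [/\ hn (fun k x => f k x - u k x) <= e, hn (fun k x => g k x - v k x) <= e &
        forall k s, a k < s -> Vc c a g k s = toC s * Vc c a f k s]) ->
  isVtilde c a v (fun k s => toC s * W k s).
Proof.
move=> hu hv hV approx; have [mW fW] := (@inL2qP R n c a c_gt0 W).1 hV.1.
have mlW : @qmeas R n a (fun k s => toC s * W k s).
  move=> k; apply: cmeasM => //; apply: cmeas_toC; exact: measurable_id.
have key phi : (forall k, testC (phi k)) ->
   (nq c a (fun k s => Vc c a phi k s - toC s * W k s)%R <=
    ((8 * hn (fun k x => phi k x - v k x)) *+ n)%:E)%E.
  move=> tphi; have hphi := inH_test tphi; have [Y tY] := test_trunc tphi.
  have ip k : crint pos (phi k) by exact: crint_testC.
  rewrite -[X in _ *+ X]card_ord -sumr_const -sumEFin; apply: lee_sum => k _.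
  set D := (`]a k, +oo[%classic : set TR).
  have mD : measurable D by exact: measurable_ray.
  pose G s := sqmod (Vc c a phi k s - toC s * W k s) * qfun c a k s.
  have mG : measurable_fun D G.
    apply: measurable_funM; last by apply: measurable_funTS; exact: meas_qfun.
    by apply: meas_sqmod; exact: (qmeasB (qmeas_Vc a c_gt0 ip) mlW k).
  pose cut (N : nat) (s : R) : R := (s <= N%:R)%R%:R.
  have mcut N : measurable_fun setT (cut N : TR -> R).
    rewrite (_ : cut N = \1_(`]-oo, N%:R]%classic : set TR)); last first.
    apply/funext => y; rewrite indicE; congr (nat_of_bool _)%:R.
    by apply/idP/idP => [yx|/set_mem/=]; [apply/mem_set; rewrite /= in_itv|rewrite in_itv].
    by apply: measurable_indic; exact: measurable_itv.
  have cut0 N s : 0 <= cut N s by rewrite ler0n.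
  pose w N s := qfun c a k s * cut N s.
  have mw N : measurable_fun D (w N).
    by apply: measurable_funM; apply: measurable_funTS; [exact: meas_qfun|exact: mcut].
  have w0 N s : 0 <= w N s by rewrite mulr_ge0 ?qfun_ge0.
  apply: (@fatou_bound _ _ _ mu D mD (fun N s => G s * cut N s) G _ 0%N).
  - by move=> N; apply: measurable_funM => //; exact: measurable_funTS.
  - by move=> N s _; rewrite mulr_ge0// mulr_ge0 ?sqmod_ge0 ?qfun_ge0.
  - move=> s _; apply: cvg_near_cst; near=> N; rewrite /cut (_ : (s <= N%:R) = true) ?mulr1//.
    by near: N; apply: nbhs_infty_ger; exact: num_real.
  move=> N _; apply/lee_addgt0Pr => e e0.
  (* With accuracy [e / K] the errors of [g] and [f] enter with weights 8 and [16 N^2], so they sum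
     to [e]. *)
  pose K : R := 8 + 16 * N%:R ^+ 2.
  have K0 : 0 < K by rewrite /K ltr_wpDr// mulr_ge0// sqr_ge0.
  have eK0 : 0 < e / K by rewrite divr_gt0.
  have [X [f [g [[hf hg tf tg] [fu gv Vgf]]]]] := approx _ eK0.
  have iff_ k' : crint pos (f k') by exact: crint_trunc hf tf.
  have ig k' : crint pos (g k') by exact: crint_trunc hg tg.
  have GE s : D s -> G s * cut N s =
      sqmod ((Vc c a phi k s - Vc c a g k s) + toC s * (Vc c a f k s - W k s)) * w N s.
    rewrite /D/= in_itv/= andbT => ks; rewrite /G /w mulrA; congr (sqmod _ * _ * _).
    by rewrite Vgf//; ring.
  have -> : (\int[mu]_(s in D) (G s * cut N s)%:E = \int[mu]_(s in D)
     (sqmod ((Vc c a phi k s - Vc c a g k s) + toC s * (Vc c a f k s - W k s)) * w N s)%:E)%E.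
    by apply: eq_integral => s /set_mem Ds; rewrite GE.
  have mB1 : cmeas D (fun s => Vc c a phi k s - Vc c a g k s).
    exact: (qmeasB (qmeas_Vc a c_gt0 ip) (qmeas_Vc a c_gt0 ig) k).
  have mB2 : cmeas D (fun s => Vc c a f k s - W k s).
    exact: (qmeasB (qmeas_Vc a c_gt0 iff_) mW k).
  have mB3 : cmeas D (fun s => toC s * (Vc c a f k s - W k s)).
    by apply: cmeasM => //; apply: cmeas_toC; exact: measurable_id.
  apply: le_trans (weighted_tri mD (mw N) (w0 N) mB1 mB3 ltr01) _.
  have one (Z : 'I_n -> R -> C) : (\int[mu]_(s in D) (sqmod (Z k s) * qfun c a k s)%:E <= nq c a Z)%E.
    rewrite /nq (bigD1 k)//= leeDl// sume_ge0 // => i _.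
    by apply: integral_ge0 => x _; rewrite lee_fin mulr_ge0 ?sqmod_ge0 ?qfun_ge0.
  have I1 : (\int[mu]_(s in D) (sqmod (Vc c a phi k s - Vc c a g k s) * w N s)%:E <=
             (2 * hn (fun k x => phi k x - g k x))%:E)%E.
    apply: le_trans (besselB a c_gt0 hphi tY hg tg).
    apply: le_trans (one (fun k s => Vc c a phi k s - Vc c a g k s)).
    apply: ge0_le_integral => //.
    - by move=> s _; rewrite lee_fin mulr_ge0 ?sqmod_ge0 ?w0.
    - by apply/measurable_EFinP; apply: measurable_funM => //; exact: meas_sqmod.
    - apply/measurable_EFinP; apply: measurable_funM; first exact: meas_sqmod.
      by apply: measurable_funTS; exact: meas_qfun.
    move=> s _; rewrite lee_fin; apply: ler_wpM2l; first exact: sqmod_ge0.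
    by rewrite /w; apply: ler_piMr; [exact: qfun_ge0|rewrite /cut lern1; case: (s <= _)].
  have I2 : (\int[mu]_(s in D) (sqmod (toC s * (Vc c a f k s - W k s)) * w N s)%:E <=
             (N%:R ^+ 2 * (8 * hn (fun k x => f k x - u k x)))%:E)%E.
    rewrite EFinM; apply: le_trans (lee_wpmul2l _ (Vtilde_dist c_gt0 hu hV hf tf)); last first.
      by rewrite lee_fin sqr_ge0.
    apply: le_trans (lee_wpmul2l _ (one (fun k s => Vc c a f k s - W k s))); last first.
      by rewrite lee_fin sqr_ge0.
    have mq : measurable_fun D (fun s => (sqmod (Vc c a f k s - W k s) * qfun c a k s)%:E).
      apply/measurable_EFinP; apply: measurable_funM; first exact: meas_sqmod.
      by apply: measurable_funTS; exact: meas_qfun.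
    rewrite -ge0_integralZl_EFin//; try exact: sqr_ge0; try by move=> s _; rewrite lee_fin mulr_ge0 ?sqmod_ge0 ?qfun_ge0.
    apply: ge0_le_integral => //.
    - by move=> s _; rewrite lee_fin mulr_ge0 ?sqmod_ge0 ?w0.
    - by apply/measurable_EFinP; apply: measurable_funM => //; exact: meas_sqmod.
    - exact: measurable_funeM.
    move=> s; rewrite /D/= in_itv/= andbT => ks; rewrite lee_fin sqmodM sqmod_toC /w /cut.
    have [sN|sN] := leP s N%:R; last first.
      by rewrite !mulr0 !mulr_ge0 ?sqmod_ge0 ?qfun_ge0 ?sqr_ge0.
    rewrite mulr1 -mulrA; apply: ler_wpM2r; first by rewrite mulr_ge0 ?sqmod_ge0 ?qfun_ge0.
    have s0 : 0 <= s by rewrite (le_trans (a_ge0 k))// ltW.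
    by rewrite lerXn2r// nnegrE ler0n.
  apply: le_trans (leeD (lee_wpmul2l _ I1) (lee_wpmul2l _ I2)) _ => //; rewrite ?invr1//.
  rewrite -!EFinM -!EFinD lee_fin.
  have h3 := hn_tri2 hphi hv hg; rewrite (hnB_sym hv hg) in h3.
  have h4 : 8 * (e / K) + 16 * (N%:R ^+ 2 * (e / K)) = e.
    have E q : 8 * q + 16 * (N%:R ^+ 2 * q) = q * K by rewrite /K; ring.
    by rewrite E divfK// gt_eqF.
  have h5 := ler_wpM2l (sqr_ge0 (N%:R : R)) fu.
  rewrite [N%:R ^+ 2 * (8 * _)]mulrCA.
  move: gv h3 h4 h5; set P := N%:R ^+ 2 * (e / K); set Q := N%:R ^+ 2 * hn (fun k x => f k x - u k x); set q := e / K.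
  set A := hn (fun k x => phi k x - g k x); set B := hn (fun k x => phi k x - v k x); set B' := hn _.
  by clearbody P Q q A B B' => *; lra.
split.
  apply/inL2qP => //; split => //.
  have [phi tphi _] := test_near hu ltr01.
  have ip k : crint pos (phi k) by exact: crint_testC.
  have mV := qmeas_Vc a c_gt0 ip.
  have := nq_tri c_gt0 (qmeasB mlW mV) mV ltr01.
  have -> : (fun k x => toC x * W k x - Vc c a phi k x + Vc c a phi k x) = fun k x => toC x * W k x.
    by apply/funext => k; apply/funext => s; rewrite subrK.
  have -> : nq c a (fun k x => toC x * W k x - Vc c a phi k x) =
      nq c a (fun k x => Vc c a phi k x - toC x * W k x).
    by rewrite -nqN; apply: eq_nq => k s _; exact: opprB.
  move=> h; apply: le_lt_trans h _; have [Y tY] := test_trunc tphi.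
  apply: lte_add_pinfty; apply: lte_mul_pinfty => //; rewrite ?lee_fin ?invr1//.
    by apply: le_lt_trans (key phi tphi) _; rewrite ltry.
  apply: le_lt_trans (bessel a c_gt0 (inH_test tphi) tY) _.
  by rewrite (nHhn (inH_test tphi)) -EFinM ltry.
move=> phi tphi cphi.
pose B m := ((8 *+ n)%:E * distH (phi m) v)%E.
have c2 : B m @[m --> \oo] --> ((8 *+ n)%:E * 0)%E by apply: cvgeZl.
rewrite mule0 in c2.
apply: (@squeeze_cvge _ _ _ _ (fun=> 0%E) _ B) => //; last exact: cvg_cst.
apply: nearW => m; apply/andP; split.
  exact: (nq_ge0 a c_gt0 (fun k s => Vop c a (phi m) k s - toC s * W k s)).
rewrite distq_Vop//; last by move=> k; exact: crint_testC.
apply: le_trans (key _ (tphi m)) _.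
rewrite /B /distH -/(nH (fun k x => phi m k x - v k x)) nHhn ?lee_fin ?mulrnAl//.
by apply: inHB => //; exact: inH_test.
Unshelve. all: by end_near. Qed.
End VtildeLimit.

(** * Weak derivatives *)

Section WeakPrimitive.
Variable R : realType.
Local Notation mu := (@lebesgue_measure R).
Local Notation TR := (measurableTypeR R).
Local Notation pos := (@pos_half R : set TR).
Implicit Types (f g h phi : R -> R) (b x t : R).

Let mpos : measurable pos := @measurable_pos_half R.

(** Integrability up to the vertex, not merely on compact subsets of the open half-line. It allows
    primitives starting at 0 and test functions that do not vanish there. *)
Definition lint g := forall X, rint mu `]0, X[ g.

Lemma lint_meas g : lint g -> measurable_fun pos g.
Proof.
move=> hg; have -> : pos = \bigcup_m (`]0, m%:R[%classic : set TR).
  rewrite eqEsubset; split=> [x /= x0|x [m _] /=]; last by rewrite in_itv/= => /andP[].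
  have [m _ hm] : \forall m \near \oo, x < m%:R by apply: nbhs_infty_gtr; exact: num_real.
  by exists m => //=; rewrite in_itv/= [0 < x]x0 hm/=.
by apply/measurable_fun_bigcup => [m|m]; [|exact: rint_meas (hg _)].
Qed.

Lemma L2r_lint g : L2r mu pos g -> lint g.
Proof. by move=> hg X; apply: L2r_rint; exact: L2rS. Qed.

Lemma continuous_lint g : continuous g -> lint g.
Proof.
move=> cg X; apply: (@integrableS _ _ _ mu `[0, X]%classic) => //.
  by apply: subset_itv; rewrite bnd_simp.
exact: rint_itv.
Qed.

Lemma lintD f g k : lint f -> lint g -> lint (fun x => f x + k * g x).
Proof. by move=> hf hg X; apply: rintD => //; exact: rintZ. Qed.

Lemma continuous_bounded_itv phi (c d : R) : continuous phi -> exists K, forall x, c <= x <= d -> `|phi x| <= K.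
Proof.
move=> cp; have [cd|dc] := leP c d; last first.
  by exists 0 => x /andP[h1 h2]; have := le_trans h1 h2; rewrite leNgt dc.
have [|e _ he] := @EVT_max R (fun x => `|phi x|) c d cd.
  apply: continuous_subspaceT => x; apply: cvg_norm; exact: cp.
by exists (`|phi e|) => x xcd; apply: he; rewrite in_itv.
Qed.

Lemma lint_mul g phi b : lint g -> continuous phi -> (forall x, b <= x -> phi x = 0) ->
  rint mu pos (fun x => g x * phi x).
Proof.
move=> hg cp p0; apply/(@rint_trunc _ b); first by move=> x hx; rewrite p0// mulr0.
have [K hK] := @continuous_bounded_itv phi 0 b cp.
have mD : measurable (`]0, b[%classic : set TR) by [].
apply: (rint_le mD _ (rintZ K mD (rint_norm mD (hg b)))).
  apply: measurable_funM; first exact: rint_meas (hg b).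
  by apply: measurable_funTS; exact: continuous_measurable_fun.
move=> x /=; rewrite in_itv/= => /andP[x0 xb].
by rewrite normrM mulrC ler_wpM2r// hK// !ltW.
Qed.

(** The primitive vanishing at 0. Starting at [- 1] with [g] extended by 0 makes it a continuous
    function on the whole line, so 0 is an interior point and two-sided results apply. *)
Definition prim g x := Rintegral mu `[-1, x] (g \_ pos).

Lemma prim_neg g x : x <= 0 -> prim g x = 0.
Proof.
move=> x0; rewrite /prim /Rintegral integral0_eq// => y /=; rewrite in_itv/= => /andP[_ yx].
by rewrite patchE; case: ifPn => // /set_mem/=; rewrite /pos_half/= ltNge (le_trans yx x0).
Qed.

Let rint_ext g X : lint g -> rint mu `[-1, X] (g \_ pos).
Proof.
move=> hg; have m1 : measurable (`[-1, X]%classic : set TR) by [].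
have mD : measurable (`]0, X + 1[%classic : set TR) by [].
apply/(rint_mkcond _ _ m1).
have := (rint_mkcond mu g mD).1 (hg (X + 1)).
move=> h; apply: (rint_le measurableT _ (rint_norm measurableT h)).
  apply/(measurable_restrictT _ _).1 => //.
  apply: measurable_funTS; apply/(measurable_restrictT _ _).1 => //; exact: lint_meas.
move=> x _; rewrite !patchE; case: ifPn => [/set_mem/=|_]; last by rewrite normr0.
rewrite in_itv/= => /andP[_ xX]; case: ifPn => [/set_mem x0|_]; last by rewrite normr0.
by rewrite mem_set//= in_itv/= [0 < x]x0/=; lra.
Qed.

Lemma prim_continuous g : lint g -> continuous (prim g).
Proof.
move=> hg x; have [x0|x0] := ltP x 0.
  rewrite /continuous_at prim_neg ?(ltW x0)//; apply: cvg_near_cst; near=> y.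
  by apply: prim_neg; apply: ltW; near: y; exact: lt_nbhsl.
have := @parameterized_integral_continuous R (-1) (x + 1) (g \_ pos); move=> /(_ _ (rint_ext _ hg)).
have le1 : -1 <= x + 1 by lra.
move=> /(_ le1) cw.
have lt1 : -1 < x + 1 by lra.
have [h _ _] := (continuous_within_itvP _ lt1).1 cw.
by apply: h; rewrite in_itv/=; apply/andP; split; lra.
Unshelve. all: by end_near. Qed.

Lemma primE g x : 0 < x -> lint g -> prim g x = Rintegral mu pos (fun y => g y * (y <= x)%R%:R).
Proof.
move=> x0 hg; rewrite /prim Rintegral_mkcond [RHS]Rintegral_mkcond; apply: eq_Rintegral => y _.
rewrite !patchE; case: ifPn => [/set_mem/=|].
  rewrite in_itv/= => /andP[_ ->]; case: ifPn => // _; by rewrite mulr1.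
move=> h; case: ifPn => // /set_mem y0; case: leP => yx; rewrite ?mulr0//.
case/negP: h; apply/mem_set; rewrite /= in_itv/= yx andbT.
by rewrite (le_trans _ (ltW y0)).
Qed.

Lemma prim_derive g x : continuous g -> (forall y, y <= 0 -> g y = 0) -> is_derive x 1 (prim g) (g x).
Proof.
move=> cg g0; have gE : g \_ pos = g.
  apply/funext => y; rewrite patchE; case: ifPn => // h; rewrite g0// leNgt.
  by apply: contra h => y0; apply/mem_set.
have [x0|x0] := ltP x 0.
  rewrite (g0 _ (ltW x0)); apply: near_eq_is_derive (is_derive_cst 0 x 1).
  by near=> y; rewrite prim_neg//; apply: ltW; near: y; exact: lt_nbhsl.
have xx1 : x < x + 1 by rewrite ltrDl.
have := @continuous_FTC1_closed R g (-1) x (x + 1) xx1.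
have hi : mu.-integrable `[-1, x + 1] (EFin \o g).
  by rewrite -{1}gE; apply: rint_ext; exact: continuous_lint.
have xm : -1 < x by lra.
move=> /(_ hi xm (cg x)) [d1 d2].
rewrite /prim gE; rewrite -[g x]d2; rewrite derive1E; exact: derivableP.
Unshelve. all: by end_near. Qed.

Lemma rint_smooth phi b : smoothR phi -> (forall x, b <= x -> phi x = 0) -> rint mu pos phi.
Proof.
move=> sp p0; rewrite pos_halfE; apply: (@rint_ray _ _ _ (Num.max 0 b)).
- by rewrite le_max lexx.
- exact: smooth_continuous.
- by move=> x; rewrite ge_max => /andP[_ h]; exact: p0.
Qed.

Lemma derive1_supp phi b x : smoothR phi -> (forall x, b <= x -> phi x = 0) -> b <= x -> derive1 phi x = 0.
Proof.
move=> sp p0; rewrite le_eqVlt => /predU1P[<-|bx]; last first.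
  apply: is_derive_derive1; apply: near_eq_is_derive (is_derive_cst 0 x 1).
  by near=> y; rewrite p0//; apply: ltW; near: y; exact: lt_nbhsr.
have cd : derive1 phi @ b --> derive1 phi b.
  by apply: smooth_continuous; exact: smooth_derive1.
have := cvg_at_right_filter cd => /(cvg_lim (@Rhausdorff R)) <-.
apply/cvg_lim => //; apply: cvg_near_cst; near=> y.
apply: is_derive_derive1; apply: near_eq_is_derive (is_derive_cst 0 y 1).
have yb : b < y by near: y; exact: nbhs_right_gt.
by near=> z; rewrite p0//; apply: ltW; near: z; exact: lt_nbhsr.
Unshelve. all: by end_near. Qed.

Lemma Rint_derive phi b y : smoothR phi -> (forall x, b <= x -> phi x = 0) ->
  Rintegral mu (`]y, +oo[%classic) (derive1 phi) = - phi y.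
Proof.
move=> sp p0; apply: (@FTC_ray _ _ _ _ (Num.max y b)).
- by rewrite le_max lexx.
- by move=> x; exact: smooth_is_derive.
- exact: smooth_continuous (smooth_derive1 sp).
- by move=> x; rewrite ge_max => /andP[_ h]; exact: derive1_supp p0 h.
- by rewrite p0// le_max lexx orbT.
Qed.

(** Fubini on the triangle [y <= s]: the kernel [K] is [dphi s] there, and its integral in [s] is
    [- phi y]. No differentiability of [prim g] enters, and [phi] is free at 0 because [prim g]
    vanishes there. *)
Lemma prim_by_parts_C1 g phi dphi b : lint g -> (forall x, is_derive x 1 phi (dphi x)) ->
  continuous dphi -> (forall x, b <= x -> phi x = 0) -> (forall x, b <= x -> dphi x = 0) ->
  Rintegral mu pos (fun x => prim g x * dphi x) = - Rintegral mu pos (fun x => g x * phi x).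
Proof.
move=> hg dp cd p0 d0.
have cp : continuous phi.
  move=> x; apply: differentiable_continuous; apply/derivable1_diffP.
  by case: (dp x).
have id_ : rint mu pos dphi.
  rewrite pos_halfE; apply: (@rint_ray _ _ _ (Num.max 0 b)) => //; first by rewrite le_max lexx.
  by move=> x; rewrite ge_max => /andP[_ h]; exact: d0.
have mD : measurable (`]0, b[%classic : set TR) by [].
pose w (s : R) := `|(dphi \_ pos) s|.
have iw : rint mu setT w.
  by apply: rint_norm => //; apply/(rint_mkcond _ _ mpos); exact: id_.
pose K (p : TR * TR) : R := if p.1 <= p.2 then (dphi \_ pos) p.2 else 0.
have mK : measurable_fun setT K.
  apply: measurable_fun_ifT.
  - by apply: measurable_fun_ler; [exact: measurable_fst|exact: measurable_snd].
  - apply: measurableT_comp; last exact: measurable_snd.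
    apply/(measurable_restrictT _ _).1 => //; apply: measurable_funTS; exact: continuous_measurable_fun.
  - exact: measurable_cst.
have Kw y s : (`]0, b[%classic : set TR) y -> `|K (y, s)| <= w s.
  by move=> _; rewrite /K /w /=; case: ifP => // _; rewrite normr0 normr_ge0.
have := @fubini_dom R (`]0, b[%classic) g w K mD (hg b) iw mK Kw.
have -> : Rintegral mu `]0, b[ (fun y => g y * Rintegral mu setT (fun s => K (y, s))) =
    - Rintegral mu pos (fun x => g x * phi x).
  rewrite -(@Rintegral_trunc _ b); last by move=> x hx; rewrite p0// mulr0.
  rewrite -(@RintN _ _ _ mu)//; last first.
    apply/(@rint_trunc _ b); first by move=> x hx; rewrite p0// mulr0.
    by apply: (@lint_mul _ _ b).
  apply: eq_Rintegral => y /set_mem/=; rewrite in_itv/= => /andP[y0 yb].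
  rewrite -mulrN; congr (_ * _).
  have <- : Rintegral mu (`]y, +oo[%classic) dphi = - phi y.
    apply: (@FTC_ray _ _ _ _ (Num.max y b)) => //; first by rewrite le_max lexx.
      by move=> x; rewrite ge_max => /andP[_ h]; exact: d0.
    by rewrite p0// le_max lexx orbT.
  rewrite Rintegral_itv_obnd_cbnd; last first.
    apply: (@integrableS _ _ _ mu pos) => //.
    by move=> s /=; rewrite in_itv/= andbT; exact: lt_trans.
  rewrite [RHS]Rintegral_mkcond; apply: eq_Rintegral => s _; rewrite /K /= !patchE.
  have [ys|ys] := boolP (y <= s).
    have -> : s \in pos by apply/mem_set; exact: lt_le_trans ys.
    by rewrite mem_set//= in_itv/= ys.
  by rewrite memNset//= in_itv/= (negbTE ys).
move=> <-; rewrite [LHS]Rintegral_mkcond; apply: eq_Rintegral => s _; rewrite patchE.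
case: ifPn => [/set_mem s0|s0]; last first.
  rewrite /Rintegral integral0_eq// => y _; rewrite /K /= patchE (negbTE s0).
  by case: ifP; rewrite mulr0.
rewrite primE// (_ : Rintegral mu `]0, b[ _ =
   Rintegral mu `]0, b[ (fun y => dphi s * (g y * (y <= s)%R%:R))); last first.
  apply: eq_Rintegral => y _; rewrite /K /= patchE mem_set//.
  by case: (y <= s); rewrite ?mulr1 ?mulr0// mulrC.
have [sb|bs] := ltP s b; last first.
  by rewrite d0// mulr0; under eq_Rintegral do rewrite mul0r; rewrite /Rintegral integral0.
have tr y : b <= y -> g y * (y <= s)%R%:R = 0.
  by move=> hy; rewrite (_ : (y <= s) = false) ?mulr0//; apply/negbTE; rewrite -ltNge (lt_le_trans sb).
rewrite (@RintZ _ _ _ mu)//; last first.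
  apply: (rint_le mD _ (rint_norm mD (hg b))).
    apply: measurable_funM; first exact: rint_meas (hg b).
    rewrite (_ : (fun y => _) = \1_(`]-oo, s]%classic : set TR)); last first.
      apply/funext => y; rewrite indicE; congr (nat_of_bool _)%:R.
      by apply/idP/idP => [yx|/set_mem/=]; [apply/mem_set; rewrite /= in_itv|rewrite in_itv].
    exact: measurable_funTS.
  by move=> y _; rewrite normrM; case: (y <= s); rewrite ?normr1 ?mulr1// normr0 mulr0.
by rewrite (Rintegral_trunc tr) mulrC.
Qed.

Lemma prim_by_parts g phi b : lint g -> smoothR phi -> (forall x, b <= x -> phi x = 0) ->
  Rintegral mu pos (fun x => prim g x * derive1 phi x) = - Rintegral mu pos (fun x => g x * phi x).
Proof.
move=> hg sp p0; apply: (@prim_by_parts_C1 _ _ _ b) => //.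
- by move=> x; exact: smooth_is_derive.
- exact: smooth_continuous (smooth_derive1 sp).
- by move=> x; exact: derive1_supp.
Qed.

End WeakPrimitive.

(** * Weak derivatives and traces on the half-line *)

Section WeakDerivative.
Variable R : realType.
Local Notation mu := (@lebesgue_measure R).
Local Notation TR := (measurableTypeR R).
Local Notation pos := (@pos_half R : set TR).
Implicit Types (f g h phi : R -> R) (b x t : R).

Let mpos : measurable pos := @measurable_pos_half R.

Definition cutoff x := 1 + (-1) * sstep (1 * x + (-1)).

Lemma smooth_cutoff : smoothR cutoff.
Proof.
apply: smoothD; first exact: smooth_cst.
by apply: smoothZ; apply: smooth_comp_lin; exact: smooth_sstep.
Qed.

Lemma cutoff1 x : x <= 1 -> cutoff x = 1.
Proof. by move=> x1; rewrite /cutoff sstep0 ?mulr0 ?addr0//; lra. Qed.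

Lemma cutoff0 x : 2 <= x -> cutoff x = 0.
Proof. by move=> x2; rewrite /cutoff sstep1; lra. Qed.

Lemma cutoff_01 x : 0 <= cutoff x <= 1.
Proof. by rewrite /cutoff; have := sstep_ge0 (1 * x + (-1)); have := sstep_le1 (1 * x + (-1)); lra. Qed.

Lemma derive1_loc_cst f x (r : R) : (\forall y \near x, f y = r) -> derive1 f x = 0.
Proof.
move=> h; apply: is_derive_derive1; apply: near_eq_is_derive (is_derive_cst r x 1).
by apply: filterS h => y ->.
Qed.

Lemma derive1_cutoff0 x : x < 1 \/ 2 < x -> derive1 cutoff x = 0.
Proof.
case=> hx; [apply: (@derive1_loc_cst _ _ 1)|apply: (@derive1_loc_cst _ _ 0)]; near=> y.
  by rewrite cutoff1//; apply: ltW; near: y; exact: lt_nbhsl.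
by rewrite cutoff0//; apply: ltW; near: y; exact: lt_nbhsr.
Unshelve. all: by end_near. Qed.

Lemma test_unit : exists2 rho, testR rho & Rintegral mu pos rho = 1.
Proof.
exists (fun x => (-1) * derive1 cutoff x).
  apply: testZ; split; first exact: smooth_derive1 smooth_cutoff.
  by exists 1, 2; split => // x; exact: derive1_cutoff0.
rewrite (@RintZ _ _ _ mu)//; last first.
  apply: (@rint_smooth _ _ 3); first exact: smooth_derive1 smooth_cutoff.
  by move=> x hx; apply: derive1_cutoff0; right; lra.
rewrite pos_halfE (@Rint_derive _ _ 2); [|exact: smooth_cutoff|exact: cutoff0].
by rewrite cutoff1// mulrNN mulr1.
Qed.

Lemma smooth_prim phi psi : (forall x, is_derive x 1 psi (phi x)) -> smoothR phi -> smoothR psi.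
Proof.
move=> d sp [|m] x; first by case: (d x).
rewrite derive1Sn (_ : derive1 psi = phi); first exact: sp.
by apply/funext => y; exact: is_derive_derive1.
Qed.

Lemma test_prim k : testR k -> Rintegral mu pos k = 0 ->
  testR (prim k) /\ derive1 (prim k) = k.
Proof.
move=> tk k0; have [al [be [al0 _ ha hb]]] := test_supp tk.
have ck := smooth_continuous tk.1.
have kneg y : y <= 0 -> k y = 0 by move=> y0; apply: ha; rewrite (le_trans y0)// ltW.
have dk x : is_derive x 1 (prim k) (k x) by exact: prim_derive.
have lk := continuous_lint ck.
split; last by apply/funext => x; exact: is_derive_derive1.
split; first exact: smooth_prim dk tk.1.
exists al, (Num.max be 1); split => // x [xa|].
  have [x0|x0] := leP x 0; first exact: prim_neg.
  rewrite primE// /Rintegral integral0_eq// => y _; case: leP => yx; rewrite ?mulr0// ha ?mul0r//.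
  by rewrite (le_trans yx)// ltW.
rewrite gt_max => /andP[bx x1]; rewrite primE//; last by rewrite (lt_trans _ x1).
rewrite -[RHS]k0; apply: eq_Rintegral => y _; case: leP => yx; rewrite ?mulr1// mulr0 hb//.
by rewrite (le_trans _ (ltW yx))// ltW.
Qed.

Lemma rint_lint_test f phi : lint f -> testR phi -> rint mu pos (fun x => f x * phi x).
Proof.
move=> hf tp; have [_ [b [_ _ _ hb]]] := test_supp tp.
by apply: (@lint_mul _ _ _ b) => //; exact: smooth_continuous tp.1.
Qed.

(** Subtracting [(int phi) rho], with [rho] of integral 1, leaves a test function of integral 0,
    whose primitive is again a test function. Hence pairing [h] with [phi] only sees [int phi], and
    the constant is the pairing with [rho]. *)
Lemma weak_const h : lint h ->
  (forall phi, testR phi -> Rintegral mu pos (fun x => h x * derive1 phi x) = 0) ->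
  exists C, {ae mu, forall x, 0 < x -> h x = C}.
Proof.
move=> hl h0; have [rho trho rho1] := test_unit.
pose C := Rintegral mu pos (fun x => h x * rho x); exists C.
have key phi : testR phi -> Rintegral mu pos (fun x => h x * phi x) = Rintegral mu pos phi * C.
  move=> tphi; pose m := Rintegral mu pos phi.
  pose k x := phi x + (- m) * rho x.
  have tk : testR k by apply: testD => //; exact: testZ.
  have k0 : Rintegral mu pos k = 0.
    rewrite /k (@RintD _ _ _ mu)//; [|exact: rint_test|by apply: rintZ => //; exact: rint_test].
    by rewrite (@RintZ _ _ _ mu)// ?rho1 ?mulr1 ?subrr//; exact: rint_test.
  have [tK dK] := test_prim tk k0.
  have := h0 _ tK; rewrite dK /k.
  rewrite (_ : (fun x => _) = fun x => h x * phi x + (- m) * (h x * rho x)); last first.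
    by apply/funext => x; ring.
  rewrite (@RintD _ _ _ mu)//; [|exact: rint_lint_test|by apply: rintZ => //; exact: rint_lint_test].
  rewrite (@RintZ _ _ _ mu)//; last exact: rint_lint_test.
  by rewrite -/C -/m mulNr => /eqP; rewrite subr_eq0 => /eqP.
have ae1 (m : nat) : {ae mu, forall x, 0 < x < m%:R -> h x - C = 0}.
  have lC : lint (fun x => h x - C).
    have cC : continuous ((fun=> C) : R -> R) by exact: cst_continuous.
    have := lintD (-1) hl (continuous_lint cC); congr lint.
    by apply/funext => x; rewrite mulN1r.
  apply: fundamental_lemma; first exact: lC.
  move=> phi tphi phi0; rewrite Rintegral_trunc; last by move=> x hx; rewrite phi0// mulr0.
  rewrite (_ : (fun x => _) = fun x => h x * phi x + (- C) * phi x); last first.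
    by apply/funext => x; ring.
  rewrite (@RintD _ _ _ mu)//; [|exact: rint_lint_test|by apply: rintZ => //; exact: rint_test].
  by rewrite (@RintZ _ _ _ mu)//; [rewrite key//; ring|exact: rint_test].
have [A [mA A0 hA]] := ae_foralln ae1; exists A; split => //.
apply: subset_trans hA; apply: subsetC => x /= hx x0; have [m _ hm] : \forall m \near \oo, x < m%:R.
  by apply: nbhs_infty_gtr; exact: num_real.
by apply/eqP; rewrite -subr_eq0; apply/eqP; apply: (hx m); rewrite x0 hm/=.
Qed.

Definition wderiv f g := forall phi, testR phi ->
  Rintegral mu pos (fun x => f x * derive1 phi x) = - Rintegral mu pos (fun x => g x * phi x).

(** Weak derivative up to the boundary: the test functions may be nonzero at 0, and [t] is the
    resulting boundary value of [f]. All traces are handled in this form. *)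
Definition hwd f g t := forall phi b, smoothR phi -> (forall x, b <= x -> phi x = 0) ->
  Rintegral mu pos (fun x => f x * derive1 phi x) = - t * phi 0 - Rintegral mu pos (fun x => g x * phi x).

Lemma du_bois_reymond f g : lint f -> lint g -> wderiv f g ->
  exists t, {ae mu, forall x, 0 < x -> f x = t + prim g x}.
Proof.
move=> lf lg fg.
have lp : lint (prim g) by apply: continuous_lint; exact: prim_continuous.
have [||t ht] := @weak_const (fun x => f x + (-1) * prim g x).
- exact: lintD.
- move=> phi tphi; have [_ [b [_ _ _ hb]]] := test_supp tphi.
  have td := test_derive1 tphi.
  rewrite (_ : (fun x => _) = fun x => f x * derive1 phi x + (-1) * (prim g x * derive1 phi x)); last first.
    by apply/funext => x; ring.
  rewrite (@RintD _ _ _ mu)//; [|exact: rint_lint_test|by apply: rintZ => //; exact: rint_lint_test].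
  rewrite (@RintZ _ _ _ mu)//; last exact: rint_lint_test.
  by rewrite fg// (prim_by_parts lg tphi.1 hb) mulN1r opprK addNr.
exists t; move: ht; apply: filterS; first exact: (ae_filter_ringOfSetsType mu).
by move=> x hx x0; rewrite -(hx x0) mulN1r subrK.
Qed.

Lemma eq_Rintegral_ae (D : set TR) f g : measurable D -> measurable_fun D f -> measurable_fun D g ->
  {ae mu, forall x, D x -> f x = g x} -> Rintegral mu D f = Rintegral mu D g.
Proof.
move=> mD mf mg fg; rewrite /Rintegral; congr fine; apply: ae_eq_integral => //.
- exact/measurable_EFinP.
- exact/measurable_EFinP.
move: fg; apply: filterS; first exact: (ae_filter_ringOfSetsType mu).
by move=> x fg Dx /=; rewrite fg.
Qed.

Lemma hwd_prim f g t : lint f -> lint g -> {ae mu, forall x, 0 < x -> f x = t + prim g x} -> hwd f g t.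
Proof.
move=> lf lg fg phi b sp p0; have d0 := derive1_supp sp p0; have sd := smooth_derive1 sp.
have lp : lint (prim g) by apply: continuous_lint; exact: prim_continuous.
have md : measurable_fun pos (derive1 phi) by apply: measurable_funTS; exact: meas_smooth.
have ip : rint mu pos (fun x => prim g x * derive1 phi x).
  by apply: (lint_mul lp _ d0); exact: smooth_continuous.
have id_ : rint mu pos (derive1 phi) by exact: rint_smooth d0.
rewrite (@eq_Rintegral_ae _ _ (fun x => t * derive1 phi x + prim g x * derive1 phi x))//.
- rewrite (@RintD _ _ _ mu)//; last exact: rintZ.
  rewrite (@RintZ _ _ _ mu)// (prim_by_parts lg sp p0) {1}pos_halfE (Rint_derive 0 sp p0).
  by rewrite mulrN mulNr.
- by apply: measurable_funM => //; exact: lint_meas.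
- by apply: rint_meas; exact: (rintD mpos (rintZ t mpos id_) ip).
move: fg; apply: filterS; first exact: (ae_filter_ringOfSetsType mu).
by move=> x fg x0; rewrite fg// mulrDl.
Qed.

(** [F] and [t + prim g] are right-continuous at 0 and agree almost everywhere. A null set contains
    no interval []0, e[], so they agree at points arbitrarily near 0. *)
Lemma trace_unique (F f g : R -> R) t : lint g -> {within `[0, +oo[, continuous F} ->
  {ae mu, forall x, 0 < x -> F x = f x} -> {ae mu, forall x, 0 < x -> f x = t + prim g x} -> F 0 = t.
Proof.
move=> lg cF Ff fg.
have h1 : {ae mu, forall x, 0 < x -> F x = t + prim g x}.
  move: Ff; apply: filterS2 fg; first exact: (ae_filter_ringOfSetsType mu).
  by move=> x e1 e2 x0; rewrite e2// e1.
have pick (e : R) : 0 < e -> exists2 x, 0 < x < e & F x = t + prim g x.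
  move=> e0; apply: contrapT => h.
  have [A [mA A0 hA]] := h1.
  have sub : (`]0, e[%classic : set TR) `<=` A.
    move=> x /=; rewrite in_itv/= => xe; apply: hA => /= hx.
    by apply: h; exists x => //; apply: hx; case/andP: xe.
  have : (mu `]0%R, e[%classic <= mu A)%E by apply: le_measure; rewrite ?inE.
  rewrite A0 lebesgue_measure_itv/= lte_fin e0 sube0 lee_fin leNgt e0.
  by [].
have cP := prim_continuous lg.
have cF0 : F x @[x --> 0^'+] --> F 0.
  by have [_ h] := (continuous_within_itvcyP 0 F).1 cF.
have cG0 : t + prim g x @[x --> 0^'+] --> t.
  have : t + prim g x @[x --> 0^'+] --> t + prim g 0.
    by apply: cvgD; [exact: cvg_cst|apply: cvg_at_right_filter; exact: cP].
  by rewrite prim_neg// addr0.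
apply/eqP; rewrite -subr_eq0 -normr_eq0 eq_le normr_ge0 andbT; apply/ler_addgt0Pl => e e0.
have cd : (F x - (t + prim g x)) @[x --> 0^'+] --> F 0 - t by apply: cvgB.
move/cvgrPdist_le/(_ _ e0): cd => [dl /= dl0 hd].
have [x /andP[x0 xd] hx] := pick _ dl0.
have := hd x; rewrite /ball_/= sub0r normrN gtr0_norm// => /(_ xd x0).
by rewrite hx subrr subr0 addr0.
Qed.

End WeakDerivative.

(** * Green's identity with a cutoff *)

Section GreenIdentity.
Variable R : realType.
Local Notation C := (R[i]).
Local Notation Re := (@ReC R).
Local Notation Im := (@ImC R).
Local Notation mu := (@lebesgue_measure R).
Local Notation TR := (measurableTypeR R).
Local Notation pos := (@pos_half R : set TR).
Implicit Types (f g h e chi : R -> R).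

Let mpos : measurable pos := @measurable_pos_half R.

Lemma derive1_smoothM f g : smoothR f -> smoothR g ->
  derive1 (fun x => f x * g x) = (fun x => derive1 f x * g x + f x * derive1 g x).
Proof.
move=> sf sg; apply/funext => x; apply: is_derive_derive1.
have h := is_deriveM (smooth_is_derive x sf) (smooth_is_derive x sg).
by apply: (is_derive_eq h); rewrite /GRing.scale/=; ring.
Qed.

Lemma derive1_smoothD f g : smoothR f -> smoothR g ->
  derive1 (fun x => f x + g x) = (fun x => derive1 f x + derive1 g x).
Proof.
move=> sf sg; apply/funext => x; apply: is_derive_derive1.
exact: (is_deriveD (smooth_is_derive x sf) (smooth_is_derive x sg)).
Qed.

(** The three premises are the integrations by parts against [(chi e)'], [chi e] and [chi' e]. [A],
    [B], [D] pair [f] with [chi'' e], [chi' e'], [chi e'']; [G], [K] pair [g] with [(chi e)'],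
    [chi' e]; [J] pairs [h] with [chi e]; [x] and [y] are [e'(0)] and [e(0)]. *)
Let green_algebra (A B D G J K t d x y : R) : A + 2 * B + D = - t * x - G -> G = - d * y - J ->
  A + B = - t * 0 - K -> A + 2 * K + J = D + t * x - d * y.
Proof. by move=> *; lra. Qed.

Section cut.
Variables (chi : R -> R) (b : R).
Hypothesis schi : smoothR chi.
Hypothesis chi0 : forall x, b <= x -> chi x = 0.
Hypothesis chi1 : chi 0 = 1.
Hypothesis chid : derive1 chi 0 = 0.

Let sd := smooth_derive1 schi.
Let d0 : forall x, b <= x -> derive1 chi x = 0.
Proof. by move=> x; exact: derive1_supp. Qed.
Let d20 : forall x, b <= x -> derive1 (derive1 chi) x = 0.
Proof. by move=> x; exact: derive1_supp. Qed.

(* second derivative of chi f, when g and h are the first two derivatives of f *)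
Definition cut2 f g h x :=
  derive1 (derive1 chi) x * f x + 2 * (derive1 chi x * g x) + chi x * h x.

Variables (f g h : R -> R) (t d : R).
Hypotheses (lf : lint f) (lg : lint g) (lh : lint h).
Hypotheses (fg : hwd f g t) (gh : hwd g h d).

Lemma rint_cut (u phi : R -> R) : lint u -> smoothR phi -> (forall x, b <= x -> phi x = 0) ->
  rint mu pos (fun x => phi x * u x).
Proof.
move=> lu sp p0; apply: eq_rint (lint_mul lu (smooth_continuous sp) p0) => // x _.
by rewrite mulrC.
Qed.

Lemma rint_cut2 : rint mu pos (cut2 f g h).
Proof.
have s2 := smooth_derive1 sd.
exact: (rintD mpos (rintD mpos (rint_cut lf s2 d20) (rintZ 2 mpos (rint_cut lg sd d0))) (rint_cut lh schi chi0)).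
Qed.

(** The function [e] need not decay, since [chi] cuts everything off far away; being flat with value
    1 at the vertex, [chi] leaves the boundary terms of [f] and [g] unchanged. This allows [e] to be
    an exponential. *)
Lemma green e : smoothR e -> Rintegral mu pos (fun x => cut2 f g h x * e x) =
  Rintegral mu pos (fun x => chi x * f x * derive1 (derive1 e) x) + t * derive1 e 0 - d * e 0.
Proof.
move=> se; have se1 := smooth_derive1 se; have se2 := smooth_derive1 se1.
have s2 := smooth_derive1 sd.
pose phi x := chi x * e x; pose phi3 x := derive1 chi x * e x.
have sphi : smoothR phi by exact: smoothM.
have sphi3 : smoothR phi3 by exact: smoothM.
have p0 x : b <= x -> phi x = 0 by move=> hx; rewrite /phi chi0// mul0r.
have p30 x : b <= x -> phi3 x = 0 by move=> hx; rewrite /phi3 d0// mul0r.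
have dphi : derive1 phi = fun x => derive1 chi x * e x + chi x * derive1 e x by exact: derive1_smoothM.
have dphi3 : derive1 phi3 = fun x => derive1 (derive1 chi) x * e x + derive1 chi x * derive1 e x.
  exact: derive1_smoothM.
have d2phi : derive1 (derive1 phi) = fun x => derive1 (derive1 chi) x * e x +
    2 * (derive1 chi x * derive1 e x) + chi x * derive1 (derive1 e) x.
  rewrite dphi (derive1_smoothD (smoothM sd se) (smoothM schi se1)).
  rewrite (derive1_smoothM sd se) (derive1_smoothM schi se1); apply/funext => x.
  move: (derive1 (derive1 chi) x) (derive1 chi x) (chi x) => p q r.
  by move: (derive1 (derive1 e) x) (derive1 e x) (e x) => *; ring.
have E1 := fg (smooth_derive1 sphi) (fun x => derive1_supp sphi p0).
have E2 := gh sphi p0; have E3 := fg sphi3 p30.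
have I (u v : R -> R) : lint u -> smoothR v -> (forall x, b <= x -> v x = 0) -> rint mu pos (fun x => u x * v x).
  by move=> lu sv v0; apply: lint_mul lu _ v0; exact: smooth_continuous.
have Ia := I f (fun x => derive1 (derive1 chi) x * e x) lf (smoothM s2 se)
  (fun x hx => etrans (congr1 (fun y => y * e x) (d20 hx)) (mul0r _)).
have Ib := I f (fun x => derive1 chi x * derive1 e x) lf (smoothM sd se1)
  (fun x hx => etrans (congr1 (fun y => y * derive1 e x) (d0 hx)) (mul0r _)).
have Ic := I f (fun x => chi x * derive1 (derive1 e) x) lf (smoothM schi se2)
  (fun x hx => etrans (congr1 (fun y => y * derive1 (derive1 e) x) (chi0 hx)) (mul0r _)).
have Ig := I g phi3 lg sphi3 p30; have Ih := I h phi lh sphi p0.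
have L : Rintegral mu pos (fun x => cut2 f g h x * e x) =
   Rintegral mu pos (fun x => f x * (derive1 (derive1 chi) x * e x)) +
   2 * Rintegral mu pos (fun x => g x * phi3 x) + Rintegral mu pos (fun x => h x * phi x).
  rewrite -(@RintZ _ _ _ mu)// -!(@RintD _ _ _ mu)//; try (by apply: rintZ); last first.
    by apply: rintD => //; apply: rintZ.
  by apply: eq_Rintegral => x _; rewrite /cut2 /phi /phi3; ring.
have F1 : Rintegral mu pos (fun x => f x * derive1 (derive1 phi) x) =
   Rintegral mu pos (fun x => f x * (derive1 (derive1 chi) x * e x)) +
   2 * Rintegral mu pos (fun x => f x * (derive1 chi x * derive1 e x)) +
   Rintegral mu pos (fun x => f x * (chi x * derive1 (derive1 e) x)).
  rewrite -(@RintZ _ _ _ mu)// -!(@RintD _ _ _ mu)//; try (by apply: rintZ); last first.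
    by apply: rintD => //; apply: rintZ.
  apply: eq_Rintegral => x _; rewrite d2phi.
  move: (f x) (derive1 (derive1 chi) x) (derive1 chi x) (chi x) => y p q r.
  by move: (derive1 (derive1 e) x) (derive1 e x) (e x) => *; ring.
have F3 : Rintegral mu pos (fun x => f x * derive1 phi3 x) =
   Rintegral mu pos (fun x => f x * (derive1 (derive1 chi) x * e x)) +
   Rintegral mu pos (fun x => f x * (derive1 chi x * derive1 e x)).
  rewrite -!(@RintD _ _ _ mu)//.
  by apply: eq_Rintegral => x _; rewrite dphi3 mulrDr.
have X : Rintegral mu pos (fun x => chi x * f x * derive1 (derive1 e) x) =
    Rintegral mu pos (fun x => f x * (chi x * derive1 (derive1 e) x)).
  by apply: eq_Rintegral => x _; ring.
have v1 : derive1 phi 0 = derive1 e 0 by rewrite dphi chi1 chid mul0r mul1r add0r.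
have v0 : phi 0 = e 0 by rewrite /phi chi1 mul1r.
have v3 : phi3 0 = 0 by rewrite /phi3 chid mul0r.
rewrite L X; move: E1 E2 E3; rewrite F1 F3 v1 v0 v3.
exact: green_algebra.
Qed.

End cut.
End GreenIdentity.

(** * The transform of the operator *)

Section CutTransform.
Variable R : realType.
Local Notation C := (R[i]).
Local Notation Re := (@ReC R).
Local Notation Im := (@ImC R).
Local Notation mu := (@lebesgue_measure R).
Local Notation TR := (measurableTypeR R).
Local Notation pos := (@pos_half R : set TR).

Let mpos : measurable pos := @measurable_pos_half R.

Lemma Re_ex_trig (w zt : C) : (fun x : R => Re (w * ex zt x)) =
  (fun x => expR (Im zt * x) * (Re w * cos (- Re zt * x) + (- Im w) * sin (- Re zt * x))).
Proof.
apply/funext => x; rewrite ReCM /ex ReC_cexp ImC_cexp.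
have -> : Re (- iC R * zt * toC x) = Im zt * x by rewrite !CE; ring.
have -> : Im (- iC R * zt * toC x) = - Re zt * x by rewrite !CE; ring.
by move: (expR _) (cos _) (sin _) (Re w) (Im w) => *; ring.
Qed.

Lemma Im_ex_trig (w zt : C) : (fun x : R => Im (w * ex zt x)) =
  (fun x => expR (Im zt * x) * (Im w * cos (- Re zt * x) + Re w * sin (- Re zt * x))).
Proof.
apply/funext => x; rewrite ImCM /ex ReC_cexp ImC_cexp.
have -> : Re (- iC R * zt * toC x) = Im zt * x by rewrite !CE; ring.
have -> : Im (- iC R * zt * toC x) = - Re zt * x by rewrite !CE; ring.
by move: (expR _) (cos _) (sin _) (Re w) (Im w) => *; ring.
Qed.

Lemma smooth_Re_ex (w zt : C) : smoothR (fun x : R => Re (w * ex zt x)).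
Proof. by rewrite Re_ex_trig; exact: smooth_exp_trig. Qed.

Lemma smooth_Im_ex (w zt : C) : smoothR (fun x : R => Im (w * ex zt x)).
Proof. by rewrite Im_ex_trig; exact: smooth_exp_trig. Qed.

Lemma derive1_Re_ex (w zt : C) : derive1 (fun x : R => Re (w * ex zt x)) =
  (fun x => Re (w * (- iC R * zt) * ex zt x)).
Proof.
apply/funext => x; apply: is_derive_derive1.
by have [h _] := cderZ w (cder_ex zt x); rewrite mulrA in h.
Qed.

Lemma derive1_Im_ex (w zt : C) : derive1 (fun x : R => Im (w * ex zt x)) =
  (fun x => Im (w * (- iC R * zt) * ex zt x)).
Proof.
apply/funext => x; apply: is_derive_derive1.
by have [_ h] := cderZ w (cder_ex zt x); rewrite mulrA in h.
Qed.

Variables (n : nat) (c a : 'I_n -> R).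
Hypothesis c_gt0 : forall k, 0 < c k.
Local Notation xz := (xiz c a).

Variables (chi : R -> R) (b : R).
Hypothesis schi : smoothR chi.
Hypothesis chi0 : forall x, b <= x -> chi x = 0.
Hypothesis chi1 : chi 0 = 1.
Hypothesis chid : derive1 chi 0 = 0.

Lemma Re_toCM (r : R) (z : C) : Re (toC r * z) = r * Re z.
Proof. by rewrite ReCM ReC_toC ImC_toC mul0r subr0. Qed.
Lemma Im_toCM (r : R) (z : C) : Im (toC r * z) = r * Im z.
Proof. by rewrite ImCM ReC_toC ImC_toC mul0r addr0. Qed.

Definition cutA k (f g h : R -> R) (x : R) := - c k * cut2 chi f g h x + a k * (chi x * f x).

Section component.
Variables (f g h : R -> R) (t d : R).
Hypotheses (lf : lint f) (lg : lint g) (lh : lint h).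
Hypotheses (fg : hwd f g t) (gh : hwd g h d).

Lemma rint_chif : rint mu pos (fun x => chi x * f x).
Proof. exact: (rint_cut lf schi chi0). Qed.

Lemma cint_cut2 zt : crint pos (fun x => toC (chi x * f x) * ex zt x) ->
  cint (fun x => toC (cut2 chi f g h x) * ex zt x) =
  - (zt * zt) * cint (fun x => toC (chi x * f x) * ex zt x) - iC R * zt * toC t - toC d.
Proof.
move=> ic; have ie x : ex zt x = 1 * ex zt x by rewrite mul1r.
have w2 : 1 * (- iC R * zt) * (- iC R * zt) = - (zt * zt).
  have -> : 1 * (- iC R * zt) * (- iC R * zt) = (iC R * iC R) * (zt * zt) by ring.
  by rewrite iC2 mulN1r.
have G1 := green schi chi0 chi1 chid lf lg lh fg gh (@smooth_Re_ex 1 zt).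
have G2 := green schi chi0 chi1 chid lf lg lh fg gh (@smooth_Im_ex 1 zt).
rewrite !derive1_Re_ex w2 ex0 in G1; rewrite !derive1_Im_ex w2 ex0 in G2.
rewrite !cintE -cintDZ//.
have -> : cintD pos (fun x => toC (cut2 chi f g h x) * ex zt x) =
   Complex (Rintegral mu pos (fun x => cut2 chi f g h x * Re (1 * ex zt x)))
           (Rintegral mu pos (fun x => cut2 chi f g h x * Im (1 * ex zt x))).
  by rewrite /cintD; congr Complex; apply: eq_Rintegral => x _; rewrite /comp ?Re_toCM ?Im_toCM mul1r.
rewrite G1 G2.
have -> : cintD pos (fun x => - (zt * zt) * (toC (chi x * f x) * ex zt x)) =
   Complex (Rintegral mu pos (fun x => chi x * f x * Re (- (zt * zt) * ex zt x)))
           (Rintegral mu pos (fun x => chi x * f x * Im (- (zt * zt) * ex zt x))).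
  by rewrite /cintD; congr Complex; apply: eq_Rintegral => x _; rewrite /comp mulrCA ?Re_toCM ?Im_toCM.
set A := Rintegral _ _ _; set B := Rintegral _ _ _.
have r1 : Re (1 * (- iC R * zt) * 1) = Im zt by rewrite !CE; ring.
have r2 : Im (1 * (- iC R * zt) * 1) = - Re zt by rewrite !CE; ring.
rewrite r1 r2 mulr1 ReC1 ImC1; clearbody A B; apply: C_ext.
  rewrite -[LHS]/(A + t * Im zt - d * 1) !ReCD !ReCN -[Re (Complex A B)]/A.
  by rewrite !CE; ring.
rewrite -[LHS]/(B + t * - Re zt - d * 0) !ImCD !ImCN -[Im (Complex A B)]/B.
by rewrite !CE; ring.
Qed.

(** Green's identity against the exponential produces boundary terms from the trace [t] and the
    slope [d]. The relation [c xi^2 = z - a] turns the second derivative into multiplication by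
    [z]. *)
Lemma Et_cut k z : Im z <= 0 -> Et c a k (cutA k f g h) z =
  z * Et c a k (fun x => chi x * f x) z + toC (c k * d) + iC R * toC (c k * t) * xz k z.
Proof.
move=> z0; have i1 := @crint_Et R n c a k _ z rint_chif.
have i2 := @crint_Et R n c a k _ z (rint_cut2 schi chi0 lf lg lh).
have E := cint_cut2 i1.
have S := @xiz_sqr R n c a c_gt0 k z z0.
have -> : Et c a k (cutA k f g h) z = - toC (c k) * Et c a k (cut2 chi f g h) z +
    toC (a k) * Et c a k (fun x => chi x * f x) z.
  rewrite /Et !cintE -!cintDZ// -cintDD//; try exact: crintZ.
  apply: eq_cintD => x _; rewrite /cutA toCD !toCM toCN; ring.
rewrite {1}/Et E -/(Et c a k (fun x => chi x * f x) z) !toCM.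
move: (Et _ _ _ _ _) (xz k z) S => P x S.
have -> : z = toC (c k) * (x * x) + toC (a k) by rewrite S subrK.
ring.
Qed.
End component.

Variables (f g h : 'I_n -> R -> R) (t : R) (d : 'I_n -> R).
Hypotheses (lf : forall k, lint (f k)) (lg : forall k, lint (g k)) (lh : forall k, lint (h k)).
Hypotheses (fg : forall k, hwd (f k) (g k) t) (gh : forall k, hwd (g k) (h k) (d k)).
Hypothesis kirchhoff : \sum_(k < n) c k * d k = 0.

(** Both vertex conditions are used. Kirchhoff removes the slopes from the sum over the edges; the
    common value [t] leaves [- t w] in that sum, whose conjugate the sine correction of edge [l]
    returns with the opposite sign. *)
Lemma Vr_cut l s : a l < s ->
  Vr c a (fun k => cutA k (f k) (g k) (h k)) l s = toC s * Vr c a (fun k x => chi x * f k x) l s.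
Proof.
move=> ls; have s0 : Im (toC s) <= 0 by rewrite ImC_toC.
have [xl xlE] := @Re_xi_gt0 R n c a c_gt0 l s ls.
have EtE k := Et_cut (lf k) (lg k) (lh k) (fg k) (gh k) k s0.
rewrite /Vr EtE.
have -> : \sum_(k < n) Et c a k (cutA k (f k) (g k) (h k)) (toC s) =
    toC s * (\sum_(k < n) Et c a k (fun x => chi x * f k x) (toC s)) - toC t * wfun c a s.
  rewrite (eq_bigr _ (fun k _ => EtE k)) 2!big_split/= -mulr_sumr -addrA; congr (_ + _).
  have -> : \sum_(k < n) toC (c k * d k) = 0.
    by rewrite -[RHS]/(toC 0) -kirchhoff (big_morph _ (@toCD R) (@toC0 R)).
  rewrite add0r wfunE// /ksum !mulr_sumr -sumrN; apply: eq_bigr => k _.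
  rewrite toCM; ring.
have cal0 : toC (cal c a l s) != 0.
  by rewrite toC_eq0 /cal mulf_neq0// gt_eqF.
have ImE (P : C) (p q r : R) : Im (toC s * P + toC p + iC R * toC q * toC r) = s * Im P + q * r.
  by rewrite !CE; ring.
rewrite xlE ImE (mulrC (c l) t) -(mulrA t) -/(cal c a l s).
move: (Et _ _ _ _ _) (\sum_(k < n) _) (wfun _ _ _) (cal _ _ _ _) cal0 => P E w q q0.
rewrite toCD !toCM mulrDr.
have -> : (toC s * E - toC t * w)^*%C = toC s * E^*%C - toC t * w^*%C.
  by apply: C_ext; rewrite !CE; ring.
have -> : w^*%C / toC q * (toC t * toC q) = toC t * w^*%C * (toC q / toC q) by ring.
rewrite divff// mulr1; ring.
Qed.

End CutTransform.

(** * Cutting off at infinity *)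

Section VtildeOperator.
Variable R : realType.
Local Notation C := (R[i]).
Local Notation Re := (@ReC R).
Local Notation Im := (@ImC R).
Local Notation mu := (@lebesgue_measure R).
Local Notation TR := (measurableTypeR R).
Local Notation pos := (@pos_half R : set TR).

Let mpos : measurable pos := @measurable_pos_half R.

(** [trace0] speaks of a continuous function equal almost everywhere. [du_bois_reymond] writes [f]
    as a constant plus a primitive, and [trace_unique] identifies that constant with the trace,
    which becomes the boundary term. *)
Lemma hwd_complex (f g : R -> C) (t : C) : cL2 f -> cL2 g -> weak_deriv f g -> trace0 f t ->
  hwd (Re \o f) (Re \o g) (Re t) /\ hwd (Im \o f) (Im \o g) (Im t).
Proof.
move=> [lf1 lf2] [lg1 lg2] fg [F [c1 c2 [A [mA A0 hA]] <-]].
have aeF x : ~ A x -> 0 < x -> F x = f x.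
  by move=> Ax x0; apply: contrapT => h; apply: Ax; apply: hA.
have w phi : testR phi -> cint (fun x => f x * toC (derive1 phi x)) = - cint (fun x => g x * toC (phi x)).
  exact: fg.
have ReM (z : C) (r : R) : Re (z * toC r) = Re z * r by rewrite !CE; ring.
have ImM (z : C) (r : R) : Im (z * toC r) = Im z * r by rewrite !CE; ring.
have w1 : wderiv (Re \o f) (Re \o g).
  move=> phi tphi; have := congr1 Re (w _ tphi); rewrite ReCN !cintE /cintD [LHS]/= [X in _ = - X]/=.
  by rewrite /comp; under eq_Rintegral do rewrite ReM; under [X in _ = - X]eq_Rintegral do rewrite ReM.
have w2 : wderiv (Im \o f) (Im \o g).
  move=> phi tphi; have := congr1 Im (w _ tphi); rewrite ImCN !cintE /cintD [LHS]/= [X in _ = - X]/=.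
  by rewrite /comp; under eq_Rintegral do rewrite ImM; under [X in _ = - X]eq_Rintegral do rewrite ImM.
have l1 := L2r_lint lf1; have l2 := L2r_lint lg1.
have l3 := L2r_lint lf2; have l4 := L2r_lint lg2.
have [t1 h1] := du_bois_reymond l1 l2 w1.
have [t2 h2] := du_bois_reymond l3 l4 w2.
split.
  have -> : Re (F 0) = t1; last exact: hwd_prim.
  apply: (trace_unique l2 c1 _ h1).
  exists A; split => // x /= hx; apply: contrapT => Ax; apply: hx => x0.
  by rewrite /comp aeF.
have -> : Im (F 0) = t2; last exact: hwd_prim.
apply: (trace_unique l4 c2 _ h2).
exists A; split => // x /= hx; apply: contrapT => Ax; apply: hx => x0.
by rewrite /comp aeF.
Qed.

Section scaled.
Variable m : nat.
Let r : R := m.+1%:R^-1.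
Let r0 : 0 < r. Proof. by rewrite invr_gt0 ltr0n. Qed.
Let r1 : r <= 1. Proof. by rewrite invf_le1 ?ltr0n// ler1n. Qed.

Definition scut (x : R) : R := cutoff (m.+1%:R^-1 * x + 0).

Lemma derive1_lin (f : R -> R) (k b : R) : smoothR f ->
  derive1 (fun x => f (k * x + b)) = fun x => k * derive1 f (k * x + b).
Proof.
move=> sf; apply/funext => x; apply: is_derive_derive1.
have hl : is_derive x 1 (k \*: id + cst b) (k *: 1 + 0).
  by apply: is_deriveD; exact: is_deriveZ.
have h := @is_derive1_comp _ f (k \*: id + cst b) x _ _ (smooth_is_derive _ sf) hl.
by apply: (is_derive_eq h); rewrite !fctE /= /GRing.scale/=; ring.
Qed.

Lemma smooth_scut : smoothR scut.
Proof. by apply: smooth_comp_lin; exact: smooth_cutoff. Qed.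

Lemma scut_supp x : 2 * m.+1%:R <= x -> scut x = 0.
Proof. by move=> hx; rewrite /scut addr0 cutoff0// ler_pdivlMl ?ltr0n// mulrC. Qed.

Lemma derive1_scut : derive1 scut = fun x => r * derive1 (@cutoff R) (r * x + 0).
Proof. by rewrite derive1_lin//; exact: smooth_cutoff. Qed.

Lemma derive2_scut : derive1 (derive1 scut) = fun x => r * (r * derive1 (derive1 (@cutoff R)) (r * x + 0)).
Proof.
have sd := smooth_derive1 (@smooth_cutoff R).
rewrite derive1_scut (@derive1_lin (fun y => r * derive1 (@cutoff R) y)); last exact: smoothZ.
apply/funext => x; congr (_ * _); apply: is_derive_derive1.
by have h := is_deriveZ r (smooth_is_derive (r * x + 0) sd); apply: (is_derive_eq h).
Qed.

Lemma scut_0 : scut 0 = 1.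
Proof. by rewrite /scut mulr0 addr0 cutoff1. Qed.

Lemma derive1_scut_0 : derive1 scut 0 = 0.
Proof. by rewrite derive1_scut mulr0 addr0 derive1_cutoff0 ?mulr0//; left. Qed.

Lemma scut_bound (K : R) : (forall x, `|derive1 (@cutoff R) x| <= K) ->
  (forall x, `|derive1 (derive1 (@cutoff R)) x| <= K) ->
  forall x, `|derive1 scut x| <= K /\ `|derive1 (derive1 scut) x| <= K.
Proof.
have r00 := ltW r0.
move=> h1 h2 x; rewrite derive2_scut derive1_scut !normrM (ger0_norm r00); split.
  by rewrite (le_trans _ (h1 (r * x + 0)))// ler_piMl.
by rewrite mulrA (le_trans _ (h2 (r * x + 0)))// ler_piMl// mulr_ile1.
Qed.

Lemma scut_01 x : 0 <= scut x <= 1. Proof. exact: cutoff_01. Qed.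

Lemma scut_flat x : x < m.+1%:R -> [/\ scut x = 1, derive1 scut x = 0 & derive1 (derive1 scut) x = 0].
Proof.
have near1 y : y < m.+1%:R -> scut y = 1.
  by move=> hy; rewrite /scut addr0 cutoff1// ler_pdivrMl ?ltr0n// mulr1 ltW.
have near2 y : y < m.+1%:R -> derive1 scut y = 0.
  move=> hy; apply: (@derive1_loc_cst _ _ _ 1); near=> z; apply: near1; near: z; exact: lt_nbhsl.
move=> hx; split; [exact: near1|exact: near2|].
by apply: (@derive1_loc_cst _ _ _ 0); near=> z; apply: near2; near: z; exact: lt_nbhsl.
Unshelve. all: by end_near. Qed.

End scaled.

Lemma cutoff_derive_bound : exists K, (forall x, `|derive1 (@cutoff R) x| <= K) /\
  (forall x, `|derive1 (derive1 (@cutoff R)) x| <= K).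
Proof.
have sd := smooth_derive1 (@smooth_cutoff R); have sd2 := smooth_derive1 sd.
have [K1 h1] := continuous_bounded_itv 0 3 (smooth_continuous sd).
have [K2 h2] := continuous_bounded_itv 0 3 (smooth_continuous sd2).
have out (x : R) : ~~ (0 <= x <= 3) -> x < 1 \/ 2 < x.
  by rewrite negb_and -!ltNge => /orP[h|h]; [left|right]; lra.
have d2 (x : R) : x < 1 \/ 2 < x -> derive1 (derive1 (@cutoff R)) x = 0.
  move=> hx; apply: (@derive1_loc_cst _ _ _ 0); case: hx => hx; near=> y; apply: derive1_cutoff0.
    by left; near: y; exact: lt_nbhsl.
  by right; near: y; exact: lt_nbhsr.
exists (Num.max 0 (Num.max K1 K2)); split => x; rewrite !le_max.
  have [xi|/out xo] := boolP (0 <= x <= 3); first by rewrite h1// orbT.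
  by rewrite derive1_cutoff0// normr0 lexx.
have [xi|/out xo] := boolP (0 <= x <= 3); first by rewrite h2// !orbT.
by rewrite d2// normr0 lexx.
Unshelve. all: by end_near. Qed.

Lemma L2r_le (f G : R -> R) : measurable_fun pos f -> L2r mu pos G ->
  (forall x, `|f x| <= `|G x|) -> L2r mu pos f.
Proof.
move=> mf hG fG; split => //; apply: (rint_le mpos _ hG.2); first exact: measurable_funX.
by move=> x _; rewrite ger0_norm ?sqr_ge0// -[f x ^+ 2]real_normK ?num_real// -[G x ^+ 2]real_normK ?num_real// lerXn2r.
Qed.

Lemma L2r_norm f : L2r mu pos f -> L2r mu pos (fun x => `|f x|).
Proof.
move=> hf; apply: (L2r_le _ hf); last by move=> x; rewrite normr_id.
by apply: measurableT_comp => //; exact: hf.1.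
Qed.

Lemma nsq_dct (f_ : nat -> R -> R) (G : R -> R) : (forall m, measurable_fun pos (f_ m)) ->
  L2r mu pos G -> (forall m x, 0 < x -> `|f_ m x| <= `|G x|) ->
  (forall x, 0 < x -> \forall m \near \oo, f_ m x = 0) ->
  nsq mu pos (f_ m) @[m --> \oo] --> (0 : R).
Proof.
move=> mf hG fG f0.
have mf2 m : measurable_fun pos (fun x => f_ m x ^+ 2) by exact: measurable_funX.
have [||_] := @Rdct _ _ _ mu _ (fun m x => f_ m x ^+ 2) (fun=> 0) (fun x => G x ^+ 2)
    mpos mf2 (measurable_cst _) _ hG.2.
- apply: aeW => x x0; apply: cvg_near_cst; apply: filterS (f0 x x0) => m ->; exact: expr0n.
- apply: aeW => x m x0; rewrite ger0_norm ?sqr_ge0//.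
  by rewrite -[f_ m x ^+ 2]real_normK ?num_real// -[G x ^+ 2]real_normK ?num_real// lerXn2r// fG.
by rewrite [X in _ --> X]/Rintegral integral0.
Qed.

Section cutconv.
Variables (f g h : R -> R) (c0 a0 : R).
Hypotheses (hf : L2r mu pos f) (hg : L2r mu pos g) (hh : L2r mu pos h).

Let mscut m : measurable_fun pos (scut m).
Proof. by apply: measurable_funTS; apply: meas_smooth; exact: smooth_scut. Qed.
Let mscut1 m : measurable_fun pos (derive1 (scut m)).
Proof. by apply: measurable_funTS; apply: meas_smooth; apply: smooth_derive1; exact: smooth_scut. Qed.
Let mscut2 m : measurable_fun pos (derive1 (derive1 (scut m))).
Proof. by apply: measurable_funTS; apply: meas_smooth; do 2 apply: smooth_derive1; exact: smooth_scut. Qed.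

Let scut_norm m x : `|scut m x| <= 1.
Proof. by have /andP[h1 h2] := scut_01 m x; rewrite ger0_norm. Qed.

Lemma L2r_scut m : L2r mu pos (fun x => scut m x * f x).
Proof.
apply: (L2r_le _ hf); first by apply: measurable_funM => //; exact: hf.1.
by move=> x; rewrite normrM ler_piMl.
Qed.

Lemma nsq_scut : nsq mu pos (fun x => scut m x * f x - f x) @[m --> \oo] --> (0 : R).
Proof.
apply: (@nsq_dct _ f) => //.
- by move=> m; apply: measurable_funB; [exact: (L2r_scut m).1|exact: hf.1].
- move=> m x _; rewrite -[X in _ - X]mul1r -mulrBl normrM ler_piMl//.
  by have /andP[h1 h2] := scut_01 m x; rewrite ler0_norm; lra.
- move=> x x0; near=> m; have [|-> _ _] := @scut_flat m x; last by rewrite mul1r subrr.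
  by rewrite -natr1 ltr_wpDr//; near: m; apply: nbhs_infty_gtr; exact: num_real.
Unshelve. all: by end_near. Qed.

(** Derivatives of the rescaled cutoffs are bounded uniformly in [m] and vanish below [m + 1]. The
    error is dominated by a fixed combination of [|f|], [|g|], [|h|] and is eventually 0 at each
    point. *)
Lemma cutA_L2 : (forall m, L2r mu pos (fun x => - c0 * cut2 (scut m) f g h x + a0 * (scut m x * f x))) /\
  nsq mu pos (fun x => - c0 * cut2 (scut m) f g h x + a0 * (scut m x * f x) -
    (- c0 * h x + a0 * f x)) @[m --> \oo] --> (0 : R).
Proof.
have [K [k1 k2]] := cutoff_derive_bound.
have K0 : 0 <= K by apply: le_trans (k1 0).
pose G x := (`|c0| * K + `|a0|) * `|f x| + (2 * `|c0| * K) * `|g x| + `|c0| * `|h x|.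
have LG : L2r mu pos G.
  by apply: L2rD => //; [apply: L2rD => //|]; apply: L2rZ => //; exact: L2r_norm.
have G0 x : 0 <= G x by rewrite !addr_ge0// !mulr_ge0// ?addr_ge0// ?mulr_ge0.
pose u m x := - c0 * cut2 (scut m) f g h x + a0 * (scut m x * f x).
pose v x := - c0 * h x + a0 * f x.
have mu_ m : measurable_fun pos (u m).
  apply: measurable_funD; apply: measurable_funM => //; last first.
    by apply: measurable_funM => //; exact: hf.1.
  apply: measurable_funD; last by apply: measurable_funM => //; exact: hh.1.
  apply: measurable_funD; first by apply: measurable_funM => //; exact: hf.1.
  by apply: measurable_funM => //; apply: measurable_funM => //; exact: hg.1.
have mv : measurable_fun pos v.
  by apply: measurable_funD; apply: measurable_funM => //; [exact: hh.1|exact: hf.1].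
(* Stated for any [s] in [[-1, 1]] so as to serve twice: with [s = scut m x] for the cut function
   and with [s = scut m x - 1] for its distance to the limit. *)
have bd m x (s : R) : `|s| <= 1 -> `|- c0 * (derive1 (derive1 (scut m)) x * f x + 2 * (derive1 (scut m) x * g x) + s * h x)
      + a0 * (s * f x)| <= G x.
  move=> s1; have [b1 b2] := @scut_bound m K k1 k2 x.
  have e1 : `|derive1 (derive1 (scut m)) x * f x| <= K * `|f x| by rewrite normrM ler_wpM2r.
  have e2 : `|derive1 (scut m) x * g x| <= K * `|g x| by rewrite normrM ler_wpM2r.
  have e3 : `|s * h x| <= `|h x| by rewrite normrM ler_piMl.
  have e4 : `|s * f x| <= `|f x| by rewrite normrM ler_piMl.
  apply: le_trans (ler_normD _ _) _; rewrite !normrM normrN.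
  have -> : G x = `|c0| * (K * `|f x| + 2 * (K * `|g x|) + `|h x|) + `|a0| * `|f x| by rewrite /G; ring.
  apply: lerD; apply: ler_wpM2l => //; last by rewrite -normrM.
  apply: le_trans (ler_normD _ _) _; apply: lerD => //.
  apply: le_trans (ler_normD _ _) _; apply: lerD => //.
  by rewrite normrM ger0_norm// ler_wpM2l.
split=> [m|].
  by apply: (L2r_le (mu_ m) LG) => x; rewrite [leRHS]ger0_norm//; exact: bd.
apply: (@nsq_dct (fun m x => u m x - v x) G) => //.
- by move=> m; exact: measurable_funB.
- move=> m x _; rewrite [leRHS]ger0_norm//; have := bd m x (scut m x - 1).
  have /andP[h1 h2] := scut_01 m x; rewrite ler0_norm; last by lra.
  move=> bx; have s1 : - (scut m x - 1) <= 1 by lra.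
  apply: le_trans (bx s1).
  by rewrite /u /v /cut2 le_eqVlt; apply/orP; left; apply/eqP; congr (`|_|); ring.
- move=> x x0; near=> m; have [|s0 s1 s2] := @scut_flat m x; last first.
    by rewrite /u /v /cut2 s0 s1 s2; ring.
  by rewrite -natr1 ltr_wpDr//; near: m; apply: nbhs_infty_gtr; exact: num_real.
Unshelve. all: by end_near. Qed.

End cutconv.
End VtildeOperator.

(** * The transform of [A u] *)

Section VtildeAop.
Variable R : realType.
Local Notation C := (R[i]).
Local Notation Re := (@ReC R).
Local Notation Im := (@ImC R).
Local Notation mu := (@lebesgue_measure R).
Local Notation TR := (measurableTypeR R).
Local Notation pos := (@pos_half R : set TR).

Let mpos : measurable pos := @measurable_pos_half R.

Variables (n : nat) (c a : 'I_n -> R).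
Hypothesis c_gt0 : forall k, 0 < c k.
Hypothesis a_ge0 : forall k, 0 <= a k.
Implicit Types (u v : 'I_n -> R -> C).

Let nc (x y : nat -> R) : (forall m, x m = y m) -> x @ \oo --> (0 : R) -> y @ \oo --> (0 : R).
Proof. by move=> /funext ->. Qed.

Lemma hn_cvg (w : nat -> 'I_n -> R -> C) :
  (forall k, nsq mu pos (fun x => Re (w m k x)) @[m --> \oo] --> (0 : R)) ->
  (forall k, nsq mu pos (fun x => Im (w m k x)) @[m --> \oo] --> (0 : R)) ->
  hn (w m) @[m --> \oo] --> (0 : R).
Proof.
move=> h1 h2; have <- : \sum_(k < n) (0 : R) = 0 by rewrite big1.
apply: cvg_big => [|k _]; first exact: add_continuous.
by rewrite -[X in _ --> X]addr0; apply: cvgD; [exact: h1|exact: h2].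
Qed.

(** The cutoffs of [u] and [A] applied to them satisfy the multiplication rule exactly by [Vr_cut],
    separately for real and imaginary parts. They converge to [u] and [v] in H, which is the input
    of [Vtilde_limit]. *)
Lemma Vtilde_Aop u v W : inH u -> isVtilde c a u W -> Aop c a u v ->
  inH v /\ isVtilde c a v (fun k s => toC s * W k s).
Proof.
move=> hu hV [g1 [g2 [t [d [[hH2 tr1 tr2 kir] hv]]]]].
have inv : inH v by move=> k; case: (hv k).
split => //.
have L0 k : cL2 (u k) by exact: (inHP u).1.
have L1 k : cL2 (g1 k) by apply/inL2P; case: (hH2 k).
have L2 k : cL2 (g2 k) by apply/inL2P; case: (hH2 k).
have Lv k : cL2 (v k) by exact: (inHP v).1.
have W1 k : hwd (Re \o u k) (Re \o g1 k) (Re t) /\ hwd (Im \o u k) (Im \o g1 k) (Im t).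
  by apply: hwd_complex => //; case: (hH2 k).
have W2 k : hwd (Re \o g1 k) (Re \o g2 k) (Re (d k)) /\ hwd (Im \o g1 k) (Im \o g2 k) (Im (d k)).
  by apply: hwd_complex => //; case: (hH2 k).
have kr : \sum_(k < n) c k * Re (d k) = 0.
  by have := congr1 Re kir; rewrite ReC_sum; under eq_bigr do rewrite Re_toCM.
have ki : \sum_(k < n) c k * Im (d k) = 0.
  by have := congr1 Im kir; rewrite ImC_sum; under eq_bigr do rewrite Im_toCM.
pose f m k x := toC (scut m x) * u k x.
pose gF (F : C -> R) m k := cutA c a (scut m) k (F \o u k) (F \o g1 k) (F \o g2 k).
pose g m k x := Complex (gF Re m k x) (gF Im m k x).
have Ref m k : Re \o f m k = fun x => scut m x * Re (u k x).
  by apply/funext => x; rewrite /comp /f Re_toCM.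
have Imf m k : Im \o f m k = fun x => scut m x * Im (u k x).
  by apply/funext => x; rewrite /comp /f Im_toCM.
have hf m : inH (f m).
  apply/inHP => k; rewrite /cL2 Ref Imf; split; apply: L2r_scut; [exact: (L0 k).1|exact: (L0 k).2].
have A1 k := cutA_L2 (c k) (a k) (L0 k).1 (L1 k).1 (L2 k).1.
have A2 k := cutA_L2 (c k) (a k) (L0 k).2 (L1 k).2 (L2 k).2.
have hg m : inH (g m).
  by apply/inHP => k; split; [exact: ((A1 k).1 m)|exact: ((A2 k).1 m)].
have cf : hn (fun k x => f m k x - u k x) @[m --> \oo] --> (0 : R).
  apply: (@hn_cvg (fun m k x => f m k x - u k x)) => k.
    apply: (nc _ (nsq_scut (L0 k).1)) => m; apply: eq_Rintegral => x _.
    by rewrite ReCD ReCN /f Re_toCM.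
  apply: (nc _ (nsq_scut (L0 k).2)) => m; apply: eq_Rintegral => x _.
  by rewrite ImCD ImCN /f Im_toCM.
have vE k : {ae mu, forall x, 0 < x -> v k x = - toC (c k) * g2 k x + toC (a k) * u k x}.
  have [_ [B [mB B0 hB]]] := hv k; exists B; split => // x /= hx; apply: hB; split.
    by apply: contrapT => x0; apply: hx => /x0.
  by move=> e; apply: hx.
have cg : hn (fun k x => g m k x - v k x) @[m --> \oo] --> (0 : R).
  apply: (@hn_cvg (fun m k x => g m k x - v k x)) => k.
    apply: (nc _ ((A1 k).2)) => m.
    apply: eq_Rintegral_ae => //.
    - apply: measurable_funX; apply: measurable_funB; first exact: ((A1 k).1 m).1.
      by apply: measurable_funD; apply: measurable_funM => //; [exact: (L2 k).1.1|exact: (L0 k).1.1].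
    - apply: measurable_funX; have [h _] := cmeasD (cL2_cmeas ((inHP _).1 (hg m) k)) (cmeasN (cL2_cmeas (Lv k))).
      exact: h.
    move: (vE k); apply: filterS; first exact: (ae_filter_ringOfSetsType mu).
    move=> x hx x0; rewrite hx// ReCD ReCN ReCD (mulNr (toC (c k))) ReCN !Re_toCM; congr (_ ^+ 2).
    by rewrite -[- (c k * Re (g2 k x))]mulNr.
  apply: (nc _ ((A2 k).2)) => m.
  apply: eq_Rintegral_ae => //.
  - apply: measurable_funX; apply: measurable_funB; first exact: ((A2 k).1 m).1.
    by apply: measurable_funD; apply: measurable_funM => //; [exact: (L2 k).2.1|exact: (L0 k).2.1].
  - apply: measurable_funX; have [_ h] := cmeasD (cL2_cmeas ((inHP _).1 (hg m) k)) (cmeasN (cL2_cmeas (Lv k))).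
    exact: h.
  move: (vE k); apply: filterS; first exact: (ae_filter_ringOfSetsType mu).
  move=> x hx x0; rewrite hx// ImCD ImCN ImCD (mulNr (toC (c k))) ImCN !Im_toCM; congr (_ ^+ 2).
  by rewrite -[- (c k * Im (g2 k x))]mulNr.
apply: (Vtilde_limit c_gt0 a_ge0 hu inv hV) => e e0.
have [N1 _ h1] := cvgr_lt _ cf _ e0; have [N2 _ h2] := cvgr_lt _ cg _ e0.
pose m := maxn N1 N2; pose X : R := 2 * m.+1%:R.
have s0 := @scut_supp R m.
have sd0 x : X <= x -> derive1 (scut m) x = 0 by exact: derive1_supp (@smooth_scut R m) s0.
have sdd0 x : X <= x -> derive1 (derive1 (scut m)) x = 0.
  by apply: derive1_supp sd0; apply: smooth_derive1; exact: smooth_scut.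
exists X, (f m), (g m); split; split => //.
- by move=> k x hx; rewrite /f s0// mul0r.
- by move=> k x hx; rewrite /g /gF /cutA /cut2 sd0// sdd0// s0// !mul0r !mulr0 !addr0 !mulr0.
- by apply: ltW; apply: h1; exact: leq_maxl.
- by apply: ltW; apply: h2; exact: leq_maxr.
move=> l s ls; rewrite /Vc.
have l0 k := L2r_lint (L0 k).1; have l1 k := L2r_lint (L1 k).1; have l2 k := L2r_lint (L2 k).1.
have l0' k := L2r_lint (L0 k).2; have l1' k := L2r_lint (L1 k).2; have l2' k := L2r_lint (L2 k).2.
have E1 := Vr_cut c_gt0 (@smooth_scut R m) s0 (@scut_0 R m) (@derive1_scut_0 R m) l0 l1 l2
   (fun k => (W1 k).1) (fun k => (W2 k).1) kr ls.
have E2 := Vr_cut c_gt0 (@smooth_scut R m) s0 (@scut_0 R m) (@derive1_scut_0 R m) l0' l1' l2'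
   (fun k => (W1 k).2) (fun k => (W2 k).2) ki ls.
rewrite (_ : (fun k => Re \o f m k) = fun k x => scut m x * Re (u k x)); last first.
  by apply/funext => k; exact: Ref.
rewrite (_ : (fun k => Im \o f m k) = fun k x => scut m x * Im (u k x)); last first.
  by apply/funext => k; exact: Imf.
apply: (etrans (f_equal2 (fun x y : C => x + iC R * y) E1 E2)).
have alg (z P Q : C) : z * P + iC R * (z * Q) = z * (P + iC R * Q) by ring.
exact: alg.
Qed.

End VtildeAop.

(** * Regularity from the form bound *)

Section WeakRegularity.
Variable R : realType.
Local Notation mu := (@lebesgue_measure R).
Local Notation TR := (measurableTypeR R).
Local Notation pos := (@pos_half R : set TR).
Implicit Types (f g h phi : R -> R) (b x t : R).

Let mpos : measurable pos := @measurable_pos_half R.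

Lemma C1_Rint0 phi dphi b : (forall x, is_derive x 1 phi (dphi x)) -> continuous dphi ->
  (forall x, b <= x -> phi x = 0) -> (forall x, b <= x -> dphi x = 0) ->
  rint mu pos dphi /\ Rintegral mu pos dphi = - phi 0.
Proof.
move=> dp cd p0 d0; have bm : 0 <= Num.max 0 b by rewrite le_max lexx.
have d0' x : Num.max 0 b <= x -> dphi x = 0 by rewrite ge_max => /andP[_ h]; exact: d0.
rewrite pos_halfE; split; first exact: rint_ray d0'.
by apply: (@FTC_ray _ _ _ _ (Num.max 0 b)) => //; rewrite p0// le_max lexx orbT.
Qed.

Lemma hwd_trace (F f g : R -> R) : lint f -> lint g -> wderiv f g -> {within `[0, +oo[, continuous F} ->
  {ae mu, forall x, 0 < x -> F x = f x} -> hwd f g (F 0).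
Proof.
move=> lf lg fg cF Ff; have [t h] := du_bois_reymond lf lg fg.
by rewrite (trace_unique lg cF Ff h); exact: hwd_prim.
Qed.

Lemma continuous_within_pos f : continuous f -> {within `[0%R, +oo[, continuous f}.
Proof. by move=> cf; exact: continuous_subspaceT. Qed.

Lemma is_derive_continuous phi dphi : (forall x, is_derive x 1 phi (dphi x)) -> continuous phi.
Proof.
move=> dp x; apply: differentiable_continuous; apply/derivable1_diffP.
by case: (dp x).
Qed.

Let alg1 (A B m : R) : A + (- m) * B = 0 -> A = - - B * m.
Proof. by move=> h; lra. Qed.
Let alg2 (A B : R) : A + B = 0 -> B = - A.
Proof. by move=> h; lra. Qed.
Let alg3 (b A : R) : - b * A + (- b) * (- A) = 0.
Proof. by ring. Qed.
Let alg4 (A B K b Z x y F p : R) : A + B = b * - x + - Z -> y + 2 * A = 0 -> b * x = p ->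
  `|Z| <= F -> `|y| <= K -> B <= `|p| + F + K.
Proof.
move=> h1 h2 <- /ler_normlP[h3 h4] /ler_normlP[h5 h6].
by have /ler_normlP[h7 h8] := lexx `|b * x|; lra.
Qed.

Let alg5 (g p q : R) : `|q| <= `|p| -> `|g * q| <= g ^+ 2 + p ^+ 2.
Proof.
move=> qp; rewrite normrM -[g ^+ 2]real_normK ?num_real// -[p ^+ 2]real_normK ?num_real//.
have := ler_wpM2l (normr_ge0 g) qp; have := sqr_ge0 (`|g| - `|p|).
have := sqr_ge0 `|g|; have := sqr_ge0 `|p|.
have -> : (`|g| - `|p|) ^+ 2 = `|g| ^+ 2 - 2 * (`|g| * `|p|) + `|p| ^+ 2 by ring.
by move: (`|g| * `|q|) (`|g| * `|p|) (`|g| ^+ 2) (`|p| ^+ 2) => *; lra.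
Qed.

(** The argument of [weak_const] one order higher: pairing with [phi'] depends on [int phi] only,
    which determines the slope [be]; after subtracting [be x], [weak_const] applies. *)
Lemma weak_affine h : lint h ->
  (forall phi, testR phi -> Rintegral mu pos (fun x => h x * derive1 (derive1 phi) x) = 0) ->
  exists al be, {ae mu, forall x, 0 < x -> h x = al + be * x}.
Proof.
move=> lh h0; have [rho trho rho1] := test_unit R.
pose be := - Rintegral mu pos (fun x => h x * derive1 rho x).
have key phi : testR phi -> Rintegral mu pos (fun x => h x * derive1 phi x) = - be * Rintegral mu pos phi.
  move=> tphi; pose m := Rintegral mu pos phi.
  pose k x := phi x + (- m) * rho x.
  have tk : testR k by apply: testD => //; exact: testZ.
  have k0 : Rintegral mu pos k = 0.
    rewrite /k (@RintD _ _ _ mu)//; [|exact: rint_test|by apply: rintZ => //; exact: rint_test].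
    by rewrite (@RintZ _ _ _ mu)// ?rho1 ?mulr1 ?subrr//; exact: rint_test.
  have [tK dK] := test_prim tk k0.
  have dk : derive1 k = fun x => derive1 phi x + (- m) * derive1 rho x.
    have sr : smoothR (fun x => (- m) * rho x) by apply: smoothZ; exact: trho.1.
    rewrite /k (derive1_smoothD tphi.1 sr); apply/funext => x; congr (_ + _).
    apply: is_derive_derive1.
    exact: (is_deriveZ (- m) (smooth_is_derive x trho.1)).
  have := h0 _ tK; rewrite dK dk.
  have tp' := test_derive1 tphi; have tr' := test_derive1 trho.
  rewrite (_ : (fun x => _) = fun x => h x * derive1 phi x + (- m) * (h x * derive1 rho x)); last first.
    by apply/funext => x; ring.
  rewrite (@RintD _ _ _ mu)//; [|exact: rint_lint_test|by apply: rintZ => //; exact: rint_lint_test].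
  rewrite (@RintZ _ _ _ mu)//; last exact: rint_lint_test.
  exact: alg1.
have lx : lint (fun x => x) by apply: continuous_lint => x; exact: cvg_id.
have [|phi tphi|al hal] := @weak_const _ (fun x => h x + (- be) * x).
- exact: lintD.
- have tp' := test_derive1 tphi; have [_ [b [_ _ _ hb]]] := test_supp tphi.
  rewrite (_ : (fun x => _) = fun x => h x * derive1 phi x + (- be) * (x * derive1 phi x)); last first.
    by apply/funext => x; ring.
  rewrite (@RintD _ _ _ mu)//; [|exact: rint_lint_test|by apply: rintZ => //; exact: (rint_lint_test lx)].
  rewrite (@RintZ _ _ _ mu)//; last exact: (rint_lint_test lx).
  rewrite key//; suff -> : Rintegral mu pos (fun x => x * derive1 phi x) = - Rintegral mu pos phi.
    exact: alg3.
  have sxp := smoothM (@smooth_id R) tphi.1.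
  have d : derive1 (fun x => x * phi x) = fun x => phi x + x * derive1 phi x.
    rewrite (derive1_smoothM (@smooth_id R) tphi.1); apply/funext => x.
    by rewrite (is_derive_derive1 (is_derive_id x 1)) mul1r.
  have := @Rint_derive _ _ b 0 sxp (fun x hx => etrans (congr1 (fun y => x * y) (hb x hx)) (mulr0 _)).
  rewrite d -pos_halfE mul0r oppr0 (@RintD _ _ _ mu)//; [|exact: rint_test|exact: (rint_lint_test lx)].
  exact: alg2.
exists al, be; move: hal; apply: filterS; first exact: (ae_filter_ringOfSetsType mu).
by move=> x hx x0; rewrite -(hx x0); ring.
Qed.

(** Integrating [G] twice from 0 gives one solution, and the difference to [f] is affine by
    [weak_affine]. Thus [f] has a C1 representative whose derivative is known explicitly. *)
Lemma weak_C1 f G : lint f -> lint G ->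
  (forall phi, testR phi -> Rintegral mu pos (fun x => f x * derive1 (derive1 phi) x) =
     Rintegral mu pos (fun x => G x * phi x)) ->
  exists (be : R) (p : R -> R), (forall x, is_derive x 1 p (be + prim G x)) /\
    {ae mu, forall x, 0 < x -> p x = f x}.
Proof.
move=> lf lG fG.
have cP := prim_continuous lG; have lP := continuous_lint cP.
have c2 := prim_continuous lP; have lPP := continuous_lint c2.
have [|phi tphi|al [be h]] := @weak_affine (fun x => f x + (-1) * prim (prim G) x).
- exact: lintD.
- have td := test_derive1 tphi; have td2 := test_derive1 td.
  have [_ [b [_ _ _ hb]]] := test_supp tphi.
  have hb' x : b <= x -> derive1 phi x = 0 by exact: derive1_supp tphi.1 hb.
  rewrite (_ : (fun x => _) = fun x => f x * derive1 (derive1 phi) x +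
     (-1) * (prim (prim G) x * derive1 (derive1 phi) x)); last by apply/funext => x; ring.
  rewrite (@RintD _ _ _ mu)//; [|exact: rint_lint_test|by apply: rintZ => //; exact: (rint_lint_test lPP)].
  rewrite (@RintZ _ _ _ mu)//; last exact: (rint_lint_test lPP).
  rewrite fG// (prim_by_parts lP td.1 hb') (prim_by_parts lG tphi.1 hb); ring.
exists be, (fun x => al + be * x + prim (prim G) x); split.
  move=> x; have h1 : is_derive x 1 (cst al + be \*: id) (0 + be *: 1).
    by apply: is_deriveD; exact: is_deriveZ.
  have h2 : is_derive x 1 (prim (prim G)) (prim G x).
    by apply: prim_derive => // y; exact: prim_neg.
  by apply: (is_derive_eq (is_deriveD h1 h2)); rewrite /GRing.scale/=; ring.
move: h; apply: filterS; first exact: (ae_filter_ringOfSetsType mu).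
by move=> x hx x0; rewrite -(hx x0); ring.
Qed.

Section energy.
Variables (f G p : R -> R) (be : R).
Hypotheses (hf : L2r mu pos f) (hG : L2r mu pos G).
Hypothesis dp : forall x, is_derive x 1 p (be + prim G x).
Hypothesis pf : {ae mu, forall x, 0 < x -> p x = f x}.

Let G1 x := be + prim G x.
Let lG : lint G := L2r_lint hG.
Let cG1 : continuous G1.
Proof. by move=> x; apply: cvgD; [exact: cvg_cst|exact: prim_continuous]. Qed.
Let cp : continuous p. Proof. exact: is_derive_continuous dp. Qed.
Let mp : measurable_fun pos p.
Proof. by apply: measurable_funTS; exact: continuous_measurable_fun. Qed.

Lemma p_nsq : L2r mu pos p /\ nsq mu pos p = nsq mu pos f.
Proof.
have mp2 : measurable_fun pos (fun x => p x ^+ 2) by exact: measurable_funX.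
have mf2 : measurable_fun pos (fun x => f x ^+ 2) by apply: measurable_funX; exact: hf.1.
have e : (\int[mu]_(x in pos) (p x ^+ 2)%:E = \int[mu]_(x in pos) (f x ^+ 2)%:E)%E.
  apply: ae_eq_integral => //; [exact/measurable_EFinP|exact/measurable_EFinP|].
  move: pf; apply: filterS; first exact: (ae_filter_ringOfSetsType mu).
  by move=> x hx x0 /=; rewrite hx.
have [|h _] := @L2rP _ _ _ mu pos mpos p (nsq mu pos f) mp; first by rewrite e nsqE.
by split => //; rewrite /nsq /Rintegral e.
Qed.

(** Two integrations by parts: [int chi p'^2] reduces to a boundary term, to [int chi p G], and to
    [int chi' p p'], which is [- (1/2) int chi'' p^2] as [chi'] vanishes at 0. Every bound is
    uniform in [m]. *)
Lemma energy m (K : R) : (forall x, `|derive1 (derive1 (scut m)) x| <= K) ->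
  Rintegral mu pos (fun x => scut m x * G1 x ^+ 2) <=
  `|be * p 0| + (nsq mu pos G + nsq mu pos f) + K * nsq mu pos f.
Proof.
move=> hK; have [Lp <-] := p_nsq.
pose X : R := 2 * m.+1%:R; pose chi := scut (R := R) m.
have schi : smoothR chi := @smooth_scut R m.
have sd := smooth_derive1 schi; have sd2 := smooth_derive1 sd.
have s0 x : X <= x -> chi x = 0 by exact: scut_supp.
have sd0 x : X <= x -> derive1 chi x = 0 by exact: derive1_supp schi s0.
have sdd0 x : X <= x -> derive1 (derive1 chi) x = 0 by exact: derive1_supp sd sd0.
have cc := smooth_continuous schi; have cc1 := smooth_continuous sd; have cc2 := smooth_continuous sd2.
have cM (u v : R -> R) : continuous u -> continuous v -> continuous (fun x => u x * v x).
  by move=> hu hv x; apply: cvgM; [exact: hu|exact: hv].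
have cD (u v : R -> R) : continuous u -> continuous v -> continuous (fun x => u x + v x).
  by move=> hu hv x; apply: cvgD; [exact: hu|exact: hv].
have one_lint : lint (fun=> 1 : R) by apply: continuous_lint => x; exact: cvg_cst.
have cint_ (u : R -> R) : continuous u -> (forall x, X <= x -> u x = 0) -> rint mu pos u.
  move=> cu u0; apply: eq_rint (lint_mul one_lint cu u0) => // x _; exact: mul1r.
have dphi x : is_derive x 1 (fun x => chi x * p x) (derive1 chi x * p x + chi x * G1 x).
  have h := is_deriveM (smooth_is_derive x schi) (dp x).
  by apply: (is_derive_eq h); rewrite /GRing.scale/= /G1; ring.
have cdphi : continuous (fun x => derive1 chi x * p x + chi x * G1 x) by apply: cD; apply: cM.
have p0 x : X <= x -> chi x * p x = 0 by move=> h; rewrite s0// mul0r.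
have d0 x : X <= x -> derive1 chi x * p x + chi x * G1 x = 0.
  by move=> h; rewrite s0// sd0// !mul0r addr0.
have E1 := prim_by_parts_C1 lG dphi cdphi p0 d0.
have [i1 E2] := C1_Rint0 dphi cdphi p0 d0.
have dphi2 x : is_derive x 1 (fun x => derive1 chi x * (p x * p x))
    (derive1 (derive1 chi) x * p x ^+ 2 + 2 * (derive1 chi x * p x * G1 x)).
  have h := is_deriveM (smooth_is_derive x sd) (is_deriveM (dp x) (dp x)).
  by apply: (is_derive_eq h); rewrite !fctE /GRing.scale/= /G1; ring.
have cp2 : continuous (fun x => p x ^+ 2).
  by under eq_fun do rewrite expr2; exact: cM.
have c3 : continuous (fun x => derive1 chi x * p x * G1 x) := cM _ _ (cM _ _ cc1 cp) cG1.
have c4 : continuous (fun x => derive1 (derive1 chi) x * p x ^+ 2) by exact: cM.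
have c5 : continuous (fun x => derive1 (derive1 chi) x * p x ^+ 2 + 2 * (derive1 chi x * p x * G1 x)).
  have c20 : continuous ((fun=> 2) : R -> R) by move=> x; exact: cvg_cst.
  exact: (cD _ _ c4 (cM _ _ c20 c3)).
have v3 x : X <= x -> derive1 chi x * p x * G1 x = 0 by move=> h; rewrite sd0// !mul0r.
have v4 x : X <= x -> derive1 (derive1 chi) x * p x ^+ 2 = 0 by move=> h; rewrite sdd0// mul0r.
have i3 := cint_ _ c3 v3; have i4 := cint_ _ c4 v4.
have v5 x : X <= x -> derive1 chi x * (p x * p x) = 0 by move=> hx; rewrite sd0// mul0r.
have v6 x : X <= x -> derive1 (derive1 chi) x * p x ^+ 2 + 2 * (derive1 chi x * p x * G1 x) = 0.
  by move=> hx; rewrite v4// v3// mulr0 addr0.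
have [_ E3] := C1_Rint0 dphi2 c5 v5 v6.
have c6 : continuous (fun x => chi x * G1 x ^+ 2).
  by under eq_fun do rewrite expr2; exact: (cM _ _ cc (cM _ _ cG1 cG1)).
have v7 x : X <= x -> chi x * G1 x ^+ 2 = 0 by move=> hx; rewrite s0// mul0r.
have i6 := cint_ _ c6 v7.
have i7 : rint mu pos (fun x => G x * (chi x * p x)) by apply: (lint_mul lG _ p0); exact: cM.
have i8 : rint mu pos (fun x => prim G x * (derive1 chi x * p x + chi x * G1 x)).
  by apply: (lint_mul _ cdphi d0); apply: continuous_lint; exact: prim_continuous.
have E4 : Rintegral mu pos (fun x => derive1 chi x * p x * G1 x) + Rintegral mu pos (fun x => chi x * G1 x ^+ 2) =
    be * Rintegral mu pos (fun x => derive1 chi x * p x + chi x * G1 x) +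
    Rintegral mu pos (fun x => prim G x * (derive1 chi x * p x + chi x * G1 x)).
  rewrite -(@RintZ _ _ _ mu)// -!(@RintD _ _ _ mu)//; last exact: rintZ.
  apply: eq_Rintegral => x _; rewrite /G1.
  by move: (derive1 chi x) (chi x) (p x) (prim G x) => *; ring.
rewrite (@RintD _ _ _ mu)// in E3; last exact: rintZ.
rewrite (@RintZ _ _ _ mu)// in E3.
have chi00 : chi 0 = 1 := scut_0 R m; have dchi0 : derive1 chi 0 = 0 := derive1_scut_0 R m.
rewrite dchi0 mul0r oppr0 in E3; rewrite E1 E2 chi00 mul1r in E4.
have B1 : `|Rintegral mu pos (fun x => G x * (chi x * p x))| <= nsq mu pos G + nsq mu pos p.
  rewrite -(@RintD _ _ _ mu)//; [|exact: hG.2|exact: Lp.2].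
  apply: Rintegral_normle => //; first by apply: rintD => //; [exact: hG.2|exact: Lp.2].
  move=> x _; have /andP[h1 h2] := scut_01 m x.
  have : `|chi x * p x| <= `|p x| by rewrite normrM ler_piMl// ger0_norm.
  exact: alg5.
have B2 : `|Rintegral mu pos (fun x => derive1 (derive1 chi) x * p x ^+ 2)| <= K * nsq mu pos p.
  rewrite -(@RintZ _ _ _ mu)//; last exact: Lp.2.
  apply: Rintegral_normle => //; first by apply: rintZ => //; exact: Lp.2.
  by move=> x _; rewrite normrM [X in _ * X]ger0_norm ?sqr_ge0// ler_wpM2r ?sqr_ge0.
exact: (alg4 E4 E3 erefl B1 B2).
Qed.

End energy.
End WeakRegularity.

(** * Regularity on a single edge *)

Section FormRegularity.
Variable R : realType.
Local Notation mu := (@lebesgue_measure R).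
Local Notation TR := (measurableTypeR R).
Local Notation pos := (@pos_half R : set TR).
Implicit Types (f g h phi : R -> R) (b x t : R).

Let mpos : measurable pos := @measurable_pos_half R.

Lemma L2r_smooth f b : smoothR f -> (forall x, b <= x -> f x = 0) -> L2r mu pos f.
Proof.
move=> sf f0; split; first by apply: measurable_funTS; exact: meas_smooth.
under eq_fun do rewrite expr2; apply: (rint_smooth (b := b)); first exact: smoothM.
by move=> x hx; rewrite f0// mul0r.
Qed.

Lemma smooth_by_parts f g b : smoothR f -> smoothR g -> (forall x, b <= x -> f x = 0) ->
  Rintegral mu pos (fun x => f x * derive1 g x) = - f 0 * g 0 - Rintegral mu pos (fun x => derive1 f x * g x).
Proof.
move=> sf sg f0; have sfg := smoothM sf sg; have sf' := smooth_derive1 sf; have sg' := smooth_derive1 sg.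
have fg0 x : b <= x -> f x * g x = 0 by move=> hx; rewrite f0// mul0r.
have f'0 x : b <= x -> derive1 f x = 0 by exact: derive1_supp sf f0.
have i1 : rint mu pos (fun x => f x * derive1 g x).
  by apply: (rint_smooth (b := b)); [exact: smoothM|move=> x hx; rewrite f0// mul0r].
have i2 : rint mu pos (fun x => derive1 f x * g x).
  by apply: (rint_smooth (b := b)); [exact: smoothM|move=> x hx; rewrite f'0// mul0r].
have := Rint_derive 0 sfg fg0; rewrite (derive1_smoothM sf sg) -pos_halfE (@RintD _ _ _ mu)//.
move: (Rintegral _ _ _) (Rintegral _ _ _) => A B e.
by rewrite mulNr -e addrC addKr.
Qed.

(** The hypothesis is exactly what [riesz] asks of the functional [phi -> <U, A phi>]. Its
    representative [v] gives [U'' = (a0 U - v) / c0] weakly, so [U] is C1. That [U'] lies in L2 is a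
    separate matter, obtained from [energy]. *)
Lemma edge_regular (U : R -> R) (c0 a0 M : R) : 0 < c0 -> L2r mu pos U ->
  (forall phi, testR phi ->
    2 * ip mu pos U (fun x => - c0 * derive1 (derive1 phi) x + a0 * phi x) - nsq mu pos phi <= M) ->
  exists (G p : R -> R) (be : R), [/\ L2r mu pos G, L2r mu pos (fun x => be + prim G x),
    (forall x, is_derive x 1 p (be + prim G x)) & {ae mu, forall x, 0 < x -> p x = U x}] /\
    wderiv U (fun x => be + prim G x) /\ wderiv (fun x => be + prim G x) G.
Proof.
move=> c00 LU hM; have cn0 : c0 != 0 by rewrite gt_eqF.
pose A0 phi (x : R) := - c0 * derive1 (derive1 phi) x + a0 * phi x.
have tA phi : testR phi -> testR (A0 phi).
  by move=> tp; apply: testD; apply: testZ => //; do 2 apply: test_derive1.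
have A0D phi g k : testR phi -> testR g -> A0 (fun x => phi x + k * g x) = fun x => A0 phi x + k * A0 g x.
  move=> tp tg; apply/funext => x; rewrite /A0.
  have sk : smoothR (fun x => k * g x) by apply: smoothZ; exact: tg.1.
  have dk f : smoothR f -> derive1 (fun x => k * f x) = fun x => k * derive1 f x.
    by move=> sf; apply/funext => y; apply: is_derive_derive1; exact: (is_deriveZ k (smooth_is_derive y sf)).
  have sp1 := smooth_derive1 tp.1; have sg1 := smooth_derive1 tg.1.
  rewrite (derive1_smoothD tp.1 sk) (dk _ tg.1) (derive1_smoothD sp1 (@smoothZ R k _ sg1)) (dk _ sg1).
  by move: (derive1 (derive1 phi) x) (derive1 (derive1 g) x) => *; ring.
have LA phi : testR phi -> L2r mu pos (A0 phi) by move=> tp; apply: L2r_test; exact: tA.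
have [||||phi|v Lv [hv _]] := @riesz _ _ _ mu pos mpos (@testR R) (fun phi => ip mu pos (A0 phi) U) M.
- exact: L2r_test.
- exact: test0.
- by move=> f g k tf tg; apply: testD => //; exact: testZ.
- move=> f g k tf tg; rewrite A0D// ipDl ?ipZl//; try exact: LA.
  by apply: L2rZ => //; exact: LA.
- by move=> tp; rewrite ipC; exact: hM.
pose G x := (a0 / c0) * U x + (- c0^-1) * v x.
have LG : L2r mu pos G by apply: L2rD => //; exact: L2rZ.
have lU := L2r_lint LU; have lG := L2r_lint LG; have lv := L2r_lint Lv.
have UG phi : testR phi -> Rintegral mu pos (fun x => U x * derive1 (derive1 phi) x) =
    Rintegral mu pos (fun x => G x * phi x).
  move=> tp; have t2 := test_derive1 (test_derive1 tp).
  have := hv _ tp; rewrite /ip.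
  have -> : Rintegral mu pos (fun x => A0 phi x * U x) =
     - c0 * Rintegral mu pos (fun x => U x * derive1 (derive1 phi) x) + a0 * Rintegral mu pos (fun x => U x * phi x).
    rewrite -!(@RintZ _ _ _ mu)//; try exact: rint_lint_test.
    rewrite -(@RintD _ _ _ mu)//; try (by apply: rintZ => //; exact: rint_lint_test).
    by apply: eq_Rintegral => x _; rewrite /A0; move: (derive1 _ x) => y; ring.
  have -> : Rintegral mu pos (fun x => G x * phi x) =
     (a0 / c0) * Rintegral mu pos (fun x => U x * phi x) + (- c0^-1) * Rintegral mu pos (fun x => v x * phi x).
    rewrite -!(@RintZ _ _ _ mu)//; try exact: rint_lint_test.
    rewrite -(@RintD _ _ _ mu)//; try (by apply: rintZ => //; exact: rint_lint_test).
    by apply: eq_Rintegral => x _; rewrite /G; ring.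
  move: (Rintegral _ _ _) (Rintegral _ _ _) (Rintegral _ _ _) => x y z <-.
  by field.
have [be [p [dp pU]]] := weak_C1 lU lG UG.
pose G1 x := be + prim G x.
have cG1 : continuous G1 by move=> x; apply: cvgD; [exact: cvg_cst|exact: prim_continuous].
have lG1 := continuous_lint cG1.
have cp := is_derive_continuous dp.
have mp : measurable_fun pos p by apply: measurable_funTS; exact: continuous_measurable_fun.
have LG1 : L2r mu pos G1.
  (* The energy bound holds with one constant for all cutoffs; as they increase to 1 pointwise,
     Fatou gives the square integrability of [G1]. *)
  have [K [k1 k2]] := @cutoff_derive_bound R.
  pose B := `|be * p 0| + (nsq mu pos G + nsq mu pos U) + K * nsq mu pos U.
  have hB m : Rintegral mu pos (fun x => scut m x * G1 x ^+ 2) <= B.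
    apply: (@energy R U G p be LU LG dp pU m K) => x.
    exact: (@scut_bound R m K k1 k2 x).2.
  have mG1 : measurable_fun pos G1 by apply: measurable_funTS; exact: continuous_measurable_fun.
  have [|h _] := @L2rP _ _ _ mu pos mpos G1 B mG1; last exact: h.
  apply: (@fatou_bound _ _ _ mu pos mpos (fun m x => scut m x * G1 x ^+ 2) _ _ 0%N).
  - move=> m; apply: measurable_funM; last exact: measurable_funX.
    by apply: measurable_funTS; apply: meas_smooth; exact: smooth_scut.
  - by move=> m x _; have /andP[h1 _] := scut_01 m x; rewrite mulr_ge0 ?sqr_ge0.
  - move=> x x0; apply: cvg_near_cst; near=> m; have [|-> _ _] := @scut_flat R m x; last by rewrite mul1r.
    by rewrite -natr1 ltr_wpDr//; near: m; apply: nbhs_infty_gtr; exact: num_real.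
  move=> m _; rewrite (@rint_EFin _ _ _ mu)// ?lee_fin//.
  have lG2 : lint (fun x => G1 x ^+ 2).
    under eq_fun do rewrite expr2.
    by apply: continuous_lint => x; apply: cvgM; exact: cG1.
  by apply: (rint_cut (b := 2 * m.+1%:R)) => //; [exact: smooth_scut|exact: scut_supp].
exists G, p, be; split; first by split.
split; move=> phi tphi; have td := test_derive1 tphi; have [al [b [al0 _ ha hb]]] := test_supp tphi.
- rewrite -(@eq_Rintegral_ae _ _ (fun x => p x * derive1 phi x))//; last 3 first.
  + by apply: measurable_funM => //; apply: measurable_funTS; exact: meas_smooth td.1.
  + by apply: measurable_funM; [exact: LU.1|apply: measurable_funTS; exact: meas_smooth td.1].
  + move: pU; apply: filterS; first exact: (ae_filter_ringOfSetsType mu).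
    by move=> x hx x0; rewrite hx.
  have dpp x : is_derive x 1 (fun x => p x * phi x) (p x * derive1 phi x + G1 x * phi x).
    have h := is_deriveM (dp x) (smooth_is_derive x tphi.1).
    by apply: (is_derive_eq h); rewrite /GRing.scale/= /G1; ring.
  have cd : continuous (fun x => p x * derive1 phi x + G1 x * phi x).
    move=> x; apply: cvgD; apply: cvgM; [exact: cp|exact: smooth_continuous td.1 x|exact: cG1|].
    exact: smooth_continuous tphi.1 x.
  have p0 x : b <= x -> p x * phi x = 0 by move=> hx; rewrite hb// mulr0.
  have d0 x : b <= x -> p x * derive1 phi x + G1 x * phi x = 0.
    by move=> hx; rewrite hb// (derive1_supp tphi.1 hb hx) !mulr0 addr0.
  have [_] := C1_Rint0 dpp cd p0 d0.
  have lp := continuous_lint cp.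
  rewrite (@RintD _ _ _ mu)//; [|exact: rint_lint_test|exact: rint_lint_test].
  rewrite (ha 0 (ltW al0)) mulr0 oppr0 => /eqP; rewrite addr_eq0 => /eqP.
  exact.
have l1 : lint (prim G) by apply: continuous_lint; exact: prim_continuous.
rewrite (_ : (fun x => _) = fun x => prim G x * derive1 phi x + be * derive1 phi x); last first.
  by apply/funext => x; ring.
rewrite (@RintD _ _ _ mu)//; [|exact: rint_lint_test|by apply: rintZ => //; exact: rint_test].
rewrite (@RintZ _ _ _ mu)//; last exact: rint_test.
rewrite (prim_by_parts lG tphi.1 hb) {2}pos_halfE (Rint_derive 0 tphi.1 hb) (ha 0 (ltW al0)).
by rewrite oppr0 mulr0 addr0.
Unshelve. all: by end_near. Qed.

(** Functions with prescribed value [p] and slope [q] at the vertex and support of length at most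
    [2 / (m + 1)]. Their norm tends to 0 while their boundary data stay fixed. *)
Definition rfam (m : nat) (p q x : R) : R := (p + q * x) * cutoff (m.+1%:R * x + 0).

Lemma smooth_rfam m p q : smoothR (rfam m p q).
Proof.
apply: smoothM; last by apply: smooth_comp_lin; exact: smooth_cutoff.
by apply: smoothD; [exact: smooth_cst|apply: smoothZ; exact: smooth_id].
Qed.

Lemma rfam_supp m p q x : 2 <= x -> rfam m p q x = 0.
Proof.
move=> hx; rewrite /rfam addr0 cutoff0 ?mulr0// (le_trans hx)// ler_peMl// ?ler1n//.
by rewrite (le_trans _ hx).
Qed.

Lemma rfam_0 m p q : rfam m p q 0 = p.
Proof. by rewrite /rfam !mulr0 !addr0 cutoff1// mulr1. Qed.

Lemma derive1_rfam_0 m p q : derive1 (rfam m p q) 0 = q.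
Proof.
have sl : smoothR (fun x : R => p + q * x).
  by apply: smoothD; [exact: smooth_cst|apply: smoothZ; exact: smooth_id].
have sc : smoothR (fun x : R => cutoff (m.+1%:R * x + 0)).
  by apply: smooth_comp_lin; exact: smooth_cutoff.
rewrite /rfam (derive1_smoothM sl sc) (@derive1_lin _ (@cutoff R)); last exact: smooth_cutoff.
rewrite !mulr0 !addr0 (@derive1_cutoff0 R 0) ?mulr0 ?addr0; last by left.
rewrite cutoff1// mulr1; apply: is_derive_derive1.
have h1 : is_derive (0 : R) (1 : R) (cst p + q \*: id) (0 + q *: 1).
  by apply: is_deriveD; exact: is_deriveZ.
by apply: (is_derive_eq h1); rewrite /GRing.scale/=; ring.
Qed.

Lemma nsq_rfam p q : nsq mu pos (rfam m p q) @[m --> \oo] --> (0 : R).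
Proof.
pose G x : R := (`|p| + 2 * `|q|) * cutoff (2^-1 * x + 0).
have sG : smoothR G by apply: smoothZ; apply: smooth_comp_lin; exact: smooth_cutoff.
have LG : L2r mu pos G.
  apply: (L2r_smooth (b := 4)) => // x hx; rewrite /G cutoff0 ?mulr0//; lra.
apply: (@nsq_dct _ (fun m => rfam m p q) G) => //.
- by move=> m; apply: measurable_funTS; apply: meas_smooth; exact: smooth_rfam.
- move=> m x x0; have [x2|x2] := leP 2 x; first by rewrite rfam_supp// normr0.
  rewrite /G cutoff1; last by lra.
  rewrite mulr1 [leRHS]ger0_norm; last by rewrite addr_ge0// mulr_ge0.
  rewrite /rfam normrM (le_trans (_ : _ <= `|p + q * x|))//.
    rewrite ler_piMr//; have /andP[h1 h2] := cutoff_01 (m.+1%:R * x + 0).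
    by rewrite ger0_norm.
  rewrite (le_trans (ler_normD _ _))// lerD2l normrM mulrC ler_wpM2r// gtr0_norm//.
  exact: ltW.
move=> x x0; near=> m; rewrite /rfam addr0 cutoff0 ?mulr0//.
rewrite -ler_pdivrMr//.
by rewrite -[m.+1%:R]natr1; apply: ler_wpDr => //; near: m; apply: nbhs_infty_ger; exact: num_real.
Unshelve. all: by end_near. Qed.

End FormRegularity.

(** * Vertex conditions from the form bound *)

Section FormDomain.
Variable R : realType.
Local Notation mu := (@lebesgue_measure R).
Local Notation TR := (measurableTypeR R).
Local Notation pos := (@pos_half R : set TR).

Let mpos : measurable pos := @measurable_pos_half R.

Variables (n : nat) (c a : 'I_n -> R).
Hypothesis c_gt0 : forall k, 0 < c k.

Definition core (b : R) (r : 'I_n -> R -> R) : Prop :=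
  [/\ forall k, smoothR (r k), forall k x, b <= x -> r k x = 0,
      forall k l, r k 0 = r l 0 & \sum_(k < n) c k * derive1 (r k) 0 = 0].

(** Integrating twice by parts up to the vertex isolates the boundary form; the rest is an inner
    product with [r] itself, hence negligible on functions of small norm. *)
Lemma ip_Ar k (U G1 G r : R -> R) (t be b : R) : L2r mu pos U -> L2r mu pos G ->
  hwd U G1 t -> hwd G1 G be -> smoothR r -> (forall x, b <= x -> r x = 0) ->
  ip mu pos U (Ar c a k r) = c k * (t * derive1 r 0 - be * r 0) +
    ip mu pos (fun x => - c k * G x + a k * U x) r.
Proof.
move=> LU LG h1 h2 sr r0; have sr1 := smooth_derive1 sr; have sr2 := smooth_derive1 sr1.
have r10 := derive1_supp sr r0; have r20 := derive1_supp sr1 r10.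
have Lr := L2r_smooth sr r0; have Lr2 := L2r_smooth sr2 r20.
have e1 := h1 _ _ sr1 r10; have e2 := h2 _ _ sr r0.
have E1 : ip mu pos U (Ar c a k r) = - c k * ip mu pos U (derive1 (derive1 r)) + a k * ip mu pos U r.
  rewrite ipC /Ar (@ipDl _ _ _ mu pos mpos _ _ _ (@L2rZ _ _ _ mu pos mpos _ _ Lr2) (@L2rZ _ _ _ mu pos mpos _ _ Lr) LU).
  by rewrite !(@ipZl _ _ _ mu pos mpos)// ![ip mu pos _ U]ipC.
rewrite E1 (@ipDl _ _ _ mu pos mpos _ _ _ (@L2rZ _ _ _ mu pos mpos _ _ LG) (@L2rZ _ _ _ mu pos mpos _ _ LU) Lr).
rewrite !(@ipZl _ _ _ mu pos mpos)//.
have -> : ip mu pos U (derive1 (derive1 r)) = - t * derive1 r 0 + be * r 0 + ip mu pos G r.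
  rewrite /ip e1 e2; move: (Rintegral _ _ _) (derive1 r 0) => A D; ring.
move: (ip mu pos U r) (ip mu pos G r) (derive1 r 0) => A B D; ring.
Qed.

Lemma core_rfam m p (q : 'I_n -> R) : \sum_(k < n) c k * q k = 0 -> core 2 (fun k => rfam m p (q k)).
Proof.
move=> q0; split.
- by move=> k; exact: smooth_rfam.
- by move=> k x; exact: rfam_supp.
- by move=> k l; rewrite !rfam_0.
- by under eq_bigr do rewrite derive1_rfam_0.
Qed.

Variables (U : 'I_n -> R -> R) (M : R).
Hypothesis LU : forall k, L2r mu pos (U k).
Hypothesis form_le : forall r b, core b r ->
  2 * \sum_(k < n) ip mu pos (U k) (Ar c a k (r k)) <= M + \sum_(k < n) nsq mu pos (r k).

Lemma form_domain : exists G1 G2 p : 'I_n -> R -> R,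
  [/\ forall k, L2r mu pos (G1 k) /\ L2r mu pos (G2 k),
      forall k, wderiv (U k) (G1 k) /\ wderiv (G1 k) (G2 k),
      forall k, continuous (p k) /\ {ae mu, forall x, 0 < x -> p k x = U k x},
      forall k, continuous (G1 k) & 
      (forall k l, p k 0 = p l 0) /\ \sum_(k < n) c k * G1 k 0 = 0].
Proof.
have hk (k : 'I_n) : exists Gpb : (R -> R) * (R -> R) * R, 
    [/\ L2r mu pos Gpb.1.1, L2r mu pos (fun x => Gpb.2 + prim Gpb.1.1 x),
    (forall x : R, is_derive x (1 : R) Gpb.1.2 (Gpb.2 + prim Gpb.1.1 x)) & {ae mu, forall x, 0 < x -> Gpb.1.2 x = U k x}] /\
    wderiv (U k) (fun x => Gpb.2 + prim Gpb.1.1 x) /\ wderiv (fun x => Gpb.2 + prim Gpb.1.1 x) Gpb.1.1.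
  have [|G [p [be h]]] := @edge_regular R (U k) (c k) (a k) M (c_gt0 k) (LU k); last by exists (G, p, be).
  move=> phi tphi; have [al [b [al0 _ ha hb]]] := test_supp tphi.
  (* A test function on one edge, continued by 0, meets all vertex conditions trivially; the global
     bound thus restricts to each edge. *)
  pose r l := if l == k then phi else (fun=> 0 : R).
  have d0 : derive1 (fun=> 0 : R) = fun=> (0 : R).
    by apply/funext => x; rewrite (derive1_cst (0 : R)).
  have cr : core b r.
    split; rewrite /r.
    - by move=> l; case: ifP => _; [exact: tphi.1|exact: smooth_cst].
    - by move=> l x hx; case: ifP => _ //; exact: hb.
    - by move=> l l'; do 2 case: ifP => _ //; rewrite ha// ltW.
    - rewrite big1// => l _; case: ifP => _; last by rewrite d0 mulr0.
      have [al' [_ [al'0 _ ha' _]]] := test_supp (test_derive1 tphi).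
      by rewrite ha' ?mulr0// ltW.
  have R0 (f : R -> R) : (forall x, f x = 0) -> Rintegral mu pos f = 0.
    by move=> f0; rewrite (_ : f = fun=> 0) /Rintegral ?integral0//; exact/funext.
  have := form_le cr; rewrite (bigD1 k)//= big1 ?addr0; last first.
    move=> l /negbTE lk; rewrite /r lk /ip /Ar d0 d0.
    by apply: R0 => x; rewrite !mulr0 addr0 mulr0.
  rewrite (bigD1 k)//= big1 ?addr0; last first.
    move=> l /negbTE lk; rewrite /r lk /nsq.
    by apply: R0 => x; rewrite expr0n.
  by rewrite /r eqxx lerBlDr.
have {hk} [S hS] := choice hk.
pose G2 k := (S k).1.1; pose p k := (S k).1.2; pose be k := (S k).2; pose G1 k x := be k + prim (G2 k) x.
have L2 k : L2r mu pos (G2 k) by case: (hS k) => -[].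
have L1 k : L2r mu pos (G1 k) by case: (hS k) => -[].
have w1 k : wderiv (U k) (G1 k) by case: (hS k) => _ [].
have w2 k : wderiv (G1 k) (G2 k) by case: (hS k) => _ [].
have pU k : {ae mu, forall x, 0 < x -> p k x = U k x} by case: (hS k) => -[].
have cp k : continuous (p k) by case: (hS k) => -[_ _ h _] _; exact: is_derive_continuous h.
have cG k : continuous (G1 k).
  by move=> x; apply: cvgD; [exact: cvg_cst|apply: prim_continuous; exact: L2r_lint (L2 k)].
have h1 k : hwd (U k) (G1 k) (p k 0).
  apply: hwd_trace (pU k); [exact: L2r_lint (LU k)|exact: L2r_lint (L1 k)|exact: w1|].
  exact: continuous_within_pos.
have h2 k : hwd (G1 k) (G2 k) (G1 k 0).
  apply: hwd_trace; [exact: L2r_lint (L1 k)|exact: L2r_lint (L2 k)|exact: w2| |].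
    exact: continuous_within_pos.
  exact: aeW.
pose v k x := - c k * G2 k x + a k * U k x.
have Lv k : L2r mu pos (v k) by apply: (@L2rD _ _ _ mu pos mpos); apply: (@L2rZ _ _ _ mu pos mpos).
pose B p0 (q : 'I_n -> R) := \sum_(k < n) c k * (p k 0 * q k - G1 k 0 * p0).
pose M' := M + \sum_(k < n) nsq mu pos (v k).
have bd r b : core b r -> 2 * \sum_(k < n) c k * (p k 0 * derive1 (r k) 0 - G1 k 0 * r k 0) <=
    M' + 2 * \sum_(k < n) nsq mu pos (r k).
  move=> cr; have := form_le cr; have [sr r0 _ _] := cr.
  under eq_bigr => k _ do rewrite (ip_Ar k (LU k) (L2 k) (h1 k) (h2 k) (sr k) (r0 k)).
  rewrite big_split/=.
  have : - (2 * \sum_(k < n) ip mu pos (v k) (r k)) <= \sum_(k < n) nsq mu pos (v k) + \sum_(k < n) nsq mu pos (r k).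
    rewrite -big_split mulr_sumr -sumrN/=; apply: ler_sum => k _.
    have := ip_le mpos ltr01 (Lv k) (L2r_smooth (sr k) (r0 k)); rewrite invr1 !mul1r.
    by apply: le_trans; rewrite -mulrN ler_pM2l// -normrN ler_norm.
  rewrite /M' /v.
  move: (\sum_(k < n) _) (\sum_(k < n) _) (\sum_(k < n) _) (\sum_(k < n) _) => x1 x2 x3 x4; lra.
(* The boundary form scales linearly under [s], while [rfam] carries the scaled data at vanishing
   norm. Hence [2 s B] stays below [M'] for every real [s], and [B = 0]; the value of [s] tested
   below would give [M' + 1 <= M']. *)
have B0 p0 q : \sum_(k < n) c k * q k = 0 -> B p0 q = 0.
  move=> q0.
  have key s : 2 * s * B p0 q <= M'.
    have q0' : \sum_(k < n) c k * (s * q k) = 0.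
      by under eq_bigr do rewrite mulrCA; rewrite -mulr_sumr q0 mulr0.
    have cs : \sum_(k < n) nsq mu pos (rfam m (s * p0) (s * q k)) @[m --> \oo] --> (0 : R).
      rewrite -[X in _ --> X](_ : \sum_(k < n) (0 : R) = _); last by rewrite big1.
      by apply: cvg_big => [|k _]; [exact: add_continuous|exact: nsq_rfam].
    have cs2 : M' + 2 * \sum_(k < n) nsq mu pos (rfam m (s * p0) (s * q k)) @[m --> \oo] --> M' + 2 * 0.
      by apply: cvgD; [exact: cvg_cst|apply: cvgM; [exact: cvg_cst|exact: cs]].
    rewrite -[M']addr0 -[X in M' + X](mulr0 2) -(cvg_lim (@Rhausdorff R) cs2).
    apply: limr_ge; first by apply/cvg_ex; eexists; exact: cs2.
    near=> m; apply: le_trans (bd _ _ (core_rfam m (s * p0) q0')).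
    under [in X in _ <= X]eq_bigr do rewrite derive1_rfam_0 rfam_0.
    rewrite -mulrA ler_pM2l// /B mulr_sumr; apply: ler_sum => k _.
    by rewrite le_eqVlt; apply/orP; left; apply/eqP; ring.
  apply/eqP; apply: contrapT => /negP Bn0.
  have := key ((M' + 1) / (2 * B p0 q)).
  rewrite (_ : _ * _ = M' + 1); last by field; rewrite Bn0.
  lra.
exists G1, G2, p; split => //; split; last first.
  have := B0 1 (fun=> 0); rewrite big1 => [/(_ erefl)|k _]; last by rewrite mulr0.
  rewrite /B => /eqP h; apply/eqP; rewrite -oppr_eq0 -sumrN; move: h.
  by under eq_bigr do rewrite mulr0 mulr1 sub0r mulrN.
move=> k l; have [->//|kl] := eqVneq k l.
(* Slopes [1 / c k] and [- 1 / c l] on two edges satisfy Kirchhoff's condition, and the boundary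
   form then reads [p k 0 - p l 0]. The Kirchhoff condition on [G1] was obtained above from value 1
   and zero slopes. *)
pose q i : R := (i == k)%:R / c k - (i == l)%:R / c l.
have ck i : c i != 0 by rewrite gt_eqF.
have sumE (f : 'I_n -> R) i : \sum_(j < n) f j * (j == i)%:R = f i.
  by rewrite (bigD1 i)//= eqxx mulr1 big1 ?addr0// => j /negbTE ->; rewrite mulr0.
have E (f : 'I_n -> R) : \sum_(i < n) c i * (f i * q i) = f k - f l.
  rewrite (eq_bigr (fun i => (c i * f i / c k) * (i == k)%:R - (c i * f i / c l) * (i == l)%:R)).
    by rewrite sumrB !sumE ![c _ * _]mulrC !mulfK.
  by move=> i _; rewrite /q; ring.
have := B0 0 q; rewrite /B.
under eq_bigr do rewrite -[q _]mul1r.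
rewrite (E (fun=> 1)) subrr => /(_ erefl).
under eq_bigr do rewrite mulr0 subr0.
by rewrite E => /eqP; rewrite subr_eq0 => /eqP.
Unshelve. all: by end_near. Qed.

End FormDomain.

(** * The inequality behind the form bound *)

Section FormBound.
Variable R : realType.
Local Notation C := (R[i]).
Local Notation Re := (@ReC R).
Local Notation Im := (@ImC R).
Local Notation mu := (@lebesgue_measure R).
Local Notation TR := (measurableTypeR R).
Local Notation pos := (@pos_half R : set TR).

Let mpos : measurable pos := @measurable_pos_half R.

Lemma wderiv_complex (f g : R -> C) : wderiv (Re \o f) (Re \o g) -> wderiv (Im \o f) (Im \o g) ->
  weak_deriv f g.
Proof.
move=> w1 w2 phi tphi.
have ReM (z : C) (r : R) : Re (z * toC r) = Re z * r by rewrite !CE; ring.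
have ImM (z : C) (r : R) : Im (z * toC r) = Im z * r by rewrite !CE; ring.
have e1 := w1 _ tphi; have e2 := w2 _ tphi.
have E (h : R -> C) (p : R -> R) : cint (fun x => h x * toC (p x)) =
    toC (Rintegral mu pos (fun x => Re (h x) * p x)) + iC R * toC (Rintegral mu pos (fun x => Im (h x) * p x)).
  rewrite /cint; congr (toC _ + _ * toC _); apply: eq_Rintegral => x _.
    by rewrite /= ReM.
  by rewrite /= ImM.
by rewrite !E e1 e2 !toCN mulrN opprD.
Qed.

Lemma toC_sum (I : Type) (s : seq I) (f : I -> R) : toC (\sum_(i <- s) f i) = \sum_(i <- s) toC (f i).
Proof. by elim/big_rec2: _ => // i x y _ <-; rewrite toCD. Qed.

Variables (n : nat) (c a : 'I_n -> R).
Hypothesis c_gt0 : forall k, 0 < c k.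

Lemma Aop_intro (u g1 g2 P : 'I_n -> R -> C) (t : C) :
  (forall k, [/\ cL2 (u k), cL2 (g1 k) & cL2 (g2 k)]) ->
  (forall k, weak_deriv (u k) (g1 k) /\ weak_deriv (g1 k) (g2 k)) ->
  (forall k, continuous (Re \o P k) /\ continuous (Im \o P k)) ->
  (forall k, continuous (Re \o g1 k) /\ continuous (Im \o g1 k)) ->
  (forall k, mu.-negligible [set x | 0 < x /\ P k x <> u k x]) ->
  (forall k, P k 0 = t) -> \sum_(k < n) toC (c k) * g1 k 0 = 0 ->
  Aop c a u (fun k x => - toC (c k) * g2 k x + toC (a k) * u k x).
Proof.
move=> hL hw hP hg hPu hPt kir.
exists g1, g2, t, (fun k => g1 k 0); split.
  split => //.
  - by move=> k; have [L0 L1 L2] := hL k; have [w1 w2] := hw k; split => //; apply/inL2P.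
  - move=> k; exists (P k); split => //.
    + by apply: continuous_within_pos; exact: (hP k).1.
    + by apply: continuous_within_pos; exact: (hP k).2.
  - move=> k; exists (g1 k); split => //.
    + by apply: continuous_within_pos; exact: (hg k).1.
    + by apply: continuous_within_pos; exact: (hg k).2.
    + rewrite (_ : [set x | _] = set0); first exact: negligible_set0.
      by apply/seteqP; split=> x //= [_ /(_ erefl)].
move=> k; have [L0 L1 L2] := hL k; split; last first.
  rewrite (_ : [set x | _] = set0); first exact: negligible_set0.
  by apply/seteqP; split=> x //= [_ /(_ erefl)].
have L (r s : R) (F : C -> R) : (forall x y : C, F (x + y) = F x + F y) -> 
    (forall r (x : C), F (toC r * x) = r * F x) ->
    L2r mu pos (F \o u k) -> L2r mu pos (F \o g2 k) ->
    L2r mu pos (F \o (fun x => toC r * g2 k x + toC s * u k x)).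
  move=> FD FM Lu Lg; rewrite (_ : _ \o _ = fun x => r * F (g2 k x) + s * F (u k x)).
    by apply: (@L2rD _ _ _ mu pos mpos); apply: (@L2rZ _ _ _ mu pos mpos).
  by apply/funext => x; rewrite /= FD !FM.
apply/inL2P; rewrite -toCN; split; apply: L => //.
- exact: ReCD.
- exact: Re_toCM.
- exact: L0.1.
- exact: L2.1.
- exact: ImCD.
- exact: Im_toCM.
- exact: L0.2.
- exact: L2.2.
Qed.

Let Re_Mt (e : C) (r : R) : Re (e * toC r) = Re e * r. Proof. by rewrite !CE; ring. Qed.
Let Im_Mt (e : C) (r : R) : Im (e * toC r) = Im e * r. Proof. by rewrite !CE; ring. Qed.

Section Core.
Variables (e : C) (r : 'I_n -> R -> R) (b : R).
Hypothesis cr : core c b r.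

Let sr k : smoothR (r k). Proof. by case: cr. Qed.
Let r0 k x : b <= x -> r k x = 0. Proof. by case: cr => _ h _ _; exact: h. Qed.

Let cL2_e (f : R -> R) : smoothR f -> (forall x, b <= x -> f x = 0) -> cL2 (fun x => e * toC (f x)).
Proof.
move=> sf f0; have Lf := L2r_smooth sf f0; split.
  rewrite (_ : _ \o _ = fun x => Re e * f x); first exact: (@L2rZ _ _ _ mu pos mpos).
  by apply/funext => x; exact: Re_Mt.
rewrite (_ : _ \o _ = fun x => Im e * f x); first exact: (@L2rZ _ _ _ mu pos mpos).
by apply/funext => x; exact: Im_Mt.
Qed.

Let cont_e (f : R -> R) : smoothR f ->
  continuous (Re \o (fun x => e * toC (f x))) /\ continuous (Im \o (fun x => e * toC (f x))).
Proof.
move=> sf; have cf := smooth_continuous sf; split.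
  rewrite (_ : _ \o _ = fun x => Re e * f x); first by move=> x; apply: cvgM; [exact: cvg_cst|exact: cf].
  by apply/funext => x; exact: Re_Mt.
rewrite (_ : _ \o _ = fun x => Im e * f x); first by move=> x; apply: cvgM; [exact: cvg_cst|exact: cf].
by apply/funext => x; exact: Im_Mt.
Qed.

Let wd_e (f : R -> R) : smoothR f -> (forall x, b <= x -> f x = 0) ->
  weak_deriv (fun x => e * toC (f x)) (fun x => e * toC (derive1 f x)).
Proof.
move=> sf f0; have f'0 := derive1_supp sf f0.
have key (s : R) : wderiv (fun x => s * f x) (fun x => s * derive1 f x).
  move=> phi tphi; have [al [b' [al0 _ ha _]]] := test_supp tphi.
  have ssf : smoothR (fun x => s * f x) by exact: smoothZ.
  have sf0 x : b <= x -> s * f x = 0 by move=> hx; rewrite f0// mulr0.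
  rewrite (@smooth_by_parts _ (fun x => s * f x) phi b ssf tphi.1 sf0).
  rewrite ha ?mulr0 ?add0r; last exact: ltW.
  congr (- _); apply: eq_Rintegral => x _; congr (_ * _).
  by apply: is_derive_derive1; exact: (is_deriveZ s (smooth_is_derive x sf)).
apply: wderiv_complex.
  rewrite (_ : _ \o _ = fun x => Re e * f x); last by apply/funext => x; exact: Re_Mt.
  by rewrite (_ : _ \o _ = fun x => Re e * derive1 f x)//; apply/funext => x; exact: Re_Mt.
rewrite (_ : _ \o _ = fun x => Im e * f x); last by apply/funext => x; exact: Im_Mt.
by rewrite (_ : _ \o _ = fun x => Im e * derive1 f x)//; apply/funext => x; exact: Im_Mt.
Qed.

(** A real core function times a unit complex number. The choices [e = 1] and [e = iC] isolate the
    real and the imaginary part of [u] in the inner product with [A psi]. *)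
Definition ecore k x := e * toC (r k x).
Definition eAcore k x := e * toC (Ar c a k (r k) x).

Lemma inH_ecore : inH ecore.
Proof. by apply/inHP => k; exact: (cL2_e (@sr k) (@r0 k)). Qed.

Lemma trunc_ecore : trunc b ecore.
Proof. by move=> k x hx; rewrite /ecore r0// mulr0. Qed.

Lemma Aop_ecore : Aop c a ecore eAcore.
Proof.
have sr1 k := smooth_derive1 (@sr k); have sr2 k := smooth_derive1 (sr1 k).
have r10 k x : b <= x -> derive1 (r k) x = 0 by move=> hx; exact: derive1_supp (@sr k) (@r0 k) hx.
have r20 k x : b <= x -> derive1 (derive1 (r k)) x = 0 by move=> hx; exact: derive1_supp (sr1 k) (r10 k) hx.
have [T hT] : exists T, forall k, r k 0 = T.
  have [_ _ h _] := cr; have [i _|h0] := pickP 'I_n; first by exists (r i 0) => k; exact: h.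
  by exists 0 => k; have := h0 k.
have -> : eAcore = fun k x => - toC (c k) * (e * toC (derive1 (derive1 (r k)) x)) + toC (a k) * ecore k x.
  apply/funext => k; apply/funext => x; rewrite /eAcore /ecore /Ar toCD !toCM toCN.
  by move: (toC (derive1 _ x)) => y; ring.
apply: (@Aop_intro ecore (fun k x => e * toC (derive1 (r k) x)) (fun k x => e * toC (derive1 (derive1 (r k)) x))
   ecore (e * toC T)).
- by move=> k; split; [exact: (cL2_e (@sr k) (@r0 k))|exact: (cL2_e (sr1 k) (r10 k))|exact: (cL2_e (sr2 k) (r20 k))].
- by move=> k; split; [exact: (wd_e (@sr k) (@r0 k))|exact: (wd_e (sr1 k) (r10 k))].
- by move=> k; exact: (cont_e (@sr k)).
- by move=> k; exact: (cont_e (sr1 k)).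
- move=> k; rewrite (_ : [set x | _] = set0); first exact: negligible_set0.
  by apply/seteqP; split=> x //= [_ /(_ erefl)].
- by move=> k; rewrite /ecore hT.
have [_ _ _ kr] := cr.
under eq_bigr do rewrite mulrCA -toCM.
by rewrite -mulr_sumr -toC_sum kr toC0 mulr0.
Qed.

Hypothesis e1 : sqmod e = 1.

Lemma hn_ecore : hn ecore = \sum_(k < n) nsq mu pos (r k).
Proof.
apply: eq_bigr => k _; rewrite /cn /ecore.
have Lr := L2r_smooth (@sr k) (@r0 k).
have -> : nsq mu pos (Re \o (fun x => e * toC (r k x))) = Re e ^+ 2 * nsq mu pos (r k).
  rewrite /nsq -(@RintZ _ _ _ mu)//; last exact: Lr.2.
  by apply: eq_Rintegral => x _; rewrite /comp Re_Mt exprMn.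
have -> : nsq mu pos (Im \o (fun x => e * toC (r k x))) = Im e ^+ 2 * nsq mu pos (r k).
  rewrite /nsq -(@RintZ _ _ _ mu)//; last exact: Lr.2.
  by apply: eq_Rintegral => x _; rewrite /comp Im_Mt exprMn.
by rewrite -mulrDl -/(sqmod e) e1 mul1r.
Qed.

Lemma hn_addA (u : 'I_n -> R -> C) : inH u -> inH eAcore ->
  hn (fun k x => u k x + eAcore k x) = hn u + hn eAcore +
  2 * \sum_(k < n) ip mu pos (fun x => Re e * Re (u k x) + Im e * Im (u k x)) (Ar c a k (r k)).
Proof.
move=> /inHP hu /inHP hA; rewrite mulr_sumr -!big_split; apply: eq_bigr => k _ /=.
have [u1 u2] := hu k; have [A1 A2] := hA k; rewrite /cn.
have -> : nsq mu pos (Re \o (fun x => u k x + eAcore k x)) =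
    nsq mu pos (fun x => Re (u k x) + 1 * Re (eAcore k x)).
  by apply: eq_Rintegral => x _; rewrite /comp ReCD mul1r.
have -> : nsq mu pos (Im \o (fun x => u k x + eAcore k x)) =
    nsq mu pos (fun x => Im (u k x) + 1 * Im (eAcore k x)).
  by apply: eq_Rintegral => x _; rewrite /comp ImCD mul1r.
have LA : L2r mu pos (Ar c a k (r k)).
  have sr1 := smooth_derive1 (@sr k); have sr2 := smooth_derive1 sr1.
  have r10 := derive1_supp (@sr k) (@r0 k); have r20 := derive1_supp sr1 r10.
  apply: (@L2rD _ _ _ mu pos mpos); apply: (@L2rZ _ _ _ mu pos mpos).
    exact: L2r_smooth r20.
  exact: L2r_smooth (@r0 k).
rewrite (nsqD mpos 1 u1 A1) (nsqD mpos 1 u2 A2).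
rewrite (@ipDl _ _ _ mu pos mpos _ _ _ (@L2rZ _ _ _ mu pos mpos _ _ u1) (@L2rZ _ _ _ mu pos mpos _ _ u2) LA).
rewrite (@ipZl _ _ _ mu pos mpos _ _ _ u1 LA) (@ipZl _ _ _ mu pos mpos _ _ _ u2 LA).
have -> : ip mu pos (Re \o u k) (Re \o eAcore k) = Re e * ip mu pos (Re \o u k) (Ar c a k (r k)).
  rewrite ipC -[X in _ = _ * X]ipC -(@ipZl _ _ _ mu pos mpos)//.
  by apply: eq_Rintegral => x _; rewrite /comp /eAcore Re_Mt.
have -> : ip mu pos (Im \o u k) (Im \o eAcore k) = Im e * ip mu pos (Im \o u k) (Ar c a k (r k)).
  rewrite ipC -[X in _ = _ * X]ipC -(@ipZl _ _ _ mu pos mpos)//.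
  by apply: eq_Rintegral => x _; rewrite /comp /eAcore Im_Mt.
move: (nsq _ _ _) (nsq _ _ _) (nsq _ _ _) (nsq _ _ _) (ip _ _ _ _) (ip _ _ _ _) => x1 x2 x3 x4 x5 x6; ring.
Qed.

End Core.

(** Pointwise the right side minus the left side is [|l W - Z|^2]. The factor [l] is moved from [Z]
    to [W] in the mixed term, which is where the integrability of [l W] comes in. *)
Lemma nq_le4 (W Z : 'I_n -> R -> C) : qmeas a W -> qmeas a Z ->
  (nq c a (fun k s => W k s + toC s * Z k s)%R <= (nq c a W + nq c a (fun k s => toC s * Z k s)%R) +
    (nq c a (fun k s => toC s * W k s)%R + nq c a Z))%E.
Proof.
move=> mW mZ; rewrite /nq -!big_split/=; apply: lee_sum => k _.
pose D : set TR := `]a k, +oo[%classic.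
have mD : measurable D by exact: measurable_ray.
have mt (Y : 'I_n -> R -> C) : qmeas a Y -> cmeas D (fun s => toC s * Y k s).
  by move=> mY; apply: cmeasM; [apply: cmeas_toC; exact: measurable_id|exact: mY].
have m1 (h : R -> C) : cmeas D h -> measurable_fun D (fun x => (sqmod (h x) * qfun c a k x)%:E).
  move=> mh; apply/measurable_EFinP; apply: measurable_funM; first exact: meas_sqmod.
  by apply: measurable_funTS; exact: meas_qfun.
have p1 (h : R -> C) x : (0 <= (sqmod (h x) * qfun c a k x)%:E)%E.
  by rewrite lee_fin mulr_ge0 ?sqmod_ge0 ?qfun_ge0.
have mWk := m1 _ (mW k); have mZk := m1 _ (mZ k); have mW' := m1 _ (mt _ mW); have mZ' := m1 _ (mt _ mZ).
have pW x : D x -> (0 <= (sqmod (W k x) * qfun c a k x)%:E)%E by move=> _; exact: p1.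
have pZ x : D x -> (0 <= (sqmod (Z k x) * qfun c a k x)%:E)%E by move=> _; exact: p1.
have pW' x : D x -> (0 <= (sqmod (toC x * W k x) * qfun c a k x)%:E)%E by move=> _; exact: (p1 (fun x => toC x * W k x)).
have pZ' x : D x -> (0 <= (sqmod (toC x * Z k x) * qfun c a k x)%:E)%E by move=> _; exact: (p1 (fun x => toC x * Z k x)).
rewrite -(ge0_integralD mu mD pW mWk pZ' mZ') -(ge0_integralD mu mD pW' mW' pZ mZk).
have pA x : D x -> (0 <= (sqmod (W k x) * qfun c a k x)%:E + (sqmod (toC x * Z k x) * qfun c a k x)%:E)%E.
  by move=> Dx; rewrite adde_ge0 ?pW ?pZ'.
have pB x : D x -> (0 <= (sqmod (toC x * W k x) * qfun c a k x)%:E + (sqmod (Z k x) * qfun c a k x)%:E)%E.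
  by move=> Dx; rewrite adde_ge0 ?pW' ?pZ.
have mA := emeasurable_funD mWk mZ'; have mB := emeasurable_funD mW' mZk.
rewrite -(ge0_integralD mu mD pA mA pB mB).
apply: ge0_le_integral => //.
- by move=> x _; exact: (p1 (fun s => W k s + toC s * Z k s)).
- by apply: (m1 (fun s => W k s + toC s * Z k s)); apply: cmeasD; [exact: mW|exact: mt].
- exact: emeasurable_funD.
move=> s _; rewrite -!EFinD lee_fin -!mulrDl ler_wpM2r ?qfun_ge0//.
have alg (p q p' q' : R) : (p + s * p') ^+ 2 + (q + s * q') ^+ 2 <=
   p ^+ 2 + q ^+ 2 + ((s * p') ^+ 2 + (s * q') ^+ 2) + ((s * p) ^+ 2 + (s * q) ^+ 2 + (p' ^+ 2 + q' ^+ 2)).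
  have := sqr_ge0 (s * p - p'); have := sqr_ge0 (s * q - q').
  rewrite -subr_ge0 => h1 h2; rewrite -subr_ge0.
  rewrite (_ : _ - _ = (s * q - q') ^+ 2 - 0 + (s * p - p') ^+ 2); last by ring.
  exact: addr_ge0.
by rewrite /sqmod ReCD ImCD !Re_toCM !Im_toCM; exact: alg.
Qed.

End FormBound.

(** * Powers of the operator *)

Section DomainCharacterization.
Variable R : realType.
Local Notation C := (R[i]).
Local Notation Re := (@ReC R).
Local Notation Im := (@ImC R).
Local Notation mu := (@lebesgue_measure R).
Local Notation TR := (measurableTypeR R).
Local Notation pos := (@pos_half R : set TR).

Let mpos : measurable pos := @measurable_pos_half R.

Variables (n : nat) (c a : 'I_n -> R).
Hypothesis c_gt0 : forall k, 0 < c k.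
Hypothesis a_ge0 : forall k, 0 <= a k.

(** The isometry translates [nq_le4] into norms of [u], [psi], [A psi] and [u + A psi]. Expanding
    the last one, [|u|^2] and [|A psi|^2] cancel, and twice the real inner product of [u] with
    [A psi] remains. *)
Lemma Vtilde_form_le (u W : 'I_n -> R -> C) (e : C) (r : 'I_n -> R -> R) b :
  inH u -> isVtilde c a u W -> inL2q c a (fun k s => toC s * W k s) -> sqmod e = 1 -> core c b r ->
  2 * \sum_(k < n) ip mu pos (fun x => Re e * Re (u k x) + Im e * Im (u k x)) (Ar c a k (r k)) <=
  fine (nq c a (fun k s => toC s * W k s)) + \sum_(k < n) nsq mu pos (r k).
Proof.
move=> hu hV hlW e1 cr.
pose psi := ecore e r; pose A := eAcore c a e r; pose Z := Vc c a psi.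
have hpsi : inH psi := inH_ecore e cr.
have VZ : isVtilde c a psi Z := Vtilde_trunc a c_gt0 hpsi (trunc_ecore e cr).
have [hA VA] := Vtilde_Aop c_gt0 a_ge0 hpsi VZ (Aop_ecore a e cr).
have huA : inH (fun k x => u k x + A k x).
  have := inH_axpy 1 hu hA; congr inH; apply/funext => k; apply/funext => x.
  by rewrite /axpy toC1 mul1r.
have VuA := Vtilde_add c_gt0 hu hA hV VA.
have I1 := isometry c_gt0 hu hV; have I2 := isometry c_gt0 hpsi VZ.
have I3 := isometry c_gt0 hA VA; have I4 := isometry c_gt0 huA VuA.
have mW := ((@inL2qP R n c a c_gt0 W).1 hV.1).1.
have mZ := ((@inL2qP R n c a c_gt0 Z).1 VZ.1).1.
have [_ flW] := (@inL2qP R n c a c_gt0 _).1 hlW.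
have := nq_le4 c_gt0 mW mZ; rewrite I1 I2 I3 I4 !nHhn//.
rewrite -(@fineK _ (nq c a (fun k s => toC s * W k s))); last first.
  by rewrite ge0_fin_numE// nq_ge0.
rewrite /= -!EFinD lee_fin (hn_ecore cr e1) (hn_addA cr hu hA).
by rewrite lerD2l.
Qed.

(** [form_domain] is applied to the real and the imaginary part of [u] separately, and the two sets
    of derivatives are reassembled. An edge [i0] exists since [n > 0]; it names the common trace. *)
Lemma Aop_Vtilde (u W : 'I_n -> R -> C) : (0 < n)%N -> inH u -> isVtilde c a u W ->
  inL2q c a (fun k s => toC s * W k s) -> exists v, Aop c a u v.
Proof.
move=> n0 hu hV hlW; have Lu k := (inHP u).1 hu k.
pose M := fine (nq c a (fun k s => toC s * W k s)).
have b1 r b : core c b r -> 2 * \sum_(k < n) ip mu pos (Re \o u k) (Ar c a k (r k)) <=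
    M + \sum_(k < n) nsq mu pos (r k).
  move=> cr; have e1 : sqmod (1 : C) = 1 by rewrite /sqmod !CE; ring.
  apply: le_trans (Vtilde_form_le hu hV hlW e1 cr); rewrite le_eqVlt; apply/orP; left; apply/eqP.
  congr (_ * _); apply: eq_bigr => k _; congr (ip _ _ _ _); apply/funext => x.
  by rewrite !CE mul1r mul0r addr0.
have b2 r b : core c b r -> 2 * \sum_(k < n) ip mu pos (Im \o u k) (Ar c a k (r k)) <=
    M + \sum_(k < n) nsq mu pos (r k).
  move=> cr; have e1 : sqmod (iC R) = 1 by rewrite /sqmod !CE; ring.
  apply: le_trans (Vtilde_form_le hu hV hlW e1 cr); rewrite le_eqVlt; apply/orP; left; apply/eqP.
  congr (_ * _); apply: eq_bigr => k _; congr (ip _ _ _ _); apply/funext => x.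
  by rewrite !CE mul1r mul0r add0r.
have [G1 [G2 [p [LG w pU cG [pt kir]]]]] := form_domain c_gt0 (fun k => (Lu k).1) b1.
have [H1 [H2 [q [LH wH qU cH [qt kirH]]]]] := form_domain c_gt0 (fun k => (Lu k).2) b2.
pose cplx (f g : 'I_n -> R -> R) k x : C := Complex (f k x) (g k x).
pose i0 := Ordinal n0.
exists (fun k x => - toC (c k) * cplx G2 H2 k x + toC (a k) * u k x).
apply: (@Aop_intro _ _ c a u (cplx G1 H1) (cplx G2 H2) (cplx p q) (cplx p q i0 0)).
- move=> k; split; first exact: Lu.
    by split; [exact: (LG k).1|exact: (LH k).1].
  by split; [exact: (LG k).2|exact: (LH k).2].
- move=> k; split; apply: wderiv_complex; [exact: (w k).1|exact: (wH k).1|exact: (w k).2|exact: (wH k).2].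
- by move=> k; split; [exact: (pU k).1|exact: (qU k).1].
- by move=> k; split; [exact: cG|exact: cH].
- move=> k; have [B1 [mB1 B10 h1]] := (pU k).2; have [B2 [mB2 B20 h2]] := (qU k).2.
  have NB : mu.-negligible (B1 `|` B2).
    by apply: negligibleU; [exists B1; split|exists B2; split].
  apply: negligibleS NB => x /= [x0 hx].
  apply: contrapT => /not_orP[n1 n2]; apply: hx; apply: C_ext.
    by apply: contrapT => e; apply: n1; apply: h1 => /= /(_ x0).
  by apply: contrapT => e; apply: n2; apply: h2 => /= /(_ x0).
- by move=> k; rewrite /cplx (pt k i0) (qt k i0).
apply: C_ext.
  by rewrite ReC_sum; under eq_bigr do rewrite Re_toCM; exact: kir.
by rewrite ImC_sum; under eq_bigr do rewrite Im_toCM; exact: kirH.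
Qed.

Lemma qmeas_lamX j (W : 'I_n -> R -> C) : qmeas a W -> qmeas a (fun k s => toC (s ^+ j) * W k s).
Proof.
move=> mW k; apply: cmeasM; last exact: mW.
by apply: cmeas_toC; apply: measurable_funX; exact: measurable_id.
Qed.

(** An intermediate power is controlled by the extreme ones: [s^2 <= 1 + s^(2 (j + 1))], by the
    first summand if [s^2 <= 1] and by the second otherwise. *)
Lemma inL2q_lam j (W : 'I_n -> R -> C) : inL2q c a W -> inL2q c a (fun k s => toC (s ^+ j.+1) * W k s) ->
  inL2q c a (fun k s => toC s * W k s).
Proof.
move=> /(@inL2qP R n c a c_gt0)[mW fW] /(@inL2qP R n c a c_gt0)[mj fj].
have m1 : qmeas a (fun k s => toC s * W k s) := qmeas_lamX 1 mW.
apply/inL2qP => //; split => //.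
apply: (@le_lt_trans _ _ (nq c a W + nq c a (fun k s => toC (s ^+ j.+1) * W k s)%R)%E); last first.
  by rewrite lte_add_pinfty.
rewrite /nq -big_split/=; apply: lee_sum => k _.
pose D : set TR := `]a k, +oo[%classic.
have mD : measurable D by exact: measurable_ray.
have mE (h : R -> C) : cmeas D h -> measurable_fun D (fun x => (sqmod (h x) * qfun c a k x)%:E).
  move=> mh; apply/measurable_EFinP; apply: measurable_funM; first exact: meas_sqmod.
  by apply: measurable_funTS; exact: meas_qfun.
have p1 (h : R -> C) x : (0 <= (sqmod (h x) * qfun c a k x)%:E)%E.
  by rewrite lee_fin mulr_ge0 ?sqmod_ge0 ?qfun_ge0.
have pW x : D x -> (0 <= (sqmod (W k x) * qfun c a k x)%:E)%E by move=> _; exact: p1.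
have pj x : D x -> (0 <= (sqmod (toC (x ^+ j.+1) * W k x) * qfun c a k x)%:E)%E.
  by move=> _; exact: (p1 (fun x => toC (x ^+ j.+1) * W k x)).
have mWk := mE _ (mW k); have mjk := mE _ (mj k).
rewrite -(ge0_integralD mu mD pW mWk pj mjk).
apply: ge0_le_integral => //.
- by move=> x _; exact: (p1 (fun s => toC s * W k s)).
- by apply: (mE (fun s => toC s * W k s)); exact: m1.
- exact: emeasurable_funD.
move=> s _; rewrite -EFinD lee_fin -mulrDl ler_wpM2r ?qfun_ge0//.
have sqmodZ (r : R) (z : C) : sqmod (toC r * z) = r ^+ 2 * sqmod z.
  by rewrite /sqmod Re_toCM Im_toCM; ring.
rewrite !sqmodZ -[X in _ <= X + _]mul1r -mulrDl ler_wpM2r ?sqmod_ge0// exprAC.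
have [s1|s1] := leP (s ^+ 2) 1; first by rewrite (le_trans s1)// lerDl exprn_ge0// sqr_ge0.
by rewrite (le_trans (_ : _ <= (s ^+ 2) ^+ j.+1))// ?lerDr// ler_eXnr// ltW.
Qed.

(** One factor [l] is peeled off at each step, since [l W] is the transform of [A u]. In the
    converse direction membership in D(A) has to be gained first, from the square integrability of
    [l W]; only then does [v] exist to which the induction hypothesis applies. *)
Lemma DApow_Vtilde j (u W : 'I_n -> R -> C) : (0 < n)%N -> inH u -> isVtilde c a u W ->
  DApow c a j u <-> inL2q c a (fun k s => toC (s ^+ j) * W k s).
Proof.
move=> n0; elim: j u W => [|j IH] u W hu hV.
  split=> // _; have := hV.1; congr inL2q; apply/funext => k; apply/funext => s.
  by rewrite expr0 toC1 mul1r.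
have E : (fun k s => toC (s ^+ j) * (toC s * W k s)) = (fun k s => toC (s ^+ j.+1) * W k s).
  by apply/funext => k; apply/funext => s; rewrite mulrA -toCM exprSr.
split=> [[v [Auv Dv]]|hj].
  have [hv Vv] := Vtilde_Aop c_gt0 a_ge0 hu hV Auv.
  by have := (IH _ _ hv Vv).1 Dv; rewrite E.
have [v Auv] := Aop_Vtilde n0 hu hV (inL2q_lam hV.1 hj).
have [hv Vv] := Vtilde_Aop c_gt0 a_ge0 hu hV Auv.
by exists v; split => //; apply/(IH _ _ hv Vv); rewrite E.
Qed.

End DomainCharacterization.

Theorem theorem7p10 (R : realType) (n : nat) (c a : 'I_n -> R)
    (u W : 'I_n -> R -> R[i]) (j : nat) :
  (2 <= n)%N ->
  (forall k, 0 < c k) ->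
  (forall k, 0 <= a k) ->
  (forall k l : 'I_n, (k <= l)%N -> a k <= a l) ->
  inH u ->
  isVtilde c a u W ->
  let Wj := fun k (lam : R) => toC (lam ^+ j) * W k lam in
  (DApow c a j u <-> inL2q c a Wj) /\
  (inL2q c a Wj <-> forall k : 'I_n, inL2qk c a k (Wj k)).
Proof.
(* The equivalence of (ii) and (iii) holds by unfolding: membership in the product space is
   membership of every component. *)
move=> n2 c0 a0 _ hu hV Wj; split; last by [].
exact: (@DApow_Vtilde R n c a c0 a0 j u W (ltnW n2) hu hV).
Qed.
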